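(* Let $k$ be a finite field of characteristic $\ne2$, $\overline C$ a smooth proper curve over $k$, $C$ a special nilpotent extension of $\overline C$ of length $2$ with nilradical $L=\mathcal N$ (a line bundle on $\overline C$). Let $A'$ be the complement in $H^0(\overline C,\omega_{\overline C}^2L^{-2})$ of the set of squares of elements of $H^0(\overline C,\omega_{\overline C}L^{-1})$, and assume that $\alpha\in A'$ has only simple zeros. Then there exists a commutative group extension $$1\to U(1)\to H_{U(1)}\to HF_\alpha(k)\to 1$$ and an action of $H_{U(1)}$ on the $\mathbb C^*$-torsor $\mathcal L_\psi$ over $HF_\alpha(k)$ (where $U(1)\subset\mathbb C^*$ acts naturally), compatible with the action of $HF_\alpha(k)$ on itself by shifts. Furthermore, there is a basis $(f_\chi)$ of $\mathcal S(HF_\alpha(k),\mathcal L_\psi)$ consisting of $\mathcal H_{\mathrm{PGL}_2,C}$-eigenvectors, numbered by the characters $\chi$ of $H_{U(1)}$ extending the identity character of $U(1)$, such that $hf_\chi=\chi(h)f_\chi$ for $h\in H_{U(1)}$.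
   Context: A nilpotent extension $C$ of $\overline C$ is a scheme of finite type whose associated reduced scheme is $\overline C$; it is special of length $2$ if its nilradical $\mathcal N$ satisfies $\mathcal N^2=0$ and is a line bundle on $\overline C$. Adeles: $F$ is the stalk of $\mathcal O_C$ at the general point; for a closed point $p$, $\mathcal O_p$ is the completed local ring of $C$ at $p$, $F_p$ its total ring of fractions; $\mathbb A$ is the restricted product of the $F_p$ with respect to the $\mathcal O_p$, $\mathcal O=\prod_p\mathcal O_p$; $\mathcal N\mathbb A$, $\mathcal N_F$ are the nilradicals of $\mathbb A$, $F$. $G=\mathrm{PGL}_2$ with Lie algebra $\mathfrak g$, identified with $\mathfrak g^\vee$ by the Killing form. $V^1(C)$ is the space of complex functions $f$ on $G(F)\backslash G(\mathbb A)/G(\mathcal O)$ (the set of isomorphism classes of $G$-bundles on $C$) that are strongly cuspidal: $\int_{U(\mathcal N_F)\backslash U(\mathcal N\mathbb A)}f(ug)\,du=0$ for all $g\in G(\mathbb A)$, with $U$ the unipotent upper triangular subgroup, $U(\mathcal N\mathbb A)=\ker(U(\mathbb A)\to U(\mathbb A/\mathcal N\mathbb A))$, $U(\mathcal N_F)=\ker(U(F)\to U(F/\mathcal N_F))$. $\mathcal H_{\mathrm{PGL}_2,C}$ is the convolution algebra of compactly supported $G(\mathcal O)$-biinvariant measures on $G(\mathbb A)$, acting by $(h*f)(g)=\int f(gx)\,dh(x)$; it preserves $V^1(C)$. An $L^{-1}$-twisted Higgs $G$-bundle on $\overline C$ is a pair $(P,\phi)$, $P$ a $G$-bundle, $\phi\in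 H^0(\overline C,\mathfrak g^\vee_P\otimes L^{-1}\omega_{\overline C})$. $HF_\alpha$ is the Hitchin fiber consisting of $(P,\phi)$ with $-\det\phi=\alpha$; $HF_\alpha(k)$ is the set of isomorphism classes of its $k$-points. Since $\alpha$ has only simple zeros, the spectral curve $\pi:C_\alpha\to\overline C$, $\pi_*\mathcal O_{C_\alpha}=\mathcal O_{\overline C}\oplus\omega_{\overline C}^{-1}L\,t$, $t^2=\alpha$, is smooth and $M\mapsto(\pi_*M,\text{multiplication by }t)$ identifies $\mathrm{Pic}(C_\alpha)/\pi^*\mathrm{Pic}(\overline C)$ with $HF_\alpha(k)$, giving the latter a group structure. Torsor $\mathcal L_\psi$: fix a nontrivial character $\psi:k\to U(1)$. For a Higgs bundle $(P,\phi)$ the liftings of $P$ to a $G$-bundle on $C$ form an $H^1(\overline C,\mathfrak g_P\otimes L)$-torsor; pushing it out along the functional $\langle\cdot,\phi\rangle:H^1(\overline C,\mathfrak g_P\otimes L)\to k$ (Serre duality) and then along $\psi$ gives the $\mathbb C^*$-torsor $\mathcal L_\psi|_{(P,\phi)}$. $\mathcal S(X,\mathcal L)$ is the space of finitely supported sections of $\mathcal L\times_{\mathbb C^*}\mathbb C$ over $X$; explicitly an element $s\in\mathcal S(HF_\alpha(k),\mathcal L_\psi)$ is a function $s(\widetilde P,\phi)$ of liftings $\widetilde P$ of $P$ and $\phi$ (with $-\det\phi=\alpha$), invariant under isomorphisms, with $s(\widetilde P+e,\phi)=\psi(\langle e,\phi\rangle)s(\widetilde P,\phi)$. There is a decomposition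 $V^1(C)\simeq\bigoplus_{\alpha\in A'}\mathcal S(HF_\alpha(k),\mathcal L_\psi)$, where $s$ corresponds to the function $f(\widetilde P)=\sum_\phi s(\widetilde P,\phi)$ (sum over $\phi$ with $-\det\phi=\alpha$); its summands are preserved by $\mathcal H_{\mathrm{PGL}_2,C}$, which defines the action of $\mathcal H_{\mathrm{PGL}_2,C}$ on $\mathcal S(HF_\alpha(k),\mathcal L_\psi)$. $H_{U(1)}$ acts on sections by $(hf)(x)=h\cdot f(h^{-1}x)$. *)

(* Defs.v *)
From HB Require Import structures.
From mathcomp Require Import all_boot all_order all_algebra complex.
From mathcomp Require Import boolp classical_sets functions cardinality fsbigop.
From mathcomp Require Import reals.

Set Implicit Arguments.
Unset Strict Implicit.
Unset Printing Implicit Defensive.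

Import Order.TTheory GRing.Theory Num.Theory.

Local Open Scope classical_set_scope.
Local Open Scope ring_scope.

Section RingHelpers.
Variable A : comUnitRingType.

Definition nilpotent_elt (x : A) : Prop := exists m : nat, x ^+ m = 0.

Definition is_subring (S : set A) : Prop :=
  [/\ S 1, (forall x y, S x -> S y -> S (x - y))
         & (forall x y, S x -> S y -> S (x * y))].

Definition span_prod (S T : set A) : set A :=
  [set x | exists s : seq (A * A),
     (forall w, w \in s -> S w.1 /\ T w.2) /\ x = \sum_(w <- s) w.1 * w.2].

Fixpoint ideal_pow (S m : set A) (n : nat) : set A :=
  if n is n'.+1 then span_prod m (ideal_pow S m n') else S.

Definition nonunits_in (S : set A) : set A :=
  [set x | S x /\ ~ (exists y, S y /\ x * y = 1)].

Definition nonzerodivisor_in (S : set A) (x : A) : Prop :=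
  S x /\ forall y, S y -> x * y = 0 -> y = 0.

End RingHelpers.

Definition adic_filt (A B : comUnitRingType) (j : A -> B) (S : set A)
    (S' : set B) (n : nat) : set B :=
  span_prod S' (j @` ideal_pow S (nonunits_in S) n).

(* The smooth proper (connected) curve Cbar over the finite field k is given by
   its function field, a finite extension of some k(x), x transcendental.  The
   constants may be larger than k. *)
Record function_field (k : finFieldType) := FunctionField {
  ff_sort :> fieldType;
  ff_const : {rmorphism k -> ff_sort};
  ff_axiom : exists x : ff_sort,
    (forall c : {poly k}, c != 0 -> (map_poly ff_const c).[x] != 0) /\
    exists (r : nat) (b : 'I_r -> ff_sort), forall y : ff_sort,
    exists (c : {poly k}) (d : 'I_r -> {poly k}),
      c != 0 /\ (map_poly ff_const c).[x] * y
                = \sum_(j < r) (map_poly ff_const (d j)).[x] * b j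
}.

(* Closed points of Cbar: nontrivial valuation rings of its function field
   containing k; the valuation ring is the local ring of Cbar at the point. *)
Record place (k : finFieldType) (X : function_field k) := Place {
  pl_ring : set X;
  pl_subring : is_subring pl_ring;
  pl_const : forall c : k, pl_ring (ff_const X c);
  pl_valuation : forall x : X, x != 0 -> pl_ring x \/ pl_ring x^-1;
  pl_nontrivial : exists x : X, ~ pl_ring x
}.

(* A special nilpotent extension C of Cbar of length 2.  [se_F] is the stalk of
   O_C at the general point, [se_red] its reduction, whose kernel is the stalk
   N_F of the nilradical, and [se_O p] is the local ring O_{C,p}, a subring of
   [se_F].  C is recovered by O_C(U) = intersection of the O_{C,p}, p in U.
   C is not required to be a scheme over k. *)
Record special_extension (k : finFieldType) (X : function_field k) :=
  SpecialExtension {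
  se_F : comUnitRingType;
  se_red : {rmorphism se_F -> X};
  se_O : place X -> set se_F;
  se_red_surj : forall b : X, exists x : se_F, se_red x = b;
  se_sq0 : forall x y : se_F, se_red x = 0 -> se_red y = 0 -> x * y = 0;
  se_line : exists nu : se_F, [/\ se_red nu = 0, nu != 0 &
    forall n, se_red n = 0 -> exists x, n = x * nu];
  se_subring : forall p, is_subring (se_O p);
  se_O_red : forall (p : place X) (b : X),
    pl_ring p b <-> exists2 x, se_O p x & se_red x = b;
  (* the stalk at p of the nilradical is free of rank one over the stalk of
     O_Cbar; finiteness at almost all p makes these glue to sheaves *)
  se_stalk : forall p, exists nu : se_F,
    [/\ se_red nu = 0, nu != 0, se_O p nu &
    forall n, se_O p n -> se_red n = 0 -> exists2 x, se_O p x & n = x * nu];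
  se_almost_int : forall x : se_F, finite_set [set p | ~ se_O p x];
  se_almost_gen : forall nu : se_F, se_red nu = 0 -> nu != 0 ->
    finite_set [set p | ~ (se_O p nu /\
      forall n, se_O p n -> se_red n = 0 -> exists2 x, se_O p x & n = x * nu)]
}.

Arguments se_red {k X} C : rename.
Arguments se_O {k X} C p x : rename.

Unset Implicit Arguments.

(* A choice of completed local rings [cp_O p] of C (completions of O_{C,p} for
   the topology of its maximal ideal) inside their total rings of fractions
   [cp_F p], together with the map from the stalk at the general point.  These
   conditions determine the data up to unique isomorphism. *)
Record completion {k : finFieldType} {X : function_field k}
    (C : special_extension X) := Completion {
  cp_F : place X -> comUnitRingType;
  cp_O : forall p : place X, set (cp_F p);
  cp_map : forall p : place X, {rmorphism se_F C -> cp_F p};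
  cp_filt := fun p : place X => adic_filt (cp_map p) (se_O C p) (cp_O p);
  cp_subring : forall p : place X, is_subring (cp_O p);
  cp_map_O : forall (p : place X) x, se_O C p x -> cp_O p (cp_map p x);
  cp_inj : forall (p : place X) n x, se_O C p x -> cp_filt p n (cp_map p x) ->
    ideal_pow (se_O C p) (nonunits_in (se_O C p)) n x;
  cp_dense : forall (p : place X) n y, cp_O p y ->
    exists2 x, se_O C p x & cp_filt p n (y - cp_map p x);
  cp_separated : forall (p : place X) y, (forall n, cp_filt p n y) -> y = 0;
  cp_complete : forall (p : place X) (y : nat -> cp_F p),
    (forall n, cp_O p (y n)) ->
    (forall n, cp_filt p n (y n.+1 - y n)) ->
    exists2 z, cp_O p z & forall n, cp_filt p n (z - y n);
  cp_nzd_unit : forall (p : place X) s, nonzerodivisor_in (cp_O p) s ->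
    s \is a GRing.unit;
  cp_fraction : forall (p : place X) x, exists y s,
    [/\ cp_O p y, nonzerodivisor_in (cp_O p) s & x = y / s]
}.

Set Implicit Arguments.
Arguments cp_F {k X C} D p : rename.
Arguments cp_O {k X C D p} x : rename.
Arguments cp_map {k X C} D p : rename.

Section Adeles.
Variables (k : finFieldType) (X : function_field k) (C : special_extension X).
Variable D : completion C.

Definition adele : Type := forall p : place X, cp_F D p.

Definition is_adele (x : adele) : Prop := finite_set [set p | ~ cp_O (x p)].

Definition nil_adele (x : adele) : Prop :=
  is_adele x /\ exists m : nat, forall p, x p ^+ m = 0.

Definition idele (z : adele) : Prop :=
  (forall p, z p \is a GRing.unit) /\
  finite_set [set p | ~ (cp_O (z p) /\ cp_O (z p)^-1)].

(* a lift to F of a rational function on Cbar, viewed in F_p; only its class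
   modulo nilpotents will matter *)
Definition lift (b : X) : se_F C := xget 0 [set x | se_red C x = b].
Definition loc (p : place X) (b : X) : cp_F D p := cp_map D p (lift b).

(* [Obar p x]: the image of x in F_p/(nilradical) lies in the completed local
   ring of Cbar at p *)
Definition Obar (p : place X) (x : cp_F D p) : Prop :=
  exists2 y, cp_O y & nilpotent_elt (x - y).

(* PGL_2 of F, A and O is GL_2 modulo scalars, these rings being local or
   (restricted) products of local rings; families of matrices below represent
   elements of PGL_2(A), i.e. (up to equivalence) PGL_2-bundles on C. *)
Definition amat : Type := forall p : place X, 'M[cp_F D p]_2.

Definition intmx (p : place X) (M : 'M[cp_F D p]_2) : Prop :=
  forall i j, cp_O (M i j).

Definition GL2A (g : amat) : Prop :=
  (forall p, g p \in unitmx) /\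
  finite_set [set p | ~ (intmx (g p) /\ intmx (invmx (g p)))].

Definition GL2O (u : amat) : Prop :=
  forall p, [/\ u p \in unitmx, intmx (u p) & intmx (invmx (u p))].

Definition amul (g h : amat) : amat := fun p => g p *m h p.
Definition ascale (z : adele) (g : amat) : amat := fun p => z p *: g p.
Definition adiag (c : 'M[se_F C]_2) : amat := fun p => map_mx (cp_map D p) c.
Definition aone : amat := fun p => 1%:M.

Definition conj_red (c : 'M[se_F C]_2) (Phi : 'M[X]_2) : 'M[X]_2 :=
  map_mx (se_red C) c *m Phi *m invmx (map_mx (se_red C) c).

(* elements of sl_2 (x) N_A *)
Definition nil_sl2 (e : amat) : Prop :=
  (forall i j, nil_adele (fun p => e p i j)) /\ forall p, \tr (e p) = 0.

(* Rational sections of L^-1 omega, following Weil: a rational differential on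
   Cbar is a continuous k-linear functional (the sum of the residues, traced to
   k) on A/NA vanishing on F/N_F, so a K-linear map from N_F to rational
   differentials, K = F/N_F, is a continuous k-linear functional on NA vanishing
   on N_F.  The values of [eta] outside NA are irrelevant. *)
Definition twisted_form (eta : adele -> k) : Prop :=
  [/\ forall m n, nil_adele m -> nil_adele n ->
        eta (fun p => m p + n p) = eta m + eta n,
      forall (c : k) n, nil_adele n ->
        eta (fun p => loc p (ff_const X c) * n p) = c * eta n,
      forall x : se_F C, se_red C x = 0 -> eta (fun p => cp_map D p x) = 0
    & exists z, idele z /\ forall n, nil_adele n -> (forall p, cp_O (n p)) ->
        eta (fun p => z p * n p) = 0].

Definition nonzero_form (eta : adele -> k) : Prop :=
  exists2 n, nil_adele n & eta n <> 0.

Section TwistedForm.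
(* [eta] is a nonzero rational section of L^-1 omega.  Every rational section of
   (L^-1 omega)^n is b eta^n for a unique b : X, and is represented by b. *)
Variable eta : adele -> k.

(* b eta is regular at p: it annihilates the nilradical of the completed local
   ring of C at p *)
Definition reg (p : place X) (b : cp_F D p) : Prop :=
  forall n : adele, (forall q, q <> p -> n q = 0) ->
    (exists m, [/\ nilpotent_elt m, cp_O m & n p = b * m]) -> eta n = 0.

(* b eta^2 is a regular section of (L^-1 omega)^2 at p *)
Definition reg2 (p : place X) (b : X) : Prop :=
  exists b1 b2 : X, [/\ reg (loc p b1), reg (loc p b2) & b = b1 * b2].

Definition max_ideal (p : place X) : set X :=
  [set m | pl_ring p m /\ (m = 0 \/ ~ pl_ring p m^-1)].

(* b eta^2 vanishes at p to order at least 2 *)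
Definition double_zero (p : place X) (b : X) : Prop :=
  exists m1 m2 c : X,
    [/\ max_ideal p m1, max_ideal p m2, reg2 p c & b = m1 * m2 * c].

Definition in_Aprime (b : X) : Prop :=
  (forall p, reg2 p b) /\
  ~ (exists c : X, (forall p, reg (loc p c)) /\ b = c ^+ 2).

Definition only_simple_zeros (b : X) : Prop := forall p, ~ double_zero p b.

(* Killing pairing of e in sl_2 (x) N_A with the Higgs field Phi eta, followed by
   the sum of residues; the Killing form of sl_2 is (x, y) |-> 4 tr(xy) *)
Definition higgs_pairing (Phi : 'M[X]_2) (e : amat) : k :=
  eta (fun p => 4%:R * \tr (map_mx (@loc p) Phi *m e p)).

Variable a : X.

(* [(g, Phi)]: the bundle P on Cbar is the reduction of the bundle defined by g,
   and phi = Phi eta is a regular section of (sl_2)_P (x) L^-1 omega,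
   where sl_2 = Lie(PGL_2) is its own dual by the Killing form, with -det phi = a eta^2. *)
Definition hpair : Type := (amat * 'M[X]_2)%type.

Definition higgs (x : hpair) : Prop :=
  [/\ GL2A x.1, \tr x.2 = 0, - \det x.2 = a &
    forall p i j, reg ((invmx (x.1 p) *m map_mx (@loc p) x.2 *m x.1 p) i j)].

(* isomorphism of Higgs bundles on Cbar: double cosets modulo NA *)
Definition higgs_iso (x y : hpair) : Prop :=
  exists c u z, [/\ c \in unitmx, GL2O u, idele z,
    forall i j, nil_adele
      (fun p => y.1 p i j - ascale z (amul (adiag c) (amul x.1 u)) p i j)
    & y.2 = conj_red c x.2].

Definition hclass (x : hpair) : set hpair := [set y | higgs_iso x y].

Definition HF : set (set hpair) := [set hclass x | x in higgs].

(* The function field of the spectral curve is E = X + X tau, tau^2 = a, where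
   t = tau eta.  Its adeles are represented by families of columns (x, y),
   standing for x + y tau. *)
Definition ecol : Type := forall p : place X, 'cV[cp_F D p]_2.

(* matrix of multiplication by v in the basis (1, tau) *)
Definition emx (p : place X) (v : 'cV[cp_F D p]_2) : 'M[cp_F D p]_2 :=
  \matrix_(i, j) if j == 0 then v i 0
                 else if i == 0 then loc p a * v 1 0 else v 0 0.

Definition ecol1 : ecol := fun p => \col_i (i == 0)%:R.
Definition emul (v w : ecol) : ecol := fun p => emx (v p) *m w p.

(* v lies in the completion at p of pi_* O = O + omega^-1 L t: here y tau is
   (y eta^-1) t *)
Definition spec_int (p : place X) (v : 'cV[cp_F D p]_2) : Prop :=
  Obar (v 0 0) /\ forall b, reg b -> Obar (v 1 0 * b).

Definition spec_idele (v : ecol) : Prop :=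
  (forall p, emx (v p) \in unitmx) /\
  finite_set [set p | ~ (spec_int (v p) /\
                         spec_int (invmx (emx (v p)) *m ecol1 p))].

(* g represents pi_* M, where the line bundle M on the spectral curve has local
   lattices v_p O_{C_alpha,p} *)
Definition pushforward (v : ecol) (g : amat) : Prop :=
  GL2A g /\ forall p (w : 'cV[cp_F D p]_2),
    (forall i, Obar ((invmx (g p) *m w) i 0)) <->
    spec_int (invmx (emx (v p)) *m w).

Definition mul_tau : 'M[X]_2 :=
  \matrix_(i, j) if i == j then 0 else if j == 0 then 1 else a.

(* the class of (pi_* M, multiplication by t) *)
Definition spectral_class (v : ecol) (c : set hpair) : Prop :=
  spec_idele v /\ exists2 g, pushforward v g & c = hclass (g, mul_tau).

(* the group law of HF_alpha(k), transported from Pic(C_alpha)/pi^*Pic(Cbar) *)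
Definition HF_mul (c1 c2 c3 : set hpair) : Prop :=
  exists v1 v2, [/\ spectral_class v1 c1, spectral_class v2 c2
                  & spectral_class (emul v1 v2) c3].

Definition HF_one (c : set hpair) : Prop := spectral_class ecol1 c.

Section Torsor.
Variables (R : realType) (psi : k -> R[i]).

(* the lifting g + e: the torsor structure over H^1(Cbar, g_P (x) L), a quotient
   of sl_2 (x) N_A *)
Definition lift_add (e g : amat) : amat := fun p => (1%:M + e p) *m g p.

(* A point of L_psi is represented by (g, Phi, c): a Higgs bundle on Cbar, the
   lifting g to C of the underlying bundle, and a scalar c; (g + e, Phi) with
   psi<e,phi> c represents the same point as (g, Phi) with c. *)
Definition lrep : Type := (hpair * R[i])%type.

Definition lrep_equiv (x y : lrep) : Prop :=
  exists cc u z e, [/\ cc \in unitmx, GL2O u, idele z, nil_sl2 e &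
    [/\ y.1.1 = ascale z (amul (adiag cc) (amul (lift_add e x.1.1) u)),
        y.1.2 = conj_red cc x.1.2
      & y.2 = psi (higgs_pairing x.1.2 e) * x.2]].

Definition lclass (x : lrep) : set lrep := [set y | lrep_equiv x y].

Definition Lpsi : set (set lrep) :=
  [set lclass x | x in [set x | higgs x.1 /\ x.2 != 0]].

Definition lscale (z : R[i]) (l : set lrep) : set lrep :=
  [set (x.1, z * x.2) | x in l].

Definition section : Type := amat -> 'M[X]_2 -> R[i].

(* S(HF_alpha(k), L_psi): [s g Phi] is the value on the lifting g; sections are
   extended by 0 to pairs which are not Higgs bundles *)
Definition in_S (s : section) : Prop :=
  [/\ forall g Phi, ~ higgs (g, Phi) -> s g Phi = 0,
      forall g Phi c u z, higgs (g, Phi) -> c \in unitmx -> GL2O u -> idele z ->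
        s (ascale z (amul (adiag c) (amul g u))) (conj_red c Phi) = s g Phi,
      forall g Phi e, higgs (g, Phi) -> nil_sl2 e ->
        s (lift_add e g) Phi = psi (higgs_pairing Phi e) * s g Phi
    & exists (n : nat) (x : 'I_n -> hpair), forall g Phi,
        s g Phi != 0 -> exists j, higgs_iso (x j) (g, Phi)].

(* the function in V^1(C) corresponding to s *)
Definition aut_fun (s : section) (g : amat) : R[i] :=
  \sum_(Phi \in [set Phi : 'M[X]_2 | \tr Phi = 0 /\ - \det Phi = a]) s g Phi.

Definition coset (x : amat) : set amat :=
  [set y | exists u z, [/\ GL2O u, idele z & y = ascale z (amul x u)]].

(* A compactly supported biinvariant measure on PGL_2(A) is given by the masses
   h x of the cosets x PGL_2(O), x in PGL_2(A): since PGL_2(O) is open and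
   compact, right invariance determines the measure on each coset. *)
Definition in_Hecke (h : amat -> R[i]) : Prop :=
  [/\ forall x, ~ GL2A x -> h x = 0,
      forall x u u' z, GL2A x -> GL2O u -> GL2O u' -> idele z ->
        h (ascale z (amul u (amul x u'))) = h x
    & exists (n : nat) (y : 'I_n -> amat), forall x,
        h x != 0 -> exists j, coset (y j) x].

(* (h * f)(g) = integral of f(gx) dh(x) *)
Definition hecke_conv (h : amat -> R[i]) (f : amat -> R[i]) (g : amat) : R[i] :=
  \sum_(c \in [set coset x | x in GL2A])
     h (xget aone c) * f (amul g (xget aone c)).

(* the action of the Hecke algebra on sections, through V^1(C): s' = h s *)
Definition hecke_sec (h : amat -> R[i]) (s s' : section) : Prop :=
  in_S s' /\ forall g, GL2A g -> aut_fun s' g = hecke_conv h (aut_fun s) g.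

Definition hecke_eigenvector (s : section) : Prop :=
  [/\ in_S s, exists g Phi, s g Phi != 0 &
    forall h, in_Hecke h -> exists ev : R[i],
      hecke_sec h s (fun g Phi => ev * s g Phi)].

Definition U1 : set R[i] := [set z | `|z| = 1].

Section Extension.
Variable H : groupType.

(* 1 -> U(1) -> H -> HF_alpha(k) -> 1 *)
Definition extension_of_HF (i : R[i] -> H) (q : H -> set hpair) : Prop :=
  [/\ forall z w, U1 z -> U1 w -> i (z * w) = (i z * i w)%g,
      forall z w, U1 z -> U1 w -> i z = i w -> z = w,
      (forall h, HF (q h)) /\ (forall h1 h2, HF_mul (q h1) (q h2) (q (h1 * h2)%g)),
      forall c, HF c -> exists h, q h = c
    & forall h, HF_one (q h) <-> exists2 z, U1 z & h = i z].

(* an action of H on the C^*-torsor L_psi, over the shifts of HF_alpha(k), in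
   which U(1) acts as a subgroup of C^* *)
Definition torsor_action (i : R[i] -> H) (q : H -> set hpair)
    (act : H -> set lrep -> set lrep) : Prop :=
  [/\ forall l, Lpsi l -> act 1%g l = l,
      forall h1 h2 l, Lpsi l -> act (h1 * h2)%g l = act h1 (act h2 l),
      forall h z l, Lpsi l -> z != 0 -> act h (lscale z l) = lscale z (act h l),
      forall z l, U1 z -> Lpsi l -> act (i z) l = lscale z l
    & forall h x, higgs x.1 -> x.2 != 0 ->
        exists y : lrep, [/\ higgs y.1, y.2 != 0, act h (lclass x) = lclass y
                           & HF_mul (q h) (hclass x.1) (hclass y.1)]].

(* (h s)(x) = h . s(h^-1 x): if y represents h^-1 . [g, Phi, 1], then the value
   of s at h^-1 x is (s y / y.2) h^-1 . [g, Phi, 1] *)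
Definition sec_act (act : H -> set lrep -> set lrep) (h : H) (s : section)
    : section :=
  fun g Phi =>
    if `[< higgs (g, Phi) >] then
      let y := xget ((g, Phi), 1) (act h^-1%g (lclass ((g, Phi), 1))) in
      s y.1.1 y.1.2 / y.2
    else 0.

(* characters of H extending the identity character of U(1) *)
Definition ext_char (i : R[i] -> H) (chi : H -> R[i]) : Prop :=
  [/\ chi 1%g = 1, forall h1 h2, chi (h1 * h2)%g = chi h1 * chi h2
    & forall z, U1 z -> chi (i z) = z].

Definition is_basis (I : set (H -> R[i])) (f : (H -> R[i]) -> section) : Prop :=
  (forall chi, I chi -> in_S (f chi)) /\
  forall s, in_S s -> exists! c : (H -> R[i]) -> R[i],
    [/\ finite_set [set chi | c chi != 0],
        forall chi, ~ I chi -> c chi = 0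
      & forall g Phi, s g Phi = \sum_(chi \in I) c chi * f chi g Phi].

End Extension.
End Torsor.
End TwistedForm.
End Adeles.

Definition nontrivial_character (k : finFieldType) (R : realType)
    (psi : k -> R[i]) : Prop :=
  [/\ forall x y, psi (x + y) = psi x * psi y,
      forall x, `|psi x| = 1 & exists x, psi x != 1].

(* Main.v *)
(* Write E for the function field of the spectral curve and T for the group of
   ideles of E over C, acting on adelic rank 2 modules through the matrices
   [emx a v].  Since alpha has only simple zeros, every local Higgs field has a
   cyclic vector, so every Higgs pair (g, phi) is isomorphic to (v g0, tau) with v
   in T, where g0 represents pi_* O.  The points of norm 1 of L_psi are therefore
   the classes of (v g0, tau, z) with v in T and |z| = 1; multiplying v's and z's
   is compatible with the equivalence of liftings, as the latter only involves
   c in GL_2(F) whose reduction commutes with tau, and this makes the set of these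
   points a commutative group H.  It contains U(1) because a pair (v, z) equivalent
   to (1, 1) with v = 1 has z = 1: if theta in E^* stabilizes g0 modulo nilpotents,
   theta / sigma(theta) (sigma being the involution of E) is an everywhere integral
   function, hence of finite order m prime to the characteristic, while the pairing
   with tau is odd under sigma, so 2 m kills the pairing attached to theta.

   By reduction theory (short vectors in rank 2 bundles, Riemann's inequality and the
   product formula) HF_alpha(k) is finite, so functions f on H with
   f(h z) = z^-1 f(h) are finite combinations of inverses of characters.  Sections
   of L_psi are exactly these functions.  A Hecke operator s'(g, phi) =
   sum_x h(x) s(g x, phi) acts on the right, hence commutes with T; s' vanishes
   unless (g, phi) is Higgs, because otherwise some nilpotent e pairs nontrivially
   with phi while 1 + e stabilizes g.  So the characters give eigenvectors. *)

Require Import Defs.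
From HB Require Import structures.
From mathcomp Require Import all_boot all_order all_algebra complex.
From mathcomp Require Import finmap.
From mathcomp Require Import boolp classical_sets functions cardinality fsbigop.
From mathcomp Require Import reals.
From mathcomp Require Import zify ring lra.
From mathcomp Require cyclic separable cyclotomic.

Set Implicit Arguments.
Unset Strict Implicit.
Unset Printing Implicit Defensive.

Import Order.TTheory GRing.Theory Num.Theory.

Local Open Scope classical_set_scope.
Local Open Scope ring_scope.

(** * Valuations at the places *)

(** Curves enter only through valuation rings, so the theory needed is built by counting: as k is
    finite and the constants of X may exceed it, cardinalities replace dimensions. [idn d] is the
    exponential of a degree, [ell d] a number of sections, and Riemann's inequality, the product
    formula and strong approximation are statements about these numbers. Discreteness of a place
    comes from the separatedness of the completion of C: an element divisible without end would have
    a lift whose square is both zero and invertible there.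

    The second obstacle is that [loc] uses arbitrary lifts, so it is a ring morphism only modulo
    nilpotents. Two nilpotents of a completed stalk multiply to zero; hence a pairing with a
    nilpotent adele sees its other factor only modulo nilpotents, and most identities are
    congruences ([nilpotent_elt], [nlm]).

    Since alpha is not a square, E is a field: this gives a cyclic vector at the generic point, and
    injectivity of Frobenius on E, which makes m prime to the characteristic. Inverting 2 serves to
    split off traces, to find local cyclic vectors and to conclude from the oddness under sigma. *)

HB.instance Definition _ (k : finFieldType) (X : function_field k) :=
  gen_eqMixin (place X).
HB.instance Definition _ (k : finFieldType) (X : function_field k) :=
  gen_choiceMixin (place X).

(** Carried as a hypothesis until a completion of C is at hand, where [place_discrete] proves it.
    The exponent [n] is minus the valuation of [x]. *)
Definition discrete (k : finFieldType) (X : function_field k) (p : place X) :=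
  exists t : X, [/\ t != 0, pl_ring p t, ~ pl_ring p t^-1 &
    forall x, x != 0 -> exists n : int,
      pl_ring p (x * t ^ n) /\ pl_ring p (x * t ^ n)^-1].

Section Valuation.
Variables (k : finFieldType) (X : function_field k).
Hypothesis places_discrete : forall p : place X, discrete p.
Implicit Types (p q : place X) (x y : X) (m n : int).

Local Notation V := pl_ring.

Lemma place_eq p q : V p = V q -> p = q.
Proof.
case: p q => [S a b c d] [S' a' b' c' d'] /= e; subst S'.
by congr Place; apply: Prop_irrelevance.
Qed.

Lemma V1 p : V p 1. Proof. by case: (pl_subring p). Qed.
Lemma VB p x y : V p x -> V p y -> V p (x - y).
Proof. by case: (pl_subring p) => _ + _; apply. Qed.
Lemma VM p x y : V p x -> V p y -> V p (x * y).
Proof. by case: (pl_subring p) => _ _; apply. Qed.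
Lemma V0 p : V p 0. Proof. by rewrite -(subrr 1); apply: VB; apply: V1. Qed.
Lemma VN p x : V p x -> V p (- x).
Proof. by rewrite -sub0r => h; apply: VB => //; apply: V0. Qed.
Lemma VD p x y : V p x -> V p y -> V p (x + y).
Proof. by move=> hx hy; rewrite -(opprK y); apply: VB => //; apply: VN. Qed.
Lemma Vsum p (I : Type) (r : seq I) (P : pred I) (F : I -> X) :
  (forall i, P i -> V p (F i)) -> V p (\sum_(i <- r | P i) F i).
Proof. by move=> h; apply: big_ind => //; [apply: V0|apply: VD]. Qed.
Lemma VX p x (n : nat) : V p x -> V p (x ^+ n).
Proof. by move=> h; elim: n => [|n IH]; rewrite ?exprS; [apply: V1|apply: VM]. Qed.

Definition unif p : X := xget 0 [set t : X | [/\ t != 0, V p t, ~ V p t^-1 &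
    forall x, x != 0 -> exists n : int, V p (x * t ^ n) /\ V p (x * t ^ n)^-1]].

Lemma unifP p : [/\ unif p != 0, V p (unif p), ~ V p (unif p)^-1 &
  forall x, x != 0 -> exists n : int,
    V p (x * unif p ^ n) /\ V p (x * unif p ^ n)^-1].
Proof. by rewrite /unif; case: xgetP => // /(_ _) H; have [t /H] := places_discrete p. Qed.

Lemma unif_neq0 p : unif p != 0. Proof. by case: (unifP p). Qed.
Hint Resolve unif_neq0 : core.

(** Order at least [n], phrased by membership so that 0 needs no separate case; congruences modulo
    powers of the maximal ideal are written with it. *)
Definition vge p n x := V p (x * unif p ^ (- n)).

Lemma unifz_neq0 p n : unif p ^ n != 0.
Proof. by rewrite expfz_neq0. Qed.
Hint Resolve unifz_neq0 : core.

Lemma V_unifz p n : V p (unif p ^ n) <-> 0 <= n.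
Proof.
have [_ h1 h2 _] := unifP p; split => [|]; last first.
  by case: n => // n _; apply: VX.
case: n => // n; rewrite NegzE -invr_expz => h.
case: h2; have -> : (unif p)^-1 = (unif p ^ n.+1%:Z)^-1 * unif p ^+ n.
  by rewrite -exprnP exprS invfM -mulrA mulVf ?mulr1 ?expf_neq0.
by apply: VM => //; apply: VX.
Qed.

Lemma vge0 p x : vge p 0 x <-> V p x.
Proof. by rewrite /vge oppr0 expr0z mulr1. Qed.
Lemma vge_0 p n : vge p n 0. Proof. by rewrite /vge mul0r; apply: V0. Qed.
Lemma vgeD p n x y : vge p n x -> vge p n y -> vge p n (x + y).
Proof. by rewrite /vge mulrDl; apply: VD. Qed.
Lemma vgeN p n x : vge p n x -> vge p n (- x).
Proof. by rewrite /vge mulNr; apply: VN. Qed.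
Lemma vgeB p n x y : vge p n x -> vge p n y -> vge p n (x - y).
Proof. by move=> a b; apply: vgeD => //; apply: vgeN. Qed.
Lemma vgeM p m n x y : vge p m x -> vge p n y -> vge p (m + n) (x * y).
Proof.
rewrite /vge => a b; rewrite opprD expfzDr // mulrACA; exact: VM.
Qed.
Lemma vgeW p m n x : m <= n -> vge p n x -> vge p m x.
Proof.
move=> h; rewrite /vge => a.
have -> : - m = - n + (n - m) by ring.
by rewrite expfzDr // mulrA; apply: VM => //; apply/V_unifz; rewrite subr_ge0.
Qed.
Lemma vge_sum p n (I : Type) (r : seq I) (P : pred I) (F : I -> X) :
  (forall i, P i -> vge p n (F i)) -> vge p n (\sum_(i <- r | P i) F i).
Proof. by move=> h; apply: big_ind => //; [apply: vge_0|apply: vgeD]. Qed.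

(* The valuation at [p], with the junk value 0 at [x = 0]; [vge p n 0] holds for all [n]. *)
Definition vl p x : int :=
  if x == 0 then 0 else xget 0 [set n | vge p n x /\ vge p (- n) x^-1].

Lemma vlP p x : x != 0 -> vge p (vl p x) x /\ vge p (- vl p x) x^-1.
Proof.
move=> nz; rewrite /vl (negPf nz); case: xgetP => [n -> //|/(_ _) H].
have [_ _ _ /(_ x nz) [n [a b]]] := unifP p.
by exfalso; apply: (H (- n)); split; rewrite /vge !opprK // -invr_expz -invfM.
Qed.

Lemma vgeP p n x : x != 0 -> vge p n x <-> n <= vl p x.
Proof.
move=> nz; have [a b] := vlP p nz; split=> [h|h]; last exact: vgeW h a.
have := vgeM h b; rewrite divff // /vge mul1r => /V_unifz; lia.
Qed.

Lemma vl_eq p n x : x != 0 -> vge p n x -> vge p (- n) x^-1 -> vl p x = n.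
Proof.
move=> nz /(vgeP _ _ nz) a b; apply/eqP; rewrite eq_le a andbT.
have [c _] := vlP p nz; have := vgeM c b; rewrite divff // /vge mul1r.
by move/V_unifz; lia.
Qed.

Lemma vlM p x y : x != 0 -> y != 0 -> vl p (x * y) = vl p x + vl p y.
Proof.
move=> hx hy; have [a b] := vlP p hx; have [c d] := vlP p hy.
apply: vl_eq; rewrite ?mulf_neq0 //; first exact: vgeM.
by rewrite invfM opprD; apply: vgeM.
Qed.


Lemma vlV p x : vl p x^-1 = - vl p x.
Proof.
have [->|nz] := eqVneq x 0; first by rewrite invr0 /vl eqxx oppr0.
by have [a b] := vlP p nz; apply: vl_eq; rewrite ?invr_neq0 // opprK invrK.
Qed.

Lemma vlf p x y : x != 0 -> y != 0 -> vl p (x / y) = vl p x - vl p y.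
Proof. by move=> a b; rewrite vlM ?invr_eq0 // vlV. Qed.

Lemma vl1 p : vl p 1 = 0.
Proof. by apply: vl_eq (oner_neq0 _) _ _; rewrite ?oppr0 ?invr1; apply/vge0/V1. Qed.

Lemma vl_unifz p n : vl p (unif p ^ n) = n.
Proof.
apply: vl_eq => //; rewrite /vge ?opprK ?mulVf //; try exact: V1.
by rewrite -invr_expz mulfV //; apply: V1.
Qed.

Lemma vlX p x (n : nat) : vl p (x ^+ n) = vl p x *+ n.
Proof.
have [->|nz] := eqVneq x 0.
  by rewrite expr0n; case: n => [|n] /=; rewrite ?vl1 // /vl eqxx mul0rn.
elim: n => [|n IH]; first by rewrite vl1.
by rewrite exprS vlM ?expf_neq0 // IH mulrS.
Qed.

Lemma V_vl p x : x != 0 -> V p x <-> 0 <= vl p x.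
Proof. by move=> nz; rewrite -vge0; apply: vgeP. Qed.

Lemma vl_V p x : V p x -> 0 <= vl p x.
Proof.
by have [->|nz] := eqVneq x 0; [rewrite /vl eqxx|move/(V_vl _ nz)].
Qed.

Definition vunit p x := [/\ x != 0, V p x & V p x^-1].

Lemma vunitP p x : x != 0 -> vunit p x <-> vl p x = 0.
Proof.
move=> nz; split=> [[_ /vl_V a /vl_V]|e]; first by rewrite vlV; lia.
by split=> //; apply/V_vl; rewrite ?invr_eq0 ?vlV ?e.
Qed.

Lemma vunit1 p : vunit p 1.
Proof. by apply/vunitP; rewrite ?oner_neq0 ?vl1. Qed.
Lemma vunitM p x y : vunit p x -> vunit p y -> vunit p (x * y).
Proof.
by move=> [a b c] [d e f]; split; rewrite ?mulf_neq0 ?invfM //; apply: VM.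
Qed.
Lemma vunitV p x : vunit p x -> vunit p x^-1.
Proof. by move=> [a b c]; split; rewrite ?invr_eq0 ?invrK. Qed.

Lemma max_idealP p x : max_ideal p x <-> vge p 1 x.
Proof.
have [->|nz] := eqVneq x 0.
  by split=> _; [apply: vge_0|split; [apply: V0|left]].
rewrite vgeP //; split=> [[/(V_vl _ nz) a [/eqP|]]|h]; first by rewrite (negPf nz).
  by rewrite V_vl ?invr_eq0 // vlV; lia.
split; first by apply/V_vl => //; lia.
by right; rewrite V_vl ?invr_eq0 // vlV; lia.
Qed.

Lemma notV_inv p x : ~ V p x -> x != 0 /\ vge p 1 x^-1.
Proof.
have [->|nz] := eqVneq x 0; first by move=> h; case: h; apply: V0.
by rewrite V_vl // => h; split=> //; rewrite vgeP ?invr_eq0 // vlV; lia.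
Qed.

(** If y had a pole, dividing the equation by y^n would put 1 into the maximal ideal. *)
Lemma V_integral p y (n : nat) (c : 'I_n -> X) :
  (forall i, V p (c i)) -> y ^+ n = \sum_(i < n) c i * y ^+ i -> V p y.
Proof.
move=> hc e; case: (pselect (V p y)) => // /notV_inv [nz h].
have n0 : (0 < n)%N.
  by case: n c hc e => // c _; rewrite big_ord0 expr0 => /eqP; rewrite oner_eq0.
have : vge p 1 1; last first.
  by rewrite /vge mul1r => /V_unifz.
have {1}-> : (1 : X) = \sum_(i < n) c i * y^-1 ^+ (n - i).
  rewrite -(mulfV (expf_neq0 n nz)) {1}e mulr_suml; apply: eq_bigr => i _.
  rewrite -mulrA; congr (_ * _); have le : (i <= n)%N by apply: ltnW.
  by rewrite -{2}(subnKC le) exprD invfM mulrA mulfV ?expf_neq0 // mul1r exprVn.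
apply: vge_sum => i _; rewrite -(add0r 1); apply: vgeM; first exact/vge0.
have : (0 < n - i)%N by rewrite subn_gt0.
case: (n - i)%N => // m _; rewrite exprS -(addr0 1); apply: vgeM => //.
by apply/vge0/VX/vge0; apply: vgeW h.
Qed.

(** Discrete valuation rings are maximal subrings: if [V q] contained [V p] and some [w] outside it,
    a large power of [w] would absorb the pole of any [z], forcing [V q] to be all of X. *)
Lemma places_incl p q : p <> q -> exists2 x, V p x & ~ V q x.
Proof.
move=> npq; apply: contrapT => h.
have sub x : V p x -> V q x by move=> a; apply: contrapT => b; apply: h; exists x.
case: npq; apply: place_eq; apply/seteqP; split=> // w qw; apply: contrapT => nw.
have [wn _] := notV_inv nw.
have vw : vl p w < 0 by move: nw; rewrite V_vl //; lia.
have [z] := pl_nontrivial q; case.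
have [->|nz] := eqVneq z 0; first exact: V0.
have -> : z = (z * w^-1 ^+ `|vl p z|%N) * w ^+ `|vl p z|%N.
  by rewrite -mulrA -exprMn mulVf // expr1n mulr1.
apply: VM; last exact: VX.
apply: sub; apply/V_vl; rewrite ?mulf_neq0 ?expf_neq0 ?invr_eq0 //.
by rewrite vlM ?expf_neq0 ?invr_eq0 // vlX vlV; nia.
Qed.

End Valuation.

(** * Existence of places *)

Lemma exprV_mul (K : fieldType) (w : K) i n : w != 0 -> (i <= n)%N ->
  w^-1 ^+ i * w ^+ n = w ^+ (n - i).
Proof.
by move=> w0 /subnKC {1}<-; rewrite exprD mulrA exprVn mulVf ?mul1r ?expf_neq0.
Qed.

Section Chevalley.
Variables (k : finFieldType) (X : function_field k).
Implicit Types (x y z u : X) (c d : {poly k}).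

Definition px x c : X := (map_poly (ff_const X) c).[x].

Lemma pxB x c d : px x (c - d) = px x c - px x d.
Proof. by rewrite /px rmorphB hornerD hornerN. Qed.
Lemma pxD x c d : px x (c + d) = px x c + px x d.
Proof. by rewrite /px rmorphD hornerD. Qed.
Lemma pxM x c d : px x (c * d) = px x c * px x d.
Proof. by rewrite /px rmorphM hornerM. Qed.
Lemma px0 x : px x 0 = 0.
Proof. by rewrite /px rmorph0 horner0. Qed.
Lemma px1 x : px x 1 = 1.
Proof. by rewrite /px rmorph1 hornerC. Qed.
Lemma pxC x (a : k) : px x a%:P = ff_const X a.
Proof. by rewrite /px map_polyC hornerC. Qed.
Lemma pxX x : px x 'X = x.
Proof. by rewrite /px map_polyX hornerX. Qed.
Lemma pxXn x c n : px x (c ^+ n) = px x c ^+ n.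
Proof. by rewrite /px rmorphXn horner_exp. Qed.
Lemma pxE x c n : (size c <= n)%N -> px x c = \sum_(i < n) ff_const X c`_i * x ^+ i.
Proof.
move=> le; rewrite /px (@horner_coef_wide _ n); last by rewrite size_map_poly.
by apply: eq_bigr => i _; rewrite coef_map.
Qed.

Definition transc x := forall c, px x c = 0 -> c = 0.

Lemma V_px (p : place X) x c : pl_ring p x -> pl_ring p (px x c).
Proof.
move=> h; rewrite (@pxE x c (size c)) //; apply: Vsum => i _.
by apply: VM; [apply: pl_const|apply: VX].
Qed.

Section Generated.
Variable u : X.

(** The k[u]-algebra generated by [A], for Chevalley's construction of places. The inductive form
    makes visible that an element involves finitely many members of [A], as Zorn's lemma
    requires. *)
Inductive gen (A : set X) : X -> Prop :=
| gen_in x of A x : gen A x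
| gen_const a : gen A (ff_const X a)
| gen_u : gen A u
| gen_B x y of gen A x & gen A y : gen A (x - y)
| gen_M x y of gen A x & gen A y : gen A (x * y).

Lemma gen_sub A B x : (forall y, A y -> gen B y) -> gen A x -> gen B x.
Proof.
move=> h; elim=> {x} [x|a||x y _ a _ b|x y _ a _ b].
- exact: h.
- exact: gen_const.
- exact: gen_u.
- exact: gen_B.
- exact: gen_M.
Qed.

Lemma gen0 x : gen set0 x -> exists c, x = px u c.
Proof.
elim=> {x} [//|a||x y _ [c ->] _ [d ->]|x y _ [c ->] _ [d ->]].
- by exists a%:P; rewrite pxC.
- by exists 'X; rewrite pxX.
- by exists (c - d); rewrite pxB.
- by exists (c * d); rewrite pxM.
Qed.

Definition proper_gen (A : set X) := forall s, gen A s -> u * s <> 1.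

Hypothesis u_transc : transc u.

Lemma u_neq0 : u != 0.
Proof. by apply/eqP => u0; have := @u_transc 'X; rewrite pxX => /(_ u0)/eqP; rewrite polyX_eq0. Qed.

(** A relation u s = 1 uses finitely many generators, hence holds already over one member of the
    chain. The empty chain gives k[u], where u is not invertible because it is transcendental. *)
Lemma proper_gen_max : exists A, proper_gen A /\ forall B, A `<` B -> ~ proper_gen B.
Proof.
apply: Zorn_bigcup => F FP Ft s gs.
have [F0|/set0P[A0 FA0]] := eqVneq F set0; last first.
  suff [A FA ga] : exists2 A, F A & gen A s by exact: (FP _ FA).
  elim: gs => {s} [x [A FA Ax]|a||x y _ [A FA ax] _ [B FB bx]|x y _ [A FA ax] _ [B FB bx]].
  - by exists A => //; apply: gen_in.
  - by exists A0 => //; apply: gen_const.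
  - by exists A0 => //; apply: gen_u.
  - have [AB|BA] := Ft _ _ FA FB.
      by exists B => //; apply: gen_B => //; apply: gen_sub ax => z /AB; apply: gen_in.
    by exists A => //; apply: gen_B => //; apply: gen_sub bx => z /BA; apply: gen_in.
  - have [AB|BA] := Ft _ _ FA FB.
      by exists B => //; apply: gen_M => //; apply: gen_sub ax => z /AB; apply: gen_in.
    by exists A => //; apply: gen_M => //; apply: gen_sub bx => z /BA; apply: gen_in.
move: gs; rewrite F0 bigcup_set0 => /gen0 [c ->].
rewrite -{1}(pxX u) -pxM => e.
have := @u_transc ('X * c - 1); rewrite pxB px1 e subrr => /(_ erefl).
move/(congr1 (fun f => f.[0])); rewrite !hornerE => /eqP.
by rewrite oppr_eq0 oner_eq0.
Qed.

Section Maximal.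
Variable A : set X.
Hypothesis A_proper : proper_gen A.
Hypothesis A_max : forall B, A `<` B -> ~ proper_gen B.

Lemma max_gen x : gen A x -> A x.
Proof.
move=> gx; apply: contrapT => nx; apply: (A_max (B := gen A)).
  by split; [move=> y; apply: gen_in|move=> /(_ _ gx)].
by move=> s gs; apply: A_proper; apply: gen_sub gs.
Qed.

Let A0 : A 0. Proof. by apply: max_gen; rewrite -(rmorph0 (ff_const X)); apply: gen_const. Qed.
Let A1 : A 1. Proof. by apply: max_gen; rewrite -(rmorph1 (ff_const X)); apply: gen_const. Qed.
Let Au : A u. Proof. by apply: max_gen; apply: gen_u. Qed.
Let AB x y : A x -> A y -> A (x - y).
Proof. by move=> a b; apply: max_gen; apply: gen_B; apply: gen_in. Qed.
Let AM x y : A x -> A y -> A (x * y).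
Proof. by move=> a b; apply: max_gen; apply: gen_M; apply: gen_in. Qed.
Let AD x y : A x -> A y -> A (x + y).
Proof. by move=> a b; have := AB a (AB A0 b); rewrite sub0r opprK. Qed.
Let Asum (I : Type) (r : seq I) (P : pred I) (F : I -> X) :
  (forall i, P i -> A (F i)) -> A (\sum_(i <- r | P i) F i).
Proof. by move=> h; apply: big_ind. Qed.
Let AX x n : A x -> A (x ^+ n).
Proof. by move=> h; elim: n => [|n IH]; rewrite ?exprS //; apply: AM. Qed.
Let uA s : A s -> u * s <> 1.
Proof. by move=> a; apply: A_proper; apply: gen_in. Qed.

Definition polyA (P : {poly X}) := forall i, A P`_i.

Lemma max_outside z : ~ A z -> exists2 P, polyA P & u * P.[z] = 1.
Proof.
move=> nz; have : ~ proper_gen (A `|` [set z]).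
  by apply: A_max; split; [move=> y; left|move=> /(_ z)/(_ (or_intror _ erefl))].
move=> /existsNP [s /not_implyP [gs /contrapT e]].
suff [P PA sP] : exists2 P, polyA P & s = P.[z] by exists P; rewrite -?sP.
have pC x : A x -> polyA x%:P by move=> Ax i; rewrite coefC; case: ifP.
elim: gs => {s e} [x [Ax|->]|a||x y _ [P PA ->] _ [Q QA ->]|x y _ [P PA ->] _ [Q QA ->]].
- by exists x%:P; rewrite ?hornerC //; apply: pC.
- by exists 'X; rewrite ?hornerX // => i; rewrite coefX; case: eqP.
- exists (ff_const X a)%:P; rewrite ?hornerC //; apply: pC.
  by apply: max_gen; apply: gen_const.
- by exists u%:P; rewrite ?hornerC //; apply: pC.
- by exists (P - Q); rewrite ?hornerD ?hornerN // => i; rewrite coefB; apply: AB.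
- by exists (P * Q); rewrite ?hornerM // => i; rewrite coefM; apply: Asum => j _; apply: AM.
Qed.

(** With w = 1 - u q, failure would give u P(1/w) = 1. Clearing denominators makes a power of w,
    which is 1 modulo u, a multiple of u, so that u divides 1 in [A]. *)
Lemma max_inv q : A q -> A (1 - u * q)^-1.
Proof.
move=> Aq; set w := 1 - u * q; apply: contrapT => /max_outside [P PA e].
have w0 : w != 0 by apply/eqP => /eqP; rewrite subr_eq0 => /eqP /esym; apply: uA.
have Aw : A w by apply: AB => //; apply: AM.
have [t At wt] : exists2 t, A t & w ^+ size P = 1 - u * t.
  elim: (size P) => [|n [t At IH]]; first by exists 0; rewrite ?mulr0 ?subr0.
  exists (q + t - u * q * t); last by rewrite exprS IH /w; ring.
  by apply: AB; [apply: AD|apply: AM => //; apply: AM].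
have : w ^+ size P = u * \sum_(i < size P) P`_i * w ^+ (size P - i).
  rewrite -[LHS]mul1r -e horner_coef -mulrA mulr_suml; congr (_ * _).
  apply: eq_bigr => i _; rewrite -mulrA; congr (_ * _).
  by rewrite exprV_mul // ltnW.
rewrite wt => /eqP; rewrite subr_eq addrC -mulrDr => /eqP/esym.
by apply: uA; apply: AD => //; apply: Asum => i _; apply: AM => //; apply: AX.
Qed.

(** Chevalley's elimination: adjoining z and adjoining 1/z cannot both make u invertible. The
    relation of smaller degree rewrites the leading term of the other one, and the total size
    decreases. *)
Lemma max_contra N z P Q : z != 0 -> polyA P -> polyA Q ->
  (size P + size Q <= N)%N -> u * P.[z] = 1 -> u * Q.[z^-1] = 1 -> False.
Proof.
elim: N z P Q => [|N IH] z P Q z0 PA QA sN eP eQ.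
  have : size P == 0%N by lia.
  rewrite size_poly_eq0 => /eqP P0; move: eP.
  by rewrite P0 horner0 mulr0 => /esym /eqP; rewrite oner_eq0.
wlog le : z P Q z0 PA QA sN eP eQ / (size Q <= size P)%N.
  move=> W; have [le|/ltnW le] := leqP (size Q) (size P); first exact: (W z P Q).
  by apply: (W z^-1 Q P); rewrite ?invr_eq0 ?invrK // addnC.
case sP: (size P) => [|n].
  move/eqP: sP; rewrite size_poly_eq0 => /eqP P0; move: eP.
  by rewrite P0 horner0 mulr0 => /esym /eqP; rewrite oner_eq0.
pose w := 1 - u * Q`_0; have Aw : A w^-1 by apply: max_inv.
have w0 : w != 0 by apply/eqP => /eqP; rewrite subr_eq0 => /eqP /esym; apply: uA.
(* z^n is replaced by u/w times the sum of the Q_{n-i} z^i, which is the relation for 1/z multiplied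
   by z^n; [max_inv] allows the division by w. *)
pose P' := \poly_(i < n) (P`_i + P`_n * (u / w) * Q`_(n - i)).
have sP' : (size P' <= n)%N by apply: size_poly.
apply: (IH z P' Q) => //; try lia.
  move=> i; rewrite coef_poly; case: ifP => // _.
  by apply: AD => //; apply: AM => //; apply: AM => //; apply: AM.
rewrite -eP (horner_coef_wide z sP') (@horner_coef_wide _ n.+1 P z); last by rewrite sP.
rewrite big_ord_recr /=; congr (_ * _).
under eq_bigr => i _ do rewrite coef_poly ltn_ord mulrDl.
rewrite big_split /=; congr (_ + _).
under eq_bigr => i _ do rewrite -!mulrA.
rewrite -!mulr_sumr; congr (_ * _).
have : u * \sum_(i < n) Q`_(n - i) * z ^+ i = w * z ^+ n.
  rewrite (@horner_coef_wide _ n.+1 Q z^-1) in eQ; last by rewrite -sP.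
  rewrite big_ord_recl /= expr0 mulr1 in eQ.
  have -> : w = u * \sum_(i < n) Q`_(i.+1) * z^-1 ^+ i.+1.
    by rewrite /w -eQ; under eq_bigr => i _ do rewrite /bump /= add1n; ring.
  rewrite -mulrA mulr_suml; congr (_ * _).
  rewrite (reindex_inj rev_ord_inj) /=; apply: eq_bigr => i _.
  have -> : (n - (n - i.+1))%N = i.+1 by have := ltn_ord i; lia.
  rewrite -mulrA; congr (_ * _).
  by rewrite exprV_mul.
move=> h; rewrite mulrCA h; rewrite mulrA mulVf ?mul1r //.
Qed.

Lemma max_place : exists p : place X, pl_ring p u /\ ~ pl_ring p u^-1.
Proof.
have nu : ~ A u^-1 by move=> /uA; rewrite mulfV ?u_neq0.
have sub : is_subring A by split.
have cst (c : k) : A (ff_const X c) by apply: max_gen; apply: gen_const.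
have vl x : x != 0 -> A x \/ A x^-1.
  move=> x0; apply: contrapT => /not_orP [/max_outside [P PA eP] /max_outside [Q QA eQ]].
  by apply: (@max_contra _ x P Q) (leqnn _) _ _.
by exists (Place sub cst vl (ex_intro (fun x => ~ A x) _ nu)).
Qed.

End Maximal.

Lemma transc_zero : exists p : place X, pl_ring p u /\ ~ pl_ring p u^-1.
Proof. by have [A [h1 h2]] := proper_gen_max; apply: max_place h1 h2. Qed.

End Generated.

Lemma px_rev x c n : x != 0 -> (size c <= n.+1)%N ->
  px x c = x ^+ n * px x^-1 (\poly_(i < n.+1) c`_(n - i)).
Proof.
move=> x0 sc; rewrite (pxE _ sc) (@pxE _ _ n.+1) ?size_poly // mulr_sumr.
rewrite (reindex_inj rev_ord_inj) /=; apply: eq_bigr => i _.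
rewrite coef_poly ltn_ord subSS mulrCA; congr (_ * _).
by rewrite mulrC exprV_mul // -ltnS.
Qed.

Lemma rev_poly_eq0 c n : (size c <= n.+1)%N ->
  \poly_(i < n.+1) c`_(n - i) = 0 -> c = 0.
Proof.
move=> sc /polyP h; apply/polyP => i; rewrite coef0.
have [le|lt] := leqP i n; last by rewrite nth_default // (leq_trans sc).
have := h (n - i)%N; rewrite coef_poly coef0 subKn //.
by rewrite ltnS leq_subr.
Qed.

Lemma transc_neq0 x : transc x -> x != 0.
Proof. exact: u_neq0. Qed.

Lemma transcV x : transc x -> transc x^-1.
Proof.
move=> tx c; have x0 := transc_neq0 tx.
have sc : (size c <= (size c).+1)%N by [].
rewrite (px_rev _ sc) ?invr_eq0 // invrK => /eqP; rewrite mulf_eq0.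
rewrite expf_eq0 invr_eq0 (negPf x0) andbF /= => /eqP /tx; exact: rev_poly_eq0.
Qed.

Lemma transc_pole x : transc x -> exists p : place X, ~ pl_ring p x.
Proof. by move=> /transcV /transc_zero [p [_]]; rewrite invrK; exists p. Qed.

End Chevalley.

(** * Residue fields *)

Section Counting.
Variables (k : finFieldType) (X : function_field k).
Hypothesis places_discrete : forall p : place X, discrete p.
Implicit Types (p q : place X) (x y z : X) (c d : {poly k}).
Local Notation V := pl_ring.

(** Spanning over k(x) with denominators cleared, so that only polynomials occur. *)
Definition kx_spans x n (b : 'I_n -> X) := forall y, exists c (d : 'I_n -> {poly k}),
  c != 0 /\ px x c * y = \sum_(j < n) px x (d j) * b j.

Definition kx_basis x n (b : 'I_n -> X) := [/\ transc x, kx_spans x b &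
  forall d : 'I_n -> {poly k}, \sum_(j < n) px x (d j) * b j = 0 -> forall j, d j = 0].

(** A spanning family of least size is free: a relation with nonzero coefficient at [b i] could be
    combined with every expansion to eliminate [b i]. *)
Lemma kx_basis_exists : exists x n (b : 'I_n -> X), kx_basis x b.
Proof.
have [x [tx [r [b sb]]]] := ff_axiom X.
have {}tx : transc x.
  by move=> c e; apply/eqP; apply: contraT => /tx; rewrite -/(px x c) e eqxx.
pose Q n := `[< exists b : 'I_n -> X, kx_spans x b >].
have exQ : exists n, Q n by exists r; apply/asboolP; exists b.
case: (ex_minnP exQ) => n /asboolP [{sb}b sb] minn.
exists x, n, b; split=> // d e i; apply/eqP; apply: contraT => di.
case: n i b sb minn d e di => [[]//|n] i b sb minn d e di.
suff : (n.+1 <= n)%N by rewrite ltnn.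
apply: minn; apply/asboolP; exists (b \o lift i) => y.
have [c [d' [c0 ey]]] := sb y.
exists (d i * c), (fun j => d i * d' (lift i j) - d' i * d (lift i j)).
split; first by rewrite mulf_neq0.
transitivity (\sum_j px x (d i * d' j - d' i * d j) * b j); last first.
  by rewrite (bigD1_ord i) //= (mulrC (d i)) subrr px0 mul0r add0r.
under eq_bigr => j _ do rewrite pxB !pxM mulrBl -!mulrA.
by rewrite sumrB -!mulr_sumr e mulr0 subr0 -ey pxM mulrA.
Qed.

Lemma px_revs x n (d : 'I_n -> {poly k}) N : x != 0 ->
  (forall j, (size (d j) <= N.+1)%N) ->
  exists d' : 'I_n -> {poly k}, forall j,
    [/\ px x (d j) = x ^+ N * px x^-1 (d' j), (size (d' j) <= N.+1)%N
      & d' j = 0 -> d j = 0].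
Proof.
move=> x0 sd; exists (fun j => \poly_(i < N.+1) (d j)`_(N - i)) => j; split.
- exact: px_rev.
- exact: size_poly.
- exact: rev_poly_eq0.
Qed.

Lemma size_family n (d : 'I_n -> {poly k}) :
  exists N, forall j, (size (d j) <= N.+1)%N.
Proof.
by exists (\max_j size (d j))%N => j; apply/leqW/(leq_bigmax (F := fun j => size (d j))).
Qed.

(** k(x) = k(1/x): reversing all coefficients at one common degree turns relations over k[x] into
    relations over k[1/x]. *)
Lemma kx_basisV x n (b : 'I_n -> X) : kx_basis x b -> kx_basis x^-1 b.
Proof.
move=> [tx sb fb]; have x0 := transc_neq0 tx; split; first exact: transcV.
  move=> y; have [c [d [c0 e]]] := sb y.
  have [N hN] := size_family d.
  pose d1 (_ : 'I_1) := c; have [N1 hN1] := size_family d1.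
  have [|d' h'] := @px_revs x n d (N + N1) x0.
    by move=> j; apply: leq_trans (hN j) _; rewrite ltnS leq_addr.
  have [|c' h1'] := @px_revs x 1 d1 (N + N1) x0.
    by move=> j; apply: leq_trans (hN1 j) _; rewrite ltnS leq_addl.
  exists (c' ord0), d'; split.
    by apply: contraNneq c0 => z; have [_ _ /(_ z)] := h1' ord0; rewrite /d1 => ->.
  apply: (mulfI (expf_neq0 (N + N1) x0)).
  rewrite mulrA; have [<- _ _] := h1' ord0; rewrite /d1 e mulr_sumr.
  by apply: eq_bigr => j _; rewrite mulrA; have [-> _ _] := h' j.
move=> d e; have [N hN] := size_family d.
have [|d' h'] := @px_revs x^-1 n d N _ hN; first by rewrite invr_eq0.
move=> j; have [_ _ ] := h' j; apply; apply: fb.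
apply: (mulfI (expf_neq0 N (invr_neq0 x0))); rewrite mulr_sumr mulr0 -[RHS]e.
apply: eq_bigr => i _; rewrite mulrA; have [-> _ _] := h' i.
by rewrite invrK.
Qed.

(** * Counting functions with polynomial coordinates of bounded degree *)

Section Box.
Variables (x : X) (n : nat) (b : 'I_n -> X).
Hypothesis basis_b : kx_basis x b.

Definition box m y := exists d : 'I_n -> {poly k},
  (forall j, (size (d j) <= m)%N) /\ y = \sum_(j < n) px x (d j) * b j.

Lemma box_card (T : finType) (F : T -> X) m :
  injective F -> (forall t, box m (F t)) -> (#|T| <= (#|k| ^ m) ^ n)%N.
Proof.
move=> injF /choice [d hd].
pose G t := [ffun j : 'I_n => [ffun i : 'I_m => (d t j)`_i]].
have injG : injective G.
  move=> t t' /ffunP e; apply: injF; rewrite (hd t).2 (hd t').2.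
  apply: eq_bigr => j _; congr (px x _ * _); apply/polyP => i.
  have [lt|le] := ltnP i m; last first.
    by rewrite !nth_default // (leq_trans _ le) // (hd _).1.
  by have := e j; rewrite !ffunE => /ffunP /(_ (Ordinal lt)); rewrite !ffunE.
by have := leq_card _ injG; rewrite !card_ffun !card_ord.
Qed.

Lemma boxD m y z : box m y -> box m z -> box m (y + z).
Proof.
move=> [d [sd ->]] [e [se ->]]; exists (fun j => d j + e j); split.
  by move=> j; apply: leq_trans (size_polyD _ _) _; rewrite geq_max sd se.
by rewrite -big_split; apply: eq_bigr => j _ /=; rewrite pxD mulrDl.
Qed.

Lemma box0 m : box m 0.
Proof.
exists (fun=> 0); split=> [j|]; first by rewrite size_poly0.
by rewrite big1 // => j _; rewrite px0 mul0r.
Qed.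

Lemma boxM m t c y : (size c <= t.+1)%N -> box m y -> box (t + m) (px x c * y).
Proof.
move=> sc [d [sd ->]]; exists (fun j => c * d j); split.
  by move=> j; apply: leq_trans (size_polyMleq _ _) _; have := sd j; lia.
by rewrite mulr_sumr; apply: eq_bigr => j _; rewrite pxM mulrA.
Qed.

Lemma boxW m m' y : (m <= m')%N -> box m y -> box m' y.
Proof. by move=> le [d [sd ->]]; exists d; split=> // j; apply: leq_trans le. Qed.

Lemma box_denom (T : finType) (Y : T -> X) :
  exists c s, c != 0 /\ forall t, box s (px x c * Y t).
Proof.
have [_ sb _] := basis_b.
have /choice [c /choice [d hd]] : forall t, exists c (d : 'I_n -> {poly k}),
    c != 0 /\ px x c * Y t = \sum_(j < n) px x (d j) * b j by move=> t; apply: sb.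
pose e t := \prod_(t' | t' != t) c t'.
exists (\prod_t c t), (\max_t (size (e t) + \max_j size (d t j)))%N.
split; first by apply/prodf_neq0 => t _; apply: (hd t).1.
move=> t; have -> : \prod_t c t = e t * c t by rewrite mulrC (bigD1 t).
rewrite pxM -mulrA.
have : box (size (e t) + \max_j size (d t j)) (px x (e t) * (px x (c t) * Y t)).
  apply: boxM; first exact: leqW.
  exists (d t); split; last exact: (hd t).2.
  by move=> j; apply: (leq_bigmax (F := fun j => size (d t j))).
apply: boxW.
exact: (leq_bigmax (F := fun t => (size (e t) + \max_j size (d t j))%N)).
Qed.

End Box.

(** This is (1 + 1/Q)^m >= 1 + m/Q with denominators cleared. *)
Lemma bernoulli Q m : (Q ^ m * (Q + m) <= Q.+1 ^ m * Q)%N.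
Proof. by elim: m => [|m IH]; rewrite ?expnS; nia. Qed.

Lemma growth_bound M Q C : (0 < Q)%N -> (forall m, M ^ m <= C * Q ^ m)%N -> (M <= Q)%N.
Proof.
move=> Q0 h; rewrite leqNgt; apply/negP => lt.
have := h (C * Q).+1; set m := (C * Q).+1 => hm.
have h1 : (Q.+1 ^ m <= M ^ m)%N by rewrite leq_exp2r.
have h2 := bernoulli Q m.
have h3 : (Q ^ m * (Q + m) <= Q ^ m * (C * Q))%N.
  by apply: leq_trans h2 _; rewrite mulnCA mulnA leq_pmul2r //; apply: leq_trans h1 _; rewrite mulnC mulnC.
by move: h3; rewrite leq_pmul2l ?expn_gt0 ?Q0 // /m; lia.
Qed.

(* Expansions [sum_i f^i Y_i] with digits [Y_i] distinct modulo [f] are distinct,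
   and they lie in a box whose size grows with slope [n deg f]. *)
Lemma adic_count x n (b : 'I_n -> X) (f : {poly k}) t (S : seq (place X)) (T : finType) (Y : T -> X) :
  kx_basis x b -> (size f <= t.+1)%N -> px x f != 0 ->
  (forall p, p \in S -> V p (px x f)) ->
  (forall p i, p \in S -> V p (Y i)) ->
  (forall i j, i != j -> exists2 p, p \in S & ~ V p ((Y i - Y j) / px x f)) ->
  (#|T| <= #|k| ^ (n * t))%N.
Proof.
move=> bb sf f0 fS YS Yn.
pose Psi := fix Psi (s : seq T) := if s is a :: s' then Y a + px x f * Psi s' else 0.
have PsiV p s : p \in S -> V p (Psi s).
  move=> pS; elim: s => [|a s IH] /=; first exact: V0.
  by apply: VD; [apply: YS|apply: VM => //; apply: fS].
have inj s s' : size s = size s' -> Psi s = Psi s' -> s = s'.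
  elim: s s' => [|a s IH] [|a' s'] //= [sz] e.
  have aa : a = a'.
    apply/eqP; apply: contraT => /Yn [p pS []].
    have -> : (Y a - Y a') / px x f = Psi s' - Psi s.
      by apply: (mulIf f0); rewrite divfK //; move/eqP: e; rewrite -subr_eq0 => /eqP e; rewrite -[RHS]addr0 -e; ring.
    by apply: VB; apply: PsiV.
  subst a'; congr (_ :: _); apply: IH => //.
  by move/addrI: e; apply: mulfI.
have [c [s0 [c0 hY]]] := box_denom bb Y.
have bx s : box x b (s0 + size s * t) (px x c * Psi s).
  elim: s => [|a s IH] /=; first by rewrite mulr0; apply: box0.
  rewrite mulrDr mulrCA; apply: boxD.
    by apply: boxW (hY a); rewrite leq_addr.
  by apply: boxW (boxM sf IH); lia.
apply: (@growth_bound _ _ (#|k| ^ (n * s0))).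
  by rewrite expn_gt0; apply/orP; left; apply/card_gt0P; exists 0.
move=> m.
have c0' : px x c != 0 by case: bb => tx _ _; apply: contra_neq c0 => /tx.
have := @box_card x n b (m.-tuple T) (fun u => px x c * Psi u) (s0 + m * t) _ _.
rewrite card_tuple -!expnM -expnD => h; apply: leq_trans (h _ _) _.
- move=> u u' /(mulfI c0') /inj e; apply: val_inj; apply: e.
  by rewrite !size_tuple.
- by move=> u; have := bx u; rewrite size_tuple.
by rewrite leq_pexp2l //; [apply/card_gt0P; exists 0|lia].
Qed.

(** If every nonzero polynomial in x were a unit at p, an element y with a pole at p could satisfy
    no algebraic equation over k(x), by [V_integral]. But n + 1 powers of y in a space of dimension
    n are dependent; the dependence is obtained by counting. *)
Lemma poly_zero_at p x n (b : 'I_n -> X) : kx_basis x b -> V p x ->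
  exists2 c, c != 0 & vge p 1 (px x c).
Proof.
move=> bb Vx; apply: contrapT => H.
have [y nVy] := pl_nontrivial p.
have unt c : c != 0 -> V p (px x c)^-1.
  move=> c0; apply: contrapT => /(notV_inv places_discrete) [_].
  by rewrite invrK => h; apply: H; exists c.
have free N (c : nat -> {poly k}) : \sum_(i < N) px x (c i) * y ^+ i = 0 ->
    forall i, (i < N)%N -> c i = 0.
  elim: N => // N IH; rewrite big_ord_recr /= => e.
  have [cN|cN] := eqVneq (c N) 0.
    move: e; rewrite cN px0 mul0r addr0 => /IH h i; rewrite ltnS leq_eqVlt.
    by case/orP => [/eqP -> //|/h].
  case: nVy; apply: (V_integral places_discrete (n := N)
    (c := fun i : 'I_N => - px x (c i) / px x (c N))).
    by move=> i; apply: VM; [apply/VN/V_px|apply: unt].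
  have n0 : px x (c N) != 0.
    by case: bb => tx _ _; apply: contra_neq cN => /tx.
  apply: (mulfI n0); move/eqP: e; rewrite addrC addr_eq0 => /eqP ->.
  rewrite -sumrN mulr_sumr; apply: eq_bigr => i _.
  by rewrite mulrA [_ * (_ / _)]mulrC divfK // mulNr.
have [c [s0 [c0 hY]]] := box_denom bb (fun i : 'I_n.+1 => y ^+ i).
(* Chosen so that m (n + 1) > (m + s0) n: there are more combinations of the powers of y than
   elements in the box. *)
pose m := (n * s0).+1.
pose pl (u : {ffun 'I_n.+1 -> {ffun 'I_m -> k}}) (i : nat) : {poly k} :=
  \poly_(l < m) (if insub i is Some i' then if insub l is Some l' then u i' l' else 0 else 0).
pose F u := px x c * \sum_(i < n.+1) px x (pl u i) * y ^+ i.
have c0' : px x c != 0 by case: bb => tx _ _; apply: contra_neq c0 => /tx.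
have := @box_card x n b _ F (m + s0) _ _.
rewrite !card_ffun !card_ord -!expnM => h.
have k1 : (1 < #|k|)%N by rewrite (cardD1 0) (cardD1 1) !inE oner_neq0.
suff : (#|k| ^ (m * n.+1) <= #|k| ^ ((m + s0) * n))%N by rewrite leq_exp2l // /m; nia.
apply: h => [u u' /(mulfI c0') /eqP|u].
  rewrite -subr_eq0 -sumrB => /eqP e.
  have e0 : \sum_(i < n.+1) px x (pl u i - pl u' i) * y ^+ i = 0.
    by rewrite -[RHS]e; apply: eq_bigr => i _; rewrite pxB mulrBl.
  apply/ffunP => i; apply/ffunP => l.
  have /eqP := free _ (fun i => pl u i - pl u' i) e0 i (ltn_ord i).
  rewrite subr_eq0 => /eqP /polyP /(_ l); rewrite !coef_poly ltn_ord !insubT //= => lt_l lt_i.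
  have -> : Sub (nat_of_ord i) lt_i = i by exact: val_inj.
  by have -> : Sub (nat_of_ord l) lt_l = l by exact: val_inj.
rewrite /F mulr_sumr; apply: big_ind; first exact: box0.
  by move=> ? ?; apply: boxD.
move=> i _; rewrite mulrCA; apply: boxM => //.
by apply: leqW; apply: size_poly.
Qed.

Definition residue_reps p (T : finType) (Y : T -> X) (v : nat) :=
  [/\ forall t, V p (Y t), forall t t', t != t' -> ~ vge p v (Y t - Y t')
    & forall y, V p y -> exists t, vge p v (y - Y t)].

Lemma residue_bound p : exists M, forall (T : finType) (Y : T -> X),
  (forall t, V p (Y t)) -> (forall t t', t != t' -> ~ vge p 1 (Y t - Y t')) ->
  (#|T| <= M)%N.
Proof.
have [x [n [b bb]]] := kx_basis_exists.
have key x' f : kx_basis x' b -> px x' f != 0 -> vge p 1 (px x' f) ->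
    exists M, forall (T : finType) (Y : T -> X),
  (forall t, V p (Y t)) -> (forall t t', t != t' -> ~ vge p 1 (Y t - Y t')) ->
  (#|T| <= M)%N.
  move=> bb' f0 vf; exists (#|k| ^ (n * size f))%N => T Y VY nY.
  apply: (@adic_count x' n b f _ [:: p]) => //.
  - by move=> q; rewrite inE => /eqP ->; apply/vge0; apply: vgeW vf.
  - by move=> q i; rewrite inE => /eqP ->.
  - move=> i j /nY nij; exists p; rewrite ?inE // => h; apply: nij.
    rewrite -(divfK f0 (Y i - Y j)) -(add0r (1 : int)).
    by apply: vgeM => //; apply/vge0.
have [Vx|nVx] := pselect (V p x).
  have [c c0 vc] := poly_zero_at bb Vx; apply: (key x c) => //.
  by case: bb => tx _ _; apply: contra_neq c0 => /tx.
have [x0 vx] := notV_inv places_discrete nVx.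
by apply: (key x^-1 'X); rewrite ?pxX ?invr_eq0 //; apply: kx_basisV.
Qed.

(** The cardinality of the residue field, read off a system of representatives since no quotient is
    formed. *)
Definition Nrm p : nat := xget 0%N
  [set N | exists Y : 'I_N -> X, residue_reps p Y 1].

(** A family of incongruent elements of maximal size, which exists by [residue_bound], is
    complete. *)
Lemma NrmP p : exists Y : 'I_(Nrm p) -> X, residue_reps p Y 1.
Proof.
rewrite /Nrm; case: xgetP => // /(_ _) H; exfalso.
have [M hM] := residue_bound p.
pose Q N := `[< exists Y : 'I_N -> X, (forall t, V p (Y t)) /\
   (forall t t', t != t' -> ~ vge p 1 (Y t - Y t')) >].
have exQ : exists N, Q N by exists 0%N; apply/asboolP; exists (fun=> 0); split=> [|[]//] t; apply: V0.
have bQ N : Q N -> (N <= M)%N.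
  by move=> /asboolP [Y [h1 h2]]; have := hM _ Y h1 h2; rewrite card_ord.
case: (ex_maxnP exQ bQ) => N /asboolP [Y [h1 h2]] maxN.
apply: (H N); exists Y; split=> // y Vy; apply: contrapT => ny.
suff : (N.+1 <= N)%N by rewrite ltnn.
apply: maxN; apply/asboolP.
exists (fun i => if unlift ord0 i is Some j then Y j else y); split.
  by move=> t; case: unliftP.
move=> t t'; case: unliftP => [j ->|->]; case: unliftP => [j' ->|->] //.
- by move=> ne; apply: h2; apply: contra_neq ne => ->.
- by move=> _ h; apply: ny; exists j; rewrite -opprB; apply: vgeN.
- by move=> _ h; apply: ny; exists j'.
Qed.

Lemma Nrm_gt1 p : (1 < Nrm p)%N.
Proof.
have [Y [h1 h2 h3]] := NrmP p.
have [t0 a0] := h3 0 (V0 p); have [t1 a1] := h3 1 (V1 p).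
case: (Nrm p) Y t0 t1 h1 h2 h3 a0 a1 => [|[|//]] Y t0 t1; first by case: t0.
rewrite !ord1 => _ _ _ a0 a1; have := vgeB a1 a0.
have -> : 1 - Y 0 - (0 - Y 0) = 1 by ring.
by rewrite /vge mul1r => /(V_unifz places_discrete).
Qed.

(** Each step of the induction appends one digit of the expansion in powers of the uniformizer. *)
Lemma reps_exist p v : exists (T : finType) (Y : T -> X),
  #|T| = (Nrm p ^ v)%N /\ residue_reps p Y v.
Proof.
elim: v => [|v [T [Y [cT [h1 h2 h3]]]]].
  exists unit, (fun=> 0); rewrite card_unit; split=> //; split.
  - by move=> _; apply: V0.
  - by move=> [] [].
  - by move=> y Vy; exists tt; apply/vge0; rewrite subr0.
have [Z [g1 g2 g3]] := NrmP p; pose w : X := unif p ^ (v : int).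
have w0 : w != 0 by apply: unifz_neq0.
have Vw : V p w by apply/(V_unifz places_discrete).
have vwP m y : vge p (v%:Z + m) (w * y) <-> vge p m y.
  by rewrite /vge opprD expfzDr ?unif_neq0 // mulrACA -(invr_expz _ v%:Z) -/w mulfV // mul1r.
exists (T * 'I_(Nrm p))%type, (fun u => Y u.1 + w * Z u.2); split.
  by rewrite card_prod cT card_ord expnSr.
have S1 : v.+1%:Z = v%:Z + 1 by lia.
split=> [[t i]|[t i] [t' i'] ne|y Vy] /=.
- by apply: VD => //; apply: VM.
- rewrite S1 => h.
  have e : Y t + w * Z i - (Y t' + w * Z i') = (Y t - Y t') + w * (Z i - Z i') by ring.
  have tt' : t = t'.
    apply/eqP; apply: contraT => /h2; case.
    have -> : Y t - Y t' = (Y t + w * Z i - (Y t' + w * Z i')) - w * (Z i - Z i') by ring.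
    apply: vgeB; first by apply: vgeW h => //; lia.
    by rewrite -[v%:Z]addr0; apply/vwP/vge0/VB.
  move: h; rewrite e tt' subrr add0r => /vwP; apply: g2.
  by apply: contra_neq ne => ->; rewrite tt'.
- have [t ht] := h3 y Vy.
  have Vq : V p ((y - Y t) / w) by move: ht; rewrite /vge -invr_expz.
  have [i hi] := g3 _ Vq; exists (t, i) => /=; rewrite S1.
  have -> : y - (Y t + w * Z i) = w * ((y - Y t) / w - Z i).
    by rewrite mulrBr [w * (_ / _)]mulrC divfK //; ring.
  exact/vwP.
Qed.

End Counting.

(** * Weak approximation *)

Section Approximation.
Variables (k : finFieldType) (X : function_field k).
Hypothesis places_discrete : forall p : place X, discrete p.
Implicit Types (p q : place X) (x y z : X) (S T : seq (place X)) (e : place X -> nat).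
Local Notation V := pl_ring.
Let D := places_discrete.

Lemma vge1_1 p : ~ vge p 1 (1 : X).
Proof. by rewrite /vge mul1r => /(V_unifz D). Qed.

Lemma vunit_1D p y : vge p 1 y -> vunit p (1 + y).
Proof.
move=> hy.
have nz (z : X) : vge p 1 z -> 1 + y != z.
  move=> hz; apply/eqP => e; apply: (@vge1_1 p).
  have -> : (1 : X) = z - y by rewrite -e addrK.
  exact: vgeB.
split; first by apply: nz; apply: vge_0.
  by apply: VD; [apply: V1|apply/vge0; apply: vgeW hy].
apply: contrapT => /(notV_inv D) [_]; rewrite invrK => h.
by have := nz _ h; rewrite eqxx.
Qed.

Lemma vunit_vge p m x y : vunit p x -> vge p m y -> vge p m (x * y).
Proof. by move=> [_ Vx _] hy; rewrite -[m]add0r; apply: vgeM => //; apply/vge0. Qed.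

Lemma add1V y : y != 0 -> 1 + y^-1 = (1 + y) / y.
Proof. by move=> y0; rewrite mulrDl mul1r divff // addrC. Qed.

Lemma vunit_frac p y : ~ V p y -> vunit p (y / (1 + y)).
Proof.
move=> /(notV_inv D) [y0 vy]; have u := vunitV (vunit_1D vy).
by rewrite (add1V y0) invfM invrK mulrC in u.
Qed.

Lemma vgeX p m x (n : nat) : (0 < n)%N -> 0 <= m -> vge p m x -> vge p m (x ^+ n).
Proof.
move=> n0 m0 vx; case: n n0 => // n _; rewrite exprSr.
rewrite -[m]add0r; apply: vgeM => //; apply/vge0/VX/vge0; exact: vgeW vx.
Qed.

Lemma vge_natX p x (n : nat) : vge p 1 x -> vge p n%:Z (x ^+ n).
Proof.
move=> vx; elim: n => [|n IH]; first by rewrite expr0; apply/vge0/V1.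
by rewrite exprS -[n.+1%:Z]/(Posz (1 + n)%N) PoszD; apply: vgeM.
Qed.

Lemma notV_X p x (n : nat) : (0 < n)%N -> ~ V p x -> ~ V p (x ^+ n).
Proof.
move=> n0 nV; have [x0 _] := notV_inv D nV; move: nV.
by rewrite !V_vl // ?expf_neq0 // vlX //; nia.
Qed.

Lemma place_sep p q : p <> q -> exists z, ~ V p z /\ vge q 1 z.
Proof.
move=> pq; have [a Va nVa] := places_incl D pq.
have [b Vb nVb] := places_incl D (nesym pq).
have [a0 va] := notV_inv D nVa.
exists (b / a); split; first by move=> h; apply: nVb; rewrite -(divfK a0 b); apply: VM.
by rewrite -[1]add0r; apply: vgeM => //; apply/vge0.
Qed.

Lemma vge_mulr p (m E : nat) x w : (m + `|vl p w| <= E)%N -> vge p E x -> vge p m (x * w).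
Proof.
move=> le hx; have [->|w0] := eqVneq w 0; first by rewrite mulr0; apply: vge_0.
have vw : vge p (vl p w) w by apply/vgeP.
by apply: vgeW (vgeM D hx vw) => //; lia.
Qed.

(** Induction of Artin and Whaples. If the z found so far is integral at the new place q', the
    product z^m z' works; if it has a pole there, z^m / (1 + z^m) is a unit at p and at q' and small
    on [T], and is multiplied by z'. *)
Lemma sep_list p T : p \notin T -> exists z, ~ V p z /\ forall q, q \in T -> vge q 1 z.
Proof.
elim: T => [_|q' T IH].
  by have [z] := pl_nontrivial p; exists z.
rewrite inE negb_or => /andP [/eqP pq' /IH [z [nVz zT]]].
have [z' [nVz' z'q]] := place_sep pq'.
have [z0 vz] := notV_inv D nVz; have [z'0 vz'] := notV_inv D nVz'.
(* Large enough for the zeros of z^m on [T] to outweigh the poles of z'. *)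
pose m := (\sum_(q <- T) `|vl q z'| + 1)%N.
have m0 : (0 < m)%N by rewrite /m addn1.
have big q : q \in T -> vge q 1 (z ^+ m * z').
  move=> qT; apply: (@vge_mulr q 1 m); last exact/vge_natX/zT.
  by rewrite /m (big_rem q) //= addnC leq_add2r leq_addr.
have [Vz|nVz''] := pselect (V q' z).
  exists (z ^+ m * z'); split; last first.
    move=> q; rewrite inE => /orP [/eqP ->|/big //].
    by rewrite -[1]add0r; apply: vgeM => //; apply/vge0/VX.
  move=> h; apply: (notV_X m0 nVz); rewrite -(mulfK z'0 (z ^+ m)).
  by apply: VM => //; apply/vge0; apply: vgeW vz'.
exists (z ^+ m / (1 + z ^+ m) * z'); split.
  move=> h; have u := vunit_frac (notV_X m0 nVz); apply: nVz'.
  case: (u) => u0 _ uV; rewrite -(mulKf u0 z'); exact: VM.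
move=> q; rewrite inE => /orP [/eqP ->|qT].
  by apply: vunit_vge => //; apply/vunit_frac/notV_X.
rewrite mulrAC mulrC; apply: vunit_vge (big q qT).
by apply/vunitV/vunit_1D/vgeX/zT.
Qed.

(** Let w be a high power of an element with a pole at p and zeros on [T]: then w / (1 + w) is close
    to 1 where w is large and to 0 where w is small. *)
Lemma approx1 p T (m : nat) : p \notin T ->
  exists z, vge p m (1 - z) /\ forall q, q \in T -> vge q m z.
Proof.
move=> /sep_list [z [nV zT]]; have [z0 vz] := notV_inv D nV.
pose w := z ^+ m.+1; have w0 : w != 0 by rewrite expf_neq0.
have vw : vge p m.+1%:Z w^-1 by rewrite -exprVn; apply: vge_natX.
exists (w / (1 + w)); split.
  have u : vunit p (1 + w^-1) by apply: vunit_1D; apply: vgeW vw.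
  have -> : 1 - w / (1 + w) = (1 + w^-1)^-1 * w^-1.
    have w1 : 1 + w != 0 by case: u; rewrite (add1V w0) mulf_eq0 negb_or => /andP[].
    rewrite (add1V w0) invfM invrK mulfK // -{1}(divff w1) -mulrBl.
    by rewrite addrK mul1r.
  by apply: vunit_vge (vunitV u) _; apply: vgeW vw => //; lia.
move=> q qT; rewrite mulrC; apply: vunit_vge.
  by apply/vunitV/vunit_1D/vgeX/zT.
by have := vge_natX m.+1 (zT q qT); apply: vgeW => //; lia.
Qed.

Lemma weak_approximation S e (y : place X -> X) : uniq S ->
  exists x, forall p, p \in S -> vge p (e p) (x - y p).
Proof.
elim: S => [_|p S IH /= /andP [pS /IH [x hx]]]; first by exists 0.
pose w := y p - x.
pose m := (\sum_(q <- p :: S) (e q + `|vl q w|))%N.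
have hm q : q \in p :: S -> (e q + `|vl q w| <= m)%N.
  by move=> qS; rewrite /m (big_rem q) //= leq_addr.
have [z [z1 z0]] := approx1 m pS.
exists (x + z * w) => q; rewrite inE => /orP [/eqP ->|qS].
  have -> : x + z * w - y p = - ((1 - z) * w) by rewrite /w; ring.
  by apply: vgeN; apply: vge_mulr z1; apply: hm; rewrite inE eqxx.
have -> : x + z * w - y q = (x - y q) + z * w by ring.
apply: vgeD; first exact: hx.
by apply: (@vge_mulr _ _ m); [apply: hm; rewrite inE qS orbT|apply: z0].
Qed.

(** These represent the product of the rings O_p / m_p^(e p), still place by place; weak
    approximation will turn them into functions. *)
Lemma reps_family S e : uniq S -> exists (T : finType) (Y : T -> place X -> X),
  [/\ #|T| = (\prod_(p <- S) Nrm p ^ e p)%N,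
      forall t p, p \in S -> V p (Y t p),
      forall t t', t != t' -> exists2 p, p \in S & ~ vge p (e p) (Y t p - Y t' p)
    & forall y : place X -> X, (forall p, p \in S -> V p (y p)) ->
        exists t, forall p, p \in S -> vge p (e p) (y p - Y t p)].
Proof.
elim: S => [_|p S IH /= /andP [pS /IH [T [Y [cT h1 h2 h3]]]]].
  exists unit, (fun _ _ => 0); rewrite card_unit big_nil; split=> [//|//|[] []//|].
  by move=> y _; exists tt.
have [T' [Z [cT' [g1 g2 g3]]]] := reps_exist D p (e p).
exists (T' * T)%type, (fun u q => if q == p then Z u.1 else Y u.2 q).
have neq q : q \in S -> (q == p) = false.
  by move=> qS; apply: contraNF pS => /eqP <-.
split.
- by rewrite card_prod cT cT' big_cons.
- move=> t q; rewrite inE; case: eqP => [-> _|_ /= qS]; [exact: g1|exact: h1].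
- move=> [t' t] [s' s] ne; have [e'|ne'] := eqVneq t' s'.
    have ts : t != s by apply: contra_neq ne => ->; rewrite e'.
    have [q qS hq] := h2 _ _ ts; exists q; first by rewrite inE qS orbT.
    by rewrite (neq q qS).
  by exists p; rewrite ?inE eqxx //; apply: g2.
move=> y Vy; have [|t ht] := h3 y.
  by move=> q qS; apply: Vy; rewrite inE qS orbT.
have [|t' ht'] := g3 (y p); first by apply: Vy; rewrite inE eqxx.
exists (t', t) => q; rewrite inE; case: eqP => [-> //|_ /= qS]; exact: ht.
Qed.

(** The zeros of f(x) have total degree at most n deg f: weak approximation lifts the residue
    classes modulo them to functions, and [adic_count] bounds the number of these. *)
Lemma zero_count x n (b : 'I_n -> X) (f : {poly k}) t S : kx_basis x b ->
  (size f <= t.+1)%N -> px x f != 0 -> uniq S ->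
  (forall p, p \in S -> V p (px x f)) ->
  (\prod_(p <- S) Nrm p ^ `|vl p (px x f)| <= #|k| ^ (n * t))%N.
Proof.
move=> bb sf f0 uS Vf; pose e p := `|vl p (px x f)|%N.
have [T [Y [<- h1 h2 _]]] := reps_family e uS.
have /choice [Z hZ] : forall t, exists x, forall p, p \in S -> vge p (e p) (x - Y t p).
  by move=> t'; apply: weak_approximation.
have ve p : p \in S -> vl p (px x f) = e p.
  by move=> /Vf /(vl_V D); rewrite /e; lia.
apply: (@adic_count k X x n b f t S T Z) => //.
- move=> p i pS; rewrite -(subrK (Y i p) (Z i)); apply: VD; last exact: h1.
  by apply/vge0; apply: vgeW (hZ i p pS).
- move=> i j /h2 [p pS np]; exists p => // h; apply: np.
  have -> : Y i p - Y j p = (Z i - Z j) / px x f * px x f - (Z i - Y i p) + (Z j - Y j p).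
    by rewrite divfK //; ring.
  apply: vgeD (hZ _ _ pS); apply: vgeB (hZ _ _ pS).
  by rewrite -[_%:Z]add0r; apply: vgeM => //; [apply/vge0|apply/vgeP; rewrite ?ve].
Qed.

End Approximation.

(** * Riemann's inequality *)

Section RiemannRoch.
Variables (k : finFieldType) (X : function_field k).
Hypothesis places_discrete : forall p : place X, discrete p.
Hypothesis finite_poles : forall x : X, finite_set [set p : place X | ~ pl_ring p x].
Implicit Types (p q : place X) (x y z : X) (d : place X -> X).
Local Notation V := pl_ring.
Let D := places_discrete.

(* [d] represents a divisor of Cbar: multiplicity [- vl p (d p)] at [p]; [L d] is its space of
   global sections and [idn d] is q to the power of its degree. *)
Definition pidele d := (forall p, d p != 0) /\ finite_set [set p | ~ vunit p (d p)].

Lemma pidele_fset d : pidele d -> exists A : {fset place X}, forall p, p \notin A -> vunit p (d p).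
Proof.
move=> [_ fd]; exists (fset_set [set p | ~ vunit p (d p)]) => p.
by rewrite in_fset_set // => np; apply: contrapT => h; move/negP: np; apply; apply/mem_set.
Qed.

Lemma fset_pidele d (A : {fset place X}) : (forall p, d p != 0) ->
  (forall p, p \notin A -> vunit p (d p)) -> pidele d.
Proof.
move=> d0 h; split=> //; apply: (@sub_finite_set _ _ [set` A]); last exact: finite_fset.
by move=> p /= np; apply: contrapT => /negP /h.
Qed.

Lemma pideleM d d' : pidele d -> pidele d' -> pidele (fun p => d p * d' p).
Proof.
move=> [d0 fd] [d0' fd']; split=> [p|]; first by rewrite mulf_neq0.
apply: (@sub_finite_set _ _ ([set p | ~ vunit p (d p)] `|` [set p | ~ vunit p (d' p)])).
  move=> p /= h; apply: contrapT => /not_orP [/contrapT a /contrapT b].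
  by apply: h; apply: vunitM.
by rewrite finite_setU.
Qed.

Lemma pideleV d : pidele d -> pidele (fun p => (d p)^-1).
Proof.
move=> [d0 fd]; split=> [p|]; first by rewrite invr_eq0.
by apply: sub_finite_set fd => p /= h u; apply: h; apply: vunitV.
Qed.

Lemma pideleX d n : pidele d -> pidele (fun p => d p ^+ n).
Proof.
move=> hd; elim: n => [|n IH]; last first.
  by under eq_fun do rewrite exprS; apply: pideleM.
apply: (@fset_pidele _ fset0) => p; rewrite expr0 ?oner_eq0 // => _; exact: vunit1.
Qed.

Lemma pidele_const z : z != 0 -> pidele (fun=> z).
Proof.
move=> z0; split=> //.
apply: (@sub_finite_set _ _ ([set p | ~ V p z] `|` [set p | ~ V p z^-1])).
  move=> p /= h; apply: contrapT => /not_orP [/contrapT a /contrapT b].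
  by apply: h; split.
by rewrite finite_setU; split.
Qed.

Definition idn d : rat := \big[*%R/1]_(p \in [set: place X]) ((Nrm p)%:R : rat) ^ (- vl p (d p)).

Lemma idnE (A : {fset place X}) d : (forall p, p \notin A -> vunit p (d p)) ->
  idn d = \prod_(p <- A) (Nrm p)%:R ^ (- vl p (d p)).
Proof.
move=> h; apply: fsbigTE => p /h u; have [u0 _ _] := u.
by move/(vunitP D p u0): u => ->; rewrite oppr0.
Qed.

Lemma Nrm_gt0 p : (0 : rat) < (Nrm p)%:R.
Proof. by rewrite ltr0n; apply: ltnW; apply: Nrm_gt1 D p. Qed.
Lemma Nrm_neq0 p : ((Nrm p)%:R : rat) != 0.
Proof. by rewrite lt0r_neq0 // Nrm_gt0. Qed.

Lemma idn_gt0 d : pidele d -> 0 < idn d.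
Proof.
move=> /pidele_fset [A hA]; rewrite (idnE hA).
by apply: prodr_gt0 => p _; apply: exprz_gt0; apply: Nrm_gt0.
Qed.

Lemma idnM d d' : pidele d -> pidele d' -> idn (fun p => d p * d' p) = idn d * idn d'.
Proof.
move=> hd hd'; have [A hA] := pidele_fset hd; have [B hB] := pidele_fset hd'.
have AB p : p \notin (A `|` B)%fset -> vunit p (d p) /\ vunit p (d' p).
  by rewrite in_fsetU negb_or => /andP [/hA a /hB b].
rewrite !(@idnE (A `|` B)%fset); try by move=> p /AB [].
  rewrite -big_split /=; apply: eq_bigr => p _.
  by rewrite vlM ?(hd.1, hd'.1) // opprD expfzDr // Nrm_neq0.
by move=> p /AB [a b]; apply: vunitM.
Qed.

Lemma idn1 : idn (fun=> 1) = 1.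
Proof.
by rewrite (@idnE fset0) ?big_seq_fset0 // => p _; apply: vunit1.
Qed.

Lemma idnV d : pidele d -> idn (fun p => (d p)^-1) = (idn d)^-1.
Proof.
move=> hd; have hV := pideleV hd.
apply: (mulfI (lt0r_neq0 (idn_gt0 hd))); rewrite mulfV ?lt0r_neq0 ?idn_gt0 //.
rewrite -idnM //; have -> : (fun p => d p * (d p)^-1) = (fun=> 1); last exact: idn1.
by apply/funext => p; rewrite mulfV // hd.1.
Qed.

Lemma idn_unit d : (forall p, vunit p (d p)) -> idn d = 1.
Proof. by move=> h; rewrite (@idnE fset0) ?big_seq_fset0. Qed.

Lemma idn_ge1 d : pidele d -> (forall p, V p (d p)^-1) -> 1 <= idn d.
Proof.
move=> hd Vd; have [A hA] := pidele_fset hd; rewrite (idnE hA).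
apply: (big_ind (fun r => 1 <= r)) => // [r s|p _]; first exact: mulr_ege1.
have := vl_V D (Vd p); rewrite (vlV D) => h.
rewrite -[_ ^ _]/(_ ^ _); case: (- vl p (d p)) h => // n _.
by apply: exprn_ege1; rewrite ler1n; apply: ltnW; apply: Nrm_gt1 D p.
Qed.

Definition pbump q (n : nat) d p := if p == q then d p * unif q ^ (- n%:Z) else d p.

Lemma pidele_bump q n d : pidele d -> pidele (pbump q n d).
Proof.
move=> hd; have [A hA] := pidele_fset hd; apply: (@fset_pidele _ (q |` A)%fset) => p.
  by rewrite /pbump; case: (p =P q) => _; [apply: mulf_neq0; [exact: hd.1|exact: unifz_neq0]|exact: hd.1].
by rewrite in_fset1U negb_or /pbump => /andP [/negPf -> /hA].
Qed.

Lemma idn_bump q n d : pidele d -> idn (pbump q n d) = (Nrm q)%:R ^+ n * idn d.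
Proof.
move=> hd; have [A hA] := pidele_fset hd.
pose B := (q |` A)%fset; have qB : q \in B by rewrite in_fset1U eqxx.
have hB p : p \notin B -> p != q /\ vunit p (d p).
  by rewrite in_fset1U negb_or => /andP [? /hA].
rewrite (@idnE B); last by move=> p /hB [/negPf + u]; rewrite /pbump => ->.
rewrite (@idnE B d); last by move=> p /hB [].
rewrite !(big_fsetD1 q qB) /= mulrA; congr (_ * _).
  rewrite /pbump eqxx (vlM D) ?(hd.1) ?(unifz_neq0 D) // (vl_unifz D) opprD opprK addrC.
  by rewrite expfzDr // Nrm_neq0.
rewrite [LHS]big_seq [RHS]big_seq; apply: eq_bigr => p.
by rewrite in_fsetD1 /pbump => /andP [/negPf ->].
Qed.

Definition L d : set X := [set x | forall p, V p (x / d p)].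
Definition ell d : nat := #|` fset_set (L d) |.

Lemma L0 d : L d 0. Proof. by move=> p; rewrite mul0r; apply: V0. Qed.
Lemma LB d x y : L d x -> L d y -> L d (x - y).
Proof. by move=> a b p; rewrite mulrBl; apply: VB. Qed.

(** [kap] plays the role of the class map from the adelic lattice of d' to its quotient by that of
    d, of order idn d' / idn d; only the places where d or d' is not a unit contribute. *)
Lemma adele_classes d d' : pidele d -> pidele d' -> (forall p, V p (d p / d' p)) ->
  exists (T : finType) (kap : (place X -> X) -> T), (#|T|%:R * idn d = idn d') /\
  forall y y' : place X -> X, (forall p, V p (y p / d' p)) -> (forall p, V p (y' p / d' p)) ->
    kap y = kap y' -> forall p, V p ((y p - y' p) / d p).
Proof.
move=> hd hd' dd'; have [A hA] := pidele_fset hd; have [B hB] := pidele_fset hd'.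
have AB p : p \notin (A `|` B)%fset -> vunit p (d p) /\ vunit p (d' p).
  by rewrite in_fsetU negb_or => /andP [/hA a /hB b].
pose e p := `|vl p (d p / d' p)|%N.
have ve p : vl p (d p / d' p) = e p by have := vl_V D (dd' p); rewrite /e; lia.
have [T [Y [cT h1 h2 h3]]] := reps_family D e (fset_uniq (A `|` B)%fset).
have nz p : d p / d' p != 0 by rewrite mulf_neq0 ?invr_eq0 ?(hd.1) ?(hd'.1).
have ex (y : place X -> X) : exists t, (forall p, V p (y p / d' p)) ->
    forall p, p \in (A `|` B)%fset -> vge p (e p) (y p / d' p - Y t p).
  have [Vy|nVy] := pselect (forall p, V p (y p / d' p)).
    by have [t ht] := h3 (fun p => y p / d' p) (fun p _ => Vy p); exists t.
  by have [t _] := h3 (fun=> 0) (fun p _ => V0 p); exists t.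
have [kap hk] := choice ex; exists T, kap; split.
  rewrite cT !(@idnE (A `|` B)%fset); try by move=> p /AB [].
  rewrite natr_prod -big_split /=; apply: eq_bigr => p _.
  rewrite natrX exprnP -expfzDr ?Nrm_neq0 //; congr (_ ^ _).
  by rewrite -ve vlf ?(hd.1) ?(hd'.1) //; ring.
move=> y y' Vy Vy' eqk p; have [pA|/AB [[d0 _ Vd] [d0' Vd' _]]] := boolP (p \in (A `|` B)%fset).
  have a := hk y Vy p pA; have b := hk y' Vy' p pA; rewrite eqk in a.
  have nzV : (d p / d' p)^-1 != 0 by rewrite invr_eq0.
  have -> : (y p - y' p) / d p = (y p - y' p) / d' p * (d p / d' p)^-1.
    by rewrite invfM invrK mulrA [_ / d' p * _]mulrAC divfK ?(hd'.1).
  apply/vge0; rewrite -(subrr (e p)%:Z); apply: vgeM => //; last first.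
    by apply/(vgeP D p _ nzV); rewrite (vlV D) ve.
  have -> : (y p - y' p) / d' p = (y p / d' p - Y (kap y') p) - (y' p / d' p - Y (kap y') p).
    by ring.
  exact: vgeB.
apply: VM => //; rewrite -(divfK d0' (y p - y' p)); apply: VM => //.
by rewrite mulrBl; apply: VB.
Qed.

(** Riemann-Roch by counting. Write A(d) for the adelic lattice of d. The adeles Y_i, distinct
    modulo A(d) + X, and the functions in [B] give sums Y_i + b in A(d'); two sums in the same class
    modulo A(d) have the same i and differ by an element of L(d). *)
Lemma count_fset d d' M (Y : 'I_M -> place X -> X) (B : {fset X}) :
  pidele d -> pidele d' -> (forall p, V p (d p / d' p)) -> finite_set (L d) ->
  (forall i p, V p (Y i p / d' p)) ->
  (forall i j, i != j -> ~ exists x, forall p, V p ((Y i p - Y j p - x) / d p)) ->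
  (forall x, x \in B -> L d' x) ->
  (M * #|` B|)%:R * idn d <= idn d' * (ell d)%:R.
Proof.
move=> hd hd' dd' fL VY nY hB.
have [T [kap [<- hk]]] := adele_classes hd hd' dd'.
rewrite mulrAC -natrM ler_wpM2r ?ler_nat ?ltW ?idn_gt0 //.
pose U : finType := ('I_M * B)%type.
pose y (u : U) p := Y u.1 p + val u.2.
have Vy u p : V p (y u p / d' p).
  by rewrite /y mulrDl; apply: VD; [exact: VY|exact: hB (valP u.2) p].
pose g u := kap (y u).
(* One sum is picked in each class, so that a sum is determined by its class and its difference from
   the chosen one. *)
pose rep u := odflt u [pick v | g v == g u].
have g_rep u : g (rep u) = g u.
  by rewrite /rep; case: pickP => [v /eqP //|/(_ u)]; rewrite eqxx.
have rep_eq u v : g u = g v -> rep u = rep v.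
  by move=> e; rewrite /rep e; case: pickP => // /(_ v); rewrite eqxx.
have key u : u.1 = (rep u).1 /\ L d (val u.2 - val (rep u).2).
  have h := hk _ _ (Vy u) (Vy (rep u)) (esym (g_rep u)).
  have e1 : u.1 = (rep u).1.
    apply/eqP; apply: contraT => /nY []; exists (val (rep u).2 - val u.2) => p.
    have := h p; rewrite /y; congr (V p (_ / _)); ring.
  split=> // p; have := h p; rewrite /y -e1; congr (V p (_ / _)); ring.
pose Ld := fset_set (L d).
have memLd x : x \in Ld = (x \in L d) by rewrite in_fset_set.
have h0 : 0 \in Ld by rewrite memLd; apply/mem_set/L0.
pose h u : T * Ld := (g u, insubd (FSetSub h0) (val u.2 - val (rep u).2)).
have inj : injective h.
  move=> u v [guv /(congr1 val)].
  have inL w : val w.2 - val (rep w).2 \in Ld by rewrite memLd; apply/mem_set; case: (key w).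
  rewrite !val_insubd !inL (rep_eq _ _ guv) => /addIr e2.
  have [a _] := key u; have [b _] := key v.
  rewrite [u]surjective_pairing [v]surjective_pairing a b (rep_eq _ _ guv).
  by congr (_, _); apply: val_inj.
by have := leq_card h inj; rewrite /U !card_prod card_ord -!cardfE.
Qed.

Lemma transc_basis : exists x n (b : 'I_n -> X), kx_basis x b.
Proof. exact: kx_basis_exists. Qed.

Lemma place_exists : exists p : place X, True.
Proof. by have [x [n [b [tx _ _]]]] := transc_basis; have [p _] := transc_pole tx; exists p. Qed.

Lemma algebraic_integral p y (c : {poly k}) : px y c = 0 -> c != 0 -> V p y.
Proof.
move=> e c0; pose n := (size c).-1.
have sc : size c = n.+1 by rewrite prednK // size_poly_gt0.
have l0 : ff_const X c`_n != 0 by rewrite fmorph_eq0 -/(lead_coef c) lead_coef_eq0.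
apply: (V_integral D (n := n) (c := fun i : 'I_n => ff_const X (- c`_i / c`_n))).
  by move=> i; apply: pl_const.
apply: (mulfI l0); move: e; rewrite (@pxE _ _ _ _ n.+1) ?sc // big_ord_recr /=.
move/eqP; rewrite addrC addr_eq0 => /eqP ->; rewrite -sumrN mulr_sumr.
apply: eq_bigr => i _; rewrite mulrA -rmorphM mulrCA mulfV ?mulr1 ?rmorphN ?mulNr //.
by rewrite -(fmorph_eq0 (ff_const X)).
Qed.

(** A function without poles is algebraic over k, since a transcendental one has a pole; then its
    inverse is algebraic too, hence integral at every place. *)
Lemma constant_unit x : L (fun=> 1) x -> x != 0 -> forall p, vunit p x.
Proof.
move=> Lx x0 p; have Vx q : V q x by have := Lx q; rewrite divr1.
split=> //.
have [tx|/existsNP [c /not_implyP [e /eqP c0]]] := pselect (transc x).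
  by have [q []] := transc_pole tx.
have sc : (size c <= (size c).+1)%N by [].
move: e; rewrite (px_rev x0 sc) => /eqP; rewrite mulf_eq0 expf_eq0 (negPf x0) andbF /=.
move=> /eqP h; apply: (algebraic_integral p h).
by apply: contra_neq c0; apply: rev_poly_eq0.
Qed.

Lemma fin_from_bound (A : set X) n : (forall B : {fset X}, (forall x, x \in B -> A x) ->
  (#|` B| <= n)%N) -> finite_set A.
Proof.
move=> h; apply: contrapT => /infinite_set_fset -/(_ n.+1) [B BA].
by rewrite leqNgt ltnS h.
Qed.

(** Differences of distinct functions without poles are units everywhere, so these functions inject
    into the residue field of any one place. *)
Lemma finite_L1 : finite_set (L (fun=> 1)).
Proof.
have [P _] := place_exists; have [Y [h1 h2 h3]] := NrmP D P.
apply: (@fin_from_bound _ (Nrm P)) => B hB.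
have ex (x : B) : exists i, vge P 1 (val x - Y i).
  by apply: h3; have := hB _ (valP x) P; rewrite divr1.
have [f hf] := choice ex.
rewrite cardfE -[X in (_ <= X)%N]card_ord; apply: (leq_card f) => x y e.
apply: val_inj; apply/eqP; rewrite -subr_eq0; apply: contraT => nz.
have [_ _] := constant_unit (LB (hB _ (valP x)) (hB _ (valP y))) nz P.
suff : vge P 1 (val x - val y).
  move=> /(max_idealP D) [_ [/eqP|//]]; by rewrite (negPf nz).
have -> : val x - val y = (val x - Y (f x)) - (val y - Y (f y)) by rewrite e; ring.
exact: vgeB.
Qed.

Lemma L_mono d d' : (forall p, V p (d p / d' p)) -> (forall p, d p != 0) -> L d `<=` L d'.
Proof.
move=> h d0 x Lx p; rewrite -(divfK (d0 p) x) -mulrA; exact: VM.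
Qed.

(** The larger of the two local lattices at each place, hence the supremum of the two divisors. *)
Definition padd d d' p := if `[< V p (d p / d' p) >] then d' p else d p.

Lemma padd_l d d' p : d p != 0 -> V p (d p / padd d d' p).
Proof. by move=> d0; rewrite /padd; case: asboolP => // _; rewrite divff //; apply: V1. Qed.
Lemma padd_r d d' p : d' p != 0 -> V p (d' p / padd d d' p).
Proof.
move=> d0; rewrite /padd; case: asboolP => [_|]; first by rewrite divff //; apply: V1.
by move=> /(notV_inv D) [_ h]; rewrite -(invrK (d' p)) -invfM mulrC; apply/vge0; apply: vgeW h.
Qed.
Lemma pidele_padd d d' : pidele d -> pidele d' -> pidele (padd d d').
Proof.
move=> hd hd'; have [A hA] := pidele_fset hd; have [B hB] := pidele_fset hd'.
apply: (@fset_pidele _ (A `|` B)%fset) => p.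
  by rewrite /padd; case: ifP; rewrite ?(hd.1) ?(hd'.1).
by rewrite in_fsetU negb_or /padd => /andP [/hA a /hB b]; case: ifP.
Qed.

Lemma pidele1 : pidele (fun=> 1).
Proof. by apply: pidele_const; rewrite oner_eq0. Qed.

Lemma finite_L_mono d d' : pidele d -> pidele d' -> (forall p, V p (d p / d' p)) ->
  finite_set (L d) -> finite_set (L d').
Proof.
move=> hd hd' dd' fL.
have [T [kap [cT _]]] := adele_classes hd hd' dd'.
apply: (@fin_from_bound _ (#|T| * ell d)) => B hB.
have := @count_fset d d' 1 (fun _ _ => 0) B hd hd' dd' fL _ _ hB.
rewrite mul1n -cT mulrAC -natrM ler_pM2r ?idn_gt0 // ler_nat; apply.
  by move=> i p; rewrite mul0r; apply: V0.
by move=> i j; rewrite !ord1.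
Qed.

Lemma finite_L d : pidele d -> finite_set (L d).
Proof.
move=> hd; have h1 := pidele1; have h := pidele_padd hd h1.
apply: (@sub_finite_set _ _ (L (padd d (fun=> 1)))).
  by apply: L_mono => p; [apply: padd_l|]; apply: hd.1.
apply: (finite_L_mono h1 h _ finite_L1) => p; apply: (@padd_r d (fun=> 1)).
by rewrite oner_eq0.
Qed.

Lemma count_le d d' M (Y : 'I_M -> place X -> X) :
  pidele d -> pidele d' -> (forall p, V p (d p / d' p)) ->
  (forall i p, V p (Y i p / d' p)) ->
  (forall i j, i != j -> ~ exists x, forall p, V p ((Y i p - Y j p - x) / d p)) ->
  (M * ell d')%:R * idn d <= idn d' * (ell d)%:R.
Proof.
move=> hd hd' dd' VY nY; apply: count_fset VY nY _ => //; first exact: finite_L.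
by move=> x; rewrite in_fset_set; [move/set_mem|apply: finite_L].
Qed.

Lemma ell_gt0 d : pidele d -> (0 < ell d)%N.
Proof.
move=> hd; rewrite /ell cardfs_gt0; apply/fset0Pn; exists 0.
by rewrite in_fset_set ?inE; [apply: L0|apply: finite_L].
Qed.

Lemma ell_ge d (T : finType) (F : T -> X) : pidele d -> injective F ->
  (forall t, L d (F t)) -> (#|T| <= ell d)%N.
Proof.
move=> hd iF LF.
have mF t : F t \in fset_set (L d).
  by rewrite in_fset_set; [apply/mem_set|apply: finite_L].
rewrite /ell cardfE; apply: (leq_card (fun t => FSetSub (mF t))).
by move=> t t' /(congr1 val) /= /iF.
Qed.

Lemma L_nonzero d : pidele d -> (1 < ell d)%N -> exists2 x, x != 0 & L d x.
Proof.
move=> hd h; apply: contrapT => H; move: h; rewrite ltnNge => /negP; apply.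
rewrite -(cardfs1 (0 : X)); apply: fsubset_leq_card; apply/fsubsetP => x.
rewrite in_fset_set ?inE; last exact: finite_L.
move=> Lx; apply: contraT => nz; case: H; exists x => //; exact: (set_mem Lx).
Qed.

(** Each pole of y at a place where x is integral is cancelled by a power of a polynomial in x
    vanishing there. *)
Lemma finite_integralize x n (b : 'I_n -> X) (y : place X -> X) : kx_basis x b ->
  finite_set [set p | ~ V p (y p)] ->
  exists2 g : {poly k}, g != 0 & forall p, V p x -> V p (px x g * y p).
Proof.
move=> bb fy.
have /choice [c hc] : forall p, exists c : {poly k}, c != 0 /\ (V p x -> vge p 1 (px x c)).
  move=> p; have [Vx|nV] := pselect (V p x).
    by have [c c0 h] := poly_zero_at D bb Vx; exists c.
  by exists 1; rewrite oner_eq0.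
exists (\prod_(p <- fset_set [set p | ~ V p (y p)]) c p ^+ `|vl p (y p)|).
  by rewrite prodf_seq_neq0; apply/allP => p _ /=; rewrite expf_neq0 // (hc p).1.
move=> p Vx; have [pA|] := boolP (p \in fset_set [set p | ~ V p (y p)]); last first.
  rewrite in_fset_set // => np; apply: VM; first exact: V_px.
  by apply: contrapT => h; move/negP: np; apply; apply/mem_set.
rewrite (big_fsetD1 p pA) /= pxM mulrAC; apply: VM.
  rewrite pxXn; apply/vge0; apply: (@vge_mulr _ _ D p 0 `|vl p (y p)|) => //.
  by apply: vge_natX => //; apply: (hc p).2.
exact: V_px.
Qed.

Lemma pole_bound x (y : place X -> X) : exists c : nat, forall m p, (c <= m)%N ->
  ~ V p x -> V p (y p / x ^+ m).
Proof.
exists (\sum_(p <- fset_set [set p | ~ V p x]) `|vl p (y p)|)%N => m p le nV.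
have [x0 vx] := notV_inv D nV.
have pA : p \in fset_set [set p | ~ V p x] by rewrite in_fset_set //; apply/mem_set.
rewrite -exprVn mulrC; apply/vge0; apply: (@vge_mulr _ _ D p 0 m); last exact: vge_natX.
by apply: leq_trans le; rewrite (big_fsetD1 p pA) /= leq_addr.
Qed.

Lemma pole_degree p x (f : {poly k}) : ~ V p x -> f != 0 ->
  vunit p (px x f / x ^+ (size f).-1).
Proof.
move=> nV f0; have [x0 vx] := notV_inv D nV; pose n := (size f).-1.
have sf : size f = n.+1 by rewrite prednK // size_poly_gt0.
rewrite (@px_rev _ _ x f n) ?sf //= mulrAC mulfV ?mul1r ?expf_neq0 //.
rewrite (@pxE _ _ _ _ n.+1) ?size_poly // big_ord_recl /= coef_poly /= subn0 expr0 mulr1.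
have l0 : ff_const X f`_n != 0 by rewrite fmorph_eq0 -/(lead_coef f) lead_coef_eq0.
have uC : vunit p (ff_const X f`_n).
  by split=> //; [apply: pl_const|rewrite -fmorphV; apply: pl_const].
set s := \sum_(i < n) _; have vs : vge p 1 s.
  apply: vge_sum => i _; rewrite -[1]add0r; apply: vgeM => //.
    by apply/vge0/pl_const.
  by apply: vgeX.
rewrite -[s](mulVKf l0) -{1}[ff_const X f`_n]mulr1 -mulrDr.
apply: vunitM => //; apply: vunit_1D => //.
by apply: vunit_vge => //; apply: vunitV.
Qed.

(** [d] is enlarged to d1, given by 1/f(x) away from the poles of x and by x^m at them. [zero_count]
    bounds the degree of d1 from above, explicit combinations of the basis bound [ell d1] from
    below, and [count_le] carries the comparison over to d with a constant independent of d. *)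
Lemma riemann : exists2 c : nat, (0 < c)%N & forall d, pidele d -> idn d <= (c * ell d)%:R.
Proof.
have [x [n [b bb]]] := transc_basis; have [tx sb fb] := bb; have x0 := transc_neq0 tx.
have k1 : (0 < #|k|)%N by apply/card_gt0P; exists 0.
have [g g0 hg] : exists2 g : {poly k}, g != 0 &
    forall j p, V p x -> V p (px x g * b j).
  have /choice [g hg] : forall j, exists g : {poly k}, g != 0 /\
      forall p, V p x -> V p (px x g * b j).
    by move=> j; have [g] := finite_integralize bb (finite_poles (b j)); exists g.
  exists (\prod_j g j); first by apply/prodf_neq0 => j _; apply: (hg j).1.
  move=> j p Vx; rewrite (bigD1 j) //= pxM mulrAC; apply: VM; first exact: (hg j).2.
  exact: V_px.
have gx0 : px x g != 0 by apply: contra_neq g0 => /tx.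
have /choice [cs hcs] : forall j, exists c : nat, forall m p, (c <= m)%N -> ~ V p x ->
    V p (px x g * b j / x ^+ m).
  by move=> j; have [c hc] := pole_bound x (fun=> px x g * b j); exists c => m p; apply: hc.
pose c0 := (\max_j cs j)%N.
exists (#|k| ^ (n * c0))%N; first by rewrite expn_gt0 k1.
move=> d hd.
have [|f f0 hf] := @finite_integralize x n b d bb.
  apply: (@sub_finite_set _ _ [set p | ~ vunit p (d p)]); last exact: hd.2.
  by move=> p /= nV [].
have [m0 hm] := pole_bound x d.
pose m := (m0 : nat); pose t := (size f).-1.
have fx0 : px x f != 0 by apply: contra_neq f0 => /tx.
pose d1 p := if `[< V p x >] then (px x f)^-1 else x ^+ m.
have hd1 : pidele d1.
  split=> [p|]; first by rewrite /d1; case: ifP; rewrite ?invr_eq0 ?expf_neq0.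
  apply: (@sub_finite_set _ _ ([set p | ~ vunit p (px x f)] `|` [set p | ~ V p x])).
    move=> p /= h; apply: contrapT => /not_orP [/contrapT a /contrapT Vx].
    by apply: h; rewrite /d1 (asboolT Vx); apply: vunitV.
  by rewrite finite_setU; split=> //; apply: (pidele_const fx0).2.
have dd1 p : V p (d p / d1 p).
  rewrite /d1; case: asboolP => [Vx|nV]; last exact: hm.
  by rewrite invrK mulrC; apply: hf.
have [A hA] := pidele_fset hd1.
have n1 : idn d1 <= (#|k| ^ (n * t) * #|k| ^ (n * m))%:R.
  rewrite (idnE hA) (bigID (fun p => `[< V p x >])) /= natrM.
  apply: ler_pM; try by apply: prodr_ge0 => p _; rewrite exprz_ge0 // ltW // Nrm_gt0.
    rewrite -big_filter; set S := filter _ _.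
    have uS : uniq S by rewrite filter_uniq // fset_uniq.
    have VS p : p \in S -> V p x by rewrite mem_filter => /andP [/asboolP].
    have st : (size f <= t.+1)%N by rewrite /t prednK // size_poly_gt0.
    have := zero_count D bb st fx0 uS (fun p pS => V_px f (VS p pS)).
    rewrite -(ler_nat rat) natr_prod; apply: le_trans; rewrite [leLHS]big_seq [leRHS]big_seq.
    apply: ler_prod => p pS; rewrite exprz_ge0 ?(ltW (Nrm_gt0 p)) //=.
    have Vx := VS p pS; rewrite /d1 (asboolT Vx) (vlV D) opprK.
    by have := vl_V D (V_px f Vx); case: (vl p (px x f)) => // a _; rewrite natrX.
  rewrite -big_filter; set S := filter _ _.
  have uS : uniq S by rewrite filter_uniq // fset_uniq.
  have VS p : p \in S -> ~ V p x by rewrite mem_filter => /andP [/asboolP].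
  have VS' p : p \in S -> V p (px x^-1 'X).
    by move=> /VS /(notV_inv D) [_ h]; rewrite pxX; apply/vge0; apply: vgeW h.
  have xn : px x^-1 'X != 0 by rewrite pxX invr_eq0.
  have sX : (size ('X : {poly k}) <= 2)%N by rewrite size_polyX.
  have := zero_count D (kx_basisV bb) sX xn uS VS'.
  rewrite muln1 expnM -(leq_exp2r _ _ (ltn0Sn m)) => h.
  have {}h : ((\prod_(p <- S) Nrm p ^ `|vl p (px x^-1 'X)|) ^ m <= (#|k| ^ n) ^ m)%N.
    have [->|m1] := posnP m; first by rewrite !expn0.
    by rewrite leq_exp2r // -(leq_exp2r _ _ (ltn0Sn m)).
  move: h; rewrite -(ler_nat rat) natrX natr_prod; apply: le_trans.
  rewrite -prodrXl [leLHS]big_seq [leRHS]big_seq.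
  apply: ler_prod => p pS; rewrite exprz_ge0 ?(ltW (Nrm_gt0 p)) //=.
  rewrite /d1 (asboolF (VS p pS)) (vlX D) pxX (vlV D).
  have := vl_V D (VS' p pS); rewrite pxX (vlV D).
  rewrite -mulNrn; case: (- vl p x) => // a _.
  have e j : a%:Z *+ j = (a * j)%N by elim: j => [|j IH]; rewrite ?muln0 // mulrS IH mulnS PoszD.
  by rewrite e natrX -exprM.
(* Coordinates of degree below s keep the poles within m + t, those of g(x) b_j costing at most c0.
   The subtraction is truncated: for s = 0 the factor q^(n c0) alone suffices. *)
pose s := ((m + t).+1 - c0)%N.
have l1 : (#|k| ^ (n * s) <= ell d1)%N.
  pose pl (u : {ffun 'I_n -> {ffun 'I_s -> k}}) j : {poly k} :=
    \poly_(l < s) (if insub l is Some l' then u j l' else 0).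
  pose F u := (px x f)^-1 * \sum_j px x (pl u j) * (px x g * b j).
  have := @ell_ge d1 _ F hd1 _ _; rewrite !card_ffun !card_ord -expnM mulnC; apply.
    move=> u u' /(mulfI (invr_neq0 fx0)) /eqP; rewrite -subr_eq0 -sumrB => /eqP e.
    have e0 : \sum_j px x (pl u j - pl u' j) * b j = 0.
      apply: (mulfI gx0); rewrite mulr0 -[RHS]e mulr_sumr; apply: eq_bigr => j _.
      by rewrite pxB; ring.
    apply/ffunP => j; apply/ffunP => l.
    move: (fb _ e0 j) => /eqP; rewrite subr_eq0 => /eqP /polyP /(_ l).
    rewrite !coef_poly ltn_ord !insubT //= => lt_l.
    by have -> : Sub (nat_of_ord l) lt_l = l by exact: val_inj.
  move=> u p; rewrite /F /d1; case: asboolP => [Vx|nV].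
    rewrite invrK mulrAC mulVf // mul1r; apply: Vsum => j _.
    by apply: VM; [apply: V_px|apply: hg].
  have uf := pole_degree nV f0; rewrite -/t in uf.
  set Q := \sum_j _.
  have -> : (px x f)^-1 * Q / x ^+ m = (px x f / x ^+ t)^-1 * (Q / x ^+ (m + t)).
    have xt := expf_neq0 t x0; rewrite exprD !invfM invrK.
    by rewrite -[LHS]mulr1 -(mulfV xt); ring.
  apply: VM; first by case: uf.
  rewrite /Q mulr_suml; apply: Vsum => j _.
  have := size_poly s (fun l => if insub l is Some l' then u j l' else 0); rewrite -/(pl u j) => sp.
  rewrite (pxE _ sp) mulr_suml mulr_suml; apply: Vsum => l _.
  have l1 : (l <= m + t)%N by have := ltn_ord l; rewrite /s; lia.
  have -> : ff_const X (pl u j)`_l * x ^+ l * (px x g * b j) / x ^+ (m + t) =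
    ff_const X (pl u j)`_l * (px x g * b j / x ^+ (m + t - l)).
    have xl := expf_neq0 l x0; rewrite -{1}(subnK l1) exprD invfM.
    by rewrite -[RHS]mulr1 -(mulfV xl); ring.
  apply: VM; first exact: pl_const.
  apply: (hcs j) => //; apply: leq_trans (leq_bigmax (F := cs) j) _.
  by have := ltn_ord l; rewrite -/c0 /s; lia.
have le1 := @count_le d d1 1 (fun _ _ => 0) hd hd1 dd1 _ _.
have {}le1 : (ell d1)%:R * idn d <= idn d1 * (ell d)%:R.
  rewrite -[ell d1]mul1n; apply: le1.
    by move=> i p; rewrite mul0r; apply: V0.
  by move=> i j; rewrite !ord1.
have e1 := ell_gt0 hd1.
rewrite -(ler_pM2l (_ : 0 < (ell d1)%:R)) ?ltr0n //.
apply: le_trans le1 _; rewrite natrM mulrA ler_wpM2r ?ler0n //.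
apply: le_trans n1 _; rewrite -natrM ler_nat -expnD.
apply: leq_trans (leq_mul l1 (leqnn _)); rewrite -expnD leq_pexp2l // /s; nia.
Qed.

End RiemannRoch.

(** * Product formula, strong approximation, short vectors *)

Section Minkowski.
Variables (k : finFieldType) (X : function_field k).
Hypothesis places_discrete : forall p : place X, discrete p.
Hypothesis finite_poles : forall x : X, finite_set [set p : place X | ~ pl_ring p x].
Implicit Types (p q : place X) (x y z : X) (d : place X -> X).
Local Notation V := pl_ring.
Let D := places_discrete.
Let F := finite_poles.

Lemma bounded_powers (e K : rat) : 0 <= e -> (forall m : nat, e ^+ m <= K) -> e <= 1.
Proof.
move=> e0 h; rewrite leNgt; apply/negP => e1; pose dl := e - 1.
have dl0 : 0 < dl by rewrite subr_gt0.
have bern m : 1 + m%:R * dl <= e ^+ m.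
  elim: m => [|m IH]; first by rewrite mul0r addr0.
  rewrite exprS; apply: le_trans (ler_wpM2l e0 IH).
  have -> : e * (1 + m%:R * dl) = 1 + m.+1%:R * dl + m%:R * dl ^+ 2 by rewrite /dl -natr1; ring.
  by rewrite lerDl mulr_ge0 ?ler0n // exprn_ge0 // ltW.
have K0 : 0 <= K / dl.
  by apply: divr_ge0; [apply: le_trans (h 0%N)|apply: ltW].
have := archi_boundP K0; rewrite ltr_pdivrMr // ltNge => /negP; apply.
by apply: le_trans (h (Num.bound (K / dl))); apply: le_trans (bern _); rewrite lerDr.
Qed.

(** Multiplication by z^m identifies L(1) with the sections of the principal divisor of z^m, so
    Riemann's inequality bounds all powers of [idn z] by one constant. *)
Lemma idn_const_le1 z : z != 0 -> idn (fun=> z : X) <= 1.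
Proof.
move=> z0; have [c c0 hc] := riemann D F.
have hz := pidele_const F z0; have h1 := pidele1 F.
apply: (@bounded_powers _ (c * ell (fun=> 1 : X))%:R); first by rewrite ltW ?idn_gt0.
move=> m; have hm := pidele_const F (expf_neq0 m z0).
have -> : idn (fun=> z) ^+ m = idn (fun=> z ^+ m : X).
  elim: m {hm} => [|m IH]; first by rewrite expr0 -(idn1 D).
  rewrite exprS IH -idnM //; last by apply: pidele_const => //; rewrite expf_neq0.
  by congr idn; apply/funext => p; rewrite exprS.
apply: le_trans (hc _ hm) _; rewrite ler_nat leq_mul2l; apply/orP; right.
pose T : finType := fset_set (L (fun=> z ^+ m : X)).
have LT (t : T) : L (fun=> z ^+ m : X) (val t).
  by have := valP t; rewrite in_fset_set ?inE //; apply: finite_L.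
have := @ell_ge _ X D F (fun=> 1) T (fun t => val t / z ^+ m) h1 _ _.
have -> : ell (fun=> z ^+ m : X) = #|T| by rewrite /T /ell cardfE.
apply.
  by move=> t t' /(mulIf (invr_neq0 (expf_neq0 m z0))) /val_inj.
by move=> t p; rewrite divr1; apply: LT.
Qed.

Lemma product_formula z : z != 0 -> idn (fun=> z : X) = 1.
Proof.
move=> z0; apply/le_anti; rewrite idn_const_le1 //=.
have zi : z^-1 != 0 by rewrite invr_eq0.
have := idn_const_le1 zi; rewrite (idnV D (pidele_const F z0)).
by rewrite invf_le1 // idn_gt0 //; apply: pidele_const.
Qed.

Lemma L_small d x : pidele d -> idn d < 1 -> L d x -> x = 0.
Proof.
move=> hd d1 Lx; apply/eqP; apply: contraT => x0; move: d1; rewrite ltNge.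
have hx := pidele_const F x0; have hV := pideleV hx.
have := @idn_ge1 _ X D _ (pideleM hd hV) _; rewrite idnM // idnV // product_formula //.
rewrite invr1 mulr1 => -> //.
by move=> p; rewrite invfM invrK mulrC; apply: Lx.
Qed.

Lemma ell_small d : pidele d -> idn d < 1 -> ell d = 1%N.
Proof.
move=> hd d1; apply/eqP; rewrite eqn_leq ell_gt0 // andbT leqNgt; apply/negP.
by move=> /(L_nonzero D F hd) [x x0 /(L_small hd d1) e]; rewrite e eqxx in x0.
Qed.

(** The number idn d / ell d is bounded by Riemann's inequality, while enlarging d by an adele
    outside A(d) + X at least doubles it; so some d0 satisfies A = A(d0) + X. If d has large degree,
    d / d0 has a nonzero section z, and multiplication by z carries the property from d0 to d. *)
Lemma strong_approximation : exists N : rat, forall d, pidele d -> N <= idn d ->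
  forall y : place X -> X, finite_set [set p | ~ V p (y p)] ->
  exists x, forall p, V p ((y p - x) / d p).
Proof.
have [c c0 hc] := riemann D F.
have [d0 [hd0 H]] : exists d0, pidele d0 /\ forall y : place X -> X,
    finite_set [set p | ~ V p (y p)] -> exists x, forall p, V p ((y p - x) / d0 p).
  apply: contrapT => H.
  have h1 := pidele1 F.
  have dbl j : exists2 d : place X -> X, pidele d & (2 ^ j * ell d)%:R <= idn d * (ell (fun=> 1 : X))%:R.
    elim: j => [|j [d hd IH]]; first by exists (fun=> 1); rewrite ?idn1 // expn0 mul1n mul1r.
    have /existsNP [y /not_implyP [fy ny]] : ~ forall y : place X -> X,
      finite_set [set p | ~ V p (y p)] -> exists x, forall p, V p ((y p - x) / d p).
      by move=> h; apply: H; exists d.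
    (* The smallest lattice containing both that of d and y. In it, y and 0 are distinct modulo A(d)
       + X, which is the origin of the factor 2. *)
    pose d' p := if `[< V p (y p / d p) >] then d p else y p.
    have nV p : ~ V p (y p / d p) -> y p != 0.
      by move=> nV; apply/eqP => e; apply: nV; rewrite e mul0r; apply: V0.
    have hd' : pidele d'.
      split=> [p|]; first by rewrite /d'; case: asboolP => [_|/nV //]; apply: hd.1.
      apply: (@sub_finite_set _ _ ([set p | ~ vunit p (d p)] `|` [set p | ~ V p (y p)])).
        move=> p /= h; apply: contrapT => /not_orP [/contrapT u /contrapT Vy]; apply: h.
        rewrite /d'; case: asboolP => // h; case: h; case: u => _ _ u; exact: VM.
      by rewrite finite_setU; split=> //; apply: hd.2.
    have dd' p : V p (d p / d' p).
      rewrite /d'; case: asboolP => [_|nVp]; first by rewrite divff ?(hd.1) //; apply: V1.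
      have [_ h] := notV_inv D nVp; rewrite -(invrK (d p)) -invfM mulrC.
      by apply/vge0; apply: vgeW h.
    have yd' p : V p (y p / d' p).
      rewrite /d'; case: asboolP => // /nV y0; rewrite divff //; apply: V1.
    exists d' => //.
    have h2 : (2 * ell d')%:R * idn d <= idn d' * (ell d)%:R.
      apply: (@count_le _ X D F d d' 2 (fun i p => if i == ord0 then y p else 0)) => //.
        by move=> i p; case: ifP => _ //; rewrite mul0r; apply: V0.
      move=> i i'; case: (i =P ord0) => [->|/eqP i0]; case: (i' =P ord0) => [->|/eqP j0] //.
      - by move=> _ [x hx]; apply: ny; exists x => p; have := hx p; rewrite subr0.
      - move=> _ [x hx]; apply: ny; exists (- x) => p; have := VN (hx p).
        by rewrite -mulNr; congr (V p (_ / _)); ring.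
      - by case: i i0 => [[|[|]]] // i i0; case: i' j0 => [[|[|]]] // j' j0; rewrite -val_eqE.
    have i0 := idn_gt0 D hd; have e0 : (0 < ell d)%N by apply: ell_gt0.
    rewrite -(ler_pM2r i0); rewrite expnS -mulnA mulnCA natrM -mulrA.
    have h3 := ler_wpM2l (ler0n rat (2 ^ j)) h2; apply: le_trans h3 _.
    have h4 := ler_wpM2l (ltW (idn_gt0 D hd')) IH.
    have -> : (2 ^ j)%:R * (idn d' * (ell d)%:R) = idn d' * (2 ^ j * ell d)%:R.
      by rewrite natrM mulrCA.
    apply: le_trans h4 _.
    by have -> : idn d' * (idn d * (ell (fun=> 1 : X))%:R) = idn d' * (ell (fun=> 1 : X))%:R * idn d
      by rewrite mulrCA mulrC.
  pose l1 := ell (fun=> 1 : X); pose j := (c * l1)%N.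
  have [d hd] := dbl j.
  have e0 : (0 < ell d)%N by apply: ell_gt0.
  rewrite leNgt => /negP; apply.
  have lt2 : (j < 2 ^ j)%N by apply: ltn_expl.
  apply: le_lt_trans (ler_wpM2r (ler0n _ _) (hc d hd)) _.
  by rewrite -natrM ltr_nat mulnAC -/j ltn_pmul2r.
(* This forces idn (d / d0) > c, hence more than one section by Riemann's inequality. *)
exists (c%:R * idn d0 + 1) => d hd le y fy.
have hdd : pidele (fun p => d p / d0 p) by apply: pideleM => //; apply: pideleV.
have [z z0 Lz] : exists2 z, z != 0 & L (fun p => d p / d0 p) z.
  apply: L_nonzero => //; rewrite ltnNge; apply/negP => l1.
  have := hc _ hdd; rewrite idnM ?idnV //; last exact: pideleV.
  rewrite ler_pdivrMr ?idn_gt0 // leNgt => /negP; apply.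
  apply: lt_le_trans le; rewrite ltr_pwDr // ler_wpM2r ?(ltW (idn_gt0 D hd0)) //.
  by rewrite ler_nat -[leqRHS]muln1 leq_mul2l l1 orbT.
have fyz : finite_set [set p | ~ V p (y p / z)].
  apply: (@sub_finite_set _ _ ([set p | ~ V p (y p)] `|` [set p | ~ V p z^-1])).
    move=> p /= h; apply: contrapT => /not_orP [/contrapT a /contrapT b].
    by apply: h; apply: VM.
  by rewrite finite_setU.
have [x hx] := H _ fyz; exists (z * x) => p.
have -> : (y p - z * x) / d p = ((y p / z - x) / d0 p) * (z / (d p / d0 p)).
  have d00 := hd0.1 p; have dp := hd.1 p.
  by field; rewrite z0 d00 dp.
by apply: VM; [apply: hx|apply: Lz].
Qed.

(** If p has at most c residue classes and x is integral there, two of the powers x^0, ..., x^c are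
    congruent at p. So p is a pole of x or a zero of one of finitely many nonzero differences x^i -
    x^j. *)
Lemma finite_norm (c : nat) : finite_set [set p : place X | (Nrm p <= c)%N].
Proof.
have [x [n [b [tx _ _]]]] := transc_basis X.
have xne i j : i != j -> x ^+ i - x ^+ j != 0.
  move=> ij; apply/eqP => e.
  have := tx ('X^i - 'X^j); rewrite pxB !pxXn pxX e => /(_ erefl) /polyP /(_ i).
  by rewrite coefB !coefXn eqxx (negPf ij) subr0 coef0 => /eqP; rewrite oner_eq0.
pose I := ('I_c.+1 * 'I_c.+1)%type.
apply: (@sub_finite_set _ _ ([set p | ~ V p x] `|`
   \bigcup_(u in [set: I]) [set p | u.1 != u.2 /\ ~ V p (x ^+ u.1 - x ^+ u.2)^-1])).
  move=> p /= le; have [Vx|] := pselect (V p x); last by left.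
  right; have [Y [h1 h2 h3]] := NrmP D p.
  have ex (i : 'I_c.+1) : exists t, vge p 1 (x ^+ i - Y t) by apply: h3; apply: VX.
  have [f hf] := choice ex.
  have [i [j [ij e]]] : exists i j, i != j /\ f i = f j.
    apply: contrapT => H; have inj : injective f.
      by move=> i j e; apply: contrapT => /eqP ij; apply: H; exists i, j.
    by have := leq_card f inj; rewrite !card_ord leqNgt ltnS le.
  exists (i, j) => //=; split=> //.
  have v : vge p 1 (x ^+ i - x ^+ j).
    have -> : x ^+ i - x ^+ j = (x ^+ i - Y (f i)) - (x ^+ j - Y (f j)) by rewrite e; ring.
    exact: vgeB.
  by move: v => /(max_idealP D) [_ [/eqP|//]]; rewrite (negPf (xne _ _ ij)).
rewrite finite_setU; split; first exact: F.
apply: bigcup_finite; first exact: finite_finset.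
move=> u _; apply: sub_finite_set (F (x ^+ u.1 - x ^+ u.2)^-1).
by move=> p /= [].
Qed.

Lemma effective_norm d q : pidele d -> (forall p, V p (d p)^-1) ->
  (Nrm q ^ `|vl q (d q)|)%:R <= idn d.
Proof.
move=> hd Vd; set n := `|_|%N.
have vn : vl q (d q) = - n%:Z by have := vl_V D (Vd q); rewrite (vlV D) /n; lia.
pose d' p := if p == q then d p * unif q ^ n%:Z else d p.
have uq m : unif q ^ m != 0 :> X by apply: unifz_neq0.
have hd' : pidele d'.
  have [A hA] := pidele_fset hd; apply: (@fset_pidele _ _ _ (q |` A)%fset) => p.
    by rewrite /d'; case: (p =P q) => _; rewrite ?mulf_eq0 ?negb_or ?(hd.1) ?uq.
  by rewrite in_fset1U negb_or /d' => /andP [/negPf -> /hA].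
have -> : d = pbump q n d'.
  apply/funext => p; rewrite /pbump /d'; case: (p =P q) => // ->.
  by rewrite -mulrA -expfzDr ?unif_neq0 // subrr expr0z mulr1.
rewrite idn_bump // natrX -[leLHS]mulr1 ler_wpM2l ?exprn_ge0 ?ler0n // idn_ge1 // => p.
rewrite /d'; case: (p =P q) => // ->; apply/V_vl => //.
  by rewrite invr_eq0 mulf_neq0 ?(hd.1).
by rewrite (vlV D) (vlM D) ?(hd.1) // (vl_unifz D) vn; lia.
Qed.

(* A nonzero vector in the rank 2 lattice with local basis
   [(1, 0), (e_p d_p, d_p)], scaled by [z]. *)
Lemma short_vector : exists2 K : rat, 0 < K & forall d (e : place X -> X),
  pidele d -> finite_set [set p | ~ V p (e p)] -> K < idn d ->
  exists (z : place X -> X) x y, [/\ pidele z, idn z ^+ 2 * idn d <= K, y != 0 &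
    forall p, V p (y / (z p * d p)) /\ V p ((x - e p * y) / z p)].
Proof.
have [c c0 hc] := riemann D F; have [P _] := place_exists X.
pose N : rat := (Nrm P)%:R; have N1 : 1 < N by rewrite ltr1n; apply: Nrm_gt1.
have N0 : 0 < N by apply: lt_trans N1.
have cc0 : 0 < c%:R ^+ 2 :> rat by rewrite exprn_gt0 // ltr0n.
exists (c%:R ^+ 2 * N ^+ 2); first by rewrite mulr_gt0 // exprn_gt0.
move=> d e hd fe lt.
(* Twisting by multiples of the single place P moves the degree by steps of N^2, so a minimal m puts
   idn z^2 idn d between c^2 and c^2 N^2; the lower bound is what forces a vector to exist. *)
have exm : exists m : nat, idn d <= c%:R ^+ 2 * N ^+ 2 * N ^+ (2 * m).
  apply: contrapT => H.
  have : N ^+ 2 <= 1; last by rewrite leNgt exprn_egt1.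
  apply: (@bounded_powers _ (idn d / (c%:R ^+ 2 * N ^+ 2))); first by rewrite exprn_ge0 ?(ltW N0).
  have K0 : 0 < c%:R ^+ 2 * N ^+ 2 by rewrite mulr_gt0 // exprn_gt0.
  move=> m; rewrite ler_pdivlMr // mulrC -exprM leNgt.
  by apply/negP => h; apply: H; exists m; apply: ltW.
case: (ex_minnP exm) => m hm minm.
have m0 : (0 < m)%N.
  by case: m hm {minm} => //; rewrite muln0 expr0 mulr1 leNgt lt.
pose z p := if p == P then unif P ^+ m else 1 : X.
have uq (j : int) : unif P ^ j != 0 :> X by apply: unifz_neq0.
have hz : pidele z.
  apply: (@fset_pidele _ _ _ [fset P]%fset) => p.
    by rewrite /z; case: (p =P P) => _; [apply: uq m|apply: oner_neq0].
  by rewrite in_fset1 /z => /negPf ->; apply: vunit1.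
have iz : idn z = (N ^+ m)^-1.
  have h1 := pidele1 F.
  have : idn (pbump P m z) = 1.
    rewrite -(idn1 D (X := X)); congr idn; apply/funext => p; rewrite /pbump /z.
    by case: (p =P P) => // _; rewrite exprnP -expfzDr ?unif_neq0 // subrr expr0z.
  rewrite idn_bump // => h; apply: (mulfI (lt0r_neq0 (exprn_gt0 m N0))).
  by rewrite h mulfV // lt0r_neq0 // exprn_gt0.
have gt : c%:R ^+ 2 < idn z ^+ 2 * idn d.
  rewrite iz exprVn mulrC -exprM mulnC ltr_pdivlMr ?exprn_gt0 // ltNge; apply/negP => h.
  have : (m <= m.-1)%N.
    apply: minm; apply: le_trans h _; rewrite -mulrA -exprD.
    by rewrite (_ : 2 + 2 * m.-1 = 2 * m)%N //; lia.
  by rewrite leqNgt prednK // leqnn.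
have le : idn z ^+ 2 * idn d <= c%:R ^+ 2 * N ^+ 2.
  by rewrite iz exprVn mulrC -exprM mulnC ler_pdivrMr ?exprn_gt0.
have z1 : idn z < 1 by rewrite iz invf_lt1 ?exprn_gt0 // exprn_egt1 // -lt0n.
pose zd p := z p * d p.
have hzd : pidele zd := pideleM hz hd.
(* Without such a vector the adeles e s, for s in L(z d), are distinct modulo A(z) + X. Since
   [ell z] is 1, counting them contradicts the lower bound c^2. *)
apply: contrapT => H.
pose S := fset_set (L zd); pose s : seq X := enum_fset S.
pose Y (i : 'I_(ell zd)) p := e p * s`_i.
have sL i : (i < ell zd)%N -> L zd s`_i.
  move=> lt'; have : s`_i \in S by apply: mem_nth.
  by rewrite in_fset_set ?inE //; apply: finite_L.
pose e' p := if `[< V p (e p) >] then 1 else e p.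
have he' : pidele e'.
  split=> [p|].
    rewrite /e'; case: asboolP => [_|nV]; first exact: oner_neq0.
    by have [] := notV_inv D nV.
  apply: sub_finite_set fe => p /= h Vp; apply: h; rewrite /e' (asboolT Vp).
  exact: vunit1.
have Ve p : V p (e p / e' p).
  rewrite /e'; case: asboolP => [|nV]; first by rewrite divr1.
  by have [e0 _] := notV_inv D nV; rewrite divff //; apply: V1.
have hezd := pideleM he' hzd; have hp := pidele_padd hz hezd.
have key : (ell zd * ell (padd z (fun p => (e' p * zd p)%R)))%:R * idn z
   <= idn (padd z (fun p => e' p * zd p)) * (ell z)%:R.
  apply: (@count_le _ X D F _ _ _ Y) => //.
  - by move=> p; apply: padd_l; apply: hz.1.
  - move=> i p; have := @padd_r _ X D z (fun p => e' p * zd p) p (hezd.1 p).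
    set w := padd _ _ p => Vw.
    have -> : Y i p / w = e p / e' p * (s`_i / zd p) * (e' p * zd p / w).
      have w0 : w != 0 by apply: hp.1.
      have e0 := he'.1 p; have zp := hz.1 p; have dp := hd.1 p.
      by rewrite /Y /zd; field; rewrite w0 e0 zp dp.
    by apply: VM => //; apply: VM => //; apply: sL.
  move=> i j ij [x hx]; apply: H; exists z, x, (s`_i - s`_j); split=> //.
    by rewrite subr_eq0 nth_uniq ?fset_uniq.
  move=> p; split; first exact: (LB (sL i (ltn_ord i)) (sL j (ltn_ord j)) p).
  rewrite -opprB mulNr; apply: VN; have := hx p; rewrite /Y.
  by congr (V p (_ / _)); ring.
rewrite (ell_small hz z1) mulr1 in key.
have {}key := le_trans key (hc _ hp).
move: key; rewrite [(c * _)%N]mulnC mulnC !natrM -mulrA.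
rewrite ler_pM2l ?ltr0n ?ell_gt0 // => key.
have := hc _ hzd; rewrite /zd idnM // natrM -/zd => le2.
move: gt; rewrite ltNge => /negP; apply.
rewrite expr2 mulrAC.
apply: le_trans (_ : (c%:R * (ell zd)%:R) * idn z <= _).
  by rewrite ler_wpM2r // ltW // idn_gt0.
by rewrite -mulrA expr2 ler_wpM2l ?ler0n.
Qed.

End Minkowski.

(** * Completed local rings *)

Section Local.
Variables (k : finFieldType) (X : function_field k) (C : special_extension X).
Variable D : completion C.
Implicit Types (p : place X) (b c t : X) (x y : se_F C).
Local Notation V := pl_ring.
Local Notation red := (se_red C).
Local Notation O := (se_O C).
Local Notation Oh := (@cp_O _ _ _ D _).
Local Notation jj := (cp_map D).
Local Notation filt p n :=
  (adic_filt (cp_map D p) (se_O C p) (@cp_O _ _ _ D p) n).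

Lemma O1 p : O p 1. Proof. by case: (se_subring C p). Qed.
Lemma OB p x y : O p x -> O p y -> O p (x - y).
Proof. by case: (se_subring C p) => _ + _; apply. Qed.
Lemma OM p x y : O p x -> O p y -> O p (x * y).
Proof. by case: (se_subring C p) => _ _; apply. Qed.
Lemma O0 p : O p 0. Proof. by rewrite -(subrr 1); apply: OB; apply: O1. Qed.
Lemma ON p x : O p x -> O p (- x).
Proof. by move=> h; rewrite -sub0r; apply: OB => //; apply: O0. Qed.
Lemma OD p x y : O p x -> O p y -> O p (x + y).
Proof. by move=> hx hy; rewrite -(opprK y); apply: OB => //; apply: ON. Qed.
Lemma OX p x n : O p x -> O p (x ^+ n).
Proof. by move=> h; elim: n => [|n IH]; rewrite ?exprS; [apply: O1|apply: OM]. Qed.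

Lemma Oh1 p : @cp_O _ _ _ D p 1. Proof. by case: (cp_subring _ D p). Qed.
Lemma OhB p (x y : cp_F D p) : Oh x -> Oh y -> Oh (x - y).
Proof. by case: (cp_subring _ D p) => _ + _; apply. Qed.
Lemma OhM p (x y : cp_F D p) : Oh x -> Oh y -> Oh (x * y).
Proof. by case: (cp_subring _ D p) => _ _; apply. Qed.
Lemma Oh0 p : @cp_O _ _ _ D p 0. Proof. by rewrite -(subrr 1); apply: OhB; apply: Oh1. Qed.
Lemma OhN p (x : cp_F D p) : Oh x -> Oh (- x).
Proof. by move=> h; rewrite -sub0r; apply: OhB => //; apply: Oh0. Qed.
Lemma OhD p (x y : cp_F D p) : Oh x -> Oh y -> Oh (x + y).
Proof. by move=> hx hy; rewrite -(opprK y); apply: OhB => //; apply: OhN. Qed.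
Lemma OhX p (x : cp_F D p) n : Oh x -> Oh (x ^+ n).
Proof. by move=> h; elim: n => [|n IH]; rewrite ?exprS; [apply: Oh1|apply: OhM]. Qed.
Lemma Oh_sum p (I : Type) (r : seq I) (P : pred I) (f : I -> cp_F D p) :
  (forall i, P i -> Oh (f i)) -> Oh (\sum_(i <- r | P i) f i).
Proof. by move=> h; apply: big_ind => //; [apply: Oh0|apply: OhD]. Qed.
Lemma Oh_map p x : O p x -> @cp_O _ _ _ D p (jj p x).
Proof. exact: cp_map_O. Qed.

Lemma red_sq0 x : red x = 0 -> x * x = 0.
Proof. by move=> h; apply: se_sq0. Qed.

Lemma unit_1n (R : comUnitRingType) (n : R) : n * n = 0 -> (1 + n) * (1 - n) = 1.
Proof. by move=> h; rewrite mulrDl mul1r mulrBr mulr1 h subr0 subrK. Qed.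

(** An inverse modulo the square-zero kernel is corrected by one step of Newton's iteration, y (2 -
    x y). *)
Lemma F_inv x y : red x * red y = 1 -> x * (y * (1 - (x * y - 1))) = 1.
Proof.
move=> e; have h : red (x * y - 1) = 0 by rewrite rmorphB rmorphM rmorph1 e subrr.
rewrite mulrA; set n := x * y - 1 in h *.
have -> : x * y = 1 + n by rewrite /n addrC subrK.
exact: unit_1n (red_sq0 h).
Qed.

Lemma F_unit x : red x != 0 -> x \is a GRing.unit.
Proof.
move=> nz; have [y hy] := se_red_surj C (red x)^-1.
by apply/unitrPr; exists (y * (1 - (x * y - 1))); apply: F_inv; rewrite hy mulfV.
Qed.

Lemma red_inv x : red x != 0 -> red x^-1 = (red x)^-1.
Proof. by move=> nz; rewrite rmorphV // F_unit. Qed.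

Lemma V_red p x : O p x -> V p (red x).
Proof. by move=> h; apply/se_O_red; exists x. Qed.

Lemma O_lift p b : V p b -> exists2 x, O p x & red x = b.
Proof. by move/se_O_red. Qed.

Lemma O_inv p x : O p x -> red x != 0 -> V p (red x)^-1 -> O p x^-1.
Proof.
move=> Ox nz /O_lift [y Oy ry].
have e : x * (y * (1 - (x * y - 1))) = 1 by apply: F_inv; rewrite ry mulfV.
have -> : x^-1 = y * (1 - (x * y - 1)) by apply: (mulrI (F_unit nz)); rewrite e mulrV // F_unit.
by apply: OM => //; apply: OB; [apply: O1|apply: OB; [apply: OM|apply: O1]].
Qed.

Lemma nonunit_red p x : nonunits_in (O p) x <-> O p x /\ max_ideal p (red x).
Proof.
split=> [[Ox nu]|[Ox [_ h]]]; last first.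
  split=> // -[y [Oy e]]; have : red x * red y = 1 by rewrite -rmorphM e rmorph1.
  case: h => [-> /esym/eqP|nV e']; first by rewrite mul0r oner_eq0.
  apply: nV; have nz : red x != 0 by apply: contra_eq_neq e' => ->; rewrite mul0r eq_sym oner_eq0.
  suff -> : (red x)^-1 = red y by apply: V_red.
  by rewrite -[LHS]mulr1 -e' mulKf.
split=> //; split; first exact: V_red.
have [|nz] := eqVneq (red x) 0; [by left|right] => h; apply: nu.
by exists x^-1; split; [apply: O_inv|apply: mulrV; apply: F_unit].
Qed.

Local Notation m_ p := (nonunits_in (O p)).

Lemma ideal_powM p n x a : O p a -> ideal_pow (O p) (m_ p) n x ->
  ideal_pow (O p) (m_ p) n (a * x).
Proof.
move=> Oa; elim: n x => [|n IH] x /=; first exact: OM.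
move=> [s [hs ->]]; exists [seq (w.1, a * w.2) | w <- s]; split.
  by move=> w /mapP [w' /hs [h1 h2] ->] /=; split=> //; apply: IH.
by rewrite big_map mulr_sumr; apply: eq_bigr => w _ /=; rewrite mulrCA.
Qed.

Lemma ideal_pow_prod p (s : seq (se_F C)) a : O p a -> (forall x, x \in s -> m_ p x) ->
  ideal_pow (O p) (m_ p) (size s) (a * \prod_(x <- s) x).
Proof.
move=> Oa hs; apply: ideal_powM => //; elim: s hs => [|x s IH] hs /=.
  by rewrite big_nil; apply: O1.
exists [:: (x, \prod_(y <- s) y)]; rewrite big_seq1 big_cons; split=> // w.
rewrite inE => /eqP -> /=; split; first by apply: hs; rewrite inE eqxx.
by apply: IH => y ys; apply: hs; rewrite inE ys orbT.
Qed.

Lemma filt_mem p n a x : Oh a -> ideal_pow (O p) (m_ p) n x -> filt p n (a * jj p x).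
Proof.
move=> Oa hx; exists [:: (a, jj p x)]; rewrite big_seq1; split=> // w.
by rewrite inE => /eqP -> /=; split=> //; exists x.
Qed.

Lemma filtD p n (x y : cp_F D p) : filt p n x -> filt p n y -> filt p n (x + y).
Proof.
move=> [s [hs ->]] [s' [hs' ->]]; exists (s ++ s'); rewrite big_cat; split=> // w.
by rewrite mem_cat => /orP [/hs|/hs'].
Qed.

Lemma filtM p n (a x : cp_F D p) : Oh a -> filt p n x -> filt p n (a * x).
Proof.
move=> Oa [s [hs ->]]; exists [seq (a * w.1, w.2) | w <- s]; split.
  by move=> w /mapP [w' /hs [h1 h2] ->] /=; split=> //; apply: OhM.
by rewrite big_map mulr_sumr; apply: eq_bigr => w _ /=; rewrite mulrA.
Qed.

Lemma filtN p n (x : cp_F D p) : filt p n x -> filt p n (- x).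
Proof. by move=> h; rewrite -mulN1r; apply: filtM => //; apply: OhN; apply: Oh1. Qed.

Lemma map_unit p x : red x != 0 -> jj p x \is a GRing.unit.
Proof. by move=> /F_unit u; apply: rmorph_unit. Qed.

Lemma O_sum p (I : eqType) (r : seq I) (f : I -> se_F C) :
  (forall i, i \in r -> O p (f i)) -> O p (\sum_(i <- r) f i).
Proof.
by move=> h; rewrite big_seq; apply: big_ind => //; [apply: O0|apply: OD].
Qed.

Lemma ideal_pow_sub p n x : ideal_pow (O p) (m_ p) n x -> O p x.
Proof.
elim: n x => [//|n IH] x [s [hs ->]]; apply: O_sum => w /hs [[Ow _] /IH Ow'].
exact: OM.
Qed.

(* Infinitely divisible elements of the valuation ring lift to elements whose
   squares lie in every power of the maximal ideal, hence vanish in the completion. *)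
Lemma no_infinitely_divisible p t : t != 0 ->
  (forall n, exists s : seq X, [/\ size s = n, forall b, b \in s -> max_ideal p b
     & exists2 c, V p c & t = c * \prod_(b <- s) b]) -> False.
Proof.
move=> t0 H.
have Vt : V p t.
  have [s [/eqP/nilP -> _ [c Vc ->]]] := H 0%N; by rewrite big_nil mulr1.
have [T OT rT] := O_lift Vt.
have z n : filt p n (jj p (T ^+ 2)).
  have [s [sn hs [c Vc e]]] := H n; have [c' Oc rc] := O_lift Vc.
  have lift b : exists x, b \in s -> m_ p x /\ red x = b.
    have [bs|] := boolP (b \in s); last by exists 0.
    have [Vb hb] := hs b bs; have [x Ox rx] := O_lift Vb; exists x => _; split=> //.
    by apply/nonunit_red; rewrite rx.
  have [f hf] := choice lift.
  pose Q := c' * \prod_(x <- map f s) x.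
  have rQ : red Q = t.
    rewrite /Q rmorphM rc big_map rmorph_prod e; congr (_ * _).
    by rewrite big_seq [RHS]big_seq; apply: eq_bigr => b /hf [].
  have e2 : T ^+ 2 = (T + T - Q) * Q.
    have : (T - Q) * (T - Q) = 0 by apply: red_sq0; rewrite rmorphB rT rQ subrr.
    by move/eqP; rewrite -subr_eq0 => /eqP h; rewrite -[LHS]subr0 -h; ring.
  have hm x : x \in map f s -> m_ p x by move=> /mapP [b /hf [h _] ->].
  have IQ : ideal_pow (O p) (m_ p) n Q.
    by rewrite -sn -(size_map f s); apply: ideal_pow_prod.
  rewrite e2 -[jj p _]mul1r; apply: filt_mem; first exact: Oh1.
  apply: ideal_powM => //; apply: OB; last exact: ideal_pow_sub IQ.
  exact: OD.
have u : jj p (T ^+ 2) \is a GRing.unit by apply: map_unit; rewrite rmorphXn rT expf_neq0.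
by move: u; rewrite (cp_separated _ D _ _ z) unitr0.
Qed.

(** If no element generated the maximal ideal, each nonzero element of it would be a product of two
    others of it; repeating this contradicts [no_infinitely_divisible]. *)
Lemma max_ideal_principal p : exists2 t, max_ideal p t /\ t != 0 &
  forall b, max_ideal p b -> V p (b / t).
Proof.
apply: contrapT => H.
have split2 t : max_ideal p t -> t != 0 -> exists b c,
    [/\ max_ideal p b, max_ideal p c, c != 0 & t = b * c].
  move=> mt t0.
  have /existsNP [y /not_implyP [my nV]] : ~ forall b, max_ideal p b -> V p (b / t).
    by move=> h; apply: H; exists t.
  have y0 : y != 0 by apply/eqP => e; apply: nV; rewrite e mul0r; apply: V0.
  exists (t / y), y; split=> //; last by rewrite divfK.
  have nz : y / t != 0 by rewrite mulf_neq0 ?invr_eq0.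
  have ety : t / y = (y / t)^-1 by rewrite invfM invrK mulrC.
  split; last by right; rewrite ety invrK.
  by case: (pl_valuation p nz) => // h; rewrite ety.
have [y nVy] := pl_nontrivial p.
have y0 : y != 0 by apply/eqP => e; apply: nVy; rewrite e; apply: V0.
have mt : max_ideal p y^-1.
  by split; [case: (pl_valuation p y0)|right; rewrite invrK].
apply: (@no_infinitely_divisible p y^-1); first by rewrite invr_eq0.
move=> n; have : y^-1 != 0 by rewrite invr_eq0.
elim: n y^-1 mt => [|n IH] t mt t0.
  by exists [::]; split=> //; exists t; rewrite ?big_nil ?mulr1 //; case: mt.
have [b [c [mb mc c0 ->]]] := split2 t mt t0.
have [s [sn hs [e Ve ->]]] := IH c mc c0.
exists (b :: s); split; first by rewrite /= sn.
  by move=> z; rewrite inE => /orP [/eqP ->|/hs].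
by exists e => //; rewrite big_cons mulrCA.
Qed.

Lemma place_discrete p : discrete p.
Proof.
have [t [mt t0] ht] := max_ideal_principal p; have [Vt mt'] := mt.
have nVt : ~ V p t^-1 by case: mt' => // e; rewrite e eqxx in t0.
have pos b : V p b -> b != 0 -> exists n : nat, V p (b / t ^+ n) /\ V p (b / t ^+ n)^-1.
  move=> Vb b0; apply: contrapT => H.
  have all n : V p (b / t ^+ n).
    elim: n => [|n IH]; first by rewrite divr1.
    have nz : b / t ^+ n != 0 by rewrite mulf_neq0 ?invr_eq0 ?expf_neq0.
    rewrite exprSr invfM mulrA; apply: ht; split=> //; right => h; apply: H.
    by exists n.
  apply: (@no_infinitely_divisible p b b0) => n; exists (nseq n t); split.
  - by rewrite size_nseq.
  - by move=> c /nseqP [-> _].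
  exists (b / t ^+ n) => //; rewrite big_nseq -[iter _ _ _]/(iter n ( *%R t) 1).
  by rewrite iter_mulr_1 divfK // expf_neq0.
exists t; split=> // x x0; case: (pl_valuation p x0) => Vx.
  by have [n [h1 h2]] := pos x Vx x0; exists (- n%:Z); rewrite -invr_expz.
have [n [h1 h2]] := pos _ Vx (invr_neq0 x0); exists n%:Z.
have e : x^-1 / t ^+ n = (x * t ^+ n)^-1 by rewrite invfM.
by rewrite -exprnP; rewrite e ?invrK in h1 h2.
Qed.

Lemma poles_finite b : finite_set [set p | ~ V p b].
Proof.
have [x rx] := se_red_surj C b.
apply: (@sub_finite_set _ _ [set p | ~ O p x]); last exact: se_almost_int.
move=> p /= nV Ox; apply: nV; by rewrite -rx; apply: V_red.
Qed.

Let DD := place_discrete.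

Definition unifF p : se_F C := xget 0 [set x | O p x /\ red x = unif p].
Lemma unifFP p : O p (unifF p) /\ red (unifF p) = unif p.
Proof.
rewrite /unifF; case: xgetP => // /(_ _) H; exfalso.
have [_ Vu _ _] := unifP DD p; have [x Ox rx] := O_lift Vu; exact: (H x).
Qed.

Definition nilgen p : se_F C := xget 0 [set nu | [/\ red nu = 0, nu != 0, O p nu &
    forall n, O p n -> red n = 0 -> exists2 x, O p x & n = x * nu]].
Lemma nilgenP p : [/\ red (nilgen p) = 0, nilgen p != 0, O p (nilgen p) &
    forall n, O p n -> red n = 0 -> exists2 x, O p x & n = x * nilgen p].
Proof.
rewrite /nilgen; case: xgetP => // /(_ _) H; exfalso.
by have [nu h] := se_stalk C p; apply: (H nu).
Qed.

Local Notation pi p := (jj p (unifF p)).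
Local Notation nn p := (jj p (nilgen p)).

Lemma Oh_pi p : Oh (pi p).
Proof. by apply: Oh_map; case: (unifFP p). Qed.
Lemma Oh_nn p : Oh (nn p).
Proof. by apply: Oh_map; case: (nilgenP p). Qed.
Lemma unit_pi p : pi p \is a GRing.unit.
Proof. by apply: map_unit; have [_ ->] := unifFP p; apply: unif_neq0. Qed.
Lemma nn_sq p : nn p * nn p = 0.
Proof. by rewrite -rmorphM red_sq0 ?rmorph0 //; case: (nilgenP p). Qed.

Lemma nonunit_form p x : m_ p x -> exists a b : se_F C, [/\ O p a, O p b & x = unifF p * a + nilgen p * b].
Proof.
move=> /nonunit_red [Ox /(max_idealP DD) v]; have [Ou ru] := unifFP p.
have : V p (red x / unif p) by move: v; rewrite /vge -invr_expz.
move=> /O_lift [a Oa ra]; have [_ _ _ gen] := nilgenP p.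
have [||b Ob e] := gen (x - unifF p * a).
- by apply: OB => //; apply: OM.
- by rewrite rmorphB rmorphM ru ra mulrC divfK ?subrr // unif_neq0.
by exists a, b; split=> //; rewrite [nilgen p * b]mulrC -e addrC subrK.
Qed.

(** The maximal ideal is generated by a uniformizer and a nilpotent of square 0, so at most one
    factor of the latter survives in a product. *)
Lemma ideal_pow_form p n x : ideal_pow (O p) (m_ p) n x ->
  exists a b : se_F C, [/\ O p a, O p b & x = unifF p ^+ n * a + unifF p ^+ n.-1 * nilgen p * b].
Proof.
have [Ou _] := unifFP p; have [rnu _ On _] := nilgenP p.
elim: n x => [|n IH] x /=.
  by move=> Ox; exists x, 0; split=> //; [apply: O0|rewrite mulr0 addr0 expr0 mul1r].
move=> [s [hs ->]]; elim: s hs => [|w s IHs] hs.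
  by exists 0, 0; rewrite big_nil !mulr0 addr0; split=> //; apply: O0.
have [|a [b [Oa Ob e]]] := IHs.
  by move=> w' h; apply: hs; rewrite inE h orbT.
rewrite big_cons e.
have [/nonunit_form [c [d [Oc Od ->]]] /IH [a' [b' [Oa' Ob' ->]]]] := hs w (mem_head _ _).
have n2 : nilgen p * nilgen p = 0 by apply: red_sq0.
(* At n = 0 the truncated exponent n.-1 is again 0, which leaves one factor of the uniformizer
   over. *)
exists (c * a' + a), (d * a' + (if n is 0 then unifF p else 1) * c * b' + b); split.
- by apply: OD => //; apply: OM.
- apply: OD => //; apply: OD; first exact: OM.
  by apply: OM => //; apply: OM => //; case: (n) => // _; apply: O1.
have -> : (unifF p * c + nilgen p * d) * (unifF p ^+ n * a' + unifF p ^+ n.-1 * nilgen p * b') =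
  unifF p ^+ n.+1 * (c * a') + unifF p ^+ n * nilgen p * (d * a') +
  (unifF p * unifF p ^+ n.-1) * nilgen p * (c * b') + (nilgen p * nilgen p) * (d * unifF p ^+ n.-1 * b').
  by rewrite exprS; ring.
rewrite n2 mul0r addr0 [in RHS]/=.
case: n {IH IHs hs e} => [|n] /=; first by rewrite !expr0; ring.
by rewrite !exprS; ring.
Qed.

Lemma filt_form p n (y : cp_F D p) : filt p n y ->
  exists a b : cp_F D p, [/\ Oh a, Oh b & y = pi p ^+ n * a + pi p ^+ n.-1 * nn p * b].
Proof.
move=> [s [hs ->]]; elim: s hs => [|w s IHs] hs.
  by exists 0, 0; rewrite big_nil !mulr0 addr0; split=> //; apply: Oh0.
have [|a [b [Oa Ob e]]] := IHs.
  by move=> w' h; apply: hs; rewrite inE h orbT.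
rewrite big_cons e; have [Ow [x /ideal_pow_form [c [d [Oc Od ->]]] <-]] := hs w (mem_head _ _).
exists (w.1 * jj p c + a), (w.1 * jj p d + b); split.
- by apply: OhD => //; apply: OhM => //; apply: Oh_map.
- by apply: OhD => //; apply: OhM => //; apply: Oh_map.
by rewrite rmorphD !rmorphM !rmorphXn; ring.
Qed.

Lemma filt_pi p n (a : cp_F D p) : Oh a -> filt p n (pi p ^+ n * a).
Proof.
move=> Oa; rewrite mulrC -rmorphXn; apply: filt_mem => //.
have := @ideal_pow_prod p (nseq n (unifF p)) 1 (O1 p) _.
rewrite size_nseq big_nseq iter_mulr_1 mul1r; apply.
move=> x /nseqP [-> _]; apply/nonunit_red; have [Ou ->] := unifFP p; split=> //.
by apply/(max_idealP DD); rewrite /vge -invr_expz mulfV ?unif_neq0 //; apply: V1.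
Qed.

Lemma dense_form p n (y : cp_F D p) : Oh y -> exists (x : se_F C) (a b : cp_F D p),
  [/\ O p x, Oh a, Oh b & y = jj p x + pi p ^+ n * a + pi p ^+ n.-1 * nn p * b].
Proof.
move=> Oy; have [x Ox /filt_form [a [b [Oa Ob e]]]] := cp_dense _ D p n _ Oy.
by exists x, a, b; split=> //; rewrite -addrA -e addrC subrK.
Qed.

(** The geometric series for 1 / (1 + pi c) converges in the completion. *)
Lemma inv_1pi p (c : cp_F D p) : Oh c -> exists2 z, Oh z & (1 + pi p * c) * z = 1.
Proof.
move=> Oc; pose q := - (pi p * c); pose y n := \sum_(i < n) q ^+ i.
have Oq : Oh q by apply: OhN; apply: OhM => //; apply: Oh_pi.
have Fq n : filt p n (q ^+ n).
  rewrite /q -mulrN exprMn; apply: filt_pi; apply: OhX; exact: OhN.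
have [||z Oz hz] := @cp_complete _ _ _ D p y.
- by move=> n; apply: Oh_sum => i _; apply: OhX.
- by move=> n; rewrite /y big_ord_recr /= addrAC subrr add0r; apply: Fq.
exists z => //; apply/eqP; rewrite -subr_eq0; apply/eqP; apply: cp_separated => n.
have e : (1 - q) * y n = 1 - q ^+ n by rewrite -[X in _ = X - _](expr1n _ n) subrXX; congr (_ * _); apply: eq_bigr => i _; rewrite expr1n mul1r.
have -> : (1 + pi p * c) * z - 1 = (1 - q) * (z - y n) - q ^+ n.
  by rewrite mulrBr e /q; ring.
apply: filtD; last exact: filtN.
by apply: filtM (hz n); apply: OhB => //; apply: Oh1.
Qed.

(** The closure of the ideal of the nilpotent generator, in the form that approximation by O_{C,p}
    yields; [Oh_nil] and [nilO_nl] compare it with nilpotence. *)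
Definition nilO p (y : cp_F D p) :=
  forall n, exists a d : cp_F D p, [/\ Oh a, Oh d & y = pi p ^+ n * a + nn p * d].

Lemma nilO_mul p (y z : cp_F D p) : nilO y -> nilO z -> y * z = 0.
Proof.
move=> hy hz; apply: cp_separated => n.
have [a [b [Oa Ob ->]]] := hy n; have [c [d [Oc Od ->]]] := hz n.
have -> : (pi p ^+ n * a + nn p * b) * (pi p ^+ n * c + nn p * d) =
  pi p ^+ n * (a * (pi p ^+ n * c) + nn p * (a * d + b * c)) + (nn p * nn p) * (b * d) by ring.
rewrite nn_sq mul0r addr0; apply: filt_pi.
have On := Oh_nn p; have Op := OhX n (Oh_pi p).
by apply: OhD; [apply: OhM => //; apply: OhM|apply: OhM => //; apply: OhD; apply: OhM].
Qed.

Definition Ohu p (u : cp_F D p) := [/\ u \is a GRing.unit, Oh u & Oh u^-1].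

(** Approximate y by elements of O_{C,p}. If at some precision the reduction of the approximation
    has an order m below the precision, y has order m and the error goes into a unit 1 + pi c; if
    this never happens, y is in [nilO]. *)
Lemma Oh_cases p (y : cp_F D p) : Oh y -> nilO y \/
  exists (n : nat) (u b : cp_F D p), [/\ Ohu u, Oh b & y = pi p ^+ n * u + nn p * b].
Proof.
move=> Oy.
have [H|/existsNP [n nH]] := pselect (forall n, exists (x : se_F C) (a b : cp_F D p), [/\ O p x, Oh a, Oh b
    & y = jj p x + pi p ^+ n.+1 * a + pi p ^+ n * nn p * b /\ vge p n.+1 (red x)]).
  left=> n; have [x [a [b [Ox Oa Ob [-> v]]]]] := H n.
  have [Ou ru] := unifFP p; have [_ _ _ gen] := nilgenP p.
  have : V p (red x / unif p ^+ n.+1) by move: v; rewrite /vge -invr_expz.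
  move=> /O_lift [c Oc rc]; have [||d Od e] := gen (x - unifF p ^+ n.+1 * c).
  - by apply: OB => //; apply: OM => //; apply: OX.
  - by rewrite rmorphB rmorphM rmorphXn ru rc mulrC divfK ?subrr // expf_neq0 // unif_neq0.
  have -> : x = unifF p ^+ n.+1 * c + d * nilgen p by rewrite -e addrC subrK.
  exists (pi p * (jj p c + a)), (jj p d + pi p ^+ n * b); split.
  - by apply: OhM; [apply: Oh_pi|apply: OhD => //; apply: Oh_map].
  - by apply: OhD; [apply: Oh_map|apply: OhM => //; apply: OhX; apply: Oh_pi].
  by rewrite rmorphD !rmorphM rmorphXn exprS; ring.
right; have [x [a [b [Ox Oa Ob e]]]] := dense_form n.+1 Oy.
have nv : ~ vge p n.+1 (red x) by move=> v; apply: nH; exists x, a, b.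
have x0 : red x != 0 by apply/eqP => e0; apply: nv; rewrite e0; apply: vge_0.
have Vx := V_red Ox; have v0 := vl_V DD Vx.
have vn : vl p (red x) < n.+1.
  by rewrite ltNge; apply/negP => h; apply: nv; apply/(vgeP DD p _ x0).
have [m em] : exists m : nat, vl p (red x) = m by exists `|vl p (red x)|%N; lia.
have [Ou ru] := unifFP p; have [_ _ _ gen] := nilgenP p.
have pm0 : unif p ^+ m != 0 by rewrite expf_neq0 // unif_neq0.
have q0 : red x / unif p ^+ m != 0 by rewrite mulf_neq0 ?invr_eq0.
have uq : vunit p (red x / unif p ^+ m).
  by apply/(vunitP DD p q0); rewrite (vlf DD) // exprnP (vl_unifz DD) em subrr.
have [_ Vq Vq'] := uq; have [U OU rU] := O_lift Vq.
have U0 : red U != 0 by rewrite rU.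
have OU' : O p U^-1 by apply: O_inv => //; rewrite rU.
have [||d Od ed] := gen (x - unifF p ^+ m * U).
- by apply: OB => //; apply: OM => //; apply: OX.
- by rewrite rmorphB rmorphM rmorphXn ru rU mulrC divfK ?subrr.
(* For this c the error term pi^(n+1) a equals pi^m U (pi c). *)
pose c := pi p ^+ (n - m) * a * jj p U^-1.
have Oc : Oh c.
  by apply: OhM; [apply: OhM => //; apply: OhX; apply: Oh_pi|apply: Oh_map].
have [z Oz ez] := inv_1pi Oc.
have uU : jj p U \is a GRing.unit by apply: map_unit.
exists m, (jj p U * (1 + pi p * c)), (jj p d + pi p ^+ n * b); split.
- have ee : (jj p U * (1 + pi p * c)) * (z * jj p U^-1) = 1.
    by rewrite -mulrA [_ * (z * _)]mulrA ez mul1r -rmorphM mulrV ?rmorph1 // F_unit.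
  have uu : jj p U * (1 + pi p * c) \is a GRing.unit by apply/unitrPr; exists (z * jj p U^-1).
  split=> //.
    apply: OhM; first exact: Oh_map.
    by apply: OhD; [apply: Oh1|apply: OhM => //; apply: Oh_pi].
  have -> : (jj p U * (1 + pi p * c))^-1 = z * jj p U^-1 by apply: (mulrI uu); rewrite ee mulrV.
  by apply: OhM => //; apply: Oh_map.
- by apply: OhD; [apply: Oh_map|apply: OhM => //; apply: OhX; apply: Oh_pi].
have eU : jj p U * jj p U^-1 = 1 by rewrite -rmorphM mulrV ?rmorph1 // F_unit.
have mn : (m <= n)%N by move: vn; rewrite em; lia.
have ex : x = unifF p ^+ m * U + d * nilgen p by rewrite -ed addrC subrK.
rewrite e ex rmorphD !rmorphM rmorphXn /c -{1}(subnKC mn) -addnS exprD exprS.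
have ea : a = jj p U * jj p U^-1 * a by rewrite eU mul1r.
by rewrite {1}ea /=; ring.
Qed.

End Local.

(** * Congruences modulo nilpotents *)

Section Nilpotents.
Variables (k : finFieldType) (X : function_field k) (C : special_extension X).
Variable D : completion C.
Implicit Types (p : place X) (b c d : X).
Local Notation V := pl_ring.
Local Notation red := (se_red C).
Local Notation Oh := (@cp_O _ _ _ D _).
Local Notation jj := (cp_map D).
Local Notation pi p := (jj p (unifF C p)).
Local Notation nn p := (jj p (nilgen C p)).
Local Notation nl := nilpotent_elt.
Let DD : forall p, discrete p := place_discrete D.

Lemma unit_add_sq0 (R : comUnitRingType) (x y : R) :
  x \is a GRing.unit -> y * y = 0 -> x + y \is a GRing.unit.
Proof.
move=> ux y2; apply/unitrPr; exists (x^-1 * (1 - y / x)).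
have n2 : (y / x) * (y / x) = 0 by rewrite mulrACA y2 mul0r.
by rewrite mulrA mulrDl mulrV //; apply: unit_1n.
Qed.

Lemma unit_not_nl (R : comUnitRingType) (x : R) : x \is a GRing.unit -> ~ nl x.
Proof. by move=> ux [m e]; have := unitrX m ux; rewrite e unitr0. Qed.

Lemma nl_of_sq0 (R : comUnitRingType) (x : R) : x * x = 0 -> nl x.
Proof. by move=> e; exists 2%N; rewrite expr2. Qed.

Lemma nl_mull (R : comUnitRingType) (a x : R) : nl x -> nl (a * x).
Proof. by move=> [m e]; exists m; rewrite exprMn e mulr0. Qed.
Lemma nl_mulr (R : comUnitRingType) (a x : R) : nl x -> nl (x * a).
Proof. by rewrite mulrC; apply: nl_mull. Qed.
Lemma nl0 (R : comUnitRingType) : nl (0 : R).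
Proof. by exists 1%N; rewrite expr1. Qed.
Lemma nlN (R : comUnitRingType) (x : R) : nl x -> nl (- x).
Proof. by rewrite -mulN1r; apply: nl_mull. Qed.

Section AtPlace.
Variable p : place X.
Implicit Types (x y z u : cp_F D p).

Lemma Oh_nil y : Oh y -> nl y -> nilO y.
Proof.
move=> Oy ny; have [//|[n [u [b [[uu _ _] _ e]]]]] := Oh_cases Oy.
case: (unit_not_nl _ ny); rewrite e; apply: unit_add_sq0.
  by rewrite unitrM uu unitrX // unit_pi.
by rewrite mulrACA nn_sq mul0r.
Qed.

Lemma nilO_nl y : nilO y -> nl y.
Proof. by move=> h; apply: nl_of_sq0; apply: nilO_mul. Qed.

Lemma Oh_nl_mul y z : Oh y -> Oh z -> nl y -> nl z -> y * z = 0.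
Proof. by move=> Oy Oz ny nz; apply: nilO_mul; apply: Oh_nil. Qed.

Lemma fraction x : exists y s, [/\ Oh y, Oh s, s \is a GRing.unit & x = y / s].
Proof.
have [y [s [Oy ns e]]] := cp_fraction _ D p x; exists y, s; split=> //.
  by case: ns.
exact: cp_nzd_unit ns.
Qed.

(** Denominators are units, so this reduces to integral nilpotents, each arbitrarily close to a
    multiple of the nilpotent generator, whose square is 0. *)
Lemma nlM0 x y : nl x -> nl y -> x * y = 0.
Proof.
have [a [s [Oa Os us ->]]] := fraction x; have [b [t [Ob Ot ut ->]]] := fraction y.
move=> na nb; rewrite mulrACA (Oh_nl_mul Oa Ob) ?mul0r //.
  by rewrite -(divrK us a); apply: nl_mulr.
by rewrite -(divrK ut b); apply: nl_mulr.
Qed.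

Lemma nlD x y : nl x -> nl y -> nl (x + y).
Proof.
move=> nx ny; apply: nl_of_sq0.
by rewrite mulrDl !mulrDr !nlM0 // !addr0.
Qed.
Lemma nlB x y : nl x -> nl y -> nl (x - y).
Proof. by move=> nx ny; apply: nlD => //; apply: nlN. Qed.
Lemma nl_sum (I : Type) (r : seq I) (P : pred I) (f : I -> cp_F D p) :
  (forall i, P i -> nl (f i)) -> nl (\sum_(i <- r | P i) f i).
Proof. by move=> h; apply: big_ind => //; [apply: nl0|apply: nlD]. Qed.

Lemma unit_nl x y : x \is a GRing.unit -> nl (y - x) -> y \is a GRing.unit.
Proof.
move=> ux n; rewrite -(subrK x y) addrC; apply: unit_add_sq0 => //; exact: nlM0.
Qed.

Lemma nlc_sym x y : nl (x - y) -> nl (y - x).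
Proof. by move=> h; rewrite -opprB; apply: nlN. Qed.
Lemma nlc_trans y x z : nl (x - y) -> nl (y - z) -> nl (x - z).
Proof. by move=> a b; rewrite -(subrK y x) -addrA; apply: nlD. Qed.
Lemma nlc_refl x : nl (x - x).
Proof. by rewrite subrr; apply: nl0. Qed.
Lemma nlc_mul x y x' y' : nl (x - x') -> nl (y - y') -> nl (x * y - x' * y').
Proof.
move=> a b; have -> : x * y - x' * y' = (x - x') * y + x' * (y - y') by ring.
by apply: nlD; [apply: nl_mulr|apply: nl_mull].
Qed.
Lemma nlc_add x y x' y' : nl (x - x') -> nl (y - y') -> nl (x + y - (x' + y')).
Proof. by move=> a b; rewrite opprD addrACA; apply: nlD. Qed.
Lemma nlc_opp x x' : nl (x - x') -> nl (- x - (- x')).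
Proof. by move=> a; rewrite -opprD; apply: nlN. Qed.
Lemma nlc_inv x y : x \is a GRing.unit -> nl (x - y) -> nl (x^-1 - y^-1).
Proof.
move=> ux n; have uy := unit_nl ux (nlc_sym n).
have -> : x^-1 - y^-1 = (y - x) * (x^-1 * y^-1).
  by rewrite mulrBl [y * _]mulrCA mulrV // mulr1 mulrA mulrV // mul1r.
by apply: nl_mulr; apply: nlc_sym.
Qed.

Lemma OhuM u v : Ohu u -> Ohu v -> Ohu (u * v).
Proof.
move=> [a b c] [d e f]; split; first by rewrite unitrM a d.
  exact: OhM.
by rewrite invrM //; apply: OhM.
Qed.
Lemma OhuV u : Ohu u -> Ohu u^-1.
Proof. by move=> [a b c]; split; rewrite ?invrK ?unitrV. Qed.
Lemma Ohu1 : Ohu (1 : cp_F D p).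
Proof. by split; rewrite ?unitr1 ?invr1; try exact: Oh1. Qed.

Lemma regular_form s : Oh s -> s \is a GRing.unit ->
  exists n u, Ohu u /\ nl (s - pi p ^+ n * u).
Proof.
move=> Os us; have [/nilO_nl /unit_not_nl//|[n [u [b [uu _ ->]]]]] := Oh_cases Os.
exists n, u; split=> //; rewrite addrAC subrr add0r.
by apply: nl_of_sq0; rewrite mulrACA nn_sq mul0r.
Qed.

Lemma unit_form x : ~ nl x ->
  exists m n u, Ohu u /\ nl (x - pi p ^+ m / pi p ^+ n * u).
Proof.
have [y [s [Oy Os us ->]]] := fraction x => nx.
have ny : ~ nl y by move=> h; apply: nx; apply: nl_mulr.
have [/nilO_nl//|[m [u [b [uu _ e]]]]] := Oh_cases Oy.
have [n [v [uv hv]]] := regular_form Os us.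
have [uv0 _ _] := uv.
have hm : nl (y - pi p ^+ m * u).
  by rewrite e addrAC subrr add0r; apply: nl_of_sq0; rewrite mulrACA nn_sq mul0r.
exists m, n, (u / v); split; first by apply: OhuM => //; apply: OhuV.
have -> : pi p ^+ m / pi p ^+ n * (u / v) = (pi p ^+ m * u) * (pi p ^+ n * v)^-1.
  by rewrite invrM ?unitrX ?unit_pi //; ring.
by apply: nlc_mul => //; apply: nlc_inv.
Qed.

Lemma not_nl_unit x : ~ nl x -> x \is a GRing.unit.
Proof.
move=> /unit_form [m [n [u [[uu _ _] h]]]].
by apply: unit_nl h; rewrite !unitrM unitrV !unitrX ?unit_pi.
Qed.

Lemma red_lift b : red (Defs.lift C b) = b.
Proof.
rewrite /Defs.lift; case: xgetP => [x -> //|/(_ _) H].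
by have [x rx] := se_red_surj C b; case: (H x).
Qed.

Lemma nl_map (x : se_F C) : red x = 0 -> nl (jj p x).
Proof. by move=> h; apply: nl_of_sq0; rewrite -rmorphM red_sq0 // rmorph0. Qed.

Lemma loc_red (x : se_F C) : nl (jj p x - loc D p (red x)).
Proof. by rewrite /loc -rmorphB; apply: nl_map; rewrite rmorphB red_lift subrr. Qed.

Lemma loc_red' (x : se_F C) b : red x = b -> nl (loc D p b - jj p x).
Proof. by move=> <-; apply: nlc_sym; apply: loc_red. Qed.

Lemma locM b c : nl (loc D p (b * c) - loc D p b * loc D p c).
Proof. by rewrite /loc -rmorphM; apply: loc_red'; rewrite rmorphM !red_lift. Qed.
Lemma locD b c : nl (loc D p (b + c) - (loc D p b + loc D p c)).
Proof. by rewrite /loc -rmorphD; apply: loc_red'; rewrite rmorphD !red_lift. Qed.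
Lemma locN b : nl (loc D p (- b) - - loc D p b).
Proof. by rewrite /loc -rmorphN; apply: loc_red'; rewrite rmorphN !red_lift. Qed.
Lemma loc1 : nl (loc D p 1 - 1).
Proof. by rewrite -(rmorph1 (jj p)); apply: loc_red'; rewrite rmorph1. Qed.
Lemma loc0 : nl (loc D p 0).
Proof. by rewrite -[loc D p 0]subr0 -(rmorph0 (jj p)); apply: loc_red'; rewrite rmorph0. Qed.
Lemma loc_unit b : b != 0 -> loc D p b \is a GRing.unit.
Proof. by move=> b0; apply: map_unit; rewrite red_lift. Qed.
Lemma locV b : b != 0 -> nl (loc D p b^-1 - (loc D p b)^-1).
Proof.
move=> b0; rewrite /loc -rmorphV; last by apply: F_unit; rewrite red_lift.
by apply: loc_red'; rewrite red_inv ?red_lift.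
Qed.
Lemma loc_pi n : nl (loc D p (unif p ^+ n) - pi p ^+ n).
Proof.
by rewrite -rmorphXn; apply: loc_red'; rewrite rmorphXn; have [_ ->] := unifFP D p.
Qed.
Lemma Obar_Oh x : Oh x -> Obar x.
Proof. by move=> h; exists x => //; apply: nlc_refl. Qed.
Lemma Obar_cong x y : nl (x - y) -> Obar y -> Obar x.
Proof. by move=> n [z Oz nz]; exists z => //; apply: nlc_trans n nz. Qed.
Lemma Obar_nl x : nl x -> Obar x.
Proof. by move=> h; exists 0; [apply: Oh0|rewrite subr0]. Qed.
Lemma ObarD x y : Obar x -> Obar y -> Obar (x + y).
Proof.
by move=> [a Oa na] [b Ob nb]; exists (a + b); [apply: OhD|apply: nlc_add].
Qed.
Lemma ObarN x : Obar x -> Obar (- x).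
Proof. by move=> [a Oa na]; exists (- a); [apply: OhN|apply: nlc_opp]. Qed.
Lemma ObarB x y : Obar x -> Obar y -> Obar (x - y).
Proof. by move=> a b; apply: ObarD => //; apply: ObarN. Qed.
Lemma ObarM x y : Obar x -> Obar y -> Obar (x * y).
Proof.
by move=> [a Oa na] [b Ob nb]; exists (a * b); [apply: OhM|apply: nlc_mul].
Qed.
Lemma Obar_sum (I : Type) (r : seq I) (P : pred I) (f : I -> cp_F D p) :
  (forall i, P i -> Obar (f i)) -> Obar (\sum_(i <- r | P i) f i).
Proof.
by move=> h; apply: big_ind => //; [apply/Obar_Oh/Oh0|apply: ObarD].
Qed.
Lemma Obar1 : Obar (1 : cp_F D p).
Proof. by apply: Obar_Oh; apply: Oh1. Qed.

Lemma Obar_mul_nl x m : Obar x -> nl m -> Oh m -> Oh (x * m).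
Proof.
move=> [y Oy ny] nm Om; have -> : x * m = y * m; last exact: OhM.
by apply/eqP; rewrite -subr_eq0 -mulrBl nlM0.
Qed.

Lemma Oh_loc b : V p b -> Obar (loc D p b).
Proof.
move=> /(O_lift C) [x Ox rx]; apply: Obar_cong (loc_red' rx) _.
by apply: Obar_Oh; apply: Oh_map.
Qed.

(** If b had a pole, multiplying it by the integral function 1 / (b unif) would give 1 = pi c modulo
    nilpotents with c integral, whereas 1 - pi c is a unit. *)
Lemma Obar_loc b : Obar (loc D p b) <-> V p b.
Proof.
split; last exact: Oh_loc.
move=> Ob; apply: contrapT => /(notV_inv DD) [b0 v].
have : V p (b^-1 / unif p) by move: v; rewrite /vge -exprN1.
move=> /Oh_loc Oc; have Opi : Obar (pi p) by apply: Obar_Oh; apply: Oh_pi.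
have [c Oc' nc] : Obar (loc D p b * loc D p (b^-1 / unif p)) by apply: ObarM.
have h : nl (1 - pi p * c).
  apply: (nlc_trans (y := loc D p (unif p * (b * (b^-1 / unif p))))).
    apply: nlc_sym; have -> : unif p * (b * (b^-1 / unif p)) = 1; last exact: loc1.
    by have u0 := unif_neq0 DD p; field; rewrite u0 b0.
  apply: nlc_trans (locM _ _) _; apply: nlc_mul.
    by have := loc_pi 1; rewrite !expr1.
  exact: nlc_trans (locM _ _) nc.
have [z _ e] := inv_1pi (OhN Oc').
apply: (unit_not_nl _ h); apply/unitrPr; exists z; by move: e; rewrite mulrN.
Qed.

Lemma unit_loc_form x : ~ nl x -> exists b u, [/\ b != 0, Ohu u & nl (x - loc D p b * u)].
Proof.
move=> /unit_form [m [n [u [uu h]]]].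
have u0 := unif_neq0 DD p.
exists (unif p ^+ m / unif p ^+ n), u; split=> //.
  by rewrite mulf_neq0 ?invr_eq0 ?expf_neq0.
apply: nlc_trans h _; apply: nlc_mul; last exact: nlc_refl.
apply: nlc_sym; apply: nlc_trans (locM _ _) _; apply: nlc_mul; first exact: loc_pi.
apply: nlc_trans (locV _) _; first by rewrite expf_neq0.
by apply: nlc_inv; [apply: loc_unit; rewrite expf_neq0|apply: loc_pi].
Qed.

Lemma Obar_unit_loc x : Obar x -> x \is a GRing.unit -> Obar x^-1 ->
  exists u, Ohu u /\ nl (x - u).
Proof.
move=> Ox ux Oxi.
have [b [u [b0 uu h]]] := unit_loc_form (unit_not_nl ux); have [uu0 Ou Oui] := uu.
have ub := loc_unit b0.
have hb : nl (loc D p b - x * u^-1).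
  have -> : loc D p b = (loc D p b * u) * u^-1 by rewrite mulrK.
  by apply: nlc_mul; [apply: nlc_sym|apply: nlc_refl].
have Vb : V p b by apply/Obar_loc; apply: Obar_cong hb _; apply: ObarM => //; apply: Obar_Oh.
have Vb' : V p b^-1.
  apply/Obar_loc; apply: Obar_cong (locV b0) _; apply: Obar_cong (nlc_inv ub hb) _.
  by rewrite invrM ?unitrV // invrK; apply: ObarM => //; apply: Obar_Oh.
have [y Oy ry] := O_lift C Vb.
have uy : red y != 0 by rewrite ry.
exists (jj p y * u); split.
  apply: OhuM => //; split; [exact: map_unit|exact: Oh_map|].
  by rewrite -rmorphV ?F_unit //; apply: Oh_map; apply: O_inv; rewrite ?ry.
by apply: nlc_trans h _; apply: nlc_mul (loc_red' ry) (nlc_refl _).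
Qed.

Lemma Obar_or_inv x : ~ nl x -> Obar x \/ Obar x^-1.
Proof.
move=> nx; have [b [u [b0 [uu Ou Oui] h]]] := unit_loc_form nx.
case: (pl_valuation p b0) => Vb; [left|right].
  by apply: Obar_cong h _; apply: ObarM; [apply: Oh_loc|apply: Obar_Oh].
apply: Obar_cong (nlc_inv (not_nl_unit nx) h) _.
rewrite invrM ?loc_unit //; apply: ObarM; first exact: Obar_Oh.
by apply: Obar_cong (nlc_sym (locV b0)) _; apply: Oh_loc.
Qed.

Lemma big_pi_div d : d != 0 -> exists N0 : nat, forall N, (N0 <= N)%N -> V p (unif p ^+ N / d).
Proof.
move=> d0; exists `|vl p d|%N => N le.
have u0 := unif_neq0 DD p.
have nz : unif p ^+ N / d != 0 by rewrite mulf_neq0 ?invr_eq0 ?expf_neq0.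
by apply/(V_vl DD p nz); rewrite (vlf DD) ?expf_neq0 // exprnP (vl_unifz DD); lia.
Qed.

(** Modulo nilpotents x is a global function times a unit, and the unit is approximated through
    [dense_form]; [d] is the prescribed precision. *)
Lemma density x d : d != 0 -> exists b, Obar ((x - loc D p b) / loc D p d).
Proof.
move=> d0; have [nx|nx] := pselect (nl x).
  by exists 0; apply: Obar_nl; apply: nl_mulr; apply: nlB => //; apply: loc0.
have [e [u [e0 [uu Ou Oui] h]]] := unit_loc_form nx.
have ed : d / e != 0 by rewrite mulf_neq0 ?invr_eq0.
have [N hN] := big_pi_div ed.
have [y [a [b [Oy Oa Ob eu]]]] := dense_form N.+1 Ou.
exists (e * red y).
have h2 : nl ((x - loc D p (e * red y)) / loc D p d - loc D p (unif p ^+ N.+1 / (d / e)) * a).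
  have e1 : nl ((x - loc D p (e * red y)) - loc D p e * (pi p ^+ N.+1 * a)).
    apply: (nlc_trans (y := loc D p e * u - loc D p e * jj p y)).
      apply: nlc_add => //; apply: nlc_opp; apply: nlc_trans (locM _ _) _.
      by apply: nlc_mul (nlc_refl _) _; apply: loc_red'.
    rewrite -mulrBr -mulrBr; apply: nl_mull; rewrite eu.
    have -> : jj p y + pi p ^+ N.+1 * a + pi p ^+ N.+1.-1 * nn p * b - jj p y - pi p ^+ N.+1 * a
      = pi p ^+ N * nn p * b by rewrite /=; ring.
    by apply: nl_of_sq0; rewrite mulrACA [X in X * _]mulrACA nn_sq mulr0 mul0r.
  apply: nlc_trans (nlc_mul e1 (nlc_refl (loc D p d)^-1)) _.
  have -> : loc D p e * (pi p ^+ N.+1 * a) / loc D p d =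
            (pi p ^+ N.+1 * ((loc D p d)^-1 * loc D p e)) * a by ring.
  apply: nlc_mul (nlc_refl _); apply: nlc_sym; rewrite invfM invrK.
  apply: nlc_trans (locM _ _) _; apply: nlc_mul (loc_pi _) _.
  by apply: nlc_trans (locM _ _) _; apply: nlc_mul (locV d0) (nlc_refl _).
apply: Obar_cong h2 _; apply: ObarM; last exact: Obar_Oh.
by apply: Oh_loc; apply: hN.
Qed.

Lemma nil_map_eq (x y : se_F C) : red x = red y -> jj p (x * nilgen C p) = jj p (y * nilgen C p).
Proof.
move=> e; congr (jj p _); apply/eqP; rewrite -subr_eq0 -mulrBl se_sq0 //.
  by rewrite rmorphB e subrr.
by case: (nilgenP C p).
Qed.

Lemma nil_density_Oh x d : d != 0 -> nl x -> Oh x -> exists b m,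
  [/\ V p b, nl m, Oh m & x = jj p (Defs.lift C b * nilgen C p) + loc D p d * m].
Proof.
move=> d0 nx Ox; have [N hN] := big_pi_div d0.
have [a [e [Oa Oe ex]]] := Oh_nil Ox nx N.
have [y [a' [b' [Oy Oa' Ob' ee]]]] := dense_form N Oe.
have ex' : x = jj p (y * nilgen C p) + pi p ^+ N * (a + nn p * a').
  rewrite ex ee rmorphM.
  transitivity (pi p ^+ N * a + nn p * jj p y + nn p * (pi p ^+ N * a') + (nn p * nn p) * (pi p ^+ N.-1 * b')).
    by ring.
  by rewrite nn_sq mul0r addr0; ring.
set m0 := a + nn p * a' in ex'.
have uN : pi p ^+ N \is a GRing.unit by rewrite unitrX ?unit_pi.
have nm0 : nl m0.
  rewrite -(mulKr uN m0); apply: nl_mull.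
  have -> : pi p ^+ N * m0 = x - jj p (y * nilgen C p) by rewrite ex' addrC addKr.
  apply: nlB => //; apply: nl_map; rewrite rmorphM.
  by case: (nilgenP C p) => -> _ _ _; rewrite mulr0.
have Om0 : Oh m0 by apply: OhD => //; apply: OhM => //; apply: Oh_nn.
have ud := loc_unit d0.
have hq : Obar ((loc D p d)^-1 * pi p ^+ N).
  apply: Obar_cong (Oh_loc (hN N (leqnn N))); rewrite mulrC.
  apply: nlc_sym; apply: nlc_trans (locM _ _) _.
  exact: nlc_mul (loc_pi _) (locV d0).
exists (red y), ((loc D p d)^-1 * pi p ^+ N * m0); split.
- exact: V_red.
- exact: nl_mull.
- exact: Obar_mul_nl.
rewrite -[_^-1 * _ * m0]mulrA mulVKr // ex'; congr (_ + _).
by apply: nil_map_eq; rewrite red_lift.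
Qed.

Lemma nil_clear x : nl x -> exists n, Oh (pi p ^+ n * x).
Proof.
have [y [s [Oy Os us ->]]] := fraction x => nx.
have ny : nl y by rewrite -(divrK us y); apply: nl_mulr.
have [n [u [[uu Ou Oui] h]]] := regular_form Os us; exists n.
have -> : pi p ^+ n * (y / s) = y * u^-1; last exact: OhM.
have upn : pi p ^+ n \is a GRing.unit by rewrite unitrX ?unit_pi.
apply/eqP; rewrite -subr_eq0.
have -> : pi p ^+ n * (y / s) - y / u = y * (pi p ^+ n * (s^-1 - (pi p ^+ n * u)^-1)).
  by rewrite invrM // [pi p ^+ n * (_ - _)]mulrBr [pi p ^+ n * (u^-1 * _)]mulrCA mulrV // mulr1; ring.
rewrite nlM0 //; apply: nl_mull; exact: nlc_inv us h.
Qed.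

(** Approximation inside the nilradical, with X acting on global nilpotents. The last clause keeps
    the approximating functions integral at almost all places when x runs through the components of
    an adele. *)
Lemma nil_density x d : d != 0 -> nl x -> exists b m,
  [/\ nl m, Oh m, x = jj p (Defs.lift C b * nilgen C p) + loc D p d * m & Oh x -> V p b].
Proof.
move=> d0 nx; have [Ox|nOx] := pselect (Oh x).
  by have [b [m [Vb nm Om e]]] := nil_density_Oh d0 nx Ox; exists b, m; split.
have [n On] := nil_clear nx.
have u0 : unif p ^+ n != 0 by rewrite expf_neq0 // (unif_neq0 DD).
have upn : pi p ^+ n \is a GRing.unit by rewrite unitrX ?unit_pi.
have dn0 : d * unif p ^+ n != 0 by rewrite mulf_neq0.
have [b [m [Vb nm Om e]]] := nil_density_Oh dn0 (nl_mull _ nx) On.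
exists (b / unif p ^+ n), m; split=> //.
apply: (mulrI upn); rewrite e mulrDr; congr (_ + _).
  rewrite -[pi p ^+ n]rmorphXn -rmorphM mulrA; apply: nil_map_eq.
  rewrite rmorphM !red_lift rmorphXn; have [_ ->] := unifFP D p.
  by rewrite mulrC divfK.
rewrite mulrA; apply/eqP; rewrite -subr_eq0 -mulrBl nlM0 //.
rewrite [pi p ^+ n * _]mulrC; apply: nlc_trans (locM _ _) _.
exact: nlc_mul (nlc_refl _) (loc_pi _).
Qed.

End AtPlace.
End Nilpotents.

(** * Twisted differential forms *)

Section Eta.
Variables (k : finFieldType) (X : function_field k) (C : special_extension X).
Variable D : completion C.
Implicit Types (p q : place X) (b c d : X).
Local Notation V := pl_ring.
Local Notation red := (se_red C).
Local Notation O := (se_O C).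
Local Notation Oh := (@cp_O _ _ _ D _).
Local Notation jj := (cp_map D).
Local Notation nl := nilpotent_elt.
Let DD : forall p, discrete p := place_discrete D.
Let FF : forall b : X, finite_set [set p | ~ V p b] := poles_finite C.

(** At every place nilpotents have square 0, so 2 always serves as the uniform exponent. *)
Lemma nil_adeleP (n : adele D) : nil_adele n <-> is_adele n /\ forall p, nl (n p).
Proof.
split=> [[a [m h]]|[a h]]; first by split=> // p; exists m.
by split=> //; exists 2%N => p; rewrite expr2 nlM0.
Qed.

Lemma adeleD (m n : adele D) : is_adele m -> is_adele n -> is_adele (fun p => m p + n p).
Proof.
move=> a b; apply: (@sub_finite_set _ _ ([set p | ~ cp_O (m p)] `|` [set p | ~ cp_O (n p)])).
  move=> p /= h; apply: contrapT => /not_orP [/contrapT x /contrapT y].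
  by apply: h; apply: OhD.
by rewrite finite_setU.
Qed.

Lemma adeleM (m n : adele D) : is_adele m -> is_adele n -> is_adele (fun p => m p * n p).
Proof.
move=> a b; apply: (@sub_finite_set _ _ ([set p | ~ cp_O (m p)] `|` [set p | ~ cp_O (n p)])).
  move=> p /= h; apply: contrapT => /not_orP [/contrapT x /contrapT y].
  by apply: h; apply: OhM.
by rewrite finite_setU.
Qed.

Lemma adeleN (n : adele D) : is_adele n -> is_adele (fun p => - n p).
Proof. by move=> a; apply: sub_finite_set a => p /= h Op; apply: h; apply: OhN. Qed.

Lemma adele_map (x : se_F C) : is_adele (fun p => jj p x).
Proof.
apply: (@sub_finite_set _ _ [set p | ~ O p x]); last exact: se_almost_int.
by move=> p /= h Ox; apply: h; apply: Oh_map.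
Qed.

Lemma adele_int (n : adele D) : (forall p, Oh (n p)) -> is_adele n.
Proof. by move=> h; apply: (@sub_finite_set _ _ set0) => // p /= /(_ (h p)). Qed.

Lemma nil_adeleD (m n : adele D) : nil_adele m -> nil_adele n -> nil_adele (fun p => m p + n p).
Proof.
move=> /nil_adeleP [a b] /nil_adeleP [c d]; apply/nil_adeleP.
by split; [apply: adeleD|move=> p; apply: nlD].
Qed.
Lemma nil_adeleN (n : adele D) : nil_adele n -> nil_adele (fun p => - n p).
Proof.
move=> /nil_adeleP [a b]; apply/nil_adeleP.
by split; [apply: adeleN|move=> p; apply: nlN].
Qed.
Lemma nil_adeleMl (m n : adele D) : is_adele m -> nil_adele n -> nil_adele (fun p => m p * n p).
Proof.
move=> a /nil_adeleP [c d]; apply/nil_adeleP.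
by split; [apply: adeleM|move=> p; apply: nl_mull].
Qed.
Lemma nil_adele0 : nil_adele (fun p => 0 : cp_F D p).
Proof. by apply/nil_adeleP; split=> [|p]; [apply: adele_int => p; apply: Oh0|apply: nl0]. Qed.
Lemma nil_adele_map (x : se_F C) : red x = 0 -> nil_adele (fun p => jj p x).
Proof. by move=> h; apply/nil_adeleP; split=> [|p]; [apply: adele_map|apply: nl_map]. Qed.
Definition single p (x : cp_F D p) : adele D := dfwith (fun q => 0 : cp_F D q) x.
Lemma single_in p (x : cp_F D p) : single x p = x.
Proof. by rewrite /single dfwith_in. Qed.
Lemma single_out p (x : cp_F D p) q : p != q -> single x q = 0.
Proof. by move=> h; rewrite /single dfwith_out. Qed.
Lemma singleP p (x : cp_F D p) (n : adele D) : (forall q, q <> p -> n q = 0) -> n p = x -> n = single x.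
Proof.
move=> h e; apply: functional_extensionality_dep => q.
by have [<-|pq] := eqVneq p q; rewrite ?single_in // single_out // h //; apply/eqP; rewrite eq_sym.
Qed.

Lemma nil_adele_single p (x : cp_F D p) : nl x -> nil_adele (single x).
Proof.
move=> nx; apply/nil_adeleP; split=> [|q]; last first.
  by have [<-|pq] := eqVneq p q; rewrite ?single_in // single_out //; apply: nl0.
apply: (@sub_finite_set _ _ [set p]) => // q /= h; apply: contrapT => /eqP pq.
by apply: h; rewrite single_out 1?eq_sym //; apply: Oh0.
Qed.

Lemma idele_form (z : adele D) : idele z -> exists d : place X -> X, pidele d /\
  forall p, exists u, Ohu u /\ nl (z p - loc D p (d p) * u).
Proof.
move=> [uz fz].
have ex p : exists d, d != 0 /\ exists u, Ohu u /\ nl (z p - loc D p d * u).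
  by have [b [u [b0 uu h]]] := unit_loc_form (unit_not_nl (uz p)); exists b; split=> //; exists u.
have [d hd] := choice ex; exists d; split; last by move=> p; case: (hd p).
split; first by move=> p; case: (hd p).
apply: sub_finite_set fz => p /= nu [Oz Ozi]; apply: nu.
have [d0 [u [[uu Ou Oui] h]]] := hd p; have ud := loc_unit D p d0.
have h1 : nl (loc D p (d p) - z p * u^-1).
  have e1 : loc D p (d p) = loc D p (d p) * u / u by rewrite mulrK.
  rewrite e1; exact: (@nlc_mul _ _ _ _ p (loc D p (d p) * u) u^-1 (z p) u^-1 (nlc_sym h) (nlc_refl _)).
split=> //; apply/(Obar_loc D).
  by apply: Obar_cong h1 _; apply: ObarM; apply: Obar_Oh.
apply: Obar_cong (locV _ _ d0) _; apply: Obar_cong (nlc_inv ud h1) _.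
by rewrite invrM ?unitrV ?uz // invrK; apply: ObarM; apply: Obar_Oh.
Qed.

(** * The divisor of a twisted differential form *)

Section Form.
Variable eta : adele D -> k.
Hypothesis eta_form : twisted_form eta.

Lemma eta_add (m n : adele D) : nil_adele m -> nil_adele n ->
  eta (fun p => m p + n p) = eta m + eta n.
Proof. by case: eta_form => h _ _ _; apply: h. Qed.
Lemma eta_scale (c : k) (n : adele D) : nil_adele n ->
  eta (fun p => loc D p (ff_const X c) * n p) = c * eta n.
Proof. by case: eta_form => _ h _ _; apply: h. Qed.
Lemma eta_global (x : se_F C) : red x = 0 -> eta (fun p => jj p x) = 0.
Proof. by case: eta_form => _ _ h _; apply: h. Qed.
Lemma eta0 : eta (fun p => 0) = 0.
Proof.
have := eta_global (rmorph0 (se_red C)).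
by have -> : (fun p => jj p 0) = (fun p => 0 : cp_F D p)
  by apply: functional_extensionality_dep => p; rewrite rmorph0.
Qed.
Lemma regE p (b : cp_F D p) : reg eta b <->
  forall m : cp_F D p, nl m -> Oh m -> eta (single (b * m)) = 0.
Proof.
split=> [h m nm Om|h n hn [m [nm Om e]]].
  apply: h => [q /eqP qp|]; first by rewrite single_out // eq_sym.
  by exists m; rewrite single_in.
by rewrite (singleP hn e); apply: h.
Qed.

Lemma reg_nl p (b : cp_F D p) : nl b -> reg eta b.
Proof.
move=> nb; apply/regE => m nm _; rewrite nlM0 // -eta0; congr eta.
by apply/esym/singleP.
Qed.

Lemma regD p (b c : cp_F D p) : reg eta b -> reg eta c -> reg eta (b + c).
Proof.
move=> /regE hb /regE hc; apply/regE => m nm Om.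
have nbm := nil_adele_single (nl_mull b nm); have ncm := nil_adele_single (nl_mull c nm).
rewrite -[RHS](addr0 0) -{1}(hb m nm Om) -(hc m nm Om) -eta_add //.
congr eta; apply/esym/singleP; last by rewrite !single_in mulrDl.
by move=> q /eqP qp; rewrite !single_out 1?eq_sym // addr0.
Qed.

Lemma regM p (a b : cp_F D p) : Obar a -> reg eta b -> reg eta (a * b).
Proof.
move=> Oa /regE hb; apply/regE => m nm Om; rewrite -mulrA mulrCA; apply: hb.
  exact: nl_mull.
exact: Obar_mul_nl.
Qed.

Lemma reg_cong p (b c : cp_F D p) : nl (b - c) -> reg eta c -> reg eta b.
Proof. by move=> n rc; rewrite -(subrK c b); apply: regD => //; apply: reg_nl. Qed.

Definition reg_int p (x : cp_F D p) :=
  exists b m : cp_F D p, [/\ reg eta b, nl m, Oh m & x = b * m].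

Lemma reg_int0 p : reg_int (0 : cp_F D p).
Proof. by exists 0, 0; split; rewrite ?mulr0 //; [apply: reg_nl; apply: nl0|apply: nl0|apply: Oh0]. Qed.

Lemma eta_fin (S : seq (place X)) (n : adele D) : nil_adele n ->
  (forall p, p \notin S -> n p = 0) -> (forall p, reg_int (n p)) -> eta n = 0.
Proof.
elim: S n => [|q S IH] n hn nS hr.
  by rewrite -eta0; congr eta; apply: functional_extensionality_dep => p; apply: nS.
have [ia nn] := proj1 (nil_adeleP n) hn.
pose n' : adele D := fun p => n p - single (n q) p.
have e : n = (fun p => n' p + single (n q) p).
  by apply: functional_extensionality_dep => p; rewrite /n' subrK.
have hs := nil_adele_single (nn q).
have hn' : nil_adele n' by apply: nil_adeleD => //; apply: nil_adeleN.
have n'p p : n' p = 0 \/ n' p = n p.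
  rewrite /n'; have [<-|qp] := eqVneq q p; first by left; rewrite single_in subrr.
  by right; rewrite single_out // subr0.
rewrite e eta_add // IH ?add0r //.
- have [b [m [rb nm Om ->]]] := hr q; exact: (proj1 (regE b) rb).
- move=> p pS; rewrite /n'; have [<-|qp] := eqVneq q p; first by rewrite single_in subrr.
  by rewrite single_out // subr0 nS // inE negb_or eq_sym qp.
- by move=> p; case: (n'p p) => ->; [apply: reg_int0|apply: hr].
Qed.

(** [twisted_form] gives vanishing on one open lattice. Away from finitely many places n lies in
    that lattice; at the remaining ones the hypothesis on n is used one place at a time. *)
Lemma eta_local (n : adele D) : nil_adele n -> (forall p, reg_int (n p)) -> eta n = 0.
Proof.
move=> hn hr; have [ia nn] := proj1 (nil_adeleP n) hn.
have [_ _ _ [z [[uz fz] hz]]] := eta_form.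
pose B := [set p | ~ cp_O (n p)] `|` [set p | ~ (cp_O (z p) /\ cp_O (z p)^-1)].
have fB : finite_set B by rewrite finite_setU.
have [S SB] := proj1 (finite_seqP _) fB.
pose n1 : adele D := fun p => if p \in S then n p else 0.
pose n2 : adele D := fun p => if p \in S then 0 else n p.
have e : n = (fun p => n1 p + n2 p).
  by apply: functional_extensionality_dep => p; rewrite /n1 /n2; case: ifP; rewrite ?addr0 ?add0r.
have sub (n' : adele D) : (forall p, n' p = 0 \/ n' p = n p) -> nil_adele n'.
  move=> h; apply/nil_adeleP; split=> [|p]; last by case: (h p) => ->; [apply: nl0|].
  by apply: sub_finite_set ia => p /= h' On; apply: h'; case: (h p) => ->; [apply: Oh0|].
have h1 : nil_adele n1 by apply: sub => p; rewrite /n1; case: ifP; [right|left].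
have h2 : nil_adele n2 by apply: sub => p; rewrite /n2; case: ifP; [left|right].
rewrite e eta_add //.
have -> : eta n1 = 0.
  apply: (@eta_fin S) => // p; first by rewrite /n1 => /negPf ->.
  by rewrite /n1; case: ifP => _; [apply: hr|apply: reg_int0].
rewrite add0r.
have zO p : p \notin S -> [/\ cp_O (n p), cp_O (z p) & cp_O (z p)^-1].
  move=> pS; have : ~ B p by rewrite SB /=; apply/negP.
  by rewrite /B => /not_orP [/contrapT a /contrapT [b c]].
pose w : adele D := fun p => (z p)^-1 * n2 p.
have Ow p : cp_O (w p).
  rewrite /w /n2; case: ifPn => [_|/zO [a b c]]; first by rewrite mulr0; apply: Oh0.
  exact: OhM.
have hw : nil_adele w.
  apply/nil_adeleP; split=> [|p]; first exact: adele_int.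
  by apply: nl_mull; case/nil_adeleP: h2.
rewrite -(hz w hw Ow); congr eta; apply: functional_extensionality_dep => p.
by rewrite /w mulVKr // uz.
Qed.

Lemma reg_pidele : exists d : place X -> X, pidele d /\ forall p, reg eta (loc D p (d p)).
Proof.
have [_ _ _ [z [iz hz]]] := eta_form.
have [d [hd h]] := idele_form iz; exists d; split=> // p.
have [u [[uu Ou Oui] e]] := h p.
have h1 : nl (loc D p (d p) - u^-1 * z p).
  have e1 : loc D p (d p) = loc D p (d p) * u / u by rewrite mulrK.
  rewrite [u^-1 * _]mulrC e1; exact: (@nlc_mul _ _ _ _ p (loc D p (d p) * u) u^-1 (z p) u^-1 (nlc_sym e) (nlc_refl _)).
apply: reg_cong h1 _; apply: regM; first exact: Obar_Oh.
apply/regE => m nm Om; have hw := nil_adele_single nm.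
have Ow q : cp_O (single m q).
  by have [<-|pq] := eqVneq p q; rewrite ?single_in // single_out //; apply: Oh0.
rewrite -(hz _ hw Ow); congr eta; apply/esym/singleP; last by rewrite single_in.
by move=> q /eqP qp; rewrite single_out 1?eq_sym // mulr0.
Qed.

Hypothesis eta_nz : nonzero_form eta.

(** If d had large degree, strong approximation would write every nilpotent adele as a global one
    plus one in d times the integral nilpotents. A form regular along d vanishes on both, but eta is
    not zero. *)
Lemma reg_bound : exists N : rat, forall d : place X -> X, pidele d ->
  (forall p, reg eta (loc D p (d p))) -> idn d < N.
Proof.
have [N hN] := strong_approximation DD FF.
have [nu [rnu nu0 gen]] := se_line C.
have /choice [W hW] : forall p, exists x, nilgen C p = x * nu.
  by move=> p; apply: gen; case: (nilgenP C p).
(* This compares the local generators of the nilradical with one rational generator nu: it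
   represents the divisor of L, by which degrees shift. *)
pose om p := red (W p).
have killed x y : x * nu = y * nu -> red x = red y.
  move=> /eqP; rewrite -subr_eq0 -mulrBl => /eqP e; apply/eqP; rewrite -subr_eq0 -rmorphB.
  apply: contraT => /F_unit u; case/negP: nu0; apply/eqP.
  by rewrite -(mulKr u nu) e mulr0.
have om0 p : om p != 0.
  apply/eqP => e; have [_ n0 _ _] := nilgenP C p; case/negP: n0.
  by rewrite hW se_sq0.
have hom : pidele om.
  split=> //.
  apply: (@sub_finite_set _ _ [set p | ~ (O p nu /\ forall n, O p n -> red n = 0 ->
    exists2 x, O p x & n = x * nu)]); last exact: se_almost_gen.
  move=> p /= nu' [Onu g]; apply: nu'.
  have [rn n0 On gn] := nilgenP C p.
  have [x Ox ex] := g _ On rn; have [y Oy ey] := gn _ Onu rnu.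
  have ex' : om p = red x by apply: killed; rewrite -hW -ex.
  have ey' : red y * om p = 1.
    by rewrite -rmorphM -(rmorph1 (se_red C)); apply: killed; rewrite mul1r -mulrA -hW -ey.
  split=> //; first by rewrite ex'; apply: V_red.
  by rewrite -[(om p)^-1]mul1r -ey' mulfK //; apply: V_red.
exists (N / idn om) => d hd rd; rewrite ltNge ler_pdivrMr ?idn_gt0 // -idnM //.
apply/negP => /(hN _ (pideleM hd hom)) H.
have [n hn] := eta_nz; apply.
have [ia nn] := proj1 (nil_adeleP n) hn.
have /choice [b /(_ _) hb] : forall p, exists b, exists m, [/\ nl m, Oh m,
    n p = jj p (Defs.lift C b * nilgen C p) + loc D p (d p) * m & Oh (n p) -> V p b].
  by move=> p; apply: nil_density; [apply: hd.1|apply: nn].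
have fy : finite_set [set p | ~ V p (b p * om p)].
  apply: (@sub_finite_set _ _ ([set p | ~ cp_O (n p)] `|` [set p | ~ vunit p (om p)])).
    move=> p /= h; apply: contrapT => /not_orP [/contrapT On /contrapT [_ Vo _]]; apply: h.
    by have [m [_ _ _ /(_ On) Vb]] := hb p; apply: VM.
  by rewrite finite_setU; split=> //; apply: hom.2.
have [x0 hx] := H (fun p => b p * om p) fy.
pose n0 : adele D := fun p => jj p (Defs.lift C x0 * nu).
have rn0 : red (Defs.lift C x0 * nu) = 0 by rewrite rmorphM rnu mulr0.
have hn0 : nil_adele n0 by apply: nil_adele_map.
have -> : n = (fun p => (n p - n0 p) + n0 p) by apply: functional_extensionality_dep => p; rewrite subrK.
have hd0 : nil_adele (fun p => n p - n0 p) by apply: nil_adeleD => //; apply: nil_adeleN.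
rewrite eta_add // [eta n0]eta_global // addr0; apply: eta_local => // p.
have [m [nm Om e _]] := hb p.
have [o Oo ro] := O_lift C (hx p).
exists (loc D p (d p)), (jj p (o * nilgen C p) + m); split.
- exact: rd.
- apply: nlD => //; apply: nl_map; rewrite rmorphM; case: (nilgenP C p) => -> _ _ _.
  by rewrite mulr0.
- apply: OhD => //; apply: Oh_map; apply: OM => //; by case: (nilgenP C p).
rewrite e mulrDr addrAC; congr (_ + _).
rewrite /n0 /loc -rmorphB -rmorphM; congr (jj p _).
rewrite hW !mulrA -mulrBl; apply/eqP; rewrite -subr_eq0 -mulrBl; apply/eqP/se_sq0 => //.
rewrite !(rmorphB, rmorphM) !red_lift ro -/(om p).
have d0 := hd.1 p; have o0 := om0 p; by field; rewrite ?d0 ?o0.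
Qed.

(** At each place the order of the pole that may still be added to d is bounded by [reg_bound], so a
    largest one exists; the same bound shows that it is 0 at almost all places. *)
Lemma reg_divisor : exists r : place X -> X, pidele r /\
  forall p (x : cp_F D p), reg eta x <-> Obar (x / loc D p (r p)).
Proof.
have [d [hd rd]] := reg_pidele; have [N hN] := reg_bound.
have id0 := idn_gt0 DD hd.
have u0 p : unif p != 0 :> X := unif_neq0 DD p.
(* A residue field has at least two elements, so n0 further poles push [idn d] beyond the bound,
   whether at one place or at n0 different ones. *)
have bnd : exists n0 : nat, N <= 2 ^+ n0 * idn d.
  apply: contrapT => H; suff : (2 : rat) <= 1 by [].
  apply: (@bounded_powers _ (N / idn d)) => // m; rewrite ler_pdivlMr // leNgt.
  by apply/negP => h; apply: H; exists m; apply: ltW.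
have [n0 hn0] := bnd.
pose Q p n := `[< reg eta (loc D p (d p * unif p ^ (- n%:Z))) >].
have Qb p n : Q p n -> (n <= n0)%N.
  move=> /asboolP h; rewrite leqNgt; apply/negP => lt.
  have hb := pidele_bump DD p n hd.
  have := hN _ hb _; rewrite idn_bump // ltNge => /(_ _)/negP; apply.
    by move=> q; rewrite /pbump; case: (q =P p) => [->|_]; [apply: h|apply: rd].
  apply: le_trans hn0 _; rewrite ler_wpM2r ?(ltW id0) //.
  have N2 : (2 : rat) <= (Nrm p)%:R by rewrite (ler_nat _ 2); apply: Nrm_gt1.
  apply: le_trans (_ : 2 ^+ n <= _); first by rewrite ler_weXn2l ?ler1n // ltnW.
  by rewrite lerXn2r // nnegrE ler0n.
have Q0 p : exists n, Q p n.
  by exists 0%N; apply/asboolP; rewrite oppr0 expr0z mulr1; apply: rd.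
pose nm p := ex_maxn (Q0 p) (@Qb p).
pose r p := d p * unif p ^ (- (nm p)%:Z).
have r0 p : r p != 0 by rewrite mulf_neq0 ?(hd.1) ?(unifz_neq0 DD).
have rr p : reg eta (loc D p (r p)).
  by rewrite /r /nm; case: ex_maxnP => m /asboolP.
have rmax p : ~ reg eta (loc D p (r p / unif p)).
  rewrite /r /nm; case: ex_maxnP => m _ mx h.
  have : Q p m.+1.
    apply/asboolP; have -> : - m.+1%:Z = - m%:Z + (- 1) by lia.
    by rewrite expfzDr // mulrA exprN1.
  by move/mx; rewrite ltnn.
have rP p b : reg eta (loc D p b) <-> V p (b / r p).
  split=> [h|h]; last first.
    have -> : b = b / r p * r p by rewrite divfK.
    apply: reg_cong (locM _ _ _ _) _; apply: regM; [exact: Oh_loc|exact: rr].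
  apply: contrapT => /(notV_inv DD) [q0 v]; apply: (rmax p).
  have b0 : b != 0 by move: q0; rewrite mulf_eq0 negb_or => /andP [].
  have -> : r p / unif p = (b / r p)^-1 / unif p * b by have up := u0 p; have rp := r0 p; field; rewrite ?b0 ?rp ?up.
  apply: reg_cong (locM _ _ _ _) _; apply: regM => //; apply: Oh_loc.
  by move: v; rewrite /vge -exprN1.
have hr : pidele r.
  split=> //; have d1 : forall p, p \in [set p | reg eta (loc D p (d p / unif p))] \/ nm p = 0%N.
    move=> p; rewrite /nm; case: ex_maxnP => -[|m] /asboolP h _; [by right|left].
    apply/mem_set => /=.
    have -> : d p / unif p = (unif p ^+ m) * (d p * unif p ^ (- m.+1%:Z)).
      have -> : - m.+1%:Z = (- 1) + - m%:Z by lia.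
      rewrite expfzDr // exprN1 mulrCA -invr_expz -exprnP; congr (_ * _).
      by rewrite mulrCA mulfV ?mulr1 // expf_neq0.
    apply: reg_cong (locM _ _ _ _) _; apply: regM => //; apply: Oh_loc.
    by apply: VX; case: (unifP DD p).
  apply: (@sub_finite_set _ _ ([set p | ~ vunit p (d p)] `|`
           [set p | reg eta (loc D p (d p / unif p))])).
    move=> p /= h; apply: contrapT => /not_orP [/contrapT u nr]; apply: h.
    by case: (d1 p) => [/set_mem //|e]; rewrite /r e oppr0 expr0z mulr1.
  rewrite finite_setU; split; first exact: hd.2.
  apply: contrapT => /infinite_set_fset -/(_ n0) [B BS cB].
  pose e p := if p \in B then (unif p)^-1 else 1.
  have he : pidele e.
    apply: (@fset_pidele _ _ _ B) => p; rewrite /e; case: ifP; rewrite ?invr_eq0 ?oner_eq0 //.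
    by move=> _ _; apply: vunit1.
  have := hN _ (pideleM hd he) _; rewrite idnM // ltNge => /(_ _)/negP; apply.
    by move=> p; rewrite /e; case: ifP => [pB|_]; rewrite ?mulr1; [apply: (BS p)|apply: rd].
  apply: le_trans hn0 _; rewrite mulrC ler_wpM2l ?(ltW id0) //.
  rewrite (@idnE _ _ DD B); last by move=> p /negPf pB; rewrite /e pB; apply: vunit1.
  apply: le_trans (_ : 2 ^+ #|` B| <= _); first by rewrite ler_weXn2l ?ler1n.
  have -> : 2 ^+ #|` B| = \prod_(p <- B) (2 : rat).
    by rewrite big_const_seq count_predT iter_mulr_1.
  rewrite big_seq [leRHS]big_seq; apply: ler_prod => p pB.
  rewrite ler0n /= /e pB (vlV DD) opprK -[unif p]expr1z (vl_unifz DD) expr1z.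
  by rewrite (ler_nat _ 2); apply: Nrm_gt1.
exists r; split=> // p x; have ur := loc_unit D p (r0 p).
split=> [h|h]; last first.
  by rewrite -(divrK ur x); apply: regM.
have [b hb] := density x (r0 p).
have h2 : reg eta (loc D p b).
  have -> : loc D p b = x - (x - loc D p b) / loc D p (r p) * loc D p (r p) by rewrite divrK // opprB addrCA subrr addr0.
  apply: regD => //; rewrite -mulNr; apply: regM; [exact: ObarN|exact: rr].
have /(Oh_loc D) := proj1 (rP p b) h2 => h3.
rewrite -(subrK (loc D p b) x) mulrDl; apply: ObarD => //.
apply: Obar_cong h3; apply: nlc_sym; apply: nlc_trans (locM _ _ _ _) _.
exact: nlc_mul (nlc_refl _) (locV _ _ (r0 p)).
Qed.

End Form.
End Eta.

(** * Adelic matrices *)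

Section Matrix2.
Variable R : comUnitRingType.
Implicit Types M N : 'M[R]_2.

Lemma ord2P (P : 'I_2 -> Prop) : P 0 -> P 1 -> forall i, P i.
Proof.
move=> h0 h1 [[|[|//]] h]; first by rewrite (_ : Ordinal h = 0) //; apply: val_inj.
by rewrite (_ : Ordinal h = 1) //; apply: val_inj.
Qed.

Lemma sum2E (f : 'I_2 -> R) : \sum_i f i = f 0 + f 1.
Proof. by rewrite !big_ord_recl big_ord0 addr0; congr (_ + f _); apply: val_inj. Qed.

Lemma mx2P M N : M 0 0 = N 0 0 -> M 0 1 = N 0 1 -> M 1 0 = N 1 0 -> M 1 1 = N 1 1 -> M = N.
Proof. by move=> *; apply/matrixP; apply: ord2P; apply: ord2P. Qed.

Lemma mul2E M N i j : (M *m N) i j = M i 0 * N 0 j + M i 1 * N 1 j.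
Proof. by rewrite mxE sum2E. Qed.

Lemma det2 M : \det M = M 0 0 * M 1 1 - M 0 1 * M 1 0.
Proof.
rewrite (expand_det_row _ 0) sum2E /cofactor !det_mx11 !mxE /=.
rewrite (_ : lift 0 0 = 1); last exact: val_inj.
rewrite (_ : lift 1 0 = 0); last exact: val_inj.
by rewrite addn0 expr0 mul1r addn1 expr1 mulN1r mulrN.
Qed.

Lemma tr2 M : \tr M = M 0 0 + M 1 1.
Proof. by rewrite /mxtrace sum2E. Qed.

Definition adj2 M : 'M[R]_2 :=
  \matrix_(i, j) if i == j then (if i == 0 then M 1 1 else M 0 0) else - M i j.

Lemma mul_adj2 M : M *m adj2 M = (\det M)%:M.
Proof.
by apply: mx2P; rewrite mul2E !mxE /= det2 ?mulr1n ?mulr0n; ring.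
Qed.

Lemma invmx2 M : M \in unitmx -> invmx M = (\det M)^-1 *: adj2 M.
Proof.
move=> uM; have uD : \det M \is a GRing.unit by rewrite -unitmxE.
by rewrite -[RHS](mulKmx uM) -scalemxAr mul_adj2 scale_scalar_mx mulVr // mulmx1.
Qed.

Lemma invmxM n (A B : 'M[R]_n) : A \in unitmx -> B \in unitmx ->
  invmx (A *m B) = invmx B *m invmx A.
Proof.
move=> uA uB; have uAB : A *m B \in unitmx by rewrite unitmx_mul uA.
have e : (A *m B) *m (invmx B *m invmx A) = 1%:M by rewrite mulmxA mulmxK // mulmxV.
by rewrite -[RHS](mulKmx uAB) e mulmx1.
Qed.

Lemma invmxZ' n (z : R) (M : 'M[R]_n) : z \is a GRing.unit -> M \in unitmx ->
  invmx (z *: M) = z^-1 *: invmx M.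
Proof.
move=> uz uM; have uzM : z *: M \in unitmx by rewrite unitmxZ.
have e : (z *: M) *m (z^-1 *: invmx M) = 1%:M.
  by rewrite -scalemxAl -scalemxAr scalerA mulrV // scale1r mulmxV.
by rewrite -[RHS](mulKmx uzM) e mulmx1.
Qed.

End Matrix2.

Section Matrices.
Variables (k : finFieldType) (X : function_field k) (C : special_extension X).
Variable D : completion C.
Implicit Types (p q : place X) (b c d : X).
Local Notation red := (se_red C).
Local Notation Oh := (@cp_O _ _ _ D _).
Local Notation jj := (cp_map D).
Local Notation nl := nilpotent_elt.

Definition aev (P : place X -> Prop) := finite_set [set p | ~ P p].
Lemma aev_and P Q : aev P -> aev Q -> aev (fun p => P p /\ Q p).
Proof.
move=> a b; apply: (@sub_finite_set _ _ ([set p | ~ P p] `|` [set p | ~ Q p])).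
  by move=> p /= h; apply: contrapT => /not_orP [/contrapT x /contrapT y]; apply: h.
by rewrite finite_setU.
Qed.
Lemma aev_imp P Q : (forall p, P p -> Q p) -> aev P -> aev Q.
Proof. by move=> h; apply: sub_finite_set => p /= nQ /h. Qed.
Lemma aev_all P : (forall p, P p) -> aev P.
Proof. by move=> h; apply: (@sub_finite_set _ _ set0) => // p /= /(_ (h p)). Qed.

(** Integrality of 1/x is known only modulo nilpotents; as x differs from a unit u by an integral
    nilpotent m, its inverse is u^-1 (1 - m u^-1). *)
Lemma Oh_inv p (x : cp_F D p) : Oh x -> x \is a GRing.unit -> Obar x^-1 -> Ohu x.
Proof.
move=> Ox ux Oxi; split=> //.
have [u [[uu Ou Oui] n]] := Obar_unit_loc (Obar_Oh Ox) ux Oxi.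
set m := x - u in n; have Om : Oh m by apply: OhB.
have e : x * (u^-1 * (1 - m * u^-1)) = 1.
  have -> : x = u + m by rewrite /m addrC subrK.
  rewrite mulrA mulrDl mulrV //; apply: unit_1n.
  by rewrite mulrACA (nlM0 n n) mul0r.
have -> : x^-1 = u^-1 * (1 - m * u^-1) by apply: (mulrI ux); rewrite e mulrV.
by apply: OhM => //; apply: OhB; [apply: Oh1|apply: OhM].
Qed.

Section AtP.
Variable p : place X.
Implicit Types (M N e u : 'M[cp_F D p]_2).

Definition nlm M := forall i j, nl (M i j).

Lemma nlmD M N : nlm M -> nlm N -> nlm (M + N).
Proof. by move=> a b i j; rewrite mxE; apply: nlD. Qed.
Lemma nlmN M : nlm M -> nlm (- M).
Proof. by move=> a i j; rewrite mxE; apply: nlN. Qed.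
Lemma nlmB M N : nlm M -> nlm N -> nlm (M - N).
Proof. by move=> a b; apply: nlmD => //; apply: nlmN. Qed.
Lemma nlm0 : nlm 0. Proof. by move=> i j; rewrite mxE; apply: nl0. Qed.
Lemma nlmZ (x : cp_F D p) M : nlm M -> nlm (x *: M).
Proof. by move=> a i j; rewrite mxE; apply: nl_mull. Qed.
Lemma nlm_mull M N : nlm N -> nlm (M *m N).
Proof. by move=> a i j; rewrite mxE; apply: nl_sum => l _; apply: nl_mull. Qed.
Lemma nlm_mulr M N : nlm M -> nlm (M *m N).
Proof. by move=> a i j; rewrite mxE; apply: nl_sum => l _; apply: nl_mulr. Qed.
Lemma nlm_mul0 M N : nlm M -> nlm N -> M *m N = 0.
Proof. by move=> a b; apply/matrixP => i j; rewrite !mxE big1 // => l _; apply: nlM0. Qed.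
Lemma nlm_sym M N : nlm (M - N) -> nlm (N - M).
Proof. by move=> h; rewrite -opprB; apply: nlmN. Qed.
Lemma nlm_trans N M M' : nlm (M - N) -> nlm (N - M') -> nlm (M - M').
Proof. by move=> a b; rewrite -(subrK N M) -addrA; apply: nlmD. Qed.
Lemma nlm_refl M : nlm (M - M). Proof. by rewrite subrr; apply: nlm0. Qed.
Lemma nlm_congM M N M' N' : nlm (M - M') -> nlm (N - N') -> nlm (M *m N - M' *m N').
Proof.
move=> a b; have -> : M *m N - M' *m N' = (M - M') *m N + M' *m (N - N').
  by rewrite mulmxBl mulmxBr addrA subrK.
by apply: nlmD; [apply: nlm_mulr|apply: nlm_mull].
Qed.
Lemma nlm_cong0 M M' N : nlm (M - M') -> nlm N -> M *m N = M' *m N.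
Proof. by move=> a b; apply/eqP; rewrite -subr_eq0 -mulmxBl nlm_mul0. Qed.
Lemma nl_det M N : nlm (M - N) -> nl (\det M - \det N).
Proof.
move=> h; have h' i j : nl (M i j - N i j) by have := h i j; rewrite !mxE.
rewrite !det2; apply: nlc_add; first exact: nlc_mul.
by apply: nlc_opp; apply: nlc_mul.
Qed.

Lemma unit_nlm M N : M \in unitmx -> nlm (N - M) -> N \in unitmx.
Proof. by rewrite !unitmxE => uM h; apply: unit_nl uM _; apply: nl_det. Qed.

Lemma mul_1nlm e : nlm e -> (1%:M + e) *m (1%:M - e) = 1%:M.
Proof. by move=> h; rewrite mulmxDl mul1mx mulmxBr mulmx1 nlm_mul0 // subr0 subrK. Qed.
Lemma unit_1nlm e : nlm e -> 1%:M + e \in unitmx.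
Proof. by move=> h; case: (mulmx1_unit (mul_1nlm h)). Qed.
Lemma inv_1nlm e : nlm e -> invmx (1%:M + e) = 1%:M - e.
Proof. by move=> h; rewrite -[RHS](mulKmx (unit_1nlm h)) mul_1nlm // mulmx1. Qed.

Lemma nlm_inv M N : M \in unitmx -> nlm (M - N) -> nlm (invmx M - invmx N).
Proof.
move=> uM h; have uN := unit_nlm uM (nlm_sym h).
have -> : invmx M - invmx N = invmx M *m (N - M) *m invmx N.
  by rewrite mulmxBr mulVmx // mulmxBl mul1mx mulmxK // -[in RHS]opprB opprB.
by apply: nlm_mulr; apply: nlm_mull; apply: nlm_sym.
Qed.

Lemma intM M N : intmx M -> intmx N -> intmx (M *m N).
Proof. by move=> a b i j; rewrite mxE; apply: Oh_sum => l _; apply: OhM. Qed.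
Lemma intD M N : intmx M -> intmx N -> intmx (M + N).
Proof. by move=> a b i j; rewrite mxE; apply: OhD. Qed.
Lemma intN M : intmx M -> intmx (- M).
Proof. by move=> a i j; rewrite mxE; apply: OhN. Qed.
Lemma intB M N : intmx M -> intmx N -> intmx (M - N).
Proof. by move=> a b; apply: intD => //; apply: intN. Qed.
Lemma int1 : intmx (1%:M : 'M[cp_F D p]_2).
Proof. by move=> i j; rewrite mxE; case: eqP => _; [apply: Oh1|apply: Oh0]. Qed.
Lemma intZ (x : cp_F D p) M : Oh x -> intmx M -> intmx (x *: M).
Proof. by move=> a b i j; rewrite mxE; apply: OhM. Qed.
Lemma int_adj2 M : intmx M -> intmx (adj2 M).
Proof. by move=> h i j; rewrite mxE; do 2?case: ifP => _ //; apply: OhN. Qed.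

Definition iu u := [/\ u \in unitmx, intmx u & intmx (invmx u)].

Lemma iuM M N : iu M -> iu N -> iu (M *m N).
Proof.
move=> [a b c] [d e f]; have uMN : M *m N \in unitmx by rewrite unitmx_mul a.
split=> //; first exact: intM.
rewrite invmxM //; exact: intM.
Qed.
Lemma iuV M : iu M -> iu (invmx M).
Proof. by move=> [a b c]; split; rewrite ?invmxK ?unitmx_inv. Qed.
Lemma iu1 : iu 1%:M.
Proof. by split; rewrite ?unitmx1 ?invmx1; try exact: int1. Qed.

Lemma iu_det M : intmx M -> Ohu (\det M) -> iu M.
Proof.
move=> h [uD Od Odi]; have uM : M \in unitmx by rewrite unitmxE.
by split=> //; rewrite invmx2 //; apply: intZ => //; apply: int_adj2.
Qed.

Lemma iu_1nlm e : nlm e -> intmx e -> iu (1%:M + e).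
Proof.
move=> ne ie; split; first exact: unit_1nlm.
  by apply: intD => //; apply: int1.
by rewrite inv_1nlm //; apply: intB => //; apply: int1.
Qed.

Definition Obmx M := forall i j, Obar (M i j).

Lemma ObmxM M N : Obmx M -> Obmx N -> Obmx (M *m N).
Proof. by move=> a b i j; rewrite mxE; apply: Obar_sum => l _; apply: ObarM. Qed.
Lemma Obmx_int M : intmx M -> Obmx M.
Proof. by move=> h i j; apply: Obar_Oh. Qed.
Lemma Obmx_cong M N : nlm (M - N) -> Obmx N -> Obmx M.
Proof. by move=> h ON i j; apply: Obar_cong (ON i j); have := h i j; rewrite !mxE. Qed.
Lemma Obar_det M : Obmx M -> Obar (\det M).
Proof. by move=> h; rewrite det2; apply: ObarB; apply: ObarM. Qed.

(** Nilpotent changes make the entries integral, and [Oh_inv] then shows that the determinant is a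
    unit of the integral ring. *)
Lemma Obmx_unit M : Obmx M -> M \in unitmx -> Obar (\det M)^-1 -> exists2 u, iu u & nlm (M - u).
Proof.
move=> OM uM Odi.
have ex i : exists f : 'I_2 -> cp_F D p, forall j, Oh (f j) /\ nl (M i j - f j).
  have h j : exists y, Oh y /\ nl (M i j - y) by have [y Oy n] := OM i j; exists y.
  by have [f hf] := choice h; exists f.
have [f hf] := choice ex; pose u : 'M[cp_F D p]_2 := \matrix_(i, j) f i j.
have nu : nlm (M - u) by move=> i j; rewrite !mxE; case: (hf i j).
have iu' : intmx u by move=> i j; rewrite mxE; case: (hf i j).
exists u => //; apply: iu_det => //.
have uD : \det M \is a GRing.unit by rewrite -unitmxE.
have ud : \det u \is a GRing.unit by apply: unit_nl uD _; apply: nl_det; apply: nlm_sym.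
apply: Oh_inv => //; first by rewrite det2; apply: OhB; apply: OhM.
by apply: Obar_cong Odi; apply: nlc_sym; apply: nlc_inv => //; apply: nl_det.
Qed.

End AtP.

Implicit Types (g h u e : amat D).

Definition nil_mx e := forall i j, nil_adele (fun p => e p i j).

Lemma nil_mx_nlm e : nil_mx e -> forall p, nlm (e p).
Proof. by move=> h p i j; have /nil_adeleP [_] := h i j; apply. Qed.

Definition amx e := forall i j, is_adele (fun p => e p i j).

Lemma nil_mxP e : nil_mx e <-> amx e /\ forall p, nlm (e p).
Proof.
split=> [h|[a n] i j]; last by apply/nil_adeleP; split=> // p; apply: n.
by split; [move=> i j; have /nil_adeleP [] := h i j|apply: nil_mx_nlm].
Qed.

Lemma amx_aev e : amx e <-> aev (fun p => intmx (e p)).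
Proof.
split=> [h|h i j]; last by apply: sub_finite_set h => p /= n /(_ i j).
have h' i j : aev (fun p => Oh (e p i j)) by apply: h.
apply: aev_imp (aev_and (aev_and (h' 0 0) (h' 0 1)) (aev_and (h' 1 0) (h' 1 1))).
by move=> p [[a b] [c d]]; apply: ord2P; apply: ord2P.
Qed.

Lemma amxM e h : amx e -> amx h -> amx (fun p => e p *m h p).
Proof.
move=> /amx_aev a /amx_aev b; apply/amx_aev.
by apply: aev_imp (aev_and a b) => p [x y]; apply: intM.
Qed.
Lemma amxD e h : amx e -> amx h -> amx (fun p => e p + h p).
Proof.
move=> /amx_aev a /amx_aev b; apply/amx_aev.
by apply: aev_imp (aev_and a b) => p [x y]; apply: intD.
Qed.
Lemma amxN e : amx e -> amx (fun p => - e p).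
Proof. by move=> /amx_aev a; apply/amx_aev; apply: aev_imp a => p; apply: intN. Qed.
Lemma amx1 : amx (fun p => 1%:M).
Proof. by apply/amx_aev/aev_all => p; apply: int1. Qed.
Lemma amxZ (z : adele D) e : is_adele z -> amx e -> amx (fun p => z p *: e p).
Proof. by move=> a b i j; move: (adeleM a (b i j)); congr is_adele; apply: functional_extensionality_dep => p; rewrite mxE. Qed.
Lemma amx_map (c : 'M[se_F C]_2) : amx (adiag D c).
Proof. by move=> i j; move: (adele_map D (c i j)); congr is_adele; apply: functional_extensionality_dep => p; rewrite mxE. Qed.

Lemma nil_mxM_l e h : amx e -> nil_mx h -> nil_mx (fun p => e p *m h p).
Proof.
move=> a /nil_mxP [b c]; apply/nil_mxP; split; first exact: amxM.
by move=> p; apply: nlm_mull.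
Qed.
Lemma nil_mxM_r e h : nil_mx e -> amx h -> nil_mx (fun p => e p *m h p).
Proof.
move=> /nil_mxP [b c] a; apply/nil_mxP; split; first exact: amxM.
by move=> p; apply: nlm_mulr.
Qed.
Lemma nil_mxD e h : nil_mx e -> nil_mx h -> nil_mx (fun p => e p + h p).
Proof.
move=> /nil_mxP [a b] /nil_mxP [c d]; apply/nil_mxP; split; first exact: amxD.
by move=> p; apply: nlmD.
Qed.
Lemma nil_mxN e : nil_mx e -> nil_mx (fun p => - e p).
Proof.
move=> /nil_mxP [a b]; apply/nil_mxP; split; first exact: amxN.
by move=> p; apply: nlmN.
Qed.

Lemma GL2A_amx g : GL2A g -> amx g /\ amx (fun p => invmx (g p)).
Proof. by move=> [_ h]; split; apply/amx_aev; apply: aev_imp h => p []. Qed.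
Lemma GL2AI g : (forall p, g p \in unitmx) -> amx g -> amx (fun p => invmx (g p)) -> GL2A g.
Proof. by move=> u /amx_aev a /amx_aev b; split=> //; apply: aev_and. Qed.


Lemma GL2AM g h : GL2A g -> GL2A h -> GL2A (fun p => g p *m h p).
Proof.
move=> Gg Gh; have [a b] := GL2A_amx Gg; have [c d] := GL2A_amx Gh.
have [ug _] := Gg; have [uh _] := Gh.
apply: GL2AI; first by move=> p; rewrite unitmx_mul ug uh.
  exact: amxM.
have -> : (fun p => invmx (g p *m h p)) = (fun p => invmx (h p) *m invmx (g p)).
  by apply: functional_extensionality_dep => p; rewrite invmxM.
exact: amxM.
Qed.
Lemma GL2AV g : GL2A g -> GL2A (fun p => invmx (g p)).
Proof.
move=> Gg; have [a b] := GL2A_amx Gg; have [ug _] := Gg; apply: GL2AI => //.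
  by move=> p; rewrite unitmx_inv.
by have -> : (fun p => invmx (invmx (g p))) = g by apply: functional_extensionality_dep => p; rewrite invmxK.
Qed.
Lemma GL2O_A u : GL2O u -> GL2A u.
Proof. by move=> h; apply: GL2AI => [p||]; [case: (h p)|apply/amx_aev/aev_all => p; case: (h p)..]. Qed.
Lemma idele_adele (z : adele D) : idele z -> is_adele z /\ is_adele (fun p => (z p)^-1).
Proof. by move=> [_ h]; split; apply: sub_finite_set h => p /= n []. Qed.
Lemma GL2AZ (z : adele D) g : idele z -> GL2A g -> GL2A (fun p => z p *: g p).
Proof.
move=> iz Gg; have [a b] := GL2A_amx Gg; have [ug _] := Gg; have [c d] := idele_adele iz.
have [uz _] := iz; apply: GL2AI; first by move=> p; rewrite (unitmxZ _ (uz p)).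
  exact: amxZ.
have -> : (fun p => invmx (z p *: g p)) = (fun p => (z p)^-1 *: invmx (g p)).
  by apply: functional_extensionality_dep => p; rewrite invmxZ'.
exact: (@amxZ (fun p => (z p)^-1) (fun p => invmx (g p))).
Qed.
Lemma jj_unitmx p (c : 'M[se_F C]_2) : c \in unitmx -> map_mx (jj p) c \in unitmx.
Proof. by rewrite !unitmxE det_map_mx => /(rmorph_unit (jj p)). Qed.
Lemma map_invmx2 p (c : 'M[se_F C]_2) : c \in unitmx -> map_mx (jj p) (invmx c) = invmx (map_mx (jj p) c).
Proof.
move=> uc; have e : map_mx (jj p) c *m map_mx (jj p) (invmx c) = 1%:M.
  by rewrite -map_mxM mulmxV // map_mx1.
by rewrite -[RHS]mulmx1 -e mulKmx // jj_unitmx.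
Qed.
Lemma GL2A_diag (c : 'M[se_F C]_2) : c \in unitmx -> GL2A (adiag D c).
Proof.
move=> uc; apply: GL2AI; first by move=> p; apply: jj_unitmx.
  exact: amx_map.
have -> : (fun p => invmx (adiag D c p)) = adiag D (invmx c).
  by apply: functional_extensionality_dep => p; rewrite /adiag map_invmx2.
exact: amx_map.
Qed.
Lemma GL2A_1nil e : nil_mx e -> GL2A (fun p => 1%:M + e p).
Proof.
move=> he; have /nil_mxP [a n] := he; apply: GL2AI; first by move=> p; apply: unit_1nlm.
  by apply: amxD => //; apply: amx1.
have -> : (fun p => invmx (1%:M + e p)) = (fun p => 1%:M + - e p).
  by apply: functional_extensionality_dep => p; rewrite inv_1nlm.
by apply: amxD; [apply: amx1|apply: amxN].
Qed.
Lemma ideleM (z w : adele D) : idele z -> idele w -> idele (fun p => z p * w p).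
Proof.
move=> [a b] [c d]; split; first by move=> p; rewrite unitrM a c.
apply: aev_imp (aev_and b d) => p [[x y] [x' y']]; split; first exact: OhM.
by rewrite (invrM (a p) (c p)); apply: OhM.
Qed.
Lemma ideleV (z : adele D) : idele z -> idele (fun p => (z p)^-1).
Proof.
move=> [a b]; split; first by move=> p; rewrite unitrV a.
by apply: aev_imp b => p [x y]; rewrite invrK.
Qed.
Lemma idele1 : idele (fun p => 1 : cp_F D p).
Proof. by split; [move=> p; rewrite unitr1|apply: aev_all => p; rewrite invr1; split; apply: Oh1]. Qed.
Lemma idele_1nil (n : adele D) : nil_adele n -> idele (fun p => 1 + n p).
Proof.
move=> /nil_adeleP [a h]; split=> [p|].
  by apply: unit_add_sq0; rewrite ?unitr1 // nlM0.
apply: aev_imp a => p On; split; first by apply: OhD => //; apply: Oh1.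
have e : (1 + n p) * (1 - n p) = 1 by apply: unit_1n; rewrite nlM0.
have u : 1 + n p \is a GRing.unit by apply/unitrPr; exists (1 - n p).
have -> : (1 + n p)^-1 = 1 - n p by apply: (mulrI u); rewrite e mulrV.
by apply: OhB => //; apply: Oh1.
Qed.
Lemma idele_global (x : se_F C) : red x != 0 -> idele (fun p => jj p x).
Proof.
move=> rx; split=> [p|]; first exact: map_unit.
apply: aev_imp (aev_and (adele_map D x) (adele_map D x^-1)) => p [a b]; split=> //.
by rewrite -rmorphV // F_unit.
Qed.

Lemma GL2OM u h : GL2O u -> GL2O h -> GL2O (fun p => u p *m h p).
Proof. by move=> a b p; apply: iuM; [apply: a|apply: b]. Qed.
Lemma GL2OV u : GL2O u -> GL2O (fun p => invmx (u p)).
Proof. by move=> a p; apply: iuV; apply: a. Qed.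
Lemma GL2O1 : GL2O (fun p => 1%:M : 'M[cp_F D p]_2).
Proof. by move=> p; apply: iu1. Qed.

End Matrices.

(** * The pairing with Higgs fields *)

(* [r] is a divisor of [eta]: [b eta] is regular at [p] iff [b / r p] is integral.  The last three
   fields say that alpha is a regular section with simple zeros and is not a square. *)
Record setup (k : finFieldType) (X : function_field k) (C : special_extension X)
    (D : completion C) (eta : adele D -> k) (a : X) (r : place X -> X) : Prop := Setup {
  su_char : (2%:R : k) != 0;
  su_form : twisted_form eta;
  su_r : pidele r;
  su_r1 : finite_set [set p | r p != 1];
  su_reg : forall p (x : cp_F D p), reg eta x <-> Obar (x / loc D p (r p));
  su_int : forall p, pl_ring p (a / r p ^+ 2);
  su_simple : forall p, ~ vge p 2 (a / r p ^+ 2);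
  su_nsq : forall c, a <> c ^+ 2 }.

(** * The divisor of the form and the properties of alpha *)

Section SetupExists.
Variables (k : finFieldType) (X : function_field k) (C : special_extension X).
Variable D : completion C.
Local Notation V := pl_ring.
Let DD : forall p : place X, discrete p := place_discrete D.

Lemma loc_div p (b c : X) : c != 0 -> nilpotent_elt (loc D p (b / c) - loc D p b / loc D p c).
Proof.
move=> c0; apply: nlc_trans (locM D p b c^-1) _; apply: nlc_mul; first exact: nlc_refl.
exact: locV.
Qed.

Lemma Obar_locdiv p (b c : X) : c != 0 -> Obar (loc D p b / loc D p c) <-> V p (b / c).
Proof.
move=> c0; rewrite -(Obar_loc D); split=> h; apply: Obar_cong h; first exact: loc_div.
by apply: nlc_sym; apply: loc_div.
Qed.

Lemma setup_exists (eta : adele D -> k) (a : X) : (2%:R : k) != 0 -> twisted_form eta ->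
  nonzero_form eta -> in_Aprime eta a -> only_simple_zeros eta a ->
  exists r, setup eta a r.
Proof.
move=> c2 ef en [a1 a2] a3; have [r0 [hr0 r0P]] := reg_divisor ef en.
(* Replacing units by 1 makes r equal to 1 at almost all places. Then its lifts form an idele,
   whereas arbitrary lifts of units are integral only modulo nilpotents. *)
pose r p := if `[< vunit p (r0 p) >] then 1 else r0 p.
have r0n : forall p, r0 p != 0 by case: hr0.
have rn p : r p != 0 by rewrite /r; case: asboolP => _ //; apply: oner_neq0.
have ru p : vunit p (r p / r0 p).
  rewrite /r; case: asboolP => [h|_]; first by rewrite mul1r; apply: vunitV.
  by rewrite divff //; apply: vunit1.
have fr : finite_set [set p | r p != 1].
  by case: hr0 => _; apply: sub_finite_set => p /= + h; rewrite /r asboolT // eqxx.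
have hr : pidele r.
  by split=> //; apply: sub_finite_set fr => p /= h; apply: contrapT => /negP; rewrite negbK => /eqP e; apply: h; rewrite e; apply: vunit1.
have rP p (x : cp_F D p) : reg eta x <-> Obar (x / loc D p (r p)).
  rewrite r0P; have u0 := loc_unit D p (r0n p); have u1 := loc_unit D p (rn p).
  have [_ v1 v2] := ru p; move: v2; rewrite invf_div => v2.
  have o1 : Obar (loc D p (r p) / loc D p (r0 p)) by apply/Obar_locdiv.
  have o2 : Obar (loc D p (r0 p) / loc D p (r p)) by apply/Obar_locdiv.
  split=> h; first by rewrite -[x in Obar (x / _)](divrK u0) -mulrA; apply: ObarM.
  by rewrite -[x in Obar (x / _)](divrK u1) -mulrA; apply: ObarM.
have reg_loc p b : reg eta (loc D p b) <-> V p (b / r p) by rewrite rP; apply: Obar_locdiv.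
exists r; split=> //.
- move=> p; have [b1 [b2 [/reg_loc h1 /reg_loc h2 ->]]] := a1 p.
  by rewrite expr2 -mulf_div; apply: VM.
- move=> p h; apply: (a3 p); pose c := a / unif p ^+ 2.
  have u0 := unif_neq0 DD p.
  have mu : max_ideal p (unif p) by split; [case: (unifP DD p)|right; case: (unifP DD p)].
  exists (unif p), (unif p), c; split=> //; last by rewrite -expr2 /c mulrC divfK // expf_neq0.
  exists (c / r p), (r p); split; last by rewrite divfK.
    apply/reg_loc; move: h; rewrite /vge; congr V; rewrite /c -exprnN.
    by field; rewrite u0 rn.
  by apply/reg_loc; rewrite divff //; apply: V1.
- move=> c ec; apply: a2; exists c; split=> // p; apply/reg_loc.
  have h : V p ((c / r p) ^+ 2).
    have [b1 [b2 [/reg_loc h1 /reg_loc h2 e]]] := a1 p.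
    by rewrite expr_div_n -ec e expr2 -mulf_div; apply: VM.
  have [->|c0] := eqVneq (c / r p) 0; first exact: V0.
  by move: h; rewrite !(V_vl DD) ?expf_neq0 // vlX //; lia.
Qed.

End SetupExists.

Section Pairing.
Variables (k : finFieldType) (X : function_field k) (C : special_extension X).
Variables (D : completion C) (eta : adele D -> k) (a : X) (r : place X -> X).
Hypothesis HS : setup eta a r.
Implicit Types (p q : place X) (g h u e : amat D) (Phi : 'M[X]_2) (c : 'M[se_F C]_2).
Local Notation V := pl_ring.
Local Notation red := (se_red C).
Local Notation Oh := (@cp_O _ _ _ D _).
Local Notation jj := (cp_map D).
Local Notation nl := nilpotent_elt.
Local Notation locm p Phi := (map_mx (loc D p) Phi).
Let ef := su_form HS.

Lemma r_neq0 p : r p != 0. Proof. by case: (su_r HS). Qed.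
Lemma locr_unit p : loc D p (r p) \is a GRing.unit. Proof. exact: loc_unit (r_neq0 p). Qed.
Lemma two_X : (2%:R : X) != 0.
Proof.
by rewrite -(rmorph_nat (ff_const X)) fmorph_eq0; apply: su_char HS.
Qed.
Lemma two_F : (2%:R : se_F C) \is a GRing.unit.
Proof. by apply: F_unit; rewrite rmorph_nat two_X. Qed.
Lemma two_Ohu p : Ohu (2%:R : cp_F D p).
Proof.
have V2 : V p (2%:R : X)^-1.
  rewrite -(rmorph_nat (ff_const X)) -fmorphV; exact: pl_const.
have O2 : se_O C p 2%:R by rewrite mulr2n; apply: OD; apply: O1.
rewrite -(rmorph_nat (jj p)); split; first exact: rmorph_unit two_F.
  exact: Oh_map.
rewrite -rmorphV ?two_F //; apply: Oh_map; apply: O_inv; rewrite ?rmorph_nat ?two_X //.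
Qed.

Lemma locmE p Phi : locm p Phi = map_mx (jj p) (map_mx (Defs.lift C) Phi).
Proof. by apply/matrixP => i j; rewrite !mxE. Qed.

Lemma redm_lift Phi : map_mx red (map_mx (Defs.lift C) Phi) = Phi.
Proof. by apply/matrixP => i j; rewrite !mxE red_lift. Qed.

Lemma locm_red p (M : 'M[se_F C]_2) : nlm (map_mx (jj p) M - locm p (map_mx red M)).
Proof. by move=> i j; rewrite !mxE; apply: loc_red. Qed.

Lemma locmM p Phi Psi : nlm (locm p (Phi *m Psi) - locm p Phi *m locm p Psi).
Proof.
rewrite [locm p Phi]locmE [locm p Psi]locmE -map_mxM; apply: nlm_sym.
by rewrite -[in X in _ - X](redm_lift Phi) -[in X in _ - X](redm_lift Psi) -map_mxM; apply: locm_red.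
Qed.

Lemma locmN p Phi : nlm (locm p (- Phi) - - locm p Phi).
Proof. by move=> i j; rewrite !mxE; apply: locN. Qed.

Local Notation pr := (higgs_pairing eta).

(** A nilpotent factor annihilates nilpotents, so any adelic matrix congruent to [Phi] may be used
    in the pairing. *)
Lemma pairE Phi (M e : amat D) : (forall p, nlm (M p - locm p Phi)) -> nil_mx e ->
  pr Phi e = eta (fun p => 4%:R * \tr (M p *m e p)).
Proof.
move=> h he; congr eta; apply: functional_extensionality_dep => p.
by rewrite (nlm_cong0 (h p) (nil_mx_nlm he p)).
Qed.

Lemma nil_tr e (M : amat D) : amx M -> nil_mx e -> nil_adele (fun p => 4%:R * \tr (M p *m e p)).
Proof.
move=> aM he; have h := nil_mxM_l aM he.
have := nil_adeleMl (adele_map D 4%:R) (nil_adeleD (h 0 0) (h 1 1)).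
by congr nil_adele; apply: functional_extensionality_dep => p; rewrite tr2 rmorph_nat.
Qed.

Lemma amx_locm Phi : amx (fun p => locm p Phi).
Proof.
have -> : (fun p => locm p Phi) = adiag D (map_mx (Defs.lift C) Phi).
  by apply: functional_extensionality_dep => p; apply: locmE.
exact: amx_map.
Qed.

Lemma pairD Phi e e' : nil_mx e -> nil_mx e' ->
  pr Phi (fun p => e p + e' p) = pr Phi e + pr Phi e'.
Proof.
move=> he he'; rewrite /higgs_pairing -(eta_add ef); try by apply: (nil_tr (amx_locm Phi)).
by congr eta; apply: functional_extensionality_dep => p; rewrite mulmxDr mxtraceD mulrDr.
Qed.

Lemma nil_mx0 : nil_mx (fun p => 0 : 'M[cp_F D p]_2).
Proof.
move=> i j; move: (nil_adele0 D); congr nil_adele.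
by apply: functional_extensionality_dep => p; rewrite mxE.
Qed.

Lemma pair0 Phi : pr Phi (fun p => 0) = 0.
Proof.
apply: (addrI (pr Phi (fun p => 0))); rewrite addr0 -(pairD _ nil_mx0 nil_mx0).
by congr (pr _ _); apply: functional_extensionality_dep => p; rewrite addr0.
Qed.

Lemma pairN Phi e : nil_mx e -> pr Phi (fun p => - e p) = - pr Phi e.
Proof.
move=> he; apply: (addrI (pr Phi e)); rewrite -(pairD _ he (nil_mxN he)) addrN.
by rewrite -[RHS](pair0 Phi); congr (pr _ _); apply: functional_extensionality_dep => p; rewrite addrN.
Qed.

Lemma pairNl Phi e : nil_mx e -> pr (- Phi) e = - pr Phi e.
Proof.
move=> he; rewrite -(pairN _ he) (@pairE (- Phi) (fun p => - locm p Phi)) //.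
  by congr eta; apply: functional_extensionality_dep => p; rewrite mulmxN mulNmx.
by move=> p; apply: nlm_sym; apply: locmN.
Qed.

Lemma nil_mx_conj (g h : amat D) e : amx g -> amx h -> nil_mx e -> nil_mx (fun p => g p *m e p *m h p).
Proof. by move=> ag ah he; apply: nil_mxM_r (ah); apply: nil_mxM_l. Qed.

Lemma amx_diagV c : c \in unitmx -> amx (fun p => invmx (map_mx (jj p) c)).
Proof. by move=> uc; case: (GL2A_amx (GL2A_diag D uc)). Qed.

Lemma pair_conj Phi Phi' (g : amat D) e : GL2A g ->
  (forall p, nlm (locm p Phi' - g p *m locm p Phi *m invmx (g p))) -> nil_mx e ->
  pr Phi' (fun p => g p *m e p *m invmx (g p)) = pr Phi e.
Proof.
move=> Gg h he; have [ag ai] := GL2A_amx Gg; have [ug _] := Gg.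
rewrite (@pairE Phi' (fun p => g p *m locm p Phi *m invmx (g p))).
- congr eta; apply: functional_extensionality_dep => p; congr (_ * _).
  by rewrite !mulmxA mulmxKV // -!mulmxA mxtrace_mulC !mulmxA mulmxKV.
- by move=> p; apply: nlm_sym.
- exact: nil_mx_conj.
Qed.

Lemma locm_conj_red p c Phi : c \in unitmx ->
  nlm (locm p (conj_red c Phi) - map_mx (jj p) c *m locm p Phi *m invmx (map_mx (jj p) c)).
Proof.
move=> uc; have ucr : map_mx red c \in unitmx by rewrite unitmxE det_map_mx rmorph_unit // -unitmxE.
have -> : conj_red c Phi = map_mx red (c *m map_mx (Defs.lift C) Phi *m invmx c).
  rewrite !map_mxM redm_lift; congr (_ *m _ *m _).
  have e : map_mx red c *m map_mx red (invmx c) = 1%:M by rewrite -map_mxM mulmxV // map_mx1.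
  by rewrite -[RHS](mulKmx ucr) e mulmx1.
apply: nlm_sym; rewrite -(map_invmx2 D p uc) locmE -!map_mxM; exact: locm_red.
Qed.

Lemma pair_conj_red Phi c e : c \in unitmx -> nil_mx e ->
  pr (conj_red c Phi) (fun p => map_mx (jj p) c *m e p *m invmx (map_mx (jj p) c)) = pr Phi e.
Proof.
move=> uc he; apply: (@pair_conj _ _ (adiag D c)) => //; first exact: GL2A_diag.
by move=> p; apply: locm_conj_red.
Qed.

(** The residue theorem, in the form that [eta] vanishes on global nilpotents. *)
Lemma pair_global Phi c : map_mx red c = 0 -> pr Phi (adiag D c) = 0.
Proof.
move=> c0; pose x := 4%:R * \tr (map_mx (Defs.lift C) Phi *m c).
have rx : red x = 0.
  by rewrite /x rmorphM /= -trace_map_mx map_mxM c0 mulmx0 mxtrace0 mulr0.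
rewrite -(eta_global ef rx); congr eta; apply: functional_extensionality_dep => p.
by rewrite locmE -map_mxM /x rmorphM rmorph_nat /= -trace_map_mx.
Qed.

Lemma nil_mx_global c : map_mx red c = 0 -> nil_mx (adiag D c).
Proof.
move=> c0; apply/nil_mxP; split; first exact: amx_map.
move=> p i j; rewrite mxE; apply: nl_map; by move/matrixP: c0 => /(_ i j); rewrite !mxE.
Qed.

Lemma regE_r p (x : cp_F D p) : reg eta x <-> Obar ((loc D p (r p))^-1 * x).
Proof. by rewrite (su_reg HS) mulrC. Qed.

Lemma higgsP g Phi : higgs eta a (g, Phi) <-> [/\ GL2A g, \tr Phi = 0, - \det Phi = a &
  forall p, Obmx ((loc D p (r p))^-1 *: (invmx (g p) *m locm p Phi *m g p))].
Proof.
split=> -[h1 h2 h3 h4]; split=> //= p i j; first by rewrite mxE; apply/regE_r.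
by apply/regE_r; have := h4 p i j; rewrite mxE.
Qed.

Lemma eta_mul_int (x n : adele D) : (forall p, reg eta (x p)) -> is_adele x -> nil_adele n -> (forall p, Oh (n p)) ->
  eta (fun p => 4%:R * (x p * n p)) = 0.
Proof.
move=> hx ax hn On.
have -> : (fun p => 4%:R * (x p * n p)) = (fun p => x p * (4%:R * n p)).
  by apply: functional_extensionality_dep => p; rewrite mulrCA.
have h4 p : Oh (4%:R : cp_F D p).
  by rewrite -(rmorph_nat (jj p)); apply: Oh_map; rewrite (natrD _ 2 2) mulr2n; do !apply: OD; apply: O1.
have n4 : nil_adele (fun p => 4%:R * n p) by apply: nil_adeleMl => //; apply: adele_int.
apply: (eta_local ef); first exact: nil_adeleMl.
move=> p; exists (x p), (4%:R * n p); split=> //; last exact: OhM.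
by have /nil_adeleP [_] := n4; apply.
Qed.

(** The factor 1 + g N g^-1 moves g inside its own class, so the pairing has to vanish; regularity
    of the Higgs field in the lattice g gives this entry by entry. *)
Lemma pair_int g Phi (N : amat D) : higgs eta a (g, Phi) -> (forall p, nlm (N p) /\ intmx (N p)) ->
  pr Phi (fun p => g p *m N p *m invmx (g p)) = 0.
Proof.
move=> [Gg _ _ hr] hN; have [ag ai] := GL2A_amx Gg; have [ug _] := Gg.
have aN : amx N by apply/amx_aev/aev_all => p; case: (hN p).
have nN : nil_mx N by apply/nil_mxP; split=> // p; case: (hN p).
pose M p := invmx (g p) *m locm p Phi *m g p.
have aM : amx M by apply: amxM => //; apply: amxM => //; apply: amx_locm.
transitivity (eta (fun p => 4%:R * (M p 0 0 * N p 0 0) + 4%:R * (M p 0 1 * N p 1 0)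
   + (4%:R * (M p 1 0 * N p 0 1) + 4%:R * (M p 1 1 * N p 1 1)))).
  congr eta; apply: functional_extensionality_dep => p.
  rewrite -!mulrDr; congr (_ * _).
  have -> : \tr (locm p Phi *m (g p *m N p *m invmx (g p))) = \tr (M p *m N p).
    by rewrite /M !mulmxA mxtrace_mulC !mulmxA.
  by rewrite tr2 !mul2E.
have nM i j i' j' : nil_adele (fun p => 4%:R * (M p i j * N p i' j')).
  have := nil_adeleMl (adele_map D 4%:R) (nil_adeleMl (aM i j) (nN i' j')).
  by congr nil_adele; apply: functional_extensionality_dep => p; rewrite rmorph_nat.
have z i j i' j' : eta (fun p => 4%:R * (M p i j * N p i' j')) = 0.
  apply: (@eta_mul_int (fun p => M p i j) (fun p => N p i' j')); [exact: (fun p => hr p i j)|exact: aM|exact: nN|].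
  by move=> p; case: (hN p).
rewrite (eta_add ef); [|exact: nil_adeleD (nM _ _ _ _) (nM _ _ _ _)..].
by rewrite !(eta_add ef); rewrite ?z ?addr0 //; apply: nM.
Qed.

Lemma pair_scalar Phi (t : adele D) : \tr Phi = 0 -> nil_adele t -> pr Phi (fun p => (t p)%:M) = 0.
Proof.
move=> tP nt; have /nil_adeleP [_ n] := nt; rewrite -[RHS](eta0 ef); congr eta.
apply: functional_extensionality_dep => p.
rewrite mul_mx_scalar mxtraceZ.
have h : nl (\tr (locm p Phi)).
  rewrite tr2 !mxE -[X in nl X]subr0; apply: (@nlc_trans _ _ _ _ _ (loc D p 0)).
    by apply: nlc_sym; rewrite -tP tr2; apply: locD.
  by rewrite subr0; apply: loc0.
by rewrite (nlM0 (n p) h) mulr0.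
Qed.

End Pairing.

(** * Equivalence of liftings *)

Section Relations.
Variables (R : realType) (k : finFieldType) (X : function_field k) (C : special_extension X).
Variables (D : completion C) (eta : adele D -> k) (a : X) (r : place X -> X).
Hypothesis HS : setup eta a r.
Variable psi : k -> R[i].
Hypothesis psi_char : nontrivial_character psi.
Implicit Types (p q : place X) (g h u e : amat D) (Phi : 'M[X]_2) (c : 'M[se_F C]_2).
Local Notation red := (se_red C).
Local Notation jj := (cp_map D).
Local Notation locm p Phi := (map_mx (loc D p) Phi).
Local Notation pr := (higgs_pairing eta).

Lemma psiD x y : psi (x + y) = psi x * psi y. Proof. by case: psi_char. Qed.
Lemma psi_norm x : `|psi x| = 1. Proof. by case: psi_char. Qed.
Lemma psi_neq0 x : psi x != 0. Proof. by rewrite -normr_eq0 psi_norm oner_neq0. Qed.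
Lemma psi0 : psi 0 = 1.
Proof. by apply: (mulfI (psi_neq0 0)); rewrite -psiD addr0 mulr1. Qed.
Lemma psiN x : psi (- x) = (psi x)^-1.
Proof. by apply: (mulfI (psi_neq0 x)); rewrite -psiD addrN psi0 mulfV // psi_neq0. Qed.

Definition gact c u (z : adele D) e g : amat D :=
  fun p => z p *: (map_mx (jj p) c *m ((1%:M + e p) *m g p *m u p)).

Definition hstep c u (z : adele D) e (x y : hpair D) :=
  [/\ c \in unitmx, GL2O u, idele z & nil_mx e] /\
  (y.1 = gact c u z e x.1 /\ y.2 = conj_red c x.2).

Lemma redm_unit c : c \in unitmx -> map_mx red c \in unitmx.
Proof. by move=> uc; rewrite unitmxE det_map_mx rmorph_unit // -unitmxE. Qed.

Lemma redm_inv c : c \in unitmx -> map_mx red (invmx c) = invmx (map_mx red c).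
Proof.
move=> uc; have e : map_mx red c *m map_mx red (invmx c) = 1%:M by rewrite -map_mxM mulmxV // map_mx1.
by rewrite -[LHS](mulKmx (redm_unit uc)) e mulmx1.
Qed.

Lemma conj_redM c c' Phi : c \in unitmx -> c' \in unitmx ->
  conj_red (c' *m c) Phi = conj_red c' (conj_red c Phi).
Proof.
move=> uc uc'; rewrite /conj_red map_mxM invmxM ?redm_unit //.
by rewrite !mulmxA.
Qed.

Lemma conj_red1 Phi : conj_red (1%:M : 'M[se_F C]_2) Phi = Phi.
Proof. by rewrite /conj_red map_mx1 invmx1 mul1mx mulmx1. Qed.

Lemma hstep_refl x : hstep 1%:M (fun p => 1%:M) (fun p => 1) (fun p => 0) x x.
Proof.
split; first by split; [exact: unitmx1|exact: GL2O1|exact: idele1|exact: nil_mx0].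
split; last by rewrite conj_red1.
by apply: functional_extensionality_dep => p; rewrite /gact map_mx1 addr0 !mul1mx mulmx1 scale1r.
Qed.

(** The nilpotent correction of a composite: e' is carried back through c, and the product of two
    corrections vanishes, so they add. *)
Definition etrans c e e' : amat D :=
  fun p => invmx (map_mx (jj p) c) *m e' p *m map_mx (jj p) c + e p.

Lemma nil_etrans c e e' : c \in unitmx -> nil_mx e -> nil_mx e' -> nil_mx (etrans c e e').
Proof.
move=> uc he he'; apply: nil_mxD => //; apply: nil_mx_conj => //; last exact: amx_map.
exact: amx_diagV.
Qed.

Lemma hstep_trans c u z e x y c' u' z' e' w : hstep c u z e x y -> hstep c' u' z' e' y w ->
  hstep (c' *m c) (fun p => u p *m u' p) (fun p => z' p * z p) (etrans c e e') x w.
Proof.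
move=> [[uc gu iz he] [e1 e2]] [[uc' gu' iz' he'] [e1' e2']]; split.
  split; [by rewrite unitmx_mul uc'|exact: GL2OM|exact: ideleM|exact: nil_etrans].
split; last by rewrite e2' e2 conj_redM.
rewrite e1' e1; apply: functional_extensionality_dep => p; rewrite /gact.
have uj := jj_unitmx D p uc; set A := map_mx (jj p) c in uj *.
have -> : 1%:M + etrans c e e' p = invmx A *m (1%:M + e' p) *m A *m (1%:M + e p).
  have h1 : invmx A *m (1%:M + e' p) *m A = 1%:M + invmx A *m e' p *m A.
    by rewrite mulmxDr mulmx1 mulmxDl mulVmx.
  have h2 : invmx A *m e' p *m A *m e p = 0.
    apply: nlm_mul0; last exact: (nil_mx_nlm he p).
    by apply: nlm_mulr; apply: nlm_mull; exact: (nil_mx_nlm he' p).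
  by rewrite h1 mulmxDr mulmx1 mulmxDl mul1mx h2 addr0 addrA.
rewrite map_mxM -/A -!scalemxAr -!scalemxAl -scalemxAr scalerA; congr (_ *: _).
by rewrite !mulmxA mulmxK.
Qed.

Lemma pair_etrans c e e' Phi : c \in unitmx -> nil_mx e -> nil_mx e' ->
  pr Phi (etrans c e e') = pr (conj_red c Phi) e' + pr Phi e.
Proof.
move=> uc he he'; have ac := amx_diagV D uc; have aj := amx_map D c.
have h : nil_mx (fun p => invmx (map_mx (jj p) c) *m e' p *m map_mx (jj p) c).
  exact: (nil_mx_conj ac aj).
rewrite (pairD HS _ h he); congr (_ + _).
rewrite -(pair_conj_red eta Phi uc h); congr (pr _ _).
apply: functional_extensionality_dep => p; have uj := jj_unitmx D p uc.
by rewrite !mulmxA mulmxV // mul1mx -mulmxA mulmxV // mulmx1.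
Qed.

Definition einv c e : amat D := fun p => - (map_mx (jj p) c *m e p *m invmx (map_mx (jj p) c)).

Lemma nil_einv c e : c \in unitmx -> nil_mx e -> nil_mx (einv c e).
Proof.
move=> uc he; apply: nil_mxN; apply: nil_mx_conj => //; first exact: amx_map.
exact: amx_diagV.
Qed.

Lemma hstep_sym c u z e x y : hstep c u z e x y ->
  hstep (invmx c) (fun p => invmx (u p)) (fun p => (z p)^-1) (einv c e) y x.
Proof.
move=> [[uc gu iz he] [e1 e2]]; split.
  by split; [rewrite unitmx_inv|exact: GL2OV|exact: ideleV|exact: nil_einv].
split; last first.
  have ur := redm_unit uc.
  by rewrite e2 /conj_red redm_inv // invmxK !mulmxA mulVmx // mul1mx mulmxKV.
rewrite e1; apply: functional_extensionality_dep => p; rewrite /gact.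
have uj := jj_unitmx D p uc; rewrite map_invmx2 //; set A := map_mx (jj p) c in uj *.
have uz : z p \is a GRing.unit by case: iz.
have uu : u p \in unitmx by case: (gu p).
rewrite -!scalemxAr -scalemxAl -scalemxAr scalerA mulVr // scale1r.
have ne := nil_mx_nlm he p.
have -> : 1%:M + einv c e p = A *m (1%:M - e p) *m invmx A.
  by rewrite mulmxBr mulmx1 mulmxBl mulmxV.
have h2 : (1%:M - e p) *m (1%:M + e p) = 1%:M.
  by have := mul_1nlm (nlmN ne); rewrite opprK.
by rewrite !mulmxA mulVmx // mul1mx (mulmxKV uj) (mulmxK uu) h2 mul1mx.
Qed.

Lemma pair_einv c e Phi : c \in unitmx -> nil_mx e ->
  pr (conj_red c Phi) (einv c e) = - pr Phi e.
Proof.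
move=> uc he; rewrite (pairN HS); last first.
  by apply: nil_mx_conj => //; [exact: amx_map|exact: amx_diagV].
by congr (- _); apply: pair_conj_red.
Qed.

Definition hrel (x y : hpair D) := exists c u z e, hstep c u z e x y.
(* [lrep_equiv] without the condition on the trace of [e]: the scalar part of [1 + e] can be moved
   to [z], see [lrep_equivP]. *)
Definition lrel (x y : lrep D R) :=
  exists c u z e, hstep c u z e x.1 y.1 /\ y.2 = psi (pr x.1.2 e) * x.2.

Lemma hrel_refl x : hrel x x.
Proof. by do 4!eexists; apply: hstep_refl. Qed.
Lemma hrel_sym x y : hrel x y -> hrel y x.
Proof. by move=> [c [u [z [e /hstep_sym h]]]]; do 4!eexists; apply: h. Qed.
Lemma hrel_trans x y w : hrel x y -> hrel y w -> hrel x w.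
Proof.
move=> [c [u [z [e h]]]] [c' [u' [z' [e' h']]]].
by have h2 := hstep_trans h h'; do 4!eexists; apply: h2.
Qed.

Lemma lrel_refl x : lrel x x.
Proof.
do 4!eexists; split; first exact: hstep_refl.
by rewrite (pair0 HS) psi0 mul1r.
Qed.
Lemma lrel_sym x y : lrel x y -> lrel y x.
Proof.
move=> [c [u [z [e [h e3]]]]]; do 4!eexists; split; first exact: (hstep_sym h).
case: h => [[uc gu iz he] [e1 e2]].
by rewrite e2 pair_einv // psiN e3 mulKf // psi_neq0.
Qed.
Lemma lrel_trans x y w : lrel x y -> lrel y w -> lrel x w.
Proof.
move=> [c [u [z [e [h e3]]]]] [c' [u' [z' [e' [h' e3']]]]].
do 4!eexists; split; first exact: (hstep_trans h h').
case: h => [[uc gu iz he] [e1 e2]]; case: h' => [[uc' gu' iz' he'] [e1' e2']].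
by rewrite pair_etrans // psiD e3' e3 e2 mulrA.
Qed.
Lemma lrel_hrel x y : lrel x y -> hrel x.1 y.1.
Proof. by move=> [c [u [z [e [h _]]]]]; exists c, u, z, e. Qed.
Lemma hrel_lrel x y : hrel x y -> exists2 t, `|t| = 1 & lrel (x, 1) (y, t).
Proof.
move=> [c [u [z [e h]]]]; exists (psi (pr x.2 e)); first exact: psi_norm.
by exists c, u, z, e; rewrite mulr1.
Qed.
Lemma lrel_scale t x y : lrel x y -> lrel (x.1, t * x.2) (y.1, t * y.2).
Proof.
by move=> [c [u [z [e [h e3]]]]]; exists c, u, z, e; split=> //=; rewrite e3 mulrCA.
Qed.

Lemma lrep_equivP x y : \tr x.1.2 = 0 -> lrep_equiv eta psi x y <-> lrel x y.
Proof.
move=> tx; split=> [[c [u [z [e [uc gu iz [he te] [e1 e2 e3]]]]]]|].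
  by exists c, u, z, e.
move=> [c [u [z [e [[[uc gu iz he] [e1 e2]] e3]]]]].
(* With t half the trace, 1 + e = (1 + t)(1 + e0) because t e0 = 0. The scalar 1 + t goes into the
   idele, and t pairs to zero with a traceless field. *)
pose t p := 2%:R^-1 * \tr (e p) : cp_F D p.
have nt : nil_adele t.
  have := nil_adeleMl (adele_map D 2%:R^-1) (nil_adeleD (he 0 0) (he 1 1)).
  by congr nil_adele; apply: functional_extensionality_dep => p; rewrite /t rmorphV ?(two_F HS) // rmorph_nat tr2.
pose e0 p := e p - (t p)%:M.
have ntm : nil_mx (fun p => (t p)%:M : 'M[cp_F D p]_2).
  move=> i j; case: (eqVneq i j) => [->|ne].
    by move: nt; congr nil_adele; apply: functional_extensionality_dep => p; rewrite mxE eqxx.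
  move: (nil_adele0 D); congr nil_adele; apply: functional_extensionality_dep => p.
  by rewrite mxE (negbTE ne).
have ne0 : nil_mx e0 by apply: nil_mxD => //; apply: nil_mxN.
exists c, u, (fun p => z p * (1 + t p)), e0; split=> //.
- by apply: ideleM => //; apply: idele_1nil.
- split=> // p; rewrite mxtraceD raddfN /= mxtrace_scalar /t.
  have [u2 _ _] := two_Ohu HS p.
  by rewrite -[X in _ - X]mulr_natr mulrAC mulVr // mul1r subrr.
split=> //.
  rewrite e1; apply: functional_extensionality_dep => p; rewrite /gact /ascale /amul /lift_add.
  have -> : 1%:M + e p = (1 + t p) *: (1%:M + e0 p).
    rewrite scalerDl scale1r scalerDr scalemx1 /e0.
    have -> : t p *: (e p - (t p)%:M) = 0.
      apply/matrixP => i j; rewrite !mxE; have /nil_adeleP [_ n] := nt.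
      apply: nlM0 (n p) _; apply: nlB; first exact: (nil_mx_nlm he p i j).
      by have := nil_mx_nlm ntm p i j; rewrite mxE.
    by rewrite addr0 -addrA subrK.
  by rewrite -!scalemxAl -scalemxAr scalerA.
rewrite e3; congr (psi _ * _).
have -> : e = fun p => e0 p + (t p)%:M.
  by apply: functional_extensionality_dep => p; rewrite subrK.
by rewrite (pairD HS) // (pair_scalar HS) // addr0.
Qed.

Lemma GL2A_gact c u z e g : c \in unitmx -> GL2O u -> idele z -> nil_mx e -> GL2A g ->
  GL2A (gact c u z e g).
Proof.
move=> uc gu iz he Gg; apply: GL2AZ => //; apply: GL2AM; first exact: GL2A_diag.
by apply: GL2AM; [apply: GL2AM => //; exact: GL2A_1nil|exact: GL2O_A].
Qed.

Lemma gact_cong c u z e g p : c \in unitmx -> GL2O u -> idele z -> nil_mx e -> GL2A g ->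
  nlm (gact c u z e g p - z p *: (map_mx (jj p) c *m (g p *m u p))).
Proof.
move=> uc gu iz he Gg; rewrite /gact -scalerBr; apply: nlmZ.
rewrite -mulmxBr; apply: nlm_mull; rewrite -mulmxBl; apply: nlm_mulr.
by rewrite mulmxDl mul1mx addrAC subrr add0r; apply: nlm_mulr; apply: nil_mx_nlm he p.
Qed.

Lemma tr_conj_red c Phi : c \in unitmx -> \tr (conj_red c Phi) = \tr Phi.
Proof. by move=> uc; rewrite /conj_red mxtrace_mulC mulmxA mulVmx ?redm_unit // mul1mx. Qed.
Lemma det_conj_red c Phi : c \in unitmx -> \det (conj_red c Phi) = \det Phi.
Proof.
move=> uc; rewrite /conj_red !det_mulmx mulrC mulrA -det_mulmx mulVmx ?redm_unit //.
by rewrite det1 mul1r.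
Qed.

Lemma higgs_hrel x y : hrel x y -> higgs eta a x -> higgs eta a y.
Proof.
case: x => g Phi; case: y => g' Phi' [c [u [z [e [[uc gu iz he] /= [e1 e2]]]]]].
move=> /(higgsP HS) [Gg t0 d0 hr]; apply/(higgsP HS).
have Gg' : GL2A g' by rewrite e1; apply: GL2A_gact.
split=> //; rewrite ?e2 ?tr_conj_red ?det_conj_red // => p.
have [ug' _] := Gg'; have [ug _] := Gg; have uu : u p \in unitmx by case: (gu p).
have uz : z p \is a GRing.unit by case: iz.
have uj := jj_unitmx D p uc.
have n1 : nlm (g' p - z p *: (map_mx (jj p) c *m (g p *m u p))) by rewrite e1; apply: gact_cong.
have n2 := locm_conj_red D p Phi uc.
set A := map_mx (jj p) c in uj n1 n2.
have := nlm_congM (nlm_congM (nlm_inv (ug' p) n1) n2) n1.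
have uW : g p *m u p \in unitmx by rewrite unitmx_mul ug.
have uAW : A *m (g p *m u p) \in unitmx by rewrite unitmx_mul uj.
have -> : invmx (z p *: (A *m (g p *m u p))) *m (A *m locm p Phi *m invmx A)
    *m (z p *: (A *m (g p *m u p))) = invmx (u p) *m (invmx (g p) *m locm p Phi *m g p) *m u p.
  rewrite (invmxZ' uz uAW) -!scalemxAl -!scalemxAr scalerA mulVr // scale1r.
  by rewrite (invmxM uj uW) (invmxM (ug p) uu) !mulmxA !(mulmxKV uj).
move=> n3.
have OM : Obmx ((loc D p (r p))^-1 *: (invmx (u p) *m (invmx (g p) *m locm p Phi *m g p) *m u p)).
  rewrite scalemxAl scalemxAr; have [_ i1 i2] := gu p.
  by apply: ObmxM; [apply: ObmxM => //|]; apply: Obmx_int.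
apply: Obmx_cong OM; rewrite -scalerBr; apply: nlmZ; exact: n3.
Qed.

(** An isomorphism modulo nilpotents becomes exact after a nilpotent correction: the difference g' -
    h is written as e0 h, and e0 is conjugated back by c. *)
Lemma higgs_isoP x y : GL2A x.1 -> higgs_iso x y <-> hrel x y.
Proof.
case: x => g Phi; case: y => g' Phi' /= Gg; split.
  move=> [c [u [z [uc gu iz /= hn e2]]]].
  pose h p := z p *: (map_mx (jj p) c *m (g p *m u p)).
  have Gh : GL2A h.
    apply: GL2AZ => //; apply: GL2AM; first exact: GL2A_diag.
    by apply: GL2AM => //; apply: GL2O_A.
  have [ah ai] := GL2A_amx Gh; have [uh _] := Gh.
  have nd : nil_mx (fun p => g' p - h p).
    by move=> i j; move: (hn i j); congr nil_adele; apply: functional_extensionality_dep => p; rewrite !mxE.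
  pose e0 p := (g' p - h p) *m invmx (h p).
  have ne0 : nil_mx e0 by apply: nil_mxM_r.
  have aj := amx_map D c; have ac := amx_diagV D uc.
  exists c, u, z, (fun p => invmx (map_mx (jj p) c) *m e0 p *m map_mx (jj p) c).
  split; first by split=> //; apply: (nil_mx_conj ac aj).
  split=> //=; apply: functional_extensionality_dep => p; rewrite /gact.
  have uj := jj_unitmx D p uc; set A := map_mx (jj p) c in uj *.
  have -> : A *m ((1%:M + invmx A *m e0 p *m A) *m g p *m u p) = (1%:M + e0 p) *m (A *m (g p *m u p)).
    by rewrite !mulmxA; congr (_ *m _ *m _); rewrite mulmxDr mulmx1 !mulmxA mulmxV // mul1mx mulmxDl mul1mx.
  rewrite scalemxAr -/(h p) mulmxDl mul1mx /e0 mulmxKV //.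
  by rewrite addrC subrK.
move=> [c [u [z [e [[uc gu iz he] /= [e1 e2]]]]]]; exists c, u, z; split=> //=.
have [ag _] := GL2A_amx Gg; have [au _] := GL2A_amx (GL2O_A gu); have [az _] := idele_adele iz.
have n : nil_mx (fun p => z p *: (map_mx (jj p) c *m (e p *m (g p *m u p)))).
  have n2 : nil_mx (fun p => map_mx (jj p) c *m (e p *m (g p *m u p))).
    by apply: (nil_mxM_l (amx_map D c)); apply: nil_mxM_r => //; apply: amxM.
  move=> i j; move: (nil_adeleMl az (n2 i j)); congr nil_adele.
  by apply: functional_extensionality_dep => p; rewrite [RHS]mxE.
move=> i j; move: (n i j); congr nil_adele; apply: functional_extensionality_dep => p.
rewrite e1 /gact /ascale /amul /adiag.
rewrite mulmxDl mul1mx mulmxDl mulmxDr scalerDr -!mulmxA.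
by rewrite [RHS in _ = RHS](_ : _ = (z p *: (map_mx (jj p) c *m (e p *m (g p *m u p)))) i j) //; rewrite [in RHS]mxE -[X in _ - X]opprK; rewrite !mxE; ring.
Qed.

End Relations.

(** * The torus of the spectral curve *)

Section Torus.
Variables (R : realType) (k : finFieldType) (X : function_field k) (C : special_extension X).
Variables (D : completion C) (eta : adele D -> k) (a : X) (r : place X -> X).
Hypothesis HS : setup eta a r.
Variable psi : k -> R[i].
Hypothesis psi_char : nontrivial_character psi.
Implicit Types (p q : place X) (g h u e : amat D) (Phi : 'M[X]_2) (c : 'M[se_F C]_2) (v w : ecol D).
Local Notation V := pl_ring.
Local Notation nl := nilpotent_elt.
Local Notation locm p Phi := (map_mx (loc D p) Phi).
Local Notation rho p := (loc D p (r p)).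
Local Notation Phi0 := (mul_tau a).
Let DD : forall p : place X, discrete p := place_discrete D.

Lemma Obar_dich p (x : cp_F D p) : Obar x ->
  (x \is a GRing.unit /\ Obar x^-1) \/ Obar (x / loc D p (unif p)).
Proof.
move=> Ox; have [nx|nx] := pselect (nl x); first by right; apply: Obar_nl; apply: nl_mulr.
have ux := not_nl_unit nx; have [b [u [b0 [uu Ou Oui] hn]]] := unit_loc_form nx.
have pi0 := unif_neq0 DD p; have upi := loc_unit D p pi0.
have ub := loc_unit D p b0.
have Vb : V p b.
  rewrite -(Obar_loc D) -[loc D p b](mulrK uu); apply: ObarM; last exact: Obar_Oh.
  by apply: Obar_cong Ox; apply: nlc_sym.
have [Vbi|nVb] := pselect (V p b^-1).
  left; split=> //; apply: Obar_cong (_ : Obar (loc D p b^-1 * u^-1)); last first.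
    by apply: ObarM; [rewrite Obar_loc|apply: Obar_Oh].
  apply: nlc_trans (nlc_inv ux hn) _; rewrite (invrM ub uu) mulrC.
  by apply: nlc_mul; [apply: nlc_sym; apply: locV|exact: nlc_refl].
right; have [_] := notV_inv DD nVb; rewrite invrK /vge exprN1 => Vp.
apply: Obar_cong (_ : Obar (loc D p (b / unif p) * u)); last first.
  by apply: ObarM; [rewrite Obar_loc|apply: Obar_Oh].
apply: (@nlc_trans _ _ _ _ _ (loc D p b * u / loc D p (unif p))).
  by apply: nlc_mul => //; exact: nlc_refl.
rewrite mulrAC; apply: nlc_mul; last exact: nlc_refl.
by apply: nlc_sym; apply: loc_div.
Qed.

(* If none of the vectors (1,0), (0,1), (1,1) is cyclic for [M], then [det M] vanishes to order 2. *)
Lemma cyclic p (M : 'M[cp_F D p]_2) : Obmx M -> \tr M = 0 ->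
  ~ Obar (\det M / loc D p (unif p) ^+ 2) ->
  exists x y : cp_F D p, [/\ x = 0 \/ x = 1, y = 0 \/ y = 1,
   x * (M 1 0 * x + M 1 1 * y) - y * (M 0 0 * x + M 0 1 * y) \is a GRing.unit
   & Obar (x * (M 1 0 * x + M 1 1 * y) - y * (M 0 0 * x + M 0 1 * y))^-1].
Proof.
move=> OM; rewrite tr2 => tM nd.
have e11 : M 1 1 = - M 0 0 by apply/eqP; rewrite -addr_eq0 addrC tM.
have [[u1 i1]|h1] := Obar_dich (OM 1 0).
  by exists 1, 0; rewrite !mulr0 !mul0r mulr1 mul1r addr0 subr0; split=> //; [right|left].
have [[u2 i2]|h2] := Obar_dich (ObarN (OM 0 1)).
  by exists 0, 1; rewrite !mulr0 !mul0r mulr1 mul1r !add0r; split=> //; [left|right].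
have [[u3 i3]|h3] := Obar_dich (ObarB (ObarB (OM 1 0) (OM 0 1)) (ObarM (Obar_Oh (let: And3 _ h _ := two_Ohu HS p in h)) (OM 0 0))).
  exists 1, 1; rewrite !mulr1 !mul1r.
  have -> : M 1 0 + M 1 1 - (M 0 0 + M 0 1) = M 1 0 - M 0 1 - 2%:R * M 0 0 by rewrite e11; ring.
  by split=> //; right.
exfalso; apply: nd; set t := loc D p (unif p) in h1 h2 h3 *.
have ut : t \is a GRing.unit by apply: loc_unit; apply: unif_neq0.
have [u2 _ o2] := two_Ohu HS p.
have h0 : Obar (M 0 0 / t).
  (* det (f, M f) is a quadratic form in f. Its values at the three vectors are divisible by t,
     hence so are its coefficients, because 2 is invertible. *)
  have -> : M 0 0 / t = 2%:R^-1 * (M 1 0 / t + (- M 0 1) / t - (M 1 0 - M 0 1 - 2%:R * M 0 0) / t).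
    apply: (mulrI u2); rewrite [RHS]mulrA mulrV // mul1r; ring.
  by apply: ObarM; [apply: Obar_Oh|apply: ObarB => //; apply: ObarD].
have -> : \det M / t ^+ 2 = - (M 0 0 / t * (M 0 0 / t)) + (- M 0 1) / t * (M 1 0 / t).
  rewrite det2 e11 expr2 invrM //; ring.
by apply: ObarD; [apply: ObarN|]; apply: ObarM.
Qed.

Lemma mul_col2 p (M : 'M[cp_F D p]_2) (v : 'cV[cp_F D p]_2) i :
  (M *m v) i 0 = M i 0 * v 0 0 + M i 1 * v 1 0.
Proof. by rewrite mxE sum2E. Qed.

Lemma emxs p (v : 'cV[cp_F D p]_2) : ((emx a v 0 0 = v 0 0)%R *
  (emx a v 0 1 = loc D p a * v 1 0)%R * (emx a v 1 0 = v 1 0)%R * (emx a v 1 1 = v 0 0)%R)%type.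
Proof. by rewrite !mxE. Qed.

Lemma emxM p (v w : 'cV[cp_F D p]_2) : emx a (emx a v *m w) = emx a v *m emx a w.
Proof. by apply: mx2P; rewrite !mul2E !emxs !mul_col2 !emxs; ring. Qed.

Lemma emxC p (v w : 'cV[cp_F D p]_2) : emx a v *m emx a w = emx a w *m emx a v.
Proof. by apply: mx2P; rewrite !mul2E !emxs; ring. Qed.

Lemma emx1 p : emx a (ecol1 D p) = 1%:M.
Proof. by apply: mx2P; rewrite !emxs !mxE ?eqxx //= mulr0. Qed.

Lemma mul_ecol1 p (M : 'M[cp_F D p]_2) i : (M *m ecol1 D p) i 0 = M i 0.
Proof. by rewrite mul_col2 !mxE /= mulr1 mulr0 addr0. Qed.

Lemma emx_ecol1 p (v : 'cV[cp_F D p]_2) : emx a v *m ecol1 D p = v.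
Proof.
apply/matrixP => i j; rewrite ord1 mul_ecol1; move: i; apply: ord2P; by rewrite emxs.
Qed.

Lemma emx_inv p (v : 'cV[cp_F D p]_2) : emx a v \in unitmx ->
  invmx (emx a v) = emx a (invmx (emx a v) *m ecol1 D p).
Proof.
move=> uv; rewrite -[RHS](mulKmx uv) -emxM.
by rewrite (mulKVmx uv) emx1 mulmx1.
Qed.

Definition Tor v := GL2A (fun p => emx a (v p)).

Lemma Tor_mul v w : Tor v -> Tor w -> Tor (emul a v w).
Proof.
move=> hv hw; have := GL2AM hv hw; congr GL2A.
by apply: functional_extensionality_dep => p; rewrite /emul emxM.
Qed.

Definition evinv v : ecol D := fun p => invmx (emx a (v p)) *m ecol1 D p.

Lemma Tor_inv v : Tor v -> Tor (evinv v).
Proof.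
move=> hv; have [uv _] := hv; have := GL2AV hv; congr GL2A.
by apply: functional_extensionality_dep => p; rewrite /evinv -emx_inv.
Qed.

Lemma Tor1 : Tor (ecol1 D).
Proof.
have := GL2O_A (GL2O1 D); congr GL2A.
by apply: functional_extensionality_dep => p; rewrite emx1.
Qed.

Lemma emul1 v : emul a (ecol1 D) v = v.
Proof. by apply: functional_extensionality_dep => p; rewrite /emul emx1 mul1mx. Qed.

Lemma emulC v w : emul a v w = emul a w v.
Proof.
apply: functional_extensionality_dep => p; rewrite /emul -[RHS](emx_ecol1 _) emxM emxC -emxM.
by rewrite emx_ecol1.
Qed.

Lemma emulA v w x : emul a v (emul a w x) = emul a (emul a v w) x.
Proof. by apply: functional_extensionality_dep => p; rewrite /emul emxM mulmxA. Qed.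

Lemma emulV v : Tor v -> emul a (evinv v) v = ecol1 D.
Proof.
move=> [uv _]; apply: functional_extensionality_dep => p; rewrite /emul -emx_inv //.
by rewrite -[X in _ *m X](emx_ecol1 (v p)) mulKmx.
Qed.

(* [g0] represents pi_* O, with basis 1 and t = tau eta. *)
Definition g0 : amat D := fun p =>
  \matrix_(i, j) if i == j then (if i == 0 then 1 else (rho p)^-1) else 0.

Definition g0i : amat D := fun p =>
  \matrix_(i, j) if i == j then (if i == 0 then 1 else rho p) else 0.

Lemma g0K p : g0 p *m g0i p = 1%:M /\ g0i p *m g0 p = 1%:M.
Proof.
have ur := locr_unit HS p.
by split; apply: mx2P; rewrite mul2E !mxE /= ?mulr0 ?mul0r ?mulr1 ?addr0 ?add0r ?mulVr ?mulrV.
Qed.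

Lemma unit_g0 p : g0 p \in unitmx.
Proof. by have [/mulmx1_unit []] := g0K p. Qed.

Lemma inv_g0 p : invmx (g0 p) = g0i p.
Proof. by have [e _] := g0K p; rewrite -[RHS](mulKmx (unit_g0 p)) e mulmx1. Qed.

Lemma idele_loc (d : place X -> X) : (forall p, d p != 0) -> finite_set [set p | d p != 1] ->
  idele (fun p => loc D p (d p)).
Proof.
move=> d0 fd; split; first by move=> p; apply: loc_unit.
have [_ h] := @idele_global _ _ _ D (Defs.lift C 1) (ltac:(by rewrite red_lift oner_neq0)).
have : aev (fun p => d p = 1) by apply: sub_finite_set fd => p /= /eqP.
move=> /(aev_and h); apply: sub_finite_set => p /= n []; move=> [o1 o2] e; apply: n.
by rewrite e.
Qed.

Lemma GL2A_g0 : GL2A g0.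
Proof.
have [ar ari] := idele_adele (idele_loc (r_neq0 HS) (su_r1 HS)).
apply: GL2AI; first exact: unit_g0.
  apply/amx_aev; apply: aev_imp ari => p o i j; rewrite mxE.
  by case: ifP => _; [case: ifP => _ //; apply: Oh1|apply: Oh0].
apply/amx_aev; apply: aev_imp ar => p o i j; rewrite inv_g0 mxE.
by case: ifP => _; [case: ifP => _ //; apply: Oh1|apply: Oh0].
Qed.

(** r eta generates the regular sections of L^-1 omega, so the condition over all regular b amounts
    to the one for b = r. *)
Lemma spec_int_g0 p (v : 'cV[cp_F D p]_2) :
  spec_int eta v <-> forall i, Obar ((invmx (g0 p) *m v) i 0).
Proof.
have ur := locr_unit HS p.
have e0 : (invmx (g0 p) *m v) 0 0 = v 0 0.
  by rewrite inv_g0 mul_col2 !mxE /= mul1r mul0r addr0.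
have e1 : (invmx (g0 p) *m v) 1 0 = rho p * v 1 0.
  by rewrite inv_g0 mul_col2 !mxE /= mul0r add0r.
split=> [[h1 h2]|h].
  apply: ord2P; rewrite ?e0 ?e1 // mulrC; apply: h2.
  by apply/(su_reg HS); rewrite mulrV //; apply: Obar1.
split; first by rewrite -e0.
move=> b /(su_reg HS) hb.
have -> : v 1 0 * b = rho p * v 1 0 * (b / rho p).
  transitivity (v 1 0 * b * (rho p / rho p)); [by rewrite mulrV // mulr1|ring].
by apply: ObarM => //; rewrite -e1.
Qed.

Definition gT v : amat D := fun p => emx a (v p) *m g0 p.

Lemma GL2A_gT v : Tor v -> GL2A (gT v).
Proof. by move=> hv; apply: GL2AM => //; apply: GL2A_g0. Qed.

Lemma pushforward_T v : Tor v -> pushforward eta a v (gT v).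
Proof.
move=> hv; split; first exact: GL2A_gT.
have [uv _] := hv; move=> p w; rewrite (spec_int_g0) /gT (invmxM (uv p) (unit_g0 p)).
by rewrite mulmxA.
Qed.

Lemma spec_idele_T v : Tor v -> spec_idele eta a v.
Proof.
move=> hv; have [uv f1] := hv; split=> //; have [_ f2] := GL2A_g0.
apply: aev_imp (aev_and f1 f2) => p [[o1 o2] [_ o3]]; split; apply/spec_int_g0 => i.
  rewrite -[v p](emx_ecol1 (v p)) mulmxA mul_ecol1; exact: Obar_Oh (intM o3 o1 i 0).
by rewrite mulmxA mul_ecol1; exact: Obar_Oh (intM o3 o2 i 0).
Qed.

Lemma tr_Phi0 : \tr Phi0 = 0. Proof. by rewrite tr2 !mxE /= addr0. Qed.
Lemma det_Phi0 : - \det Phi0 = a.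
Proof. by rewrite det2 !mxE /= mul0r mulr1 sub0r opprK. Qed.

Definition tcol p : 'cV[cp_F D p]_2 := \col_i (i == 1)%:R.
(** Multiplication by tau with exact entries 0 and 1, so that it commutes with every [emx a v]. The
    lifts of 0 and 1 in [locm p Phi0] are arbitrary, and that matrix agrees with this one only
    modulo nilpotents. *)
Definition tmx p := emx a (tcol p).

Lemma tmxE p : [/\ tmx p 0 0 = 0, tmx p 0 1 = loc D p a, tmx p 1 0 = 1 & tmx p 1 1 = 0].
Proof. by split; rewrite !mxE /= ?mulr1. Qed.

Lemma locm_Phi0 p : nlm (locm p Phi0 - tmx p).
Proof.
have [e00 e01 e10 e11] := tmxE p.
apply: ord2P; apply: ord2P; rewrite [X in nl X]mxE [X in _ + X]mxE ?e00 ?e01 ?e10 ?e11 !mxE /=.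
- by rewrite subr0; apply: loc0.
- exact: nlc_refl.
- exact: loc1.
- by rewrite subr0; apply: loc0.
Qed.

Lemma Obmx_tau p : Obmx ((rho p)^-1 *: (invmx (g0 p) *m tmx p *m g0 p)).
Proof.
have [e00 e01 e10 e11] := tmxE p; have ur := locr_unit HS p.
rewrite inv_g0; apply: ord2P; apply: ord2P; rewrite mxE !mul2E ?e00 ?e01 ?e10 ?e11 !mxE /= ?mulr0 ?mul0r ?addr0 ?add0r ?mulr1 ?mul1r ?mulr0.
- by rewrite ?mulr0 ?mul0r ?mulr0; apply: Obar_nl; apply: nl0.
- apply: Obar_cong (_ : Obar (loc D p (a / r p ^+ 2))); last by rewrite Obar_loc; apply: su_int HS p.
  apply: nlc_sym; apply: nlc_trans (loc_div D p a (expf_neq0 2 (r_neq0 HS p))) _.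
  rewrite mulrCA -invrM //; apply: nlc_mul; first exact: nlc_refl.
  apply: nlc_inv; first by apply: loc_unit; rewrite expf_neq0 ?(r_neq0 HS).
  by rewrite expr2; apply: locM.
- by rewrite mulVr //; apply: Obar1.
- by rewrite ?mulr0 ?mul0r ?mulr0; apply: Obar_nl; apply: nl0.
Qed.

Lemma higgs_T v : Tor v -> higgs eta a (gT v, Phi0).
Proof.
move=> hv; apply/(higgsP HS); split; [exact: GL2A_gT|exact: tr_Phi0|exact: det_Phi0|move=> p].
have [uv _] := hv; apply: Obmx_cong (Obmx_tau p); rewrite -scalerBr; apply: nlmZ.
have -> : invmx (g0 p) *m tmx p *m g0 p = invmx (gT v p) *m tmx p *m gT v p.
  rewrite /gT (invmxM (uv p) (unit_g0 p)) -!mulmxA; congr (_ *m _).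
  by rewrite !mulmxA -[_ *m tmx p *m _]mulmxA /tmx emxC mulKmx.
apply: nlm_congM; last exact: nlm_refl.
by apply: nlm_congM; [exact: nlm_refl|exact: locm_Phi0].
Qed.

End Torus.

(** * Torus orbits and torsion *)

Section Torsion.
Variables (R : realType) (k : finFieldType) (X : function_field k) (C : special_extension X).
Variables (D : completion C) (eta : adele D -> k) (a : X) (r : place X -> X).
Hypothesis HS : setup eta a r.
Variable psi : k -> R[i].
Hypothesis psi_char : nontrivial_character psi.
Implicit Types (p q : place X) (g h u e : amat D) (Phi : 'M[X]_2) (c : 'M[se_F C]_2) (v w : ecol D).
Local Notation V := pl_ring.
Local Notation red := (se_red C).
Local Notation Oh := (@cp_O _ _ _ D _).
Local Notation jj := (cp_map D).
Local Notation locm p Phi := (map_mx (loc D p) Phi).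
Local Notation pr := (higgs_pairing eta).
Local Notation rho p := (loc D p (r p)).
Local Notation Phi0 := (mul_tau a).
Let DD : forall p : place X, discrete p := place_discrete D.

Local Notation g0 := (g0 D r).
Local Notation gT := (gT a r).
Local Notation Tor := (Tor a).
Local Notation tmx p := (tmx D a p).
Local Notation lrel := (lrel eta psi).

Lemma map_lift_unit (M : 'M[X]_2) : M \in unitmx -> map_mx (Defs.lift C) M \in unitmx.
Proof.
rewrite !unitmxE => uM; apply: F_unit.
by rewrite -det_map_mx redm_lift -unitfE.
Qed.

Lemma higgs_Phi0 g Phi : higgs eta a (g, Phi) -> exists g', hrel (g, Phi) (g', Phi0).
Proof.
move=> [_ /= tP dP _]; pose x := Phi 0 0; pose z := Phi 1 0.
have e11 : Phi 1 1 = - x by apply/eqP; rewrite -addr_eq0 addrC -tP tr2.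
have ea : x ^+ 2 + Phi 0 1 * z = a by rewrite -dP det2 e11 /x /z; ring.
have z0 : z != 0.
  by apply/eqP => z0; apply: (su_nsq HS (c := x)); rewrite -ea z0 mulr0 addr0.
(* The columns are (1, 0) and its image under Phi, a basis because z is nonzero; in it Phi takes the
   form of multiplication by tau. *)
pose c0 : 'M[X]_2 := \matrix_(i, j) if j == 0 then (i == 0)%:R else (if i == 0 then x else z).
have uc0 : c0 \in unitmx by rewrite unitmxE det2 !mxE /= mul1r mulr0 subr0 unitfE.
have e : Phi *m c0 = c0 *m Phi0.
  apply: mx2P; rewrite !mul2E !mxE /= ?e11 -/x -/z ?mulr0 ?mulr1 ?mul0r ?mul1r ?addr0 ?add0r //.
  by ring.
have uL := map_lift_unit uc0; set c1 := map_mx (Defs.lift C) c0 in uL.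
have rc : map_mx (se_red C) c1 = c0 by apply: redm_lift.
pose c := invmx c1; have uc : c \in unitmx by rewrite unitmx_inv.
exists (gact c (fun p => 1%:M) (fun p => 1) (fun p => 0) g).
exists c, (fun p => 1%:M), (fun p => 1), (fun p => 0); split.
  by split=> //; [exact: GL2O1|exact: idele1|exact: nil_mx0].
split=> //=; rewrite /conj_red redm_inv // rc invmxK -mulmxA e mulmxA mulVmx // mul1mx //.
Qed.

Lemma col2mx p (M : 'M[cp_F D p]_2) (f : 'cV[cp_F D p]_2) i j :
  (row_mx f (M *m f) : 'M_(2, 1 + 1)) i j = if j == 0 then f i 0 else (M *m f) i 0.
Proof.
by move: j; apply: ord2P; rewrite mxE; case: splitP => // j; rewrite (ord1 j).
Qed.

(** Let M be the matrix of the Higgs field in the lattice g1, divided by r, and f an integral cyclic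
    vector of M. Then u = (f, M f) satisfies g1 u = v g0 for v = g1 f, since g1 carries M f to tau v
    / r. *)
Lemma higgs_reduce g Phi : higgs eta a (g, Phi) -> exists2 v, Tor v & hrel (g, Phi) (gT v, Phi0).
Proof.
move=> /[dup] hg0 /higgs_Phi0 [g1 hr]; have := higgs_hrel HS hr hg0.
move=> /(higgsP HS) [Gg _ _ hO]; have [ug _] := Gg; have [ag agi] := GL2A_amx Gg.
suff [v hv h2] : exists2 v, Tor v & hrel (g1, Phi0) (gT v, Phi0).
  by exists v => //; apply: hrel_trans hr h2.
pose M p := (rho p)^-1 *: (invmx (g1 p) *m tmx p *m g1 p).
have OM p : Obmx (M p).
  apply: Obmx_cong (hO p); rewrite -scalerBr; apply: nlmZ; apply: nlm_congM; last exact: nlm_refl.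
  by apply: nlm_congM; [exact: nlm_refl|apply: nlm_sym; exact: locm_Phi0].
have tM p : \tr (M p) = 0.
  rewrite mxtraceZ mxtrace_mulC mulmxA mulmxV // mul1mx tr2.
  by have [-> _ _ ->] := tmxE D a p; rewrite addr0 mulr0.
have dM p : \det (M p) = - (loc D p a / rho p ^+ 2).
  have ud : \det (g1 p) \is a GRing.unit by rewrite -unitmxE.
  rewrite detZ !det_mulmx det_inv (mulrC (\det (g1 p))^-1) divrK // det2.
  by have [-> -> -> ->] := tmxE D a p; rewrite exprVn; ring.
have nd p : ~ Obar (\det (M p) / loc D p (unif p) ^+ 2).
  rewrite dM => h; apply: (su_simple HS (p := p)); rewrite /vge -exprnN -(Obar_loc D).
  have u1 := unif_neq0 DD p; have r0 := r_neq0 HS p.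
  apply: Obar_cong (ObarN h); rewrite mulNr opprK.
  apply: nlc_trans (loc_div D p _ (expf_neq0 2 u1)) _; apply: nlc_mul.
    apply: nlc_trans (loc_div D p _ (expf_neq0 2 r0)) _; apply: nlc_mul; first exact: nlc_refl.
    by apply: nlc_inv; [apply: loc_unit; rewrite expf_neq0|rewrite !expr2; apply: locM].
  by apply: nlc_inv; [apply: loc_unit; rewrite expf_neq0|rewrite !expr2; apply: locM].
have cyc p : exists f : 'cV[cp_F D p]_2, (forall i, Oh (f i 0)) /\
    (row_mx f (M p *m f) \in unitmx /\ Obar (\det (row_mx f (M p *m f)))^-1).
  have [x [y [hx hy ud Od]]] := cyclic HS (OM p) (tM p) (@nd p).
  pose f : 'cV[cp_F D p]_2 := \col_i if i == 0 then x else y.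
  have df : \det (row_mx f (M p *m f)) =
      x * (M p 1 0 * x + M p 1 1 * y) - y * (M p 0 0 * x + M p 0 1 * y).
    by rewrite det2 !col2mx /= !mul_col2 !mxE /=; ring.
  exists f; rewrite unitmxE df; split=> //; apply: ord2P; rewrite mxE /=.
    by case: hx => ->; [apply: Oh0|apply: Oh1].
  by case: hy => ->; [apply: Oh0|apply: Oh1].
pose f p := xget 0 [set f : 'cV[cp_F D p]_2 | (forall i, Oh (f i 0)) /\
    (row_mx f (M p *m f) \in unitmx /\ Obar (\det (row_mx f (M p *m f)))^-1)].
have fP p : (forall i, Oh (f p i 0)) /\
    (row_mx (f p) (M p *m f p) \in unitmx /\ Obar (\det (row_mx (f p) (M p *m f p)))^-1).
  by rewrite /f; case: xgetP => [y _ //|h]; have [f1 hf1] := cyc p; case: (h f1).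
pose u p : 'M[cp_F D p]_2 := row_mx (f p) (M p *m f p).
pose v : ecol D := fun p => g1 p *m f p.
have ur p := locr_unit HS p.
have eg p : g1 p *m u p = gT v p.
  have eM : g1 p *m M p = (rho p)^-1 *: (tmx p *m g1 p).
    by rewrite -scalemxAr !mulmxA mulmxV // mul1mx.
  apply/matrixP => i j; rewrite mul2E /u !col2mx; move: j; apply: ord2P => /=.
    rewrite -mul_col2 -/(v p) /gT mul2E !mxE /= mulr0 addr0 mulr1.
    by move: i; apply: ord2P; rewrite /= ?eqxx.
  rewrite -mul_col2 mulmxA eM -scalemxAl -mulmxA -/(v p) mxE mul_col2.
  rewrite /gT mul2E !mxE /= mulr0 add0r mulrC; congr (_ * _).
  by move: i; apply: ord2P; rewrite /= ?mulr0 ?mulr1 ?mul0r ?mul1r ?addr0 ?add0r.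
have Ou p : Obmx (u p).
  have Of : forall i, Obar (f p i 0) by move=> i; apply: Obar_Oh; case: (fP p).
  move=> i j; rewrite /u col2mx; case: ifP => _ //; rewrite mul_col2.
  by apply: ObarD; apply: ObarM => //; apply: OM.
have uu p : u p \in unitmx by case: (fP p) => _ [].
(* u is integral with integral inverse only modulo nilpotents; u1 is a genuine element of GL_2(O)
   congruent to it, and the discrepancy becomes the nilpotent e below. *)
have [u1 hu1] : exists u1 : amat D, forall p, iu (u1 p) /\ nlm (u p - u1 p).
  have h p : exists u1 : 'M[cp_F D p]_2, iu u1 /\ nlm (u p - u1).
    by have [_ [a1 a2]] := fP p; have [u1 b1 b2] := Obmx_unit (Ou p) a1 a2; exists u1.
  exists (fun p => xget 0 [set u1 | iu u1 /\ nlm (u p - u1)]) => p.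
  by case: xgetP => [y _ //|n]; have [u1 b] := h p; case: (n u1).
have uv p : emx a (v p) \in unitmx.
  have : emx a (v p) *m g0 p \in unitmx by rewrite -/(gT v p) -eg unitmx_mul ug uu.
  by rewrite unitmx_mul => /andP [].
have av : amx (fun p => emx a (v p)).
  have [ar _] : is_adele (fun p => loc D p a) /\ True by split=> //; apply: adele_map.
  apply/amx_aev; have := aev_and ((amx_aev _).1 ag) ar; apply: aev_imp => p [o1 o2].
  have ov i : Oh (v p i 0) by rewrite /v mul_col2; have [fO _] := fP p; apply: OhD; apply: OhM.
  by apply: ord2P; apply: ord2P; rewrite emxs //; apply: OhM.
have Tv : Tor v.
  apply: GL2AI => //; apply/amx_aev.
  have [_ fr] := idele_loc D (r_neq0 HS) (su_r1 HS).
  apply: aev_imp (aev_and (aev_and ((amx_aev _).1 av) ((amx_aev _).1 agi)) fr) => p [[o1 o2] [o3 o4]].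
  suff [_ _ //] : iu (emx a (v p)); apply: iu_det => //.
  have d1 : \det (emx a (v p)) = \det (g1 p) * \det (u p) * rho p.
    have : \det (g1 p *m u p) = \det (emx a (v p)) * (rho p)^-1.
      by rewrite eg /gT det_mulmx [\det (g0 p)]det2 !mxE /= mul1r mulr0 subr0.
    by rewrite det_mulmx => ->; rewrite (divrK (ur p)).
  apply: Oh_inv; rewrite -?unitmxE //; first by rewrite det2; apply: OhB; apply: OhM.
  have ud1 : \det (g1 p) \is a GRing.unit by rewrite -unitmxE.
  have ud2 : \det (u p) \is a GRing.unit by rewrite -unitmxE.
  rewrite d1 (invrM _ (ur p)) ?unitrM ?ud1 // (invrM ud1 ud2).
  apply: ObarM; first exact: Obar_Oh.
  apply: ObarM; first by have [_ []] := fP p.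
  by rewrite -det_inv; apply: Obar_Oh; rewrite det2; apply: OhB; apply: OhM.
exists v => //; pose e p := g1 p *m ((u p - u1 p) *m invmx (u1 p)) *m invmx (g1 p).
have uu1 p : u1 p \in unitmx by case: (hu1 p) => [[]].
have e1 p : 1%:M + e p = gT v p *m invmx (u1 p) *m invmx (g1 p).
  rewrite -eg /e mulmxBl mulmxBr mulmxV // mulmx1 mulmxBl mulmxV // addrC subrK.
  by rewrite !mulmxA.
have gu1 : GL2O u1 by move=> p; case: (hu1 p).
have he : nil_mx e.
  apply/nil_mxP; split; last first.
    by move=> p; apply: nlm_mulr; apply: nlm_mull; apply: nlm_mulr; case: (hu1 p).
  have -> : e = fun p => gT v p *m invmx (u1 p) *m invmx (g1 p) + - 1%:M.
    by apply: functional_extensionality_dep => p; rewrite -e1 addrAC subrr add0r.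
  apply: amxD; last by apply: amxN; apply: amx1.
  apply: amxM => //; apply: amxM; first by case: (GL2A_amx (GL2A_gT HS Tv)).
  by case: (GL2A_amx (GL2O_A gu1)).
exists 1%:M, u1, (fun p => 1), e; split; first by split=> //; [exact: unitmx1|exact: idele1].
split; last by rewrite conj_red1.
apply: functional_extensionality_dep => p; rewrite /gact map_mx1 scale1r mul1mx /= e1.
by rewrite mulmxKV // mulmxKV.
Qed.

Definition actE v g : amat D := fun p => emx a (v p) *m g p.

Lemma fix_Phi0 c : c \in unitmx -> conj_red c Phi0 = Phi0 -> map_mx red c *m Phi0 = Phi0 *m map_mx red c.
Proof.
move=> uc e; rewrite -[in RHS]e /conj_red mulmxKV //; exact: redm_unit.
Qed.

Lemma comm_Phi0 (N : 'M[X]_2) : N *m Phi0 = Phi0 *m N -> N 1 1 = N 0 0 /\ N 0 1 = a * N 1 0.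
Proof.
move=> e; have e1 : (N *m Phi0) 1 0 = (Phi0 *m N) 1 0 by rewrite e.
have e2 : (N *m Phi0) 0 0 = (Phi0 *m N) 0 0 by rewrite e.
move: e1 e2; rewrite !mul2E !mxE /= !mulr0 !mul0r !mulr1 !mul1r !add0r !addr0.
by move=> -> ->.
Qed.

Lemma tmxC p (w : 'cV[cp_F D p]_2) : emx a w *m tmx p = tmx p *m emx a w.
Proof. exact: emxC. Qed.

Lemma emx_fix v : Tor v -> forall p, nlm (locm p Phi0 - emx a (v p) *m locm p Phi0 *m invmx (emx a (v p))).
Proof.
move=> [uv _] p; apply: (@nlm_trans _ _ _ _ _ (tmx p)); first exact: locm_Phi0.
have -> : tmx p = emx a (v p) *m tmx p *m invmx (emx a (v p)) by rewrite tmxC mulmxK.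
apply: nlm_congM; last exact: nlm_refl.
by apply: nlm_congM; [exact: nlm_refl|apply: nlm_sym; exact: locm_Phi0].
Qed.

(** c commutes with tau only after reduction. Its first column defines cE, multiplication by an
    element of F + F tau, which commutes with w exactly. Then c = cE (1 + ep) with ep nilpotent and
    global, and global nilpotents pair to zero. *)
Lemma lrel_torus w g g' z z' : Tor w -> lrel ((g, Phi0), z) ((g', Phi0), z') ->
  lrel ((actE w g, Phi0), z) ((actE w g', Phi0), z').
Proof.
move=> Tw [c [u [t [e [[[uc gu iz he] /= [e1 e2]] e3]]]]].
have [cb1 cb2] := comm_Phi0 (fix_Phi0 uc (esym e2)); move: cb1 cb2; rewrite !mxE => cb1 cb2.
pose cE : 'M[se_F C]_2 := \matrix_(i, j) if j == 0 then c i 0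
   else if i == 0 then Defs.lift C a * c 1 0 else c 0 0.
have rE : map_mx red cE = map_mx red c.
  by apply: mx2P; rewrite !mxE //= rmorphM /= red_lift.
have uE : cE \in unitmx.
  by rewrite unitmxE; apply: F_unit; rewrite -det_map_mx rE -unitfE -unitmxE redm_unit.
pose vE : ecol D := fun p => \col_i jj p (c i 0).
have jE p : map_mx (jj p) cE = emx a (vE p).
  by apply: mx2P; rewrite emxs !mxE //= rmorphM.
pose ep := invmx cE *m c - 1%:M.
have rep : map_mx red ep = 0.
  by rewrite map_mxB map_mxM map_mx1 redm_inv // rE mulVmx ?subrr // redm_unit.
have nep := nil_mx_global D rep.
pose ee p := adiag D ep p + e p; have nee : nil_mx ee by apply: nil_mxD.
have [uw _] := Tw; have [aw awi] := GL2A_amx Tw.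
pose e' p := emx a (w p) *m ee p *m invmx (emx a (w p)).
exists cE, u, t, e'; split; last first.
  rewrite e3 /=; congr (psi _ * _); rewrite (pair_conj eta Tw (emx_fix Tw) nee).
  by rewrite (pairD HS) // (pair_global HS) // add0r.
split; first by split=> //; apply: nil_mx_conj.
split; last first.
  by rewrite /= {1}e2 /conj_red rE.
rewrite /= /actE e1; apply: functional_extensionality_dep => p; rewrite /gact.
have -> : 1%:M + e' p = emx a (w p) *m (1%:M + ee p) *m invmx (emx a (w p)).
  by rewrite mulmxDr mulmx1 mulmxDl mulmxV.
have -> : map_mx (jj p) c *m ((1%:M + e p) *m g p *m u p) =
   map_mx (jj p) cE *m ((1%:M + ee p) *m g p *m u p).
  have ec : c = cE *m (1%:M + ep) by rewrite /ep addrC subrK mulKVmx.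
  have h0 : adiag D ep p *m e p = 0 by apply: nlm_mul0; exact: nil_mx_nlm.
  rewrite {1}ec map_mxM map_mxD map_mx1 -mulmxA; congr (_ *m _); rewrite !mulmxA; congr (_ *m _ *m _).
  by rewrite mulmxDr mulmx1 mulmxDl mul1mx h0 addr0 /ee addrA.
rewrite -scalemxAr; congr (_ *: _); rewrite jE !mulmxA (emxC a (w p) (vE p)).
by rewrite mulmxKV.
Qed.

Lemma actE_gT v w : actE w (gT v) = gT (emul a w v).
Proof. by apply: functional_extensionality_dep => p; rewrite /actE /gT /emul emxM mulmxA. Qed.

(** The adelic centralizer of tau modulo nilpotents; conjugation by it preserves the pairing with
    tau. *)
Definition Tau (th : amat D) := GL2A th /\
  forall p, nlm (locm p Phi0 - th p *m locm p Phi0 *m invmx (th p)).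

(* The automorphisms of the adelic lattice [g0]. *)
Definition GK (m : amat D) := exists2 u, GL2O u & m = fun p => g0 p *m u p *m invmx (g0 p).

Lemma GKM m m' : GK m -> GK m' -> GK (fun p => m p *m m' p).
Proof.
move=> [u gu ->] [u' gu' ->]; exists (fun p => u p *m u' p); first exact: GL2OM.
apply: functional_extensionality_dep => p.
by rewrite !mulmxA (mulmxKV (unit_g0 HS p)).
Qed.

Lemma GKV m : GK m -> GK (fun p => invmx (m p)).
Proof.
move=> [u gu ->]; exists (fun p => invmx (u p)); first exact: GL2OV.
apply: functional_extensionality_dep => p; have ug := unit_g0 HS p.
have [uu _ _] := gu p.
by rewrite invmxM ?unitmx_mul ?ug ?unitmx_inv // (invmxM ug uu) invmxK mulmxA.
Qed.

Lemma TauM th th' : Tau th -> Tau th' -> Tau (fun p => th p *m th' p).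
Proof.
move=> [G f] [G' f']; have [u _] := G; have [u' _] := G'; split; first exact: GL2AM.
move=> p; apply: nlm_trans (f p) _; rewrite invmxM // !mulmxA.
rewrite -(mulmxA (th p) (th' p)) -(mulmxA (th p) (th' p *m _)).
by apply: nlm_congM; [apply: nlm_congM; [exact: nlm_refl|exact: f']|exact: nlm_refl].
Qed.

Lemma TauV th : Tau th -> Tau (fun p => invmx (th p)).
Proof.
move=> [G f]; have [u _] := G; split; first exact: GL2AV.
move=> p; rewrite invmxK.
have h : nlm (invmx (th p) *m (locm p Phi0) *m th p - invmx (th p) *m (th p *m locm p Phi0 *m invmx (th p)) *m th p).
  by apply: nlm_congM; [apply: nlm_congM; [exact: nlm_refl|exact: f]|exact: nlm_refl].
by apply: nlm_sym; move: h; rewrite !mulmxA mulVmx // mul1mx mulmxKV.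
Qed.

(* [th] stabilizes [g0] modulo nilpotents, and [n] is the pairing with tau of the nilpotent correction;
   it is additive in [th], odd under [sig], and zero when [th] reduces to 1 ([tk_global]). *)
Definition tk (n : k) (th : amat D) := exists e, [/\ nil_mx e, pr Phi0 e = n &
  GK (fun p => th p *m (1%:M + e p))].

Lemma tkM n n' th th' : Tau th -> Tau th' -> tk n th -> tk n' th' -> tk (n + n') (fun p => th p *m th' p).
Proof.
move=> Tt Tt' [e [ne <- G]] [e' [ne' <- G']].
have [Gt' f'] := Tt'; have [at' ait'] := GL2A_amx Gt'; have [u' _] := Gt'.
have TV := TauV Tt'; have [GV fV] := TV.
pose e1 p := invmx (th' p) *m e p *m invmx (invmx (th' p)).
have ne1 : nil_mx e1.
  have -> : e1 = fun p => invmx (th' p) *m e p *m th' p.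
    by apply: functional_extensionality_dep => p; rewrite /e1 invmxK.
  exact: nil_mx_conj.
exists (fun p => e1 p + e' p); split; first exact: nil_mxD.
  by rewrite (pairD HS _ ne1 ne') (pair_conj eta GV fV ne).
have := GKM G G'; congr GK; apply: functional_extensionality_dep => p.
have h0 : e1 p *m e' p = 0 by apply: nlm_mul0; exact: nil_mx_nlm.
have -> : 1%:M + (e1 p + e' p) = (1%:M + e1 p) *m (1%:M + e' p).
  by rewrite mulmxDr mulmx1 mulmxDl mul1mx h0 addr0 addrA.
rewrite !mulmxA; congr (_ *m _); rewrite -!mulmxA; congr (_ *m _).
by rewrite mulmxDr mulmx1 /e1 invmxK !mulmxA mulmxV // mul1mx mulmxDl mul1mx.
Qed.

Lemma tkV n th : Tau th -> tk n th -> tk (- n) (fun p => invmx (th p)).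
Proof.
move=> Tt [e [ne <- G]]; have [Gt f] := Tt; have [at_ ait] := GL2A_amx Gt; have [u _] := Gt.
pose e1 p := th p *m e p *m invmx (th p).
have ne1 : nil_mx e1 by apply: nil_mx_conj.
exists (fun p => - e1 p); split; first exact: nil_mxN.
  by rewrite (pairN HS _ ne1) (pair_conj eta Gt f ne).
have := GKV G; congr GK; apply: functional_extensionality_dep => p.
have n1 := nil_mx_nlm ne p; have u1 := unit_1nlm n1.
rewrite (invmxM (u p) u1) (inv_1nlm n1) /e1 mulmxBl mulmxBr mulmx1 mul1mx.
by rewrite !mulmxA mulVmx // mul1mx.
Qed.

(** The involution sigma, tau to -tau, in the basis (1, tau). *)
Definition smx (K : comUnitRingType) : 'M[K]_2 :=
  \matrix_(i, j) if i == j then (if i == 0 then 1 else -1) else 0.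

Lemma smxK (K : comUnitRingType) : smx K *m smx K = 1%:M.
Proof. by apply: mx2P; rewrite mul2E !mxE /= ?mulr0 ?mul0r ?mulr1 ?addr0 ?add0r ?mulrNN ?mulr1. Qed.

Lemma smx_unit (K : comUnitRingType) : smx K \in unitmx.
Proof. by case: (mulmx1_unit (smxK K)). Qed.

Lemma smx_inv (K : comUnitRingType) : invmx (smx K) = smx K.
Proof. by rewrite -[RHS](mulKmx (smx_unit K)) smxK mulmx1. Qed.

Lemma smx_map (K K' : comUnitRingType) (f : {rmorphism K -> K'}) : map_mx f (smx K) = smx K'.
Proof.
by apply: mx2P; rewrite !mxE /= ?rmorph0 ?rmorph1 ?rmorphN1.
Qed.

Lemma smx_Phi0 : smx X *m Phi0 *m smx X = - Phi0.
Proof.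
by apply: mx2P; rewrite mul2E !mul2E !mxE /=; ring.
Qed.

Lemma smx_g0 p : smx _ *m g0 p = g0 p *m smx _.
Proof.
by apply: mx2P; rewrite !mul2E !mxE /=; ring.
Qed.

Lemma iu_smx p : iu (smx (cp_F D p)).
Proof.
have i : intmx (smx (cp_F D p)).
  move=> i j; rewrite mxE; case: ifP => _; last exact: Oh0.
  by case: ifP => _; [exact: Oh1|apply: OhN; exact: Oh1].
by split; rewrite ?smx_unit ?smx_inv.
Qed.

Definition sig (th : amat D) : amat D := fun p => smx _ *m th p *m smx _.

Lemma locm_smx p : nlm (locm p (- Phi0) - smx _ *m locm p Phi0 *m smx _).
Proof.
have := locm_conj_red D p Phi0 (smx_unit (se_F C)).
by rewrite /conj_red !smx_map !smx_inv smx_Phi0.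
Qed.

Lemma GK_sig m : GK m -> GK (sig m).
Proof.
move=> [u gu ->]; exists (fun p => smx _ *m u p *m smx _).
  by move=> p; apply: iuM; [apply: iuM => //|]; exact: iu_smx.
apply: functional_extensionality_dep => p; rewrite /sig.
have ug := unit_g0 HS p.
have e : invmx (g0 p) *m smx _ = smx _ *m invmx (g0 p).
  by rewrite -[LHS](mulmxK ug) -(mulmxA (invmx (g0 p))) smx_g0 mulKmx.
by rewrite !mulmxA smx_g0 -!mulmxA e.
Qed.

Lemma GL2A_sig th : GL2A th -> GL2A (sig th).
Proof.
move=> G; have Gs : GL2A (fun p => smx (cp_F D p)) by apply: GL2O_A => p; apply: iu_smx.
by apply: GL2AM => //; apply: GL2AM.
Qed.

Lemma sig_inv th p : th p \in unitmx -> invmx (sig th p) = smx _ *m invmx (th p) *m smx _.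
Proof.
move=> u; rewrite /sig invmxM ?smx_unit ?unitmx_mul ?smx_unit ?u //.
by rewrite invmxM ?smx_unit // smx_inv mulmxA.
Qed.

Lemma Tau_sig th : Tau th -> Tau (sig th).
Proof.
move=> [G f]; split; first exact: GL2A_sig.
have [u _] := G => p; rewrite sig_inv // /sig.
have h := locm_smx p.
have h1 : nlm (locm p Phi0 + smx _ *m locm p Phi0 *m smx _).
  have := nlmN (nlm_trans (nlm_sym (locmN D p Phi0)) h).
  by rewrite !opprB addrC opprK.
have h2 : nlm (smx _ *m locm p Phi0 *m smx _ - smx _ *m (th p *m locm p Phi0 *m invmx (th p)) *m smx _).
  by apply: nlm_congM; [apply: nlm_congM; [exact: nlm_refl|exact: f]|exact: nlm_refl].
have h3 : nlm (smx _ *m (th p *m (smx _ *m locm p Phi0 *m smx _) *m invmx (th p)) *m smx _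
   + smx _ *m (th p *m locm p Phi0 *m invmx (th p)) *m smx _).
  rewrite -mulmxDl; apply: nlm_mulr; rewrite -mulmxDr; apply: nlm_mull.
  by rewrite -mulmxDl; apply: nlm_mulr; rewrite -mulmxDr; apply: nlm_mull; rewrite addrC.
have zm (M : zmodType) (x b c y : M) : x + b - (b - c) - (y + c) = x - y.
  by rewrite opprB addrACA subrr addr0 opprD addrACA subrr addr0.
by have := nlmB (nlmB h1 h2) h3; rewrite zm !mulmxA.
Qed.

Lemma tk_sig n th : tk n th -> tk (- n) (sig th).
Proof.
move=> [e [ne <- G]].
have Gs : GL2A (fun p => smx (cp_F D p)) by apply: GL2O_A => p; apply: iu_smx.
have nl_e : nil_mx (fun p => smx _ *m e p *m invmx (smx (cp_F D p))).
  by have [a1 a2] := GL2A_amx Gs; apply: nil_mx_conj.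
exists (fun p => smx _ *m e p *m invmx (smx (cp_F D p))); split=> //.
  rewrite -[Phi0 in LHS]opprK (pairNl HS) //; congr (- _); apply: pair_conj => //.
  by move=> p; rewrite smx_inv; apply: locm_smx.
have := GK_sig G; congr GK; apply: functional_extensionality_dep => p.
rewrite /sig smx_inv; set S := smx _.
have -> : 1%:M + S *m e p *m S = S *m (1%:M + e p) *m S.
  by rewrite mulmxDr mulmx1 mulmxDl smxK.
by rewrite !mulmxA -(mulmxA (S *m th p) S S) smxK mulmx1.
Qed.

(** Writing c = 1 + ep, the product c (1 + e) = 1 + (ep + e) stabilizes g0, so ep + e pairs to zero
    by [pair_int]; the global part ep pairs to zero by itself. *)
Lemma tk_global n th c : th = adiag D c -> map_mx red c = 1%:M -> tk n th -> n = 0.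
Proof.
move=> -> rc [e [ne <- [u gu eG]]].
have G0 : higgs eta a (g0, Phi0).
  have := higgs_T HS (Tor1 D a); congr (higgs _ _ (_, _)).
  by apply: functional_extensionality_dep => p; rewrite /gT emx1 mul1mx.
pose ep := c - 1%:M; have rep : map_mx red ep = 0 by rewrite map_mxB rc map_mx1 subrr.
have ec : c = 1%:M + ep by rewrite /ep addrC subrK.
clearbody ep; have nep := nil_mx_global D rep.
have h p : adiag D ep p + e p = g0 p *m (u p - 1%:M) *m invmx (g0 p).
  have ug := unit_g0 HS p.
  rewrite mulmxBr mulmx1 mulmxBl mulmxV //.
  have <- : adiag D c p *m (1%:M + e p) = g0 p *m u p *m invmx (g0 p).
    by move: eG => /(congr1 (fun f => f p)).
  have -> : c = 1%:M + ep by rewrite ec.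
  have h0 : adiag D ep p *m e p = 0 by apply: nlm_mul0; exact: nil_mx_nlm.
  rewrite /adiag in h0 *; rewrite map_mxD map_mx1 mulmxDr mulmx1 mulmxDl mul1mx h0 addr0.
  by rewrite [RHS]addrAC [1%:M + _]addrC addrK.
transitivity (pr Phi0 (fun p => adiag D ep p + e p)).
  by rewrite (pairD HS _ nep ne) (pair_global HS) // add0r.
rewrite -[RHS](pair_int HS G0 (N := fun p => u p - 1%:M)); last first.
  move=> p; split; last by apply: intB; [case: (gu p)|exact: int1].
  have ug := unit_g0 HS p.
  have -> : u p - 1%:M = invmx (g0 p) *m (adiag D ep p + e p) *m g0 p.
    by rewrite h !mulmxA mulVmx // mul1mx mulmxKV.
  by apply: nlm_mulr; apply: nlm_mull; apply: nlmD; exact: nil_mx_nlm.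
by congr (pr _ _); apply: functional_extensionality_dep => p; apply: h.
Qed.

Lemma tkX n th m : Tau th -> tk n th -> tk (n *+ m) (fun p => (th p : 'M_2) ^+ m) /\ Tau (fun p => (th p : 'M_2) ^+ m).
Proof.
move=> Tt ht; elim: m => [|m [IH1 IH2]].
  have T1 : Tau (fun p => 1%:M).
    split; first exact: (GL2O_A (GL2O1 D)).
    by move=> p; rewrite invmx1 mul1mx mulmx1; exact: nlm_refl.
  split; last by [].
  exists (fun p => 0); split; [exact: nil_mx0|exact: pair0 HS _|].
  exists (fun p => 1%:M); first exact: GL2O1.
  by apply: functional_extensionality_dep => p; rewrite addr0 !mulmx1 mulmxV // (unit_g0 HS).
rewrite mulrS; have -> : (fun p => (th p : 'M_2) ^+ m.+1) = (fun p => th p *m th p ^+ m).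
  by apply: functional_extensionality_dep => p; rewrite exprS mulmxE.
by split; [exact: tkM|exact: TauM].
Qed.

Lemma nat_collision (T : choiceType) (A : set T) (f : nat -> T) : finite_set A ->
  (forall n, A (f n)) -> exists i j, (i < j)%N /\ f i = f j.
Proof.
move=> fA hf; apply: contrapT => h.
have inj : injective f.
  move=> i j e; apply: contrapT => /eqP; rewrite neq_ltn => /orP [l|l]; apply: h.
    by exists i, j.
  by exists j, i.
apply: infinite_nat; apply: sub_finite_set (finite_preimage (f := f) (B := A) _ fA).
  by move=> n _; apply: hf.
by move=> x y _ _; apply: inj.
Qed.

Lemma g0_conj_entries p (N : 'M[X]_2) : Obmx (invmx (g0 p) *m locm p N *m g0 p) ->
  V p (N 0 0) /\ V p (N 1 0 * r p).
Proof.
move=> h; split; rewrite -(Obar_loc D).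
  by have := h 0 0; rewrite (inv_g0 HS) !mul2E !mxE /= !mul1r !mul0r !addr0 mulr1 mulr0 addr0.
have := h 1 0; rewrite (inv_g0 HS) !mul2E !mxE /= !mul0r !add0r mulr1 mulr0 addr0.
by apply: Obar_cong; rewrite mulrC; apply: locM.
Qed.

Lemma comm_Phi0_det0 (N : 'M[X]_2) : N *m Phi0 = Phi0 *m N -> \det N = 0 -> N = 0.
Proof.
move=> /comm_Phi0 [e1 e2]; rewrite det2 e1 e2 => d0.
have y0 : N 1 0 = 0.
  apply: contrapT => /eqP y0; apply: (su_nsq HS (c := N 0 0 / N 1 0)).
  rewrite expr_div_n; apply: (mulIf (expf_neq0 2 y0)); rewrite divfK ?expf_neq0 //.
  by apply/eqP; rewrite eq_sym -subr_eq0 -d0; apply/eqP; ring.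
have x0 : N 0 0 = 0.
  by move: d0; rewrite y0 mulr0 subr0 => /eqP; rewrite mulf_eq0 orbb => /eqP.
by apply: mx2P; rewrite ?e1 ?e2 ?x0 ?y0 !mxE ?mulr0.
Qed.

Lemma adiagX c j : (fun p => (adiag D c p : 'M_2) ^+ j) = adiag D (c ^+ j).
Proof. by apply: functional_extensionality_dep => p; rewrite /adiag rmorphXn. Qed.

Lemma Tau_global c : c \in unitmx -> conj_red c Phi0 = Phi0 -> Tau (adiag D c).
Proof.
move=> uc e; split; first exact: GL2A_diag.
by move=> p; have := locm_conj_red D p Phi0 uc; rewrite e.
Qed.

(** The first columns of the powers of M, the reduction of c, lie in two finite spaces of sections,
    so two powers of M agree. The least order m is prime to the characteristic q: if m = m' q, the
    q-th power of M^m' - 1 vanishes, and E is a field. *)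
Lemma finite_order n c : c \in unitmx -> conj_red c Phi0 = Phi0 -> tk n (adiag D c) ->
  exists m, (m%:R : k) != 0 /\ map_mx red (c ^+ m) = 1%:M.
Proof.
move=> uc ec ht; have Tc := Tau_global uc ec.
pose M := map_mx red c; have uM : M \in unitmx by apply: redm_unit.
have cM : M *m Phi0 = Phi0 *m M by apply: fix_Phi0.
have NE j : map_mx red (c ^+ j) = M ^+ j by rewrite rmorphXn.
have cX j : M ^+ j *m Phi0 = Phi0 *m M ^+ j.
  elim: j => [|j IH]; first by rewrite expr0 -[1]/(1%:M) mul1mx mulmx1.
  by rewrite exprS -mulmxE -mulmxA IH mulmxA cM mulmxA.
have ent j p : V p ((M ^+ j) 0 0) /\ V p ((M ^+ j) 1 0 * r p).
  have [[e [ne _ [u gu eG]]] _] := tkX j Tc ht.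
  apply: g0_conj_entries; have ug := unit_g0 HS p; have [uu iu1 iu2] := gu p.
  have -> : locm p (M ^+ j) = locm p (map_mx red (c ^+ j)) by rewrite NE.
  apply: Obmx_cong (Obmx_int iu1).
  have -> : u p = invmx (g0 p) *m (adiag D (c ^+ j) p *m (1%:M + e p)) *m g0 p.
    have -> : adiag D (c ^+ j) p *m (1%:M + e p) = g0 p *m u p *m invmx (g0 p).
      by rewrite -adiagX; move: eG => /(congr1 (fun f => f p)).
    by rewrite !mulmxA mulVmx // mul1mx mulmxKV.
  apply: nlm_congM; last exact: nlm_refl.
  apply: nlm_congM; first exact: nlm_refl.
  rewrite mulmxDr mulmx1 -[X in X - _]addr0 opprD addrACA sub0r.
  apply: nlmD; first by apply: nlm_sym; apply: locm_red.
  by apply: nlmN; apply: nlm_mull; exact: nil_mx_nlm.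
have fA := finite_L DD (poles_finite C) (pidele1 (poles_finite C)).
have fB := finite_L DD (poles_finite C) (pideleV (su_r HS)).
have hAB l : (L (fun=> 1) `*` L (fun p => (r p)^-1))%classic ((M ^+ l) 0 0, (M ^+ l) 1 0).
  by split=> p; have [h1 h2] := ent l p; rewrite /= ?divr1 ?invrK.
have [i [j [lij eij]]] := nat_collision (finite_setX fA fB) hAB.
have eM : M ^+ i = M ^+ j.
  have [a1 b1] := comm_Phi0 (cX i); have [a2 b2] := comm_Phi0 (cX j).
  by case: eij => e1 e2; apply: mx2P; rewrite ?a1 ?a2 ?b1 ?b2 ?e1 ?e2.
have uX l : M ^+ l \in unitmx.
  elim: l => [|l IH]; first by rewrite expr0 unitmx1.
  by rewrite exprS -mulmxE unitmx_mul uM.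
have ex : exists m, (0 < m)%N && (M ^+ m == 1).
  exists (j - i)%N; rewrite subn_gt0 lij /=; apply/eqP.
  rewrite -[LHS](mulKmx (uX i)) mulmxE -exprD subnKC; last exact: ltnW.
  by rewrite -mulmxE -eM mulVmx.
case: (ex_minnP ex) => m /andP [m0 /eqP em] hm; exists m; split; last by rewrite NE em.
apply/eqP => mk; have [q cq] := natf0_pchar m0 (introT eqP mk); have pq := pcharf_prime cq.
have dq : (q %| m)%N by rewrite (dvdn_pcharf cq) mk.
pose m' := (m %/ q)%N; have em' : m = (m' * q)%N by rewrite divnK.
have m'0 : (0 < m')%N by rewrite divn_gt0 ?prime_gt0 // dvdn_leq.
have qX : (q%:R : X) = 0.
  by rewrite -(rmorph_nat (ff_const X)) (pcharf0 cq) rmorph0.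
have qM : q \in [pchar 'M[X]_2].
  rewrite inE pq /=; apply/eqP.
  by rewrite -[LHS](@scaler_nat X) qX scale0r.
have M1 : M ^+ m' = 1.
  have z : (M ^+ m' - 1) ^+ q = 0.
    rewrite -(pFrobenius_autE qM) pFrobenius_autB_comm; last by rewrite /GRing.comm mulr1 mul1r.
    by rewrite !pFrobenius_autE expr1n -exprM -em' em subrr.
  apply/eqP; rewrite -subr_eq0; apply/eqP; apply: comm_Phi0_det0.
    by rewrite mulmxBl mulmxBr cX mul1mx mulmx1.
  have detX l (A : 'M[X]_2) : \det (A ^+ l) = (\det A) ^+ l.
    by elim: l => [|l IH]; [rewrite !expr0 det1|rewrite !exprS -mulmxE det_mulmx IH].
  have := detX q (M ^+ m' - 1); rewrite z det0 => /esym /eqP.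
  by rewrite expf_eq0 => /andP [_ /eqP].
have := hm m'; rewrite m'0 M1 eqxx => /(_ isT); rewrite em'.
by have := prime_gt1 pq; nia.
Qed.

Lemma torsion z : lrel ((g0, Phi0), 1) ((g0, Phi0), z) -> z = 1.
Proof.
move=> [c [u [t [e [[[uc gu it ne] /= [e1 e2]] ->]]]]]; rewrite mulr1.
suff -> : pr Phi0 e = 0 by apply: psi0.
have Tc := Tau_global uc (esym e2).
have [ut _] := it.
pose th : amat D := fun p => t p *: adiag D c p.
have Tt : Tau th.
  have [Gc fc] := Tc; have [uj _] := Gc; split; first exact: GL2AZ.
  move=> p; rewrite /th (invmxZ' (ut p) (uj p)) -!scalemxAl -scalemxAr scalerA (mulrV (ut p)) scale1r.
  exact: fc.
have ht : tk (pr Phi0 e) th.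
  exists e; split=> //; exists (fun p => invmx (u p)); first exact: GL2OV.
  apply: functional_extensionality_dep => p; have ug := unit_g0 HS p; have [uu _ _] := gu p.
  apply: (can_inj (mulmxK ug)); rewrite mulmxKV //.
  apply: (can_inj (mulmxK uu)); rewrite mulmxKV //.
  have e1p : g0 p = gact c u t e g0 p by rewrite -e1.
  rewrite [RHS]e1p.
  by rewrite /gact /th -!scalemxAl !mulmxA.
have Ts := Tau_sig Tt; have hs := tkV Ts (tk_sig ht); rewrite opprK in hs.
have h2 := tkM Tt (TauV Ts) ht hs.
(* Dividing theta by its conjugate cancels the idele t, which is not global; what remains comes from
   GL_2(F), as [finite_order] requires. *)
pose w := c *m (smx _ *m invmx c *m smx _).
have uw : w \in unitmx by rewrite !unitmx_mul !smx_unit unitmx_inv uc.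
have ew : (fun p => th p *m invmx (sig th p)) = adiag D w.
  apply: functional_extensionality_dep => p; have uj := jj_unitmx D p uc.
  have uth : th p \in unitmx by rewrite /th (unitmxZ _ (ut p)).
  rewrite sig_inv // /th (invmxZ' (ut p) uj) -!scalemxAr -!scalemxAl -scalemxAr scalerA (mulrV (ut p)).
  by rewrite scale1r /w /adiag !map_mxM map_invmx2 // !smx_map !mulmxA.
rewrite ew in h2.
have cw : conj_red w Phi0 = Phi0.
  have ucV : invmx c \in unitmx by rewrite unitmx_inv.
  have us := smx_unit (se_F C).
  have eV : conj_red (invmx c) Phi0 = Phi0.
    by rewrite {1}e2 -conj_redM // mulVmx // conj_red1.
  have es : conj_red (smx (se_F C)) Phi0 = - Phi0 by rewrite /conj_red smx_map smx_inv smx_Phi0.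
  have eN c' : conj_red c' (- Phi0) = - conj_red c' Phi0 by rewrite /conj_red mulmxN mulNmx.
  have u1 : smx (se_F C) *m invmx c \in unitmx by rewrite unitmx_mul us.
  have u2 : smx (se_F C) *m invmx c *m smx (se_F C) \in unitmx by rewrite unitmx_mul u1.
  rewrite /w (conj_redM Phi0 u2 uc) (conj_redM _ us u1) (conj_redM _ ucV us).
  by rewrite es eN eV eN es opprK -e2.
have [m [m0 rm]] := finite_order uw cw h2.
have [h3 _] := tkX m (Tau_global uw cw) h2.
have := tk_global (adiagX w m) rm h3.
rewrite -mulr2n -mulrnA -mulr_natl natrM => /eqP; rewrite !mulf_eq0 (negbTE (su_char HS)) (negbTE m0) /=.
by move/eqP.
Qed.

End Torsion.

(** * The extension H *)

Section GroupH.
Variables (R : realType) (k : finFieldType) (X : function_field k) (C : special_extension X).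
Variables (D : completion C) (eta : adele D -> k) (a : X) (r : place X -> X).
Hypothesis HS : setup eta a r.
Variable psi : k -> R[i].
Hypothesis psi_char : nontrivial_character psi.
Implicit Types (p q : place X) (g u e : amat D) (Phi : 'M[X]_2) (c : 'M[se_F C]_2) (v w : ecol D).
Local Notation Phi0 := (mul_tau a).

Local Notation g0 := (g0 D r).
Local Notation gT := (gT a r).
Local Notation Tor := (Tor a).
Local Notation lrel := (lrel eta psi).

Lemma higgs_tr x : higgs eta a x -> \tr x.2 = 0. Proof. by case. Qed.

Lemma lclassE x : \tr x.1.2 = 0 -> lclass eta psi x = [set y | lrel x y].
Proof. by move=> tx; apply/seteqP; split=> y /=; apply (lrep_equivP HS psi y tx). Qed.

Lemma lrel_set x y : [set w | lrel x w] = [set w | lrel y w] <-> lrel x y.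
Proof.
split=> [e|h].
  have : [set w | lrel y w] y by apply: (lrel_refl HS psi_char).
  by rewrite -e.
apply/seteqP; split=> w /= hw; last exact: (lrel_trans HS psi_char h hw).
exact: (lrel_trans HS psi_char (lrel_sym HS psi_char h) hw).
Qed.

Lemma hclass_eq x y : higgs eta a x -> hrel x y -> hclass x = hclass y.
Proof.
move=> hx h; have hy := higgs_hrel HS h hx.
have Gx : GL2A x.1 by case: hx. 
have Gy : GL2A y.1 by case: hy.
apply/seteqP; split=> w; rewrite /hclass /= !higgs_isoP // => hw.
  exact: hrel_trans (hrel_sym h) hw.
exact: hrel_trans h hw.
Qed.

Lemma hclass_hrel x y : higgs eta a x -> higgs eta a y -> hclass x = hclass y -> hrel x y.
Proof.
move=> hx hy e; have : hclass y y by apply/higgs_isoP; [case: hy|apply: hrel_refl].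
by rewrite -e => /higgs_isoP; apply; case: hx.
Qed.

Definition tpt v (z : R[i]) : lrep D R := ((gT v, Phi0), z).
Definition tau v z : set (lrep D R) := [set y | lrel (tpt v z) y].

Lemma tauP v z v' z' : tau v z = tau v' z' <-> lrel (tpt v z) (tpt v' z').
Proof. exact: lrel_set. Qed.

Lemma tau_lclass v z : tau v z = lclass eta psi (tpt v z).
Proof. by rewrite lclassE //; apply: tr_Phi0. Qed.

Lemma tau_mul w v z v' z' t : Tor w -> tau v z = tau v' z' ->
  tau (emul a w v) (t * z) = tau (emul a w v') (t * z').
Proof.
move=> Tw /tauP h; apply/tauP; have := lrel_torus HS Tw (lrel_scale t h).
by rewrite !actE_gT.
Qed.

(** The product does not depend on representatives: [lrel_torus] handles the second factor,
    commutativity the first. *)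
Lemma tau_mul2 v w z t v' w' z' t' : Tor v -> Tor w' -> tau v z = tau v' z' -> tau w t = tau w' t' ->
  tau (emul a v w) (z * t) = tau (emul a v' w') (z' * t').
Proof.
move=> Tv Tw' e1 e2; rewrite (tau_mul z Tv e2).
by rewrite (emulC a v) (emulC a v') (mulrC z) (mulrC z'); apply: tau_mul.
Qed.

Lemma lrel_norm x y : lrel x y -> `|y.2| = `|x.2|.
Proof. by move=> [c [u [z [e [_ ->]]]]]; rewrite normrM (psi_norm psi_char) mul1r. Qed.

Lemma hclass_tau x : higgs eta a x.1 -> exists v t, [/\ Tor v, `|t| = 1 &
  lclass eta psi x = tau v (t * x.2)].
Proof.
case: x => [[g Phi] z] /= hx; have [v Tv hr] := higgs_reduce HS hx.
have [t nt lr] := hrel_lrel eta psi_char hr; exists v, t; split=> //.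
rewrite lclassE ?(higgs_tr hx) //; apply/lrel_set.
by have := lrel_scale z lr; rewrite /= mulr1 [z * t]mulrC.
Qed.

Lemma Lpsi_tau l : Lpsi eta a psi l <-> exists v z, [/\ Tor v, z != 0 & l = tau v z].
Proof.
split=> [[x [hx z0] <-]|[v [z [Tv z0 ->]]]].
  have [v [t [Tv nt e]]] := hclass_tau hx; exists v, (t * x.2); split=> //.
  by rewrite mulf_neq0 // -normr_eq0 nt oner_neq0.
exists (tpt v z); last by rewrite tau_lclass.
by split=> //=; apply: higgs_T.
Qed.

Lemma lscale_tau t v z : t != 0 -> lscale t (tau v z) = tau v (t * z).
Proof.
move=> t0; apply/seteqP; split=> [y [x hx <-]|y hy]; first exact: (lrel_scale t hx).
exists (y.1, t^-1 * y.2); last by rewrite /= mulVKf //; case: y {hy}.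
by have := lrel_scale t^-1 hy; rewrite /= mulKf.
Qed.

Record Hel := MkH { Hset : set (lrep D R);
  HsetP : exists v z, [/\ Tor v, `|z| = 1 & Hset = tau v z] }.

Implicit Types h : Hel.

Lemma Hel_eq h h' : Hset h = Hset h' -> h = h'.
Proof. by case: h => s p; case: h' => s' p' /= e; subst s'; congr MkH; apply: Prop_irrelevance. Qed.

Lemma tau_Hel v z : Tor v -> `|z| = 1 -> exists v' z', [/\ Tor v', `|z'| = 1 & tau v z = tau v' z'].
Proof. by move=> *; exists v, z. Qed.

Definition mkH v z (Tv : Tor v) (nz : `|z| = 1) : Hel := MkH (tau_Hel Tv nz).

Lemma Hel_rep (h : Hel) : exists vz : ecol D * R[i], [/\ Tor vz.1, `|vz.2| = 1 & Hset h = tau vz.1 vz.2].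
Proof. by have [v [z p]] := HsetP h; exists (v, z). Qed.

(** Multiplication is defined through chosen representatives; [HmulE] shows that any others give the
    same product. *)
Definition Hv h := (projT1 (cid (Hel_rep h))).1.
Definition Hz h := (projT1 (cid (Hel_rep h))).2.

Lemma Hrep h : [/\ Tor (Hv h), `|Hz h| = 1 & Hset h = tau (Hv h) (Hz h)].
Proof. by rewrite /Hv /Hz; case: cid. Qed.
Lemma HvT h : Tor (Hv h). Proof. by case: (Hrep h). Qed.
Lemma Hz1 h : `|Hz h| = 1. Proof. by case: (Hrep h). Qed.
Lemma HsetE h : Hset h = tau (Hv h) (Hz h). Proof. by case: (Hrep h). Qed.
Lemma norm1M (z t : R[i]) : `|z| = 1 -> `|t| = 1 -> `|z * t| = 1.
Proof. by move=> a1 b1; rewrite normrM a1 b1 mulr1. Qed.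
Lemma norm1V (z : R[i]) : `|z| = 1 -> `|z^-1| = 1.
Proof. by move=> a1; rewrite normfV a1 invr1. Qed.

Definition Hmul h h' := mkH (Tor_mul (HvT h) (HvT h')) (norm1M (Hz1 h) (Hz1 h')).
Definition Hone := mkH (Tor1 D a) (normr1 R[i]).
Definition Hinv h := mkH (Tor_inv (HvT h)) (norm1V (Hz1 h)).

Lemma HmulE h h' v z v' z' : Tor v -> Tor v' -> Hset h = tau v z -> Hset h' = tau v' z' ->
  Hset (Hmul h h') = tau (emul a v v') (z * z').
Proof. by move=> Tv Tv' e e'; apply: tau_mul2 => //; rewrite -?HsetE //; apply: HvT. Qed.

Lemma HmulA : associative Hmul.
Proof.
move=> x y z; apply: Hel_eq.
have h1 := HmulE (HvT y) (HvT z) (HsetE y) (HsetE z).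
have h2 := HmulE (HvT x) (HvT y) (HsetE x) (HsetE y).
rewrite (HmulE (HvT x) (Tor_mul (HvT y) (HvT z)) (HsetE x) h1).
by rewrite (HmulE (Tor_mul (HvT x) (HvT y)) (HvT z) h2 (HsetE z)) emulA mulrA.
Qed.
Lemma HmulC : commutative Hmul.
Proof. by move=> x y; apply: Hel_eq; rewrite /= emulC mulrC. Qed.
Lemma Hmul1 : left_id Hone Hmul.
Proof.
move=> x; apply: Hel_eq; rewrite (HmulE (h := Hone) (z := 1) (Tor1 D a) (HvT x) erefl (HsetE x)).
by rewrite emul1 mul1r -HsetE.
Qed.
Lemma HmulV : left_inverse Hone Hinv Hmul.
Proof.
move=> x; apply: Hel_eq; rewrite (HmulE (h := Hinv x) (z := (Hz x)^-1) (Tor_inv (HvT x)) (HvT x) erefl (HsetE x)).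
by rewrite emulV ?mulVf //; [rewrite -normr_eq0 Hz1 oner_neq0|exact: HvT].
Qed.
Lemma Hmul1r : right_id Hone Hmul. Proof. by move=> x; rewrite HmulC Hmul1. Qed.
Lemma HmulVr : right_inverse Hone Hinv Hmul. Proof. by move=> x; rewrite HmulC HmulV. Qed.

HB.instance Definition _ := gen_eqMixin Hel.
HB.instance Definition _ := gen_choiceMixin Hel.

Definition Hgrp : groupType :=
  HB.pack Hel (isGroup.Build Hel HmulA Hmul1 Hmul1r HmulV HmulVr).

(** The neutral element is a default value off the unit circle. *)
Definition Hi (z : R[i]) : Hgrp :=
  if pselect (`|z| = 1) is left e then mkH (Tor1 D a) e else Hone.
Definition Hq (h : Hgrp) : set (hpair D) := hclass (gT (Hv h), Phi0).

Lemma HiE z : `|z| = 1 -> Hset (Hi z) = tau (ecol1 D) z.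
Proof. by rewrite /Hi; case: pselect. Qed.

Lemma HqE (h : Hgrp) v z : Tor v -> Hset h = tau v z -> Hq h = hclass (gT v, Phi0).
Proof.
move=> Tv; rewrite HsetE => /tauP /lrel_hrel h1; apply: hclass_eq h1.
by apply: (higgs_T HS); apply: HvT.
Qed.

Lemma Hgrp_mulE (h h' : Hgrp) : (h * h')%g = Hmul h h'. Proof. by []. Qed.

Lemma spectral_gT v : Tor v -> spectral_class eta a v (hclass (gT v, Phi0)).
Proof.
move=> Tv; split; first exact: (spec_idele_T HS).
by exists (gT v) => //; apply: (pushforward_T HS).
Qed.

Lemma gT1 : gT (ecol1 D) = g0.
Proof. by apply: functional_extensionality_dep => p; rewrite /gT emx1 mul1mx. Qed.

(** [pushforward] prescribes only the lattice of g modulo nilpotents. Applied to the columns of g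
    and of g0, it makes g0^-1 g and its inverse integral, so that g0^-1 g comes from GL_2(O) modulo
    nilpotents. *)
Lemma pushforward_one g : pushforward eta a (ecol1 D) g -> hrel (g0, Phi0) (g, Phi0).
Proof.
move=> [Gg hp]; have [ug _] := Gg; have G0 := GL2A_g0 HS.
have hp' p (w : 'cV[cp_F D p]_2) : (forall i, Obar ((invmx (g p) *m w) i 0)) <->
    (forall i, Obar ((invmx (g0 p) *m w) i 0)).
  by rewrite hp emx1 invmx1 mul1mx; apply: (spec_int_g0 HS).
have cols p (M N : 'M[cp_F D p]_2) j i : (M *m col j N) i 0 = (M *m N) i j.
  by rewrite mul_col2 mul2E !mxE.
have Ocol p (M : 'M[cp_F D p]_2) : M \in unitmx -> forall j i, Obar ((invmx M *m col j M) i 0).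
  by move=> uM j i; rewrite cols mulVmx //; apply: (Obmx_int (M := 1%:M)); apply: int1.
pose M p := invmx (g0 p) *m g p; have u0 := unit_g0 HS.
have uM p : M p \in unitmx by rewrite unitmx_mul unitmx_inv u0 ug.
have OM p : Obmx (M p).
  by move=> i j; rewrite /M -cols; apply: (hp' _ _).1; apply: Ocol.
have OMi p : Obmx (invmx (M p)).
  rewrite invmxM ?unitmx_inv ?u0 // invmxK => i j.
  by rewrite -cols; apply: (hp' _ _).2; apply: Ocol.
have [u hu] : exists u : amat D, forall p, iu (u p) /\ nlm (M p - u p).
  have h p : exists u : 'M[cp_F D p]_2, iu u /\ nlm (M p - u).
    have d : Obar (\det (M p))^-1 by rewrite -det_inv; apply: Obar_det.
    by have [u b1 b2] := Obmx_unit (OM p) (uM p) d; exists u.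
  exists (fun p => xget 0 [set u | iu u /\ nlm (M p - u)]) => p.
  by case: xgetP => [y _ //|n]; have [u b] := h p; case: (n u).
have gu : GL2O u by move=> p; case: (hu p).
have nM : nil_mx (fun p => g p - g0 p *m u p).
  have [ag _] := GL2A_amx Gg; have [a0 _] := GL2A_amx G0; have [au _] := GL2A_amx (GL2O_A gu).
  apply/nil_mxP; split; first by apply: amxD => //; apply: amxN; apply: amxM.
  move=> p; have -> : g p - g0 p *m u p = g0 p *m (M p - u p).
    by rewrite mulmxBr /M mulKVmx.
  by apply: nlm_mull; case: (hu p).
apply/higgs_isoP => //; exists 1%:M, u, (fun p => 1).
split=> //; [exact: unitmx1|exact: idele1| |by rewrite conj_red1].
move=> i j; move: (nM i j); congr nil_adele; apply: functional_extensionality_dep => p.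
by rewrite /ascale /amul /adiag map_mx1 mul1mx scale1r [LHS]mxE [X in _ + X = _]mxE.
Qed.

Lemma H_extension : extension_of_HF eta a Hi Hq.
Proof.
split.
- move=> z w nz nw; apply: Hel_eq; rewrite HiE; last exact: norm1M.
  by rewrite (HmulE (Tor1 D a) (Tor1 D a) (HiE nz) (HiE nw)) emul1.
- move=> z w nz nw /(congr1 Hset); rewrite !HiE // => /tauP.
  move=> /(lrel_scale z^-1); rewrite /tpt gT1 /= mulVf; last by rewrite -normr_eq0 nz oner_neq0.
  move=> /(torsion HS psi_char) e; rewrite -[LHS]mulr1 -e mulVKf //.
  by rewrite -normr_eq0 nz oner_neq0.
- split.
    move=> h; exists (gT (Hv h), Phi0) => //; apply: (higgs_T HS); exact: HvT.
  move=> h1 h2; exists (Hv h1), (Hv h2); split; [exact: spectral_gT (HvT h1)|exact: spectral_gT (HvT h2)|].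
  rewrite (HqE (z := Hz h1 * Hz h2) (Tor_mul (HvT h1) (HvT h2))) //.
  exact: spectral_gT (Tor_mul (HvT h1) (HvT h2)).
- move=> c [[g Phi] hx <-]; have [v Tv hr] := higgs_reduce HS hx.
  exists (mkH Tv (normr1 _)); rewrite (HqE Tv (z := 1)) //; apply/esym; exact: hclass_eq.
- move=> h; split=> [[_ [g hp e]]|[z nz ->]]; last first.
    by rewrite (HqE (Tor1 D a) (HiE nz)); apply: spectral_gT; exact: Tor1.
  have h1 := pushforward_one hp.
  have hT1 : higgs eta a (g0, Phi0) by rewrite -gT1; apply: (higgs_T HS); exact: Tor1.
  have h2 : hrel (g0, Phi0) (gT (Hv h), Phi0).
    apply: hclass_hrel => //; first by apply: (higgs_T HS); exact: HvT.
    by rewrite -/(Hq h) e; apply: hclass_eq.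
  have [t nt lr] := hrel_lrel eta psi_char h2.
  have nt' : `|Hz h / t| = 1 by rewrite norm1M ?Hz1 ?norm1V.
  exists (Hz h / t) => //; apply: Hel_eq; rewrite HiE // HsetE; apply/esym/tauP.
  have := lrel_scale (Hz h / t) lr; rewrite /tpt gT1 /= mulr1 divfK //.
  by rewrite -normr_eq0 nt oner_neq0.
Qed.

Definition Lrep (l : set (lrep D R)) : ecol D * R[i] :=
  xget (ecol1 D, 1) [set vz | [/\ Tor vz.1, vz.2 != 0 & l = tau vz.1 vz.2]].

(* Every point of L_psi is [tau v z] for some [v] in the torus and nonzero [z]. *)
Definition Hact (h : Hgrp) (l : set (lrep D R)) : set (lrep D R) :=
  tau (emul a (Hv h) (Lrep l).1) (Hz h * (Lrep l).2).

Lemma LrepP v z : Tor v -> z != 0 -> [/\ Tor (Lrep (tau v z)).1, (Lrep (tau v z)).2 != 0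
  & tau v z = tau (Lrep (tau v z)).1 (Lrep (tau v z)).2].
Proof.
move=> Tv z0; rewrite /Lrep; case: xgetP => [y _ //|n].
by case: (n (v, z)).
Qed.

Lemma HactE (h : Hgrp) w t v z : Tor w -> Tor v -> z != 0 -> Hset h = tau w t ->
  Hact h (tau v z) = tau (emul a w v) (t * z).
Proof.
move=> Tw Tv z0 e; have [T' z0' e'] := LrepP Tv z0.
apply: tau_mul2 => //; [exact: HvT|by rewrite -HsetE].
Qed.

Lemma H_action : torsor_action eta a psi Hi Hq Hact.
Proof.
split.
- move=> l /Lpsi_tau [v [z [Tv z0 ->]]].
  by rewrite (HactE (h := Hone) (Tor1 D a) Tv z0 erefl) emul1 mul1r.
- move=> h1 h2 l /Lpsi_tau [v [z [Tv z0 ->]]].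
  have z0' : Hz h2 * z != 0 by rewrite mulf_neq0 // -normr_eq0 Hz1 oner_neq0.
  rewrite (HactE (HvT h2) Tv z0 (HsetE h2)).
  rewrite (HactE (HvT h1) (Tor_mul (HvT h2) Tv) z0' (HsetE h1)).
  rewrite (HactE (h := Hmul h1 h2) (Tor_mul (HvT h1) (HvT h2)) Tv z0 erefl).
  by rewrite emulA mulrA.
- move=> h z l /Lpsi_tau [v [t [Tv t0 ->]]] z0.
  rewrite lscale_tau // (HactE (HvT h) Tv _ (HsetE h)) ?mulf_neq0 //.
  by rewrite (HactE (HvT h) Tv _ (HsetE h)) // lscale_tau // mulrCA.
- move=> z l nz /Lpsi_tau [v [t [Tv t0 ->]]].
  rewrite (HactE (Tor1 D a) Tv t0 (HiE nz)) emul1 lscale_tau //.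
  by rewrite -normr_eq0 nz oner_neq0.
- move=> h x hx x0; have [v [t [Tv nt e]]] := hclass_tau hx.
  have t0 : t != 0 by rewrite -normr_eq0 nt oner_neq0.
  have h0 : Hz h != 0 by rewrite -normr_eq0 Hz1 oner_neq0.
  exists (tpt (emul a (Hv h) v) (Hz h * (t * x.2))); split=> /=.
  + by apply: (higgs_T HS); apply: Tor_mul => //; exact: HvT.
  + by rewrite !mulf_neq0.
  + by rewrite e (HactE (HvT h) Tv _ (HsetE h)) ?mulf_neq0 // tau_lclass.
  exists (Hv h), v; split; [exact: spectral_gT (HvT h)| |exact: spectral_gT (Tor_mul (HvT h) Tv)].
  have -> : hclass x.1 = hclass (gT v, Phi0); last exact: spectral_gT.
  apply: hclass_eq => //.
  have h1 : lrel x (tpt v (t * x.2)).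
    by apply/lrel_set; rewrite -/(tau _ _) -e lclassE //; apply: higgs_tr.
  exact: (lrel_hrel h1).
Qed.

End GroupH.

(** * Finiteness of the Hitchin fiber *)

Section Finiteness.
Variables (R : realType) (k : finFieldType) (X : function_field k) (C : special_extension X).
Variables (D : completion C) (eta : adele D -> k) (a : X) (r : place X -> X).
Hypothesis HS : setup eta a r.
Variable psi : k -> R[i].
Hypothesis psi_char : nontrivial_character psi.
Implicit Types (p q : place X) (Phi : 'M[X]_2) (c : 'M[se_F C]_2) (v w : ecol D).
Local Notation V := pl_ring.
Local Notation red := (se_red C).
Local Notation Oh := (@cp_O _ _ _ D _).
Local Notation jj := (cp_map D).
Local Notation nl := nilpotent_elt.
Local Notation locm p Phi := (map_mx (loc D p) Phi).
Local Notation rho p := (loc D p (r p)).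
Local Notation Phi0 := (mul_tau a).
Let DD : forall p : place X, discrete p := place_discrete D.

Let FF : forall b : X, finite_set [set p | ~ V p b] := poles_finite C.

Lemma locm1 p : nlm (locm p 1%:M - 1%:M).
Proof.
by have := locm_red D p (1%:M : 'M[se_F C]_2); rewrite !map_mx1; apply: nlm_sym.
Qed.

Lemma locm_inv p (A : 'M[X]_2) : A \in unitmx ->
  locm p A \in unitmx /\ nlm (locm p (invmx A) - invmx (locm p A)).
Proof.
move=> uA; have uL := map_lift_unit C uA; set AL := map_mx _ A in uL.
have e : locm p A = map_mx (jj p) AL by apply: locmE.
split; first by rewrite e; apply: jj_unitmx.
rewrite e -(map_invmx2 D p uL); apply: nlm_sym.
have -> : invmx A = map_mx red (invmx AL) by rewrite redm_inv // redm_lift.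
exact: locm_red.
Qed.

Lemma locm_det p (A : 'M[X]_2) : nl (loc D p (\det A) - \det (locm p A)).
Proof.
rewrite locmE det_map_mx; apply: nlc_sym.
by rewrite -[in loc D p _](redm_lift C A) det_map_mx; apply: loc_red.
Qed.

Definition Vmx p (U : 'M[X]_2) := (forall i j, V p (U i j)) /\ vunit p (\det U).

Lemma Obmx_locm p (U : 'M[X]_2) : Obmx (locm p U) <-> forall i j, V p (U i j).
Proof. by split=> h i j; have := h i j; rewrite mxE Obar_loc. Qed.

Lemma Vmx_iu p U : Vmx p U -> exists2 u, iu u & nlm (locm p U - u).
Proof.
move=> [VU [d0 _ Vd]]; have uU : U \in unitmx by rewrite unitmxE unitfE.
have [uL _] := locm_inv p uU; apply: Obmx_unit => //; first exact/Obmx_locm.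
have ud : \det (locm p U) \is a GRing.unit by rewrite -unitmxE.
apply: Obar_cong (_ : Obar (loc D p (\det U)^-1)); last by rewrite Obar_loc.
apply: nlc_sym; apply: nlc_trans (locV D p d0) _; apply: nlc_inv; first exact: loc_unit.
exact: locm_det.
Qed.

Lemma iu_Vmx p U u : iu u -> nlm (locm p U - u) -> Vmx p U.
Proof.
move=> [uu iu1 iu2] n; split.
  by apply/Obmx_locm; apply: Obmx_cong n _; apply: Obmx_int.
have nd : nl (loc D p (\det U) - \det u) by apply: nlc_trans (locm_det p U) _; apply: nl_det.
have ud : \det u \is a GRing.unit by rewrite -unitmxE.
have uld : loc D p (\det U) \is a GRing.unit by apply: unit_nl ud _.
have d0 : \det U != 0.
  by apply/eqP => e; apply: unit_not_nl uld _; rewrite e; apply: loc0.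
split=> //; rewrite -(Obar_loc D).
  by apply: Obar_cong nd _; apply: Obar_det; apply: Obmx_int.
apply: Obar_cong (locV D p d0) _; apply: Obar_cong (nlc_inv uld nd) _.
by rewrite -det_inv; apply: Obar_det; apply: Obmx_int.
Qed.

Lemma Vmx_inv p U : Vmx p U -> Vmx p (invmx U).
Proof.
move=> [VU vd]; have [d0 Vd Vdi] := vd.
have uU : U \in unitmx by rewrite unitmxE unitfE.
split; last by rewrite det_inv; apply: vunitV.
move=> i j; rewrite invmx2 // mxE; apply: VM => //; rewrite mxE.
by case: ifP => _; [case: ifP|apply: VN].
Qed.

(** Hermite normal form of a rank 2 lattice: up to the twist f, the line spanned by (1, 0), a
    quotient line measured by d, and the gluing e. With f = 1 this is the lattice of
    [short_vector]. *)
Definition nmx (f d e : X) : 'M[X]_2 :=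
  \matrix_(i, j) if i == 0 then (if j == 0 then f else f * (e * d))
                 else (if j == 0 then 0 else f * d).

Lemma nmxE f d e : ((nmx f d e 0 0 = f)%R * (nmx f d e 0 1 = f * (e * d))%R *
  (nmx f d e 1 0 = 0)%R * (nmx f d e 1 1 = f * d)%R)%type.
Proof. by rewrite !mxE. Qed.

Lemma nmx_det f d e : \det (nmx f d e) = f ^+ 2 * d.
Proof. by rewrite det2 !nmxE; ring. Qed.

Lemma nmx1 : nmx 1 1 0 = 1%:M.
Proof. by apply: mx2P; rewrite nmxE !mxE /= ?mul0r ?mulr0 ?mulr1. Qed.

Lemma nmx_unit f d e : f != 0 -> d != 0 -> nmx f d e \in unitmx.
Proof. by move=> f0 d0; rewrite unitmxE unitfE nmx_det mulf_neq0 ?expf_neq0. Qed.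

Lemma iu_entries p (b1 b2 b3 b4 : cp_F D p) (u : 'M[cp_F D p]_2) :
  u 0 0 = b1 -> u 0 1 = b2 -> u 1 0 = b3 -> u 1 1 = b4 ->
  Oh b1 -> Oh b2 -> Oh b3 -> Oh b4 -> Ohu (b1 * b4 - b2 * b3) -> iu u.
Proof.
move=> <- <- <- <- o1 o2 o3 o4 od; apply: iu_det; last by rewrite det2.
by apply: ord2P; apply: ord2P.
Qed.

Lemma OhuN p (x : cp_F D p) : Ohu x -> Ohu (- x).
Proof. by move=> [u o oi]; split; rewrite ?unitrN ?invrN //; apply: OhN. Qed.

(** Of the two bottom entries one divides the other modulo nilpotents, so a column operation clears
    the lower left one. *)
Lemma bottom_left p (g : 'M[cp_F D p]_2) : exists2 u, iu u & nl ((g *m u) 1 0).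
Proof.
pose u1 y : 'M[cp_F D p]_2 := \matrix_(i, j) if i == 0 then (j == 0)%:R else (if j == 0 then - y else 1).
pose u2 y : 'M[cp_F D p]_2 := \matrix_(i, j) if i == 0 then (if j == 0 then - y else 1) else (j == 0)%:R.
have i1 y : Oh y -> iu (u1 y).
  move=> Oy; apply: (@iu_entries _ 1 0 (- y) 1); rewrite ?mxE ?eqxx //=; [exact: Oh1|exact: Oh0|exact: OhN|exact: Oh1|].
  by rewrite mulr1 mul0r subr0; apply: Ohu1.
have i2 y : Oh y -> iu (u2 y).
  move=> Oy; apply: (@iu_entries _ (- y) 1 1 0); rewrite ?mxE ?eqxx //=; [exact: OhN|exact: Oh1|exact: Oh1|exact: Oh0|].
  by rewrite mulr0 mul1r sub0r; apply/OhuN/Ohu1.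
have [nc|nc] := pselect (nl (g 1 0)).
  by exists 1%:M; [exact: iu1|rewrite mulmx1].
have [nd|nd] := pselect (nl (g 1 1)).
  exists (u2 0); first by apply: i2; exact: Oh0.
  by rewrite mul2E !mxE /= oppr0 mulr0 mulr1 add0r.
have uc := not_nl_unit nc; have ud := not_nl_unit nd.
have ncd : ~ nl (g 1 0 / g 1 1) by apply: unit_not_nl; rewrite unitrM uc unitrV.
have [[y Oy ny]|] := Obar_or_inv ncd.
  exists (u1 y); first exact: i1.
  rewrite mul2E !mxE /= mulr1.
  have -> : g 1 0 + g 1 1 * - y = g 1 1 * (g 1 0 / g 1 1 - y) by rewrite mulrBr mulrCA mulrV // mulr1 mulrN.
  exact: nl_mull.
rewrite invrM ?unitrV // invrK => -[y Oy ny].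
exists (u2 y); first exact: i2.
rewrite mul2E !mxE /= mulr1.
have -> : g 1 0 * - y + g 1 1 = g 1 0 * (g 1 1 / g 1 0 - y) by rewrite mulrBr mulrCA mulrV // mulr1 mulrN addrC.
exact: nl_mull.
Qed.

Lemma hermite p (g : 'M[cp_F D p]_2) : g \in unitmx -> exists f d e,
  [/\ f != 0, d != 0 & exists2 u, iu u & nlm (g *m u - locm p (nmx f d e))].
Proof.
move=> ug; have [u1 iu1 n10] := bottom_left g; set g1 := g *m u1 in n10.
have ug1 : g1 \in unitmx by rewrite unitmx_mul ug; case: iu1.
have eg1 : g *m u1 = g1 by []; clearbody g1.
have ud : g1 0 0 * g1 1 1 \is a GRing.unit.
  apply: (@unit_nl _ _ _ _ _ (\det g1)); first by rewrite -unitmxE.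
  by rewrite det2 opprB addrC subrK; apply: nl_mull.
have [ua udd] : g1 0 0 \is a GRing.unit /\ g1 1 1 \is a GRing.unit by apply/andP; rewrite -unitrM.
have [f [u [f0 ou nu]]] := unit_loc_form (unit_not_nl ua).
have [d' [w [d'0 ow nw]]] := unit_loc_form (unit_not_nl udd).
pose d := d' / f; have d0 : d != 0 by rewrite mulf_neq0 ?invr_eq0.
have efd : f * d = d' by rewrite /d mulrC divfK.
have [[uu _ oui] [uw _ owi]] := (ou, ow).
have uld := loc_unit D p d'0; have ulf := loc_unit D p f0.
pose b := g1 0 1 * w^-1.
(* e approximates b / d' closely enough for the remaining error t to be integral, hence removable by
   the column operation [tm]. *)
have [e he] := density (b / loc D p d') (invr_neq0 d0).
pose t := (b - loc D p e * loc D p d') / loc D p f.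
have ot : Obar t.
  apply: Obar_cong he; have uldi := loc_unit D p (invr_neq0 d0).
  have -> : t = (b / loc D p d' - loc D p e) * (loc D p d' / loc D p f).
    by rewrite mulrA mulrBl divrK // /t.
  apply: nlc_mul; first exact: nlc_refl.
  apply: nlc_trans (nlc_sym (loc_div D p d' f0)) _; rewrite -/d.
  by have := nlc_inv uldi (locV D p d0); rewrite invrK => h; apply: nlc_sym.
have [t' Ot' nt] := ot.
pose dg : 'M[cp_F D p]_2 := \matrix_(i, j) if i == j then (if i == 0 then u^-1 else w^-1) else 0.
pose tm : 'M[cp_F D p]_2 := \matrix_(i, j) if i == j then 1 else (if i == 0 then - t' else 0).
have idg : iu dg.
  apply: (@iu_entries _ u^-1 0 0 w^-1); rewrite ?mxE //=; try exact: Oh0.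
  by rewrite mulr0 subr0; apply: OhuM; apply: OhuV.
have itm : iu tm.
  apply: (@iu_entries _ 1 (- t') 0 1); rewrite ?mxE //=; try exact: Oh0; try exact: Oh1; first exact: OhN.
  by rewrite mulr0 subr0 mulr1; apply: Ohu1.
exists f, d, e; split=> //; exists (u1 *m (dg *m tm)); first by apply: iuM => //; apply: iuM.
rewrite mulmxA eg1 mulmxA.
have ea : nl (g1 0 0 / u - loc D p f).
  by have := nlc_mul nu (nlc_refl u^-1); rewrite mulrK.
have ed : nl (g1 1 1 / w - loc D p d').
  by have := nlc_mul nw (nlc_refl w^-1); rewrite mulrK.
have E00 : (g1 *m dg *m tm) 0 0 = g1 0 0 / u by rewrite !mul2E !mxE /= !mulr0 mulr1 !addr0.
have E10 : (g1 *m dg *m tm) 1 0 = g1 1 0 / u by rewrite !mul2E !mxE /= !mulr0 mulr1 !addr0.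
have E01 : (g1 *m dg *m tm) 0 1 = b - g1 0 0 / u * t'.
  by rewrite !mul2E !mxE /= /b; ring.
have E11 : (g1 *m dg *m tm) 1 1 = g1 1 1 / w - g1 1 0 / u * t'.
  by rewrite !mul2E !mxE /= /b; ring.
apply: ord2P; apply: ord2P; rewrite [X in nl X]mxE [X in _ + X]mxE [X in _ - X]mxE nmxE ?E00 ?E01 ?E10 ?E11.
- exact: ea.
- apply: (@nlc_trans _ _ _ _ _ (b - loc D p f * t)).
    apply: nlc_add; first exact: nlc_refl.
    by apply: nlc_opp; apply: nlc_mul => //; apply: nlc_sym.
  rewrite /t mulrCA mulrV // mulr1 opprB addrCA subrr addr0; apply: nlc_sym.
  by rewrite mulrCA efd; apply: locM.
- apply: nlc_trans (_ : nl (_ - 0)) _; first by rewrite subr0; apply: nl_mulr; exact: n10.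
  by rewrite sub0r; apply: nlN; apply: loc0.
- rewrite efd -[loc D p d']subr0; apply: nlc_add => //; apply: nlc_opp; rewrite subr0.
  by apply: nl_mulr; apply: nl_mulr.
Qed.

Lemma GL2A_locm (A : place X -> 'M[X]_2) : (forall p, A p \in unitmx) ->
  finite_set [set p | A p <> 1%:M] -> GL2A (fun p => locm p (A p)).
Proof.
move=> uA fA; split; first by move=> p; case: (locm_inv p (uA p)).
have h1 : aev (fun p => A p = 1%:M) by apply: fA.
have u1 : map_mx (Defs.lift C) (1%:M : 'M[X]_2) \in unitmx by apply: map_lift_unit; apply: unitmx1.
have [_ h2] := GL2A_diag D u1.
apply: aev_imp (aev_and h1 h2) => p [-> h]; rewrite locmE; exact: h.
Qed.

Lemma hrelI x y c u (z : adele D) : GL2A x.1 -> GL2A y.1 -> c \in unitmx -> GL2O u -> idele z ->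
  (forall p, nlm (y.1 p - z p *: (map_mx (jj p) c *m (x.1 p *m u p)))) -> y.2 = conj_red c x.2 ->
  hrel x y.
Proof.
move=> Gx Gy uc gu iz n e; apply/higgs_isoP => //; exists c, u, z; split=> //.
have [ax _] := GL2A_amx Gx; have [ay _] := GL2A_amx Gy; have [au _] := GL2A_amx (GL2O_A gu).
have [az _] := idele_adele iz.
have N : nil_mx (fun p => y.1 p - z p *: (map_mx (jj p) c *m (x.1 p *m u p))).
  apply/nil_mxP; split=> //; apply: amxD => //; apply: amxN; apply: amxZ => //.
  by apply: amxM; [exact: amx_map|exact: amxM].
move=> i j; move: (N i j); congr nil_adele; apply: functional_extensionality_dep => p.
by rewrite [LHS]mxE [X in _ + X = _]mxE.
Qed.

Definition nfam (f d e : place X -> X) : amat D := fun p => locm p (nmx (f p) (d p) (e p)).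
Definition tidy (f d e : place X -> X) := [/\ forall p, f p != 0, forall p, d p != 0 &
  finite_set [set p | ~ [/\ f p = 1, d p = 1 & e p = 0]]].

Lemma GL2A_nfam f d e : tidy f d e -> GL2A (nfam f d e).
Proof.
move=> [f0 d0 fin]; apply: GL2A_locm => [p|]; first exact: nmx_unit.
by apply: sub_finite_set fin => p /= + [ef ed ee]; rewrite ef ed ee nmx1.
Qed.

Lemma normal_form (g : amat D) : GL2A g -> exists f d e, tidy f d e /\
  exists2 u, GL2O u & forall p, nlm (g p *m u p - nfam f d e p).
Proof.
(* The last clause imposes the trivial form wherever g is already in GL_2(O), which keeps the family
   trivial at almost all places. *)
move=> [ug fg]; pose P p (w : X * X * X * 'M[cp_F D p]_2) :=
  [/\ w.1.1.1 != 0, w.1.1.2 != 0, iu w.2,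
     nlm (g p *m w.2 - locm p (nmx w.1.1.1 w.1.1.2 w.1.2))
   & iu (g p) -> [/\ w.1.1.1 = 1, w.1.1.2 = 1 & w.1.2 = 0]].
have ex p : exists w : X * X * X * 'M[cp_F D p]_2, P p w.
  have [ig|nig] := pselect (iu (g p)).
    exists (1, 1, 0, invmx (g p)); split=> //=; rewrite ?oner_neq0 //; first exact: iuV.
    by rewrite mulmxV // nmx1; apply: nlm_sym; apply: locm1.
  have [f [d [e [f0 d0 [u i1 n]]]]] := hermite (ug p).
  by exists (f, d, e, u).
pose w p := xget (1, 1, 0, 1%:M) (P p).
have wP p : P p (w p) by rewrite /w; case: xgetP => [y _ //|n]; have [y hy] := ex p; case: (n y).
exists (fun p => (w p).1.1.1), (fun p => (w p).1.1.2), (fun p => (w p).1.2); split.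
  split=> [p|p|]; try by case: (wP p).
  apply: sub_finite_set fg => p /= h [i1 i2]; apply: h; case: (wP p) => _ _ _ _; apply.
  by split.
by exists (fun p => (w p).2) => p; case: (wP p).
Qed.

Lemma normal_hrel (g : amat D) f d e (u : amat D) Phi : GL2A g -> tidy f d e -> GL2O u ->
  (forall p, nlm (g p *m u p - nfam f d e p)) -> hrel (g, Phi) (nfam (fun=> 1) d e, Phi).
Proof.
move=> Gg td gu n; have [f0 d0 fin] := td.
have td1 : tidy (fun=> 1) d e.
  split=> //; first by move=> p; apply: oner_neq0.
  by apply: sub_finite_set fin => p /= h [ef ed ee]; apply: h.
have fV : idele (fun p => loc D p (f p)^-1).
  apply: idele_loc => [p|]; first by rewrite invr_eq0.
  by apply: sub_finite_set fin => p /= /eqP h [ef _ _]; apply: h; rewrite ef invr1.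
apply: (@hrelI (g, Phi) (nfam (fun=> 1) d e, Phi) 1%:M u _ Gg (GL2A_nfam td1) (unitmx1 _ _) gu fV);
  last by rewrite conj_red1.
move=> p /=; rewrite map_mx1 mul1mx.
apply: (@nlm_trans _ _ _ _ _ (loc D p (f p)^-1 *: nfam f d e p)); last first.
  by rewrite -scalerBr; apply: nlmZ; apply: nlm_sym.
have -> : nfam (fun=> 1) d e p = locm p ((f p)^-1 *: nmx (f p) (d p) (e p)).
  rewrite /nfam; congr (locm p _); have f0p := f0 p.
  by apply: mx2P; rewrite [RHS]mxE !nmxE ?mul1r ?mulr0 ?mulVf ?mulKf.
move=> i j; rewrite [X in nl X]mxE [X in X + _]mxE [X in loc D p X]mxE [X in _ + X]mxE [X in _ - X]mxE [locm _ _ _ _]mxE.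
exact: locM.
Qed.

(** Conjugated into this basis, tau has 1/d and e among its entries up to sign, and both must be
    regular. *)
Lemma higgs_nfam d e : tidy (fun=> 1) d e -> higgs eta a (nfam (fun=> 1) d e, Phi0) ->
  forall p, V p (d p * r p)^-1 /\ V p (e p / r p).
Proof.
move=> [_ d0 _] /(higgsP HS) [_ _ _ hO] p; have u := nmx_unit (e p) (oner_neq0 X) (d0 p).
have [uL nL] := locm_inv p u; have r0 := r_neq0 HS p.
pose B := invmx (nmx 1 (d p) (e p)) *m Phi0 *m nmx 1 (d p) (e p).
have OB : Obmx ((rho p)^-1 *: locm p B).
  apply: Obmx_cong (hO p); rewrite -scalerBr; apply: nlmZ; rewrite /B.
  apply: nlm_trans (locmM D p _ _) _; apply: nlm_congM; last exact: nlm_refl.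
  apply: nlm_trans (locmM D p _ _) _; apply: nlm_congM; last exact: nlm_refl.
  exact: nL.
have VB i j : V p (B i j / r p).
  have := OB i j; rewrite !mxE mulrC => h; apply/(Obar_locdiv D) => //.
have dn : d p != 0 := d0 p.
have eB : B = \matrix_(i, j) (if i == 0 then (if j == 0 then - e p else a * d p - e p ^+ 2 * d p)
    else (if j == 0 then (d p)^-1 else e p)).
  apply: (can_inj (mulKmx u)); rewrite /B !mulmxA mulmxV // mul1mx.
  by apply: mx2P; rewrite !mul2E !nmxE !mxE /=; field.
split; first by have := VB 1 0; rewrite eB mxE /= -invfM.
by have := VN (VB 0 0); rewrite eB mxE /= mulNr opprK.
Qed.

(** The two normal forms differ by the matrix with rows (1, (e' - e) d') and (0, d'/d). *)
Lemma hrel_nfam (d e d' e' : place X -> X) Phi : tidy (fun=> 1) d e -> tidy (fun=> 1) d' e' ->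
  (forall p, vunit p (d' p / d p) /\ V p ((e' p - e p) * d' p)) ->
  hrel (nfam (fun=> 1) d e, Phi) (nfam (fun=> 1) d' e', Phi).
Proof.
move=> td td' h; have [_ d0 _] := td; have [_ d0' _] := td'.
pose U p := invmx (nmx 1 (d p) (e p)) *m nmx 1 (d' p) (e' p).
have un p := nmx_unit (e p) (oner_neq0 X) (d0 p).
have eU p : U p = \matrix_(i, j) (if i == 0 then (if j == 0 then 1 else (e' p - e p) * d' p)
    else (if j == 0 then 0 else d' p / d p)).
  have dn : d p != 0 := d0 p.
  apply: (can_inj (mulKmx (un p))); rewrite /U !mulmxA mulmxV // mul1mx.
  by apply: mx2P; rewrite !mul2E !nmxE !mxE /=; field.
have VU p : Vmx p (U p).
  have [h1 h2] := h p; split; last by rewrite eU det2 !mxE /= mul1r mulr0 subr0.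
  rewrite eU; apply: ord2P; apply: ord2P; rewrite mxE /=; [exact: V1|exact: h2|exact: V0|by case: h1].
have [u hu] : exists u : amat D, forall p, iu (u p) /\ nlm (locm p (U p) - u p).
  have ex p : exists u : 'M[cp_F D p]_2, iu u /\ nlm (locm p (U p) - u).
    by have [u b1 b2] := Vmx_iu (VU p); exists u.
  exists (fun p => xget 0 [set u | iu u /\ nlm (locm p (U p) - u)]) => p.
  by case: xgetP => [y _ //|n]; have [u b] := ex p; case: (n u).
have gu : GL2O u by move=> p; case: (hu p).
apply: (@hrelI (nfam (fun=> 1) d e, Phi) (nfam (fun=> 1) d' e', Phi) 1%:M u _ (GL2A_nfam td)
  (GL2A_nfam td') (unitmx1 _ _) gu (idele1 D)); last by rewrite conj_red1.
move=> p /=; rewrite map_mx1 mul1mx scale1r; apply: nlm_sym.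
apply: (@nlm_trans _ _ _ _ _ (nfam (fun=> 1) d e p *m locm p (U p))).
  by apply: nlm_congM; [exact: nlm_refl|apply: nlm_sym; case: (hu p)].
apply: nlm_trans (nlm_sym (locmM D p _ _)) _.
by rewrite /U mulmxA mulmxV // mul1mx; exact: nlm_refl.
Qed.

Definition xemx (x y : X) : 'M[X]_2 :=
  \matrix_(i, j) if j == 0 then (if i == 0 then x else y) else (if i == 0 then a * y else x).

Lemma xemx_det x y : y != 0 -> \det (xemx x y) != 0.
Proof.
move=> y0; rewrite det2 !mxE /=; apply/eqP => d0; apply: (su_nsq HS (c := x / y)).
rewrite expr_div_n; apply: (mulIf (expf_neq0 2 y0)); rewrite divfK ?expf_neq0 //.
by apply/eqP; rewrite eq_sym -subr_eq0 -d0; apply/eqP; ring.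
Qed.

Lemma xemx_comm x y : xemx x y *m Phi0 = Phi0 *m xemx x y.
Proof. by apply: mx2P; rewrite !mul2E !mxE /=; ring. Qed.

Lemma idn_vunit (d d' : place X -> X) : pidele d -> pidele d' -> (forall p, vunit p (d p / d' p)) ->
  idn d = idn d'.
Proof.
move=> hd hd' h; have := idnM DD hd (pideleV hd'); rewrite (idn_unit DD h) (idnV DD hd').
by move=> /esym/divr1_eq.
Qed.

Lemma tidy_pidele f d e : tidy f d e -> [/\ pidele f, pidele d & finite_set [set p | ~ V p (e p)]].
Proof.
move=> [f0 d0 fin]; split; [split=> //|split=> //|];
  apply: sub_finite_set fin => p /= h [ef ed ee]; apply: h; rewrite ?ef ?ed ?ee; by [exact: vunit1|exact: V0].
Qed.

Lemma tidy_up (z : place X -> X) : pidele z -> exists z' : place X -> X,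
  [/\ forall p, z' p != 0, finite_set [set p | z' p != 1] & forall p, vunit p (z' p / z p)].
Proof.
move=> [z0 fz]; exists (fun p => if `[< vunit p (z p) >] then 1 else z p); split.
- by move=> p; case: asboolP => _ //; apply: oner_neq0.
- by apply: sub_finite_set fz => p /= + h; rewrite asboolT // eqxx.
- move=> p; case: asboolP => [h|_]; first by rewrite mul1r; apply: vunitV.
  by rewrite divff //; apply: vunit1.
Qed.

(* A rank 2 bundle of large degree twisted by a suitable line bundle has a section [x + y tau];
   dividing by it in E^* makes 1 a section, which bounds the degree of the quotient line bundle. *)
Lemma reduce_idn : exists K : rat, forall (g : amat D), higgs eta a (g, Phi0) ->
  exists d e, [/\ tidy (fun=> 1) d e, idn d <= K & hrel (g, Phi0) (nfam (fun=> 1) d e, Phi0)].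
Proof.
have [K K0 hK] := short_vector DD FF; exists K => g hg; have Gg : GL2A g by case: hg.
have [f [d [e [td [u gu nu]]]]] := normal_form Gg.
have hr := normal_hrel Phi0 Gg td gu nu.
have td1 : tidy (fun=> 1) d e.
  by case: td => f0 d0 fin; split=> // [p|]; [exact: oner_neq0|apply: sub_finite_set fin => p /= h [ef ed ee]; apply: h].
have [pf pd fe] := tidy_pidele td1; have [_ d0 _] := td1.
have [le|lt] := leP (idn d) K; first by exists d, e.
have [z [x [y [pz hz y0 hxy]]]] := hK d e pd fe lt.
have [z' [z'0 fz' vz']] := tidy_up pz; have z0 : forall p, z p != 0 by case: pz.
have pz' : pidele z'.
  split=> //; apply: sub_finite_set fz' => p /= h; apply: contrapT => /negP; rewrite negbK => /eqP e1.
  by apply: h; rewrite e1; apply: vunit1.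
pose W := xemx x y; have uW : W \in unitmx by rewrite unitmxE unitfE xemx_det.
have uWi : invmx W \in unitmx by rewrite unitmx_inv.
pose c := map_mx (Defs.lift C) (invmx W); have uc : c \in unitmx by apply: map_lift_unit.
have rc : map_mx red c = invmx W by apply: redm_lift.
have cc : conj_red c Phi0 = Phi0.
  by rewrite /conj_red rc invmxK -mulmxA -xemx_comm mulmxA mulVmx // mul1mx.
have iz' := idele_loc D z'0 fz'.
pose g' := gact c (fun p => 1%:M) (fun p => loc D p (z' p)) (fun p => 0) (nfam (fun=> 1) d e).
have n0 : nil_mx (fun p => 0 : 'M[cp_F D p]_2) by exact: nil_mx0.
have GN := GL2A_nfam td1.
have Gg' : GL2A g' by apply: GL2A_gact => //; exact: GL2O1.
have hr' : hrel (nfam (fun=> 1) d e, Phi0) (g', Phi0).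
  exists c, (fun p => 1%:M), (fun p => loc D p (z' p)), (fun p => 0).
  by split; [split=> //; exact: GL2O1|split].
have [f2 [d2 [e2 [td2 [u2 gu2 nu2]]]]] := normal_form Gg'.
have hr2 := normal_hrel Phi0 Gg' td2 gu2 nu2.
have td21 : tidy (fun=> 1) d2 e2.
  by case: td2 => f0 d0' fin; split=> // [p|]; [exact: oner_neq0|apply: sub_finite_set fin => p /= h [ef ed ee]; apply: h].
exists d2, e2; split=> //; last by apply: hrel_trans hr (hrel_trans hr' hr2).
have [pf2 pd2 _] := tidy_pidele td2; have [f20 d20 _] := td2.
pose A p := z' p *: (invmx W *m nmx 1 (d p) (e p)).
have uN p := nmx_unit (e p) (oner_neq0 X) (d0 p).
have uA p : A p \in unitmx by rewrite unitmxZ ?unitfE ?z'0 // unitmx_mul uWi uN.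
pose N2 p := nmx (f2 p) (d2 p) (e2 p).
have nA p : nlm (g' p - locm p (A p)).
  rewrite /g' /gact addr0 mul1mx mulmx1 -(locmE D p (invmx W)).
  apply: (@nlm_trans _ _ _ _ _ (loc D p (z' p) *: locm p (invmx W *m nmx 1 (d p) (e p)))).
    by rewrite -scalerBr; apply: nlmZ; apply: nlm_sym; apply: locmM.
  by move=> i j; rewrite !mxE; apply: nlc_sym; have := locM D p (z' p) ((invmx W *m nmx 1 (d p) (e p)) i j); rewrite !mxE.
have VU p : Vmx p (invmx (A p) *m N2 p).
  apply: (@iu_Vmx _ _ (u2 p)); first exact: gu2.
  have [uLA nLA] := locm_inv p (uA p).
  apply: nlm_trans (locmM D p _ _) _.
  apply: (@nlm_trans _ _ _ _ _ (invmx (locm p (A p)) *m (g' p *m u2 p))).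
    by apply: nlm_congM => //; apply: nlm_sym; apply: nu2.
  rewrite -[X in _ - X](mulKmx uLA); apply: nlm_congM; first exact: nlm_refl.
  by apply: nlm_congM; [exact: nA|exact: nlm_refl].
(* Both families describe the same lattice, so their determinants agree up to units; by the product
   formula for det W, idn f2^2 idn d2 = idn z^2 idn d. *)
have vdet p : vunit p (f2 p ^+ 2 * d2 p / (z' p ^+ 2 * d p / \det W)).
  have [_] := VU p; rewrite det_mulmx det_inv /A detZ det_mulmx det_inv !nmx_det expr1n mul1r.
  have zn := z'0 p; have dn := d0 p; have wn := xemx_det x y0.
  congr (vunit p _); field; by rewrite zn dn wn.
have pW := pidele_const FF (_ : \det W != 0); have {}pW := pW (xemx_det x y0).
have pz2 := pideleX DD 2 pz'; have pf22 := pideleX DD 2 pf2.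
have e1 := idn_vunit (pideleM pf22 pd2) (pideleM (pideleM pz2 pd) (pideleV pW)) vdet.
have idX (w : place X -> X) : pidele w -> idn (fun p => w p ^+ 2) = idn w ^+ 2.
  by move=> pw; rewrite expr2 -(idnM DD pw pw); congr idn; apply: funext => p; rewrite expr2.
rewrite (idnM DD pf22 pd2) (idnM DD (pideleM pz2 pd) (pideleV pW)) (idnM DD pz2 pd) (idnV DD pW) in e1.
rewrite (product_formula DD FF (xemx_det x y0)) invr1 mulr1 !idX // in e1.
rewrite (idn_vunit pz' pz vz') in e1.
pose E1 : 'cV[X]_2 := \col_j (if j == 0 then 1 else 0).
(* Division by the short vector has put (1, 0) into the new lattice. In normal form this says that
   1/f2 is integral, hence [idn f2] is at least 1. *)
have f2V p : V p (f2 p)^-1.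
  have [VUi _] := Vmx_inv (VU p).
  have V1 i : V p ((invmx (A p) *m E1) i 0).
    have [h1 h2] := hxy p; have vzi := vunitV (vz' p); rewrite invf_div in vzi.
    have [_ vz1 _] := vzi; have z'n := z'0 p; have zn := z0 p; have dn := d0 p.
    have -> : invmx (A p) *m E1 =
       \col_j if j == 0 then (x - e p * y) / z p * (z p / z' p) else y / (z p * d p) * (z p / z' p).
      apply: (can_inj (mulKmx (uA p))); rewrite !mulmxA mulmxV // mul1mx.
      apply: (can_inj (mulKmx uW)); rewrite /A -scalemxAl -scalemxAr !mulmxA mulmxV // mul1mx.
      apply/matrixP => i' j; rewrite (ord1 j); move: i'; apply: ord2P; rewrite !mxE !sum2E !nmxE !mxE /=; field; by rewrite z'n zn dn.
    by move: i; apply: ord2P; rewrite mxE /=; apply: VM.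
  have : V p ((invmx (N2 p) *m E1) 0 0).
    have uN2 := nmx_unit (e2 p) (f20 p) (d20 p).
    have -> : invmx (N2 p) = invmx (invmx (A p) *m N2 p) *m invmx (A p).
      by rewrite invmxM ?unitmx_inv // invmxK -mulmxA mulmxV // mulmx1.
    by rewrite -mulmxA mxE; apply: Vsum => i _; apply: VM.
  have uN2 := nmx_unit (e2 p) (f20 p) (d20 p).
  have -> : invmx (N2 p) *m E1 = \col_j if j == 0 then (f2 p)^-1 else 0.
    have f2n := f20 p; apply: (can_inj (mulKmx uN2)); rewrite !mulmxA mulmxV // mul1mx.
    apply/matrixP => i' j; rewrite (ord1 j); move: i'; apply: ord2P; rewrite !mxE !sum2E !nmxE !mxE /=; by field.
  by rewrite mxE.
have f2ge := idn_ge1 DD pf2 f2V.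
have d2gt := idn_gt0 DD pd2.
have hz2 : idn f2 ^+ 2 * idn d2 <= K by rewrite e1.
apply: le_trans hz2; apply: ler_peMl; first exact: ltW.
by apply: exprn_ege1.
Qed.

(** [reduce_idn] bounds the degree of d, and regularity of tau makes 1/(d r) and e/r integral. So d
    r represents an effective divisor of bounded degree, supported in a finite set by [finite_norm],
    and e matters only modulo a bounded power at these places. *)
Lemma HF_finite : exists (n : nat) (x : 'I_n -> hpair D), forall y, higgs eta a y -> exists j, hrel (x j) y.
Proof.
have [K hK] := reduce_idn; have pr_ := su_r HS; have r0 := r_neq0 HS.
pose K' := K * idn r.
(* Norms are at least 2, so an effective divisor with [idn] below 2^B has multiplicities below B and
   is supported at places of norm at most 2^B. *)
have [B hB] : exists B : nat, K' < (2 ^ B)%:R.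
  have h : 0 <= `|K'| by apply: normr_ge0.
  exists (Num.bound `|K'|); apply: le_lt_trans (ler_norm _) _.
  apply: lt_le_trans (archi_boundP h) _; rewrite ler_nat; apply: ltnW; exact: ltn_expl.
have fS := finite_norm DD FF (2 ^ B); pose S : seq (place X) := fset_set [set p | (Nrm p <= 2 ^ B)%N].
have memS p : (p \in S) = (Nrm p <= 2 ^ B)%N.
  by rewrite /S in_fset_set //; apply/idP/idP; rewrite inE.
have uS : uniq S by apply: fset_uniq.
have [T [Y [_ _ _ hY]]] := reps_family DD (fun=> B) uS.
pose I := ({ffun 'I_(size S) -> 'I_B} * T)%type.
pose kk (k0 : {ffun 'I_(size S) -> 'I_B}) p : nat :=
  if insub (index p S) is Some i then k0 i else 0%N.
pose dd k0 p := (r p)^-1 * unif p ^ (- (kk k0 p)%:Z).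
pose ee (t : T) p := if p \in S then r p * Y t p else 0.
have kk0 k0 p : p \notin S -> kk k0 p = 0%N.
  move=> h; rewrite /kk insubF //; apply/negbTE; rewrite -leqNgt.
  by rewrite leqNgt index_mem.
have dd0 k0 p : dd k0 p != 0 by rewrite mulf_neq0 ?invr_eq0 ?(unifz_neq0 DD).
have tid k0 t : tidy (fun=> 1) (dd k0) (ee t).
  split=> // [p|]; first exact: oner_neq0.
  apply: (@sub_finite_set _ _ ([set p | r p != 1] `|` [set` S])).
    move=> p /= h; have [pS|pS] := boolP (p \in S); first by right.
    left; apply/eqP => r1; apply: h; split=> //; last by rewrite /ee (negbTE pS).
    by rewrite /dd kk0 // r1 invr1 oppr0 expr0z mulr1.
  by rewrite finite_setU; split; [exact: su_r1 HS|exact: finite_seq].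
exists #|{: I}|, (fun j => let: (k0, t) := enum_val j in (nfam (fun=> 1) (dd k0) (ee t), Phi0)).
move=> [g Phi] hy; have [g1 h1] := higgs_Phi0 HS hy; have hg1 := higgs_hrel HS h1 hy.
have [d [e [td hd h2]]] := hK g1 hg1; have hN := higgs_hrel HS h2 hg1.
have VV := higgs_nfam td hN; have [_ pd fe] := tidy_pidele td; have [_ d0 _] := td.
have pdr := pideleM pd pr_.
have idnK : idn (fun p => d p * r p) <= K'.
  by rewrite (idnM DD pd pr_) ler_wpM2r // ltW // (idn_gt0 DD).
have eff q := le_trans (effective_norm DD q pdr (fun p => (VV p).1)) idnK.
have vlB q : (`|vl q (d q * r q)| < B)%N.
  have := le_lt_trans (eff q) hB; rewrite ltr_nat => h.
  rewrite ltnNge; apply/negP => hb; move: h; rewrite ltnNge => /negP; apply.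
  apply: leq_trans (_ : 2 ^ `|vl q (d q * r q)| <= _)%N; first by rewrite leq_exp2l.
  by have [->|m0] := posnP `|vl q (d q * r q)|; rewrite ?expn0 // leq_exp2r //; exact: Nrm_gt1 DD q.
have vlS q : q \notin S -> vl q (d q * r q) = 0.
  move=> qS; apply: contrapT => /eqP v0.
  have := le_lt_trans (eff q) hB; rewrite ltr_nat => h.
  move: qS; rewrite memS -ltnNge => h'.
  have : (Nrm q <= Nrm q ^ `|vl q (d q * r q)|)%N.
    by rewrite -{1}(expn1 (Nrm q)) leq_pexp2l ?absz_gt0 //; exact: ltnW (Nrm_gt1 DD q).
  by move=> h3; have := leq_trans h' (leq_trans h3 (ltnW h)); rewrite ltnn.
have dn q : d q * r q != 0 by rewrite mulf_neq0.
have vlneg q : vl q (d q * r q) <= 0.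
  by have := vl_V DD (VV q).1; rewrite vlV // oppr_ge0.
have [p0 _] := place_exists X.
pose k0 : {ffun 'I_(size S) -> 'I_B} := [ffun i : 'I_(size S) => Ordinal (vlB (nth p0 S i))].
have kkE q : (kk k0 q)%:Z = - vl q (d q * r q).
  have [qS|qS] := boolP (q \in S); last by rewrite kk0 // vlS // oppr0.
  rewrite /kk; have hi : (index q S < size S)%N by rewrite index_mem.
  by rewrite insubT ffunE /= nth_index //; have := vlneg q; lia.
have [t ht] := hY (fun p => e p / r p) (fun p _ => (VV p).2).
exists (enum_rank (k0, t)); rewrite enum_rankK.
apply: hrel_sym; apply: hrel_trans h1 (hrel_trans h2 _).
apply: hrel_nfam => // p; split.
  apply/(vunitP DD); first by rewrite mulf_neq0 ?invr_eq0.
  rewrite (vlf DD) // /dd (vlM DD) ?invr_eq0 ?(unifz_neq0 DD) // (vlV DD) // (vl_unifz DD) kkE opprK.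
  by rewrite (vlM DD) //; lia.
rewrite /dd; have [pS|pS] := boolP (p \in S); last first.
  rewrite /ee (negbTE pS) kk0 // oppr0 expr0z mulr1 sub0r mulNr; apply: VN.
  exact: (VV p).2.
have := ht p pS; rewrite /ee pS => /(vgeN (p := p)); rewrite opprB /vge => hv.
have -> : (r p * Y t p - e p) * ((r p)^-1 * unif p ^ (- (kk k0 p)%:Z)) =
   (Y t p - e p / r p) * unif p ^ (- B%:Z) * unif p ^ (B%:Z - (kk k0 p)%:Z).
  rewrite -[RHS]mulrA -expfzDr ?(unif_neq0 DD) // addrA addNr add0r mulrA; congr (_ * _).
  by field; apply: r0.
apply: VM => //; apply/(V_unifz DD); rewrite subr_ge0 lez_nat.
have kB : (kk k0 p < B)%N by move: (vlB p); have := kkE p; have := vlneg p; lia.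
exact: ltnW.
Qed.

End Finiteness.

(** * Characters of central extensions *)

(** X^n - 1 splits over the complex numbers and is separable in characteristic 0. *)
Lemma prim_root_complex (R : realType) n : (0 < n)%N -> exists z : R[i], n.-primitive_root z.
Proof.
move=> n0; pose p : {poly R[i]} := 'X^n - 1; have [r Dp] := closed_field_poly_normal p.
rewrite (monicP _) ?monicXnsubC // scale1r in Dp.
have rn1 : all n.-unity_root r by apply/allP => z; rewrite -root_prod_XsubC -Dp.
have sz_r : (n < (size r).+1)%N by rewrite -(size_prod_XsubC r id) -Dp size_XnsubC.
have [|z _ hz] := hasP (cyclic.has_prim_root n0 rn1 _ sz_r); last by exists z.
by rewrite -separable.separable_prod_XsubC -Dp cyclotomic.separable_Xn_sub_1 // pnatr_eq0 -lt0n.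
Qed.

Lemma fsum_seq (T : choiceType) (K : nzRingType) (A : set T) (r : seq T) (f : T -> K) : uniq r ->
  (forall t, A t -> f t != 0 -> t \in r) -> (forall t, t \in r -> ~ A t -> f t = 0) ->
  \sum_(t \in A) f t = \sum_(t <- r) f t.
Proof.
move=> ur h1 h2; rewrite [RHS](fsbig_seq _ _ ur).
rewrite (fsbig_widen A (A `|` [set` r])); last 2 first.
- by move=> t; left.
- by move=> t /= [[//|tr] nA]; apply: h2.
apply/esym; apply: fsbig_widen => [t|t]; first by right.
move=> /= [[At|//] nr]; apply/eqP; apply: contra_notT nr; exact: h1.
Qed.

Section Characters.
Variables (R : realType) (H : groupType) (i : R[i] -> H).
Hypothesis HC : forall g h : H, (g * h = h * g)%g.
Hypothesis iM : forall z w : R[i], U1 z -> U1 w -> i (z * w) = (i z * i w)%g.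
Variables (n : nat) (x : 'I_n -> H).
Hypothesis reps : forall h : H, exists j z, U1 z /\ h = (x j * i z)%g.
Implicit Types (h g : H) (F G : H -> R[i]) (z w : R[i]) (chi : H -> R[i]).

Lemma U1_1 : U1 (1 : R[i]). Proof. exact: normr1. Qed.
Lemma U1M z w : U1 z -> U1 w -> U1 (z * w).
Proof. by rewrite /U1 /= normrM => -> ->; rewrite mulr1. Qed.
Lemma U1V z : U1 z -> U1 z^-1. Proof. by rewrite /U1 /= normfV => ->; rewrite invr1. Qed.
Lemma U1_neq0 z : U1 z -> z != 0. Proof. by rewrite /U1 /= -normr_eq0 => ->; rewrite oner_neq0. Qed.

Lemma i1 : i 1 = 1%g.
Proof. by apply: (mulgI (i 1)); rewrite -iM ?mulr1 ?mulg1 //; exact: U1_1. Qed.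
Lemma iX z m : U1 z -> i (z ^+ m) = (i z ^+ m)%g.
Proof.
move=> hz; elim: m => [|m IH]; first by rewrite expr0 expg0 i1.
rewrite exprS expgS iM ?IH // /U1 /=; by rewrite normrX hz expr1n.
Qed.

(** Among n + 1 powers of h two lie in the same coset of U(1). *)
Lemma power_central h : exists m z, [/\ (0 < m)%N, U1 z & (h ^+ m)%g = i z].
Proof.
have ch : exists f : nat -> 'I_n * R[i], forall l, U1 (f l).2 /\ (h ^+ l)%g = (x (f l).1 * i (f l).2)%g.
  have e l : exists p : 'I_n * R[i], U1 p.2 /\ (h ^+ l)%g = (x p.1 * i p.2)%g.
    by have [j [z hz]] := reps (h ^+ l)%g; exists (j, z).
  by have [f hf] := choice e; exists f.
have [f hf] := ch.
have /injectivePn [j1 [j2 nj ej]] : ~~ injectiveb (fun l : 'I_n.+1 => (f l).1).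
  by apply/negP => /injectiveP inj; have := leq_card _ inj; rewrite !card_ord ltnn.
have gen (l1 l2 : 'I_n.+1) : (l1 < l2)%N -> (f l1).1 = (f l2).1 ->
    exists m z, [/\ (0 < m)%N, U1 z & (h ^+ m)%g = i z].
  move=> lt e; have [u1 e1] := hf l1; have [u2 e2] := hf l2.
  exists (l2 - l1)%N, ((f l2).2 / (f l1).2); split; first by rewrite subn_gt0.
    by apply: U1M => //; apply: U1V.
  apply: (mulgI (h ^+ l1)%g); rewrite -expgnDr subnKC; last exact: ltnW.
  rewrite e2 e1 -e -mulgA -iM //; last by apply: U1M => //; apply: U1V.
  by congr (_ * i _)%g; rewrite mulrCA mulfV ?mulr1 //; apply: U1_neq0.
have : (j1 != j2 :> nat) by [].
by rewrite neq_ltn => /orP [l|l]; apply: (gen _ _ l).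
Qed.

(** U(1) is divisible, so the power of h that lies in U(1) is killed by multiplying h with an m-th
    root of its inverse. *)
Lemma torsion_rep h : exists t m, [/\ U1 t, (0 < m)%N & ((h * i t) ^+ m = 1)%g].
Proof.
have [m [z [m0 hz e]]] := power_central h; pose t := m.-root z^-1.
have et : t ^+ m = z^-1 by apply: rootCK.
have ut : U1 t.
  have := U1V hz; rewrite -et /U1 /= normrX => /eqP; rewrite pexpr_eq1 ?normr_ge0 //.
  by move/eqP.
exists t, m; split=> //.
rewrite expgMn; last exact: HC.
by rewrite e -iX // et -iM ?mulfV ?i1 //; [exact: U1_neq0|exact: U1V].
Qed.

Definition equivariant F := forall h z, U1 z -> F (h * i z)%g = z^-1 * F h.
Definition eigen h F := exists l : R[i], forall g, F (h * g)%g = l * F g.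

(** Finite sums of functions satisfying P, with scalars left to P. *)
Inductive Sp (P : (H -> R[i]) -> Prop) : (H -> R[i]) -> Prop :=
| Sp_nil : Sp P (fun=> 0)
| Sp_cons F G of P F & Sp P G : Sp P (fun h => F h + G h).

Lemma SpD P F G : Sp P F -> Sp P G -> Sp P (fun h => F h + G h).
Proof.
elim=> [|F1 F2 PF1 _ IH] hG.
  by have -> : (fun h => 0 + G h) = G by apply: funext => h; rewrite add0r.
have -> : (fun h => F1 h + F2 h + G h) = (fun h => F1 h + (F2 h + G h)).
  by apply: funext => h; rewrite addrA.
by apply: Sp_cons => //; apply: IH.
Qed.
Lemma Sp_one (P : (H -> R[i]) -> Prop) F : P F -> Sp P F.
Proof.
move=> PF; have -> : F = (fun h => F h + (fun=> 0) h) by apply: funext => h; rewrite addr0.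
by apply: Sp_cons => //; exact: Sp_nil.
Qed.
Lemma Sp_bind (P Q : (H -> R[i]) -> Prop) F : (forall G, P G -> Sp Q G) -> Sp P F -> Sp Q F.
Proof. by move=> h; elim=> [|F1 F2 /h hF1 _ IH]; [exact: Sp_nil|exact: SpD]. Qed.
Lemma Sp_sum P m (f : 'I_m -> H -> R[i]) : (forall l, P (f l)) -> Sp P (fun h => \sum_(l < m) f l h).
Proof.
elim: m f => [|m IH] f hf.
  have -> : (fun h => \sum_(l < 0) f l h) = (fun=> 0) by apply: funext => h; rewrite big_ord0.
  exact: Sp_nil.
have -> : (fun h => \sum_(l < m.+1) f l h) = (fun h => f ord0 h + \sum_(l < m) f (lift ord0 l) h).
  by apply: funext => h; rewrite big_ord_recl.
by apply: Sp_cons => //; apply: IH.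
Qed.

(** Discrete Fourier transform: when g^m = 1, the projector onto the eigenvalue w^-l of translation
    by g. *)
Definition proj g m w (l : nat) F h := m%:R^-1 * \sum_(j < m) w ^+ (l * j) * F (g ^+ j * h)%g.

Lemma proj_sum g m w F h : m.-primitive_root w -> F h = \sum_(l < m) proj g m w l F h.
Proof.
move=> pw; have m0 := prim_order_gt0 pw; have mR : (m%:R : R[i]) != 0 by rewrite pnatr_eq0 -lt0n.
rewrite -mulr_sumr exchange_big /=; apply: (mulfI mR); rewrite mulVKf //.
rewrite (bigD1 (Ordinal m0)) //= [X in _ + X]big1 ?addr0; last first.
  move=> j j0; rewrite -mulr_suml.
  have -> : \sum_(l < m) w ^+ (l * j) = 0; last by rewrite mul0r.
  have nw : w ^+ j - 1 != 0.
    rewrite subr_eq0 -[1]/(w ^+ 0) (eq_prim_root_expr pw) modn_small // mod0n.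
    by apply: contra j0 => /eqP e; apply/eqP/val_inj.
  apply: (mulfI nw); rewrite mulr0.
  have -> : \sum_(l < m) w ^+ (l * j) = \sum_(l < m) (w ^+ j) ^+ l.
    by apply: eq_bigr => l _; rewrite mulnC exprM.
  by rewrite -subrX1 -exprM mulnC exprM (prim_expr_order pw) expr1n subrr.
under eq_bigr => l _ do rewrite muln0 expr0 expg0 mul1g mul1r.
by rewrite sumr_const card_ord mulr_natl.
Qed.

Lemma proj_eigen g m w l F : m.-primitive_root w -> (g ^+ m = 1)%g -> eigen g (proj g m w l F).
Proof.
move=> pw gm; have w0 : w != 0 by rewrite (prim_root_eq0 pw) -lt0n (prim_order_gt0 pw).
exists (w ^+ l)^-1 => h; apply: (mulfI (expf_neq0 l w0)); rewrite mulVKf ?expf_neq0 //.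
rewrite /proj mulrCA; congr (_ * _); rewrite mulr_sumr.
have -> : \sum_(j < m) w ^+ l * (w ^+ (l * j) * F (g ^+ j * (g * h))%g) =
    \sum_(j < m) w ^+ (l * j.+1) * F (g ^+ j.+1 * h)%g.
  by apply: eq_bigr => j _; rewrite mulrA -exprD mulnS mulgA -expgSr.
have m0 := prim_order_gt0 pw; case: m pw gm m0 => // m pw gm _.
rewrite big_ord_recr big_ord_recl /= muln0 expr0 expg0 mulnC exprM (prim_expr_order pw) expr1n gm.
by rewrite addrC; congr (_ + _); apply: eq_bigr.
Qed.

Lemma proj_equivariant g m w l F : equivariant F -> equivariant (proj g m w l F).
Proof.
move=> hF h z hz; rewrite /proj mulrCA; congr (_ * _); rewrite mulr_sumr.
by apply: eq_bigr => j _; rewrite mulgA hF // mulrCA.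
Qed.

Lemma eigen_proj g' g m w l F : eigen g' F -> eigen g' (proj g m w l F).
Proof.
move=> [c hc]; exists c => h; rewrite /proj mulrCA; congr (_ * _); rewrite mulr_sumr.
by apply: eq_bigr => j _; rewrite mulgA (HC _ g') -mulgA hc mulrCA.
Qed.

Definition scaled_inv F := exists c chi, ext_char i chi /\ F = (fun h => c * (chi h)^-1).

(** The eigenvalue of translation by h is multiplicative in h and equals z^-1 on U(1), so its
    inverse is a character; evaluation at 1 recovers F. *)
Lemma common_eigen F : equivariant F -> (forall h, eigen h F) -> Sp scaled_inv F.
Proof.
move=> eF hF; have [F0|] := pselect (forall h, F h = 0).
  by rewrite (funext F0 : F = fun=> 0); exact: Sp_nil.
move=> /existsNP [h0 /eqP n0].
have [lam hl] := choice hF.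
have lE h : lam h = F (h * h0)%g / F h0 by rewrite hl mulfK.
have l1 : lam 1%g = 1 by rewrite lE mul1g divff.
have lM h g : lam (h * g)%g = lam h * lam g.
  by rewrite lE -mulgA hl hl mulrA mulfK.
have li z : U1 z -> lam (i z) = z^-1.
  by move=> hz; rewrite lE HC eF // mulfK.
apply: Sp_one; exists (F 1%g), (fun h => (lam h)^-1); split.
  split; first by rewrite l1 invr1.
    by move=> h g; rewrite lM invfM.
  by move=> z hz; rewrite li // invrK.
by apply: funext => h; rewrite invrK -{1}(mulg1 h) hl mulrC.
Qed.

(* Adjusting coset representatives by U(1) makes them of finite order; they then act through
   commuting operators of finite order, and one projects successively onto the eigenspaces. *)
Lemma equivariant_span F : equivariant F -> Sp scaled_inv F.
Proof.
move=> eF.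
have [y hy] : exists y : 'I_n -> H, forall j, (exists t, U1 t /\ y j = (x j * i t)%g) /\
    exists m, (0 < m)%N /\ (y j ^+ m = 1)%g.
  have e j : exists y, (exists t, U1 t /\ y = (x j * i t)%g) /\ exists m, (0 < m)%N /\ (y ^+ m = 1)%g.
    by have [t [m [ut m0 e]]] := torsion_rep (x j); exists (x j * i t)%g; split; [exists t|exists m].
  by have [y hy] := choice e; exists y.
pose P m G := equivariant G /\ forall j : 'I_n, (j < m)%N -> eigen (y j) G.
have hP m : (m <= n)%N -> Sp (P m) F.
  elim: m => [|m IH] mn; first by apply: Sp_one.
  apply: Sp_bind (IH (ltnW mn)) => G [eG hG]; pose j0 := Ordinal mn.
  have [_ [o [o0 oy]]] := hy j0; have [w pw] := prim_root_complex R o0.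
  have -> : G = fun h => \sum_(l < o) proj (y j0) o w l G h.
    by apply: funext => h; apply: proj_sum.
  apply: Sp_sum => l; split; first exact: proj_equivariant.
  move=> j; rewrite ltnS leq_eqVlt => /orP [/eqP ej|lt]; last by apply: eigen_proj; apply: hG.
  have -> : j = j0 by apply: val_inj.
  exact: proj_eigen.
apply: Sp_bind (hP n (leqnn n)) => G [eG hG]; apply: common_eigen => // h.
have [j [z [hz ->]]] := reps h; have [[t [ht ey]] _] := hy j.
have [c hc] := hG j (ltn_ord j); exists (c * (z / t)^-1) => g.
have -> : x j = (y j * i (t^-1)%R)%g by rewrite ey -mulgA -iM ?mulfV ?i1 ?mulg1 //; [exact: U1_neq0|exact: U1V].
have ut := U1V ht.
rewrite -!mulgA hc (mulgA (i (t^-1)%R)) -iM // HC eG; last exact: U1M.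
by rewrite mulrA [t^-1 * z]mulrC.
Qed.

Definition expansion F (c : (H -> R[i]) -> R[i]) :=
  [/\ finite_set [set chi | c chi != 0], forall chi, ~ ext_char i chi -> c chi = 0
    & forall h, F h = \sum_(chi \in ext_char i) c chi * (chi h)^-1].

Lemma expansionE (c : (H -> R[i]) -> R[i]) (r : seq (H -> R[i])) (f : (H -> R[i]) -> R[i]) :
  uniq r -> (forall chi, c chi != 0 -> chi \in r) -> (forall chi, ~ ext_char i chi -> c chi = 0) ->
  \sum_(chi \in ext_char i) c chi * f chi = \sum_(chi <- r) c chi * f chi.
Proof.
move=> ur hr hc.
apply: fsum_seq => // chi.
  by move=> _ h; apply: hr; apply: contra_neq h => ->; rewrite mul0r.
by move=> _ nx; rewrite hc ?mul0r.
Qed.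

Lemma expansion_exists F : equivariant F -> exists c, expansion F c.
Proof.
move=> /equivariant_span; elim=> [|F1 F2 [c0 [chi0 [h0 ->]]] _ [c [fc oc ec]]].
  exists (fun=> 0); split=> //.
    by apply: (@sub_finite_set _ _ set0) => // chi /=; rewrite eqxx.
  by move=> h; rewrite fsbig1 // => chi _; rewrite mul0r.
exists (fun chi => (if chi == chi0 then c0 else 0) + c chi); split.
- apply: (@sub_finite_set _ _ ([set chi0] `|` [set chi | c chi != 0])).
    move=> chi /=; case: (eqVneq chi chi0) => [->|ne]; first by left.
    by rewrite add0r; right.
  by rewrite finite_setU; split=> //; exact: finite_set1.
- move=> chi nx; rewrite oc // addr0; case: eqP => // e; by rewrite e in nx.
- move=> h; pose r := undup (chi0 :: fset_set [set chi | c chi != 0]).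
  have ur : uniq r by apply: undup_uniq.
  have h0r : chi0 \in r by rewrite mem_undup inE eqxx.
  have hr chi : c chi != 0 -> chi \in r.
    by move=> hc; rewrite mem_undup inE in_fset_set //; apply/orP; right; rewrite inE.
  rewrite ec (expansionE _ ur hr oc) (expansionE _ ur); last 2 first.
  + move=> chi; case: (eqVneq chi chi0) => [-> //|ne]; rewrite add0r; exact: hr.
  + move=> chi nx; rewrite oc // addr0; case: eqP => // e; by rewrite e in nx.
  under [RHS]eq_bigr => chi _ do rewrite mulrDl.
  rewrite big_split /=; congr (_ + _).
  rewrite (bigD1_seq chi0) //= eqxx big1 ?addr0 // => chi ne.
  by rewrite (negbTE ne) mul0r.
Qed.

Lemma ext_char_neq0 chi h : ext_char i chi -> chi h != 0.
Proof.
move=> [h1 hM _]; apply/eqP => e; have := hM h h^-1%g; rewrite mulgV h1 e mul0r => /eqP.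
by rewrite oner_eq0.
Qed.

(** Comparing the relation at g h with the one at h, for a g where chi differs from chi0, eliminates
    chi0. *)
Lemma dedekind (r : seq (H -> R[i])) (d : (H -> R[i]) -> R[i]) : uniq r ->
  (forall chi, chi \in r -> ext_char i chi) ->
  (forall h, \sum_(chi <- r) d chi * (chi h)^-1 = 0) -> forall chi, chi \in r -> d chi = 0.
Proof.
elim: r d => [//|chi0 r IH] d /= /andP [n0 ur] hr hs.
have hr' chi : chi \in r -> ext_char i chi by move=> h; apply: hr; rewrite inE h orbT.
have h0 : ext_char i chi0 by apply: hr; rewrite inE eqxx.
have z chi : chi \in r -> d chi = 0.
  move=> hc; have /existsNP [g /eqP ng] : ~ (forall g, chi g = chi0 g).
    by move=> e; move: n0; rewrite -(funext e) hc.
  have := IH (fun c => d c * ((c g)^-1 - (chi0 g)^-1)) ur hr' _ chi hc.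
  have e h : \sum_(c <- r) d c * ((c g)^-1 - (chi0 g)^-1) * (c h)^-1 = 0.
    have := hs (g * h)%g; have := hs h; rewrite !big_cons => e1 e2.
    have -> : \sum_(c <- r) d c * ((c g)^-1 - (chi0 g)^-1) * (c h)^-1 =
        \sum_(c <- r) d c * (c (g * h)%g)^-1 - (chi0 g)^-1 * \sum_(c <- r) d c * (c h)^-1.
      rewrite mulr_sumr -sumrB; apply: eq_big_seq => c hcr; have [_ cM _] := hr' c hcr.
      by rewrite cM invfM; ring.
    move: e1 e2 => /eqP; rewrite addr_eq0 => /eqP e1 /eqP; rewrite addr_eq0 => /eqP e2.
    have [_ c0M _] := h0; move: e2; rewrite c0M invfM => e2.
    apply/eqP; rewrite subr_eq0; apply/eqP; apply: oppr_inj; rewrite -e2 -mulrN -e1; ring.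
  move=> /(_ e) /eqP; rewrite mulf_eq0 => /orP [/eqP //|]; rewrite subr_eq0 => /eqP /invr_inj e'.
  by rewrite e' eqxx in ng.
move=> chi; rewrite inE => /orP [/eqP ->|]; last exact: z.
have := hs 1%g; rewrite big_cons big_seq big1 ?addr0; last by move=> c hc; rewrite z ?mul0r.
by have [-> _ _] := h0; rewrite invr1 mulr1.
Qed.

Lemma expansion_unique F c c' : expansion F c -> expansion F c' -> c = c'.
Proof.
move=> [f1 o1 e1] [f2 o2 e2].
pose r := undup (fset_set [set chi | c chi != 0] ++ fset_set [set chi | c' chi != 0]).
have ur : uniq r by apply: undup_uniq.
have r1 chi : c chi != 0 -> chi \in r.
  by move=> h; rewrite mem_undup mem_cat in_fset_set //; apply/orP; left; rewrite inE.
have r2 chi : c' chi != 0 -> chi \in r.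
  by move=> h; rewrite mem_undup mem_cat !in_fset_set //; apply/orP; right; rewrite inE.
have hr chi : chi \in r -> ext_char i chi.
  rewrite mem_undup mem_cat !in_fset_set // => /orP []; rewrite inE /= => h; apply: contrapT => nx.
    by rewrite o1 // eqxx in h.
  by rewrite o2 // eqxx in h.
apply: funext => chi; have [hc|hc] := boolP (chi \in r); last first.
  have -> : c chi = 0 by apply: contraNeq hc => /r1.
  by apply/esym; apply: contraNeq hc => /r2.
apply/eqP; rewrite -subr_eq0; apply/eqP.
apply: (@dedekind r (fun chi => c chi - c' chi)) => // h.
under eq_bigr => chi' _ do rewrite mulrBl.
by rewrite sumrB -(expansionE _ ur r1 o1) -(expansionE _ ur r2 o2) -e1 -e2 subrr.
Qed.

End Characters.

(** * Sections as functions on H *)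

Section Sections.
Variables (R : realType) (k : finFieldType) (X : function_field k) (C : special_extension X).
Variables (D : completion C) (eta : adele D -> k) (a : X) (r : place X -> X).
Hypothesis HS : setup eta a r.
Variable psi : k -> R[i].
Hypothesis psi_char : nontrivial_character psi.
Implicit Types (p q : place X) (Phi : 'M[X]_2) (c : 'M[se_F C]_2) (v w : ecol D).
Local Notation pr := (higgs_pairing eta).
Local Notation Phi0 := (mul_tau a).

Local Notation gT := (gT a r).
Local Notation Tor := (Tor a).
Local Notation lrel := (lrel eta psi).
Local Notation Hgrp := (Hgrp HS psi_char).
Local Notation Hi := (Hi HS psi_char).
Local Notation Hact := (Hact (HS := HS) (psi_char := psi_char)).
Local Notation tau := (tau eta a r psi).

Lemma U1P (z : R[i]) : U1 z <-> `|z| = 1. Proof. by []. Qed.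

Lemma Hmul_i (h : Hgrp) v z t : Tor v -> U1 t -> Hset h = tau v z -> Hset (h * Hi t)%g = tau v (z * t).
Proof.
move=> Tv nt e; rewrite Hgrp_mulE HmulC.
by rewrite (HmulE HS psi_char (Tor1 D a) Tv (HiE HS psi_char nt) e) emul1 mulrC.
Qed.

(* The point of H above a Higgs bundle determined by its lifting. *)
Definition pt (x : hpair D) : Hgrp := xget (Hone eta a r psi) [set h : Hgrp | Hset h = lclass eta psi (x, 1)].

Lemma ptP x : higgs eta a x -> Hset (pt x) = lclass eta psi (x, 1).
Proof.
move=> hx; rewrite /pt; case: xgetP => [y _ //|n].
have [v [t [Tv nt e]]] := hclass_tau HS psi_char (x := (x, 1)) hx.
rewrite mulr1 in e; by case: (n (mkH eta r psi Tv nt)); rewrite /= e.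
Qed.

Lemma Hset_scale (h : Hgrp) (y : lrep D R) t : U1 t -> Hset h = [set w | lrel y w] ->
  Hset (h * Hi t)%g = [set w | lrel (y.1, t * y.2) w].
Proof.
move=> nt e; rewrite (Hmul_i (HvT h) nt (HsetE h)); apply/(lrel_set HS psi_char).
have h1 : lrel (tpt a r (Hv h) (Hz h)) y by apply/(lrel_set HS psi_char); rewrite -e; apply/esym/HsetE.
by have := lrel_scale t h1; rewrite /tpt /= mulrC.
Qed.

Lemma pt_lrel x y t : higgs eta a x -> U1 t -> lrel (x, 1) (y, t) -> pt x = (pt y * Hi t)%g.
Proof.
move=> hx nt h; have hy := higgs_hrel HS (lrel_hrel h) hx.
have ey : Hset (pt y) = [set w | lrel (y, 1) w].
  by rewrite ptP // (lclassE HS psi) //; exact: higgs_tr hy.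
apply: Hel_eq; rewrite (Hset_scale nt ey) ptP // (lclassE HS psi); last exact: higgs_tr hx.
by rewrite /= mulr1; apply/(lrel_set HS psi_char).
Qed.

Lemma pt_tpt (h : Hgrp) : h = (pt (gT (Hv h), Phi0) * Hi (Hz h))%g.
Proof.
have hT := higgs_T HS (HvT h).
have e : Hset (pt (gT (Hv h), Phi0)) = tau (Hv h) 1 by rewrite ptP // (tau_lclass HS psi).
by apply: Hel_eq; rewrite (Hmul_i (HvT h) (Hz1 h) e) mul1r; exact: HsetE.
Qed.

Lemma H_reps : exists (n : nat) (x : 'I_n -> Hgrp), forall h, exists j z, U1 z /\ h = (x j * Hi z)%g.
Proof.
have [n [x hx]] := HF_finite HS; exists n, (fun j => pt (x j)) => h.
have hT := higgs_T HS (HvT h); have [j hj] := hx _ hT; exists j.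
have hxj := higgs_hrel HS (hrel_sym hj) hT.
have [t nt lr] := hrel_lrel eta psi_char hj; exists (Hz h / t).
have nt' : U1 (Hz h / t) by apply: U1M; [exact: Hz1|exact: U1V].
split=> //; rewrite (pt_lrel hxj nt lr) -mulgA; have [iM _ _ _ _] := H_extension HS psi_char.
rewrite -iM //; have -> : t * (Hz h / t) = Hz h by rewrite mulrCA mulfV ?mulr1 //; exact: U1_neq0.
exact: pt_tpt.
Qed.

(** [in_S] prescribes the behaviour under traceless e only; [lrep_equivP] moves the scalar part of a
    general e into the idele. *)
Lemma hstep_sec s x y c u z e : in_S eta a psi s -> hstep c u z e x y ->
  s y.1 y.2 = psi (pr x.2 e) * s x.1 x.2.
Proof.
move=> [s0 s1 s2 _]; case: x => g Phi h; have hr : hrel (g, Phi) y by exists c, u, z, e.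
have [hx|nx] := pselect (higgs eta a (g, Phi)); last first.
  have ny : ~ higgs eta a y by move=> hy; apply: nx; exact: (higgs_hrel HS (hrel_sym hr) hy).
  by case: y {h hr} ny => g' Phi' /= ny; rewrite !s0 ?mulr0.
have tx := higgs_tr hx.
have l : lrel ((g, Phi), 1) (y, psi (pr Phi e)) by exists c, u, z, e; rewrite mulr1.
have [c' [u' [z' [e' [uc' gu' iz' ne' [/= e1 e2 e3]]]]]] := (lrep_equivP HS psi (y, _) (x := ((g, Phi), 1)) tx).2 l.
rewrite e1 e2 mulr1 in e3 *.
have hm : higgs eta a (lift_add e' g, Phi).
  apply: (higgs_hrel HS _ hx); exists 1%:M, (fun p => 1%:M), (fun p => 1), e'; split.
    by case: ne' => ? ?; split=> //; [exact: unitmx1|exact: GL2O1|exact: idele1].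
  split=> /=; last by rewrite conj_red1.
  by apply: functional_extensionality_dep => p; rewrite /gact map_mx1 scale1r mul1mx mulmx1.
by rewrite s1 // s2 // e3.
Qed.

Lemma sec_lrel s x y : in_S eta a psi s -> lrel x y ->
  s y.1.1 y.1.2 * x.2 = s x.1.1 x.1.2 * y.2.
Proof.
by move=> hs [c [u [z [e [h ->]]]]]; rewrite (hstep_sec hs h) mulrAC mulrC mulrA.
Qed.

Definition sec (F : Hgrp -> R[i]) : section D R :=
  fun g Phi => if `[< higgs eta a (g, Phi) >] then F (pt (g, Phi)) else 0.

Lemma secE F g Phi : higgs eta a (g, Phi) -> sec F g Phi = F (pt (g, Phi)).
Proof. by move=> h; rewrite /sec asboolT. Qed.

Lemma sec_in_S F : equivariant Hi F -> in_S eta a psi (sec F).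
Proof.
move=> eF; split.
- by move=> g Phi n; rewrite /sec asboolF.
- move=> g Phi c u z hg uc gu iz.
  have hs : hstep c u z (fun p => 0) (g, Phi) (ascale z (amul (adiag D c) (amul g u)), conj_red c Phi).
    split; first by split=> //; exact: nil_mx0.
    by split=> //=; apply: functional_extensionality_dep => p; rewrite /gact addr0 mul1mx.
  have hr : hrel (g, Phi) (ascale z (amul (adiag D c) (amul g u)), conj_red c Phi) by exists c, u, z, (fun p => 0).
  have hy := higgs_hrel HS hr hg; rewrite !secE //; congr F; apply/esym.
  have l : lrel ((g, Phi), 1) ((ascale z (amul (adiag D c) (amul g u)), conj_red c Phi), 1).
    by exists c, u, z, (fun p => 0); split=> //=; rewrite (pair0 HS) (psi0 psi_char) mulr1.
  rewrite (pt_lrel hg (U1_1 R) l) -[RHS]mulg1; congr (_ * _)%g.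
  have [iM _ _ _ _] := H_extension HS psi_char; exact: (i1 iM).
- move=> g Phi e hg [ne te].
  have hs : hstep 1%:M (fun p => 1%:M) (fun p => 1) e (g, Phi) (lift_add e g, Phi).
    split; first by split=> //; [exact: unitmx1|exact: GL2O1|exact: idele1].
    split=> /=; last by rewrite conj_red1.
    by apply: functional_extensionality_dep => p; rewrite /gact map_mx1 scale1r mul1mx mulmx1.
  have hr : hrel (g, Phi) (lift_add e g, Phi) by exists 1%:M, (fun p => 1%:M), (fun p => 1), e.
  have hy := higgs_hrel HS hr hg; rewrite !secE //.
  have l : lrel ((g, Phi), 1) ((lift_add e g, Phi), psi (pr Phi e)).
    by exists 1%:M, (fun p => 1%:M), (fun p => 1), e; rewrite mulr1.
  have np : U1 (psi (pr Phi e)) by apply: psi_norm.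
  by rewrite (pt_lrel hg np l) eF // mulVKf // (psi_neq0 psi_char).
- have [n [x hx]] := HF_finite HS; exists n, x => g Phi h.
  have hg : higgs eta a (g, Phi).
    by apply: contrapT => nh; rewrite /sec asboolF // eqxx in h.
  have [j hj] := hx _ hg; exists j; apply/higgs_isoP => //.
  by case: (higgs_hrel HS (hrel_sym hj) hg).
Qed.

(** Dividing by the scalar makes the value independent of the representative of h, see [secFE]. *)
Definition secF (s : section D R) (h : Hgrp) : R[i] := s (gT (Hv h)) Phi0 / Hz h.

Lemma secFE s (h : Hgrp) (y : lrep D R) : in_S eta a psi s -> y.2 != 0 -> Hset h = [set w | lrel y w] ->
  secF s h = s y.1.1 y.1.2 / y.2.
Proof.
move=> hs y0 e; have l : lrel y (tpt a r (Hv h) (Hz h)).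
  by apply/(lrel_set HS psi_char); rewrite -e; exact: HsetE.
have := sec_lrel hs l; rewrite /= => e1; rewrite /secF.
have z0 : Hz h != 0 by apply: U1_neq0; exact: Hz1.
by apply: (mulIf y0); rewrite divfK // mulrAC e1 mulfK.
Qed.

Lemma secF_equivariant s : in_S eta a psi s -> equivariant Hi (secF s).
Proof.
move=> hs h z hz; have z0 := U1_neq0 hz; have h0 : Hz h != 0 by apply: U1_neq0; exact: Hz1.
rewrite (secFE (y := (gT (Hv h), Phi0, z * Hz h)) hs) ?mulf_neq0 //.
  by rewrite /secF /= invfM mulrCA.
by rewrite (Hset_scale (y := (gT (Hv h), Phi0, Hz h)) hz) //; exact: HsetE.
Qed.

Lemma secFK s : in_S eta a psi s -> sec (secF s) = s.
Proof.
move=> hs; apply: functional_extensionality_dep => g; apply: funext => Phi.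
have [hg|ng] := pselect (higgs eta a (g, Phi)); last first.
  by rewrite /sec asboolF //; case: hs => s0 _ _ _; rewrite s0.
rewrite secE // (secFE (y := (g, Phi, 1)) hs) ?oner_neq0 //= ?divr1 //.
by rewrite ptP // (lclassE HS psi) //; exact: (higgs_tr hg).
Qed.

(** The inverse fits (h s)(x) = h . s(h^-1 x): sections scale by z^-1 along U(1), and evaluation at
    h^-1 x then produces the eigenvalue chi(h). *)
Definition fchi (chi : Hgrp -> R[i]) : section D R := sec (fun h => (chi h)^-1).

Lemma ext_char_equivariant chi : ext_char Hi chi -> equivariant Hi (fun h => (chi h)^-1).
Proof. by move=> [_ cM ci] h z hz; rewrite cM ci // invfM mulrC. Qed.

Lemma fchi_basis : is_basis eta a psi (ext_char Hi) fchi.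
Proof.
split=> [chi hc|s hs]; first by apply: sec_in_S; exact: ext_char_equivariant.
have [n [x hx]] := H_reps; have [iM _ _ _ _] := H_extension HS psi_char.
have HC : forall g h : Hgrp, (g * h = h * g)%g by move=> g h; rewrite !Hgrp_mulE HmulC.
have eF := secF_equivariant hs; have [c hc] := expansion_exists HC iM hx eF.
have [c1 c2 c3] := hc.
exists c; split.
  split=> // g Phi; rewrite -{1}(secFK hs).
  have [hg|ng] := pselect (higgs eta a (g, Phi)); last first.
    rewrite /sec asboolF // fsbig1 // => chi _; by rewrite /fchi /sec asboolF // mulr0.
  by rewrite secE // c3; apply: eq_fsbigr => chi _; rewrite /fchi secE.
move=> c' [d1 d2 d3]; apply: (expansion_unique hc); split=> // h.
have hT := higgs_T HS (HvT h); have hz := Hz1 h; have z0 := U1_neq0 hz.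
have e1 : secF s h = (Hz h)^-1 * s (gT (Hv h)) Phi0 by rewrite /secF mulrC.
rewrite e1 d3 mulr_fsumr; apply: eq_fsbigr => chi; rewrite inE => -[_ cM ci].
by rewrite /fchi secE // [in RHS](pt_tpt h) cM ci // invfM; ring.
Qed.

Lemma fchi_act chi : ext_char Hi chi -> forall h, sec_act eta a psi Hact h (fchi chi)
  = (fun g Phi => chi h * fchi chi g Phi).
Proof.
move=> hc h; have [c1 cM ci] := hc.
apply: functional_extensionality_dep => g; apply: funext => Phi; rewrite /sec_act.
have [hg|ng] := pselect (higgs eta a (g, Phi)); last first.
  by rewrite asboolF // /fchi /sec asboolF // mulr0.
rewrite asboolT //.
have [v [t [Tv nt el]]] := hclass_tau HS psi_char (x := ((g, Phi), 1)) hg.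
rewrite mulr1 in el; have t0 : t != 0 := U1_neq0 nt.
have ept : Hset (pt (g, Phi)) = tau v t by rewrite ptP.
rewrite el (HactE (HvT h^-1%g) Tv t0 (HsetE h^-1%g)).
set w := emul a (Hv h^-1%g) v; set z := Hz h^-1%g * t.
have nz : `|z| = 1 by rewrite norm1M //; exact: Hz1.
have Tw : Tor w by apply: Tor_mul => //; exact: HvT.
(* [sec_act] evaluates at an arbitrary representative of the translated point; [e2] below locates it
   in H. *)
case: xgetP => [[[g' Phi'] z'] _ hy|n]; last first.
  by case: (n (tpt a r w z)); exact: (lrel_refl HS psi_char).
have lry : lrel (tpt a r w z) ((g', Phi'), z') := hy.
have hTw := higgs_T HS Tw; have hhy := higgs_hrel HS (lrel_hrel lry) hTw.
have ny : U1 z' by rewrite U1P (lrel_norm psi_char lry).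
have e1 : Hset (h^-1 * pt (g, Phi))%g = tau w z.
  exact: (HmulE HS psi_char (HvT h^-1%g) Tv (HsetE h^-1%g) ept).
have e2 : (h^-1 * pt (g, Phi))%g = (pt (g', Phi') * Hi z')%g.
  apply: Hel_eq; rewrite e1.
  have ey : Hset (pt (g', Phi')) = [set w | lrel ((g', Phi'), 1) w].
    by rewrite ptP // (lclassE HS psi) //; exact: (higgs_tr hhy).
  rewrite (Hset_scale ny ey) /= mulr1; apply/(lrel_set HS psi_char).
  exact: lry.
have e3 : chi (pt (g, Phi)) = chi h * (chi (pt (g', Phi')) * z').
  by rewrite -(ci _ ny) -cM -e2 -cM mulgA mulgV mul1g.
have h0 := ext_char_neq0 h hc.
rewrite /fchi !secE //.
by rewrite e3 invfM mulVKf // -invfM.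
Qed.

End Sections.

(** * Hecke operators *)

Section Hecke.
Variables (R : realType) (k : finFieldType) (X : function_field k) (C : special_extension X).
Variables (D : completion C) (eta : adele D -> k) (a : X) (r : place X -> X).
Hypothesis HS : setup eta a r.
Variable psi : k -> R[i].
Hypothesis psi_char : nontrivial_character psi.
Implicit Types (p q : place X) (Phi : 'M[X]_2) (v w : ecol D).
Local Notation V := pl_ring.
Local Notation Oh := (@cp_O _ _ _ D _).
Local Notation nl := nilpotent_elt.
Local Notation locm p Phi := (map_mx (loc D p) Phi).
Local Notation pr := (higgs_pairing eta).
Local Notation rho p := (loc D p (r p)).
Local Notation Phi0 := (mul_tau a).
Let DD : forall p : place X, discrete p := place_discrete D.

Local Notation g0 := (g0 D r).
Local Notation gT := (gT a r).
Local Notation Tor := (Tor a).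
Local Notation Hgrp := (Hgrp HS psi_char).
Local Notation Hi := (Hi HS psi_char).
Local Notation Hact := (Hact (HS := HS) (psi_char := psi_char)).
Local Notation tau := (tau eta a r psi).
Local Notation fchi := (fchi (HS := HS) (psi_char := psi_char)).

Lemma amx_bound (g : amat D) : amx g -> exists d : place X -> X, pidele d /\
  forall p, Obmx (loc D p (d p) *: g p).
Proof.
move=> /amx_aev fg.
have bd p (x : cp_F D p) : exists b, [/\ b != 0, V p b & Obar (loc D p b * x)].
  have [nx|nx] := pselect (nl x).
    by exists 1; split; [exact: oner_neq0|exact: V1|apply: Obar_nl; apply: nl_mull].
  have [b [u [b0 [uu Ou _] n]]] := unit_loc_form nx.
  have [Vb|nVb] := pselect (V p b).
    exists 1; split; [exact: oner_neq0|exact: V1|].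
    apply: ObarM; first by rewrite Obar_loc; apply: V1.
    by apply: Obar_cong n _; apply: ObarM; [rewrite Obar_loc|exact: Obar_Oh].
  exists b^-1; split; [by rewrite invr_eq0|by case: (pl_valuation p b0)|].
  apply: Obar_cong (_ : Obar u); last exact: Obar_Oh.
  apply: nlc_trans (nlc_mul (locV D p b0) n) _; rewrite mulKr; last exact: loc_unit.
  exact: nlc_refl.
have bm p : exists b, [/\ b != 0, Obmx (loc D p b *: g p) & intmx (g p) -> b = 1].
  have [ig|ng] := pselect (intmx (g p)).
    exists 1; split=> //; [exact: oner_neq0|].
    move=> i j; rewrite mxE; apply: ObarM; first by rewrite Obar_loc; apply: V1.
    exact: Obar_Oh.
  have [b1 [n1 v1 o1]] := bd p (g p 0 0); have [b2 [n2 v2 o2]] := bd p (g p 0 1).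
  have [b3 [n3 v3 o3]] := bd p (g p 1 0); have [b4 [n4 v4 o4]] := bd p (g p 1 1).
  exists (b1 * b2 * b3 * b4); split=> //; first by rewrite !mulf_neq0.
  have aux (b c : X) x : V p b -> Obar (loc D p c * x) -> Obar (loc D p (b * c) * x).
    move=> Vb Oc; apply: Obar_cong (_ : Obar (loc D p b * (loc D p c * x))).
      by rewrite mulrA; apply: nlc_mul; [exact: locM|exact: nlc_refl].
    by apply: ObarM => //; rewrite Obar_loc.
  apply: ord2P; apply: ord2P; rewrite mxE.
  - by rewrite (_ : b1 * b2 * b3 * b4 = b2 * b3 * b4 * b1); [apply: aux => //; do !apply: VM|ring].
  - by rewrite (_ : b1 * b2 * b3 * b4 = b1 * b3 * b4 * b2); [apply: aux => //; do !apply: VM|ring].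
  - by rewrite (_ : b1 * b2 * b3 * b4 = b1 * b2 * b4 * b3); [apply: aux => //; do !apply: VM|ring].
  - by apply: aux => //; do !apply: VM.
have [d hd] := choice bm; exists d; split=> [|p]; last by case: (hd p).
split; first by move=> p; case: (hd p).
apply: sub_finite_set fg => p /= n h; apply: n; case: (hd p) => _ _ e; rewrite (e h); exact: vunit1.
Qed.

(** The Higgs fields on a fixed bundle have their entries in one finite space of sections, so the
    sums defining [aut_fun] are finite. *)
Lemma finite_higgs (g : amat D) : finite_set [set Phi | higgs eta a (g, Phi)].
Proof.
have [Gg|nG] := pselect (GL2A g); last first.
  by apply: (@sub_finite_set _ _ set0) => // Phi /= [].
have [ag agi] := GL2A_amx Gg; have [ug _] := Gg.
have [d [pd hd]] := amx_bound ag; have [d' [pd' hd']] := amx_bound agi.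
have d0 p : d p != 0 by case: pd. 
have d0' p : d' p != 0 by case: pd'.
have r0 := r_neq0 HS.
pose b p := r p / (d p * d' p).
have pb : pidele b by apply: pideleM; [exact: su_r HS|apply: pideleV; apply: pideleM].
have fL := finite_L DD (poles_finite C) pb.
have ent Phi i j : higgs eta a (g, Phi) -> L b (Phi i j).
  move=> /(higgsP HS) [_ _ _ h] p; rewrite -(Obar_loc D).
  have bn : b p != 0 by rewrite mulf_neq0 ?invr_eq0 ?mulf_neq0.
  apply: Obar_cong (loc_div D p (Phi i j) bn) _.
  have := ObmxM (ObmxM (hd p) (h p)) (hd' p).
  have -> : loc D p (d p) *: g p *m ((rho p)^-1 *: (invmx (g p) *m locm p Phi *m g p)) *m (loc D p (d' p) *: invmx (g p))
     = (loc D p (d p) * loc D p (d' p) / rho p) *: locm p Phi.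
    rewrite -!scalemxAl -!scalemxAr -!scalemxAl !scalerA !mulmxA mulmxV // mul1mx mulmxK //.
    by congr (_ *: _); ring.
  move=> /(_ i j); rewrite !mxE; apply: Obar_cong; rewrite [X in _ - X]mulrC.
  apply: nlc_mul; first exact: nlc_refl.
  have ur := locr_unit HS p; have ub := loc_unit D p bn.
  have u1 := loc_unit D p (d0 p); have u2 := loc_unit D p (d0' p).
  have u12 : loc D p (d p) * loc D p (d' p) \is a GRing.unit by rewrite unitrM u1.
  have -> : loc D p (d p) * loc D p (d' p) / rho p = (rho p / (loc D p (d p) * loc D p (d' p)))^-1.
    by rewrite invrM ?unitrV // invrK.
  apply: nlc_inv => //; apply: nlc_trans (loc_div D p _ (mulf_neq0 (d0 p) (d0' p))) _.
  apply: nlc_mul; first exact: nlc_refl.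
  by apply: nlc_inv; [apply: loc_unit; rewrite mulf_neq0|apply: locM].
pose mk (w : X * X * (X * X)) : 'M[X]_2 :=
  \matrix_(i, j) if i == 0 then (if j == 0 then w.1.1 else w.1.2) else (if j == 0 then w.2.1 else w.2.2).
have f4 : finite_set ((L b `*` L b) `*` (L b `*` L b))%classic by do !apply: finite_setX.
apply: sub_finite_set (finite_image mk f4) => Phi /= hP.
exists ((Phi 0 0, Phi 0 1), (Phi 1 0, Phi 1 1)); first by split; split; apply: ent.
by apply: mx2P; rewrite mxE.
Qed.

Definition rep (c : set (amat D)) : amat D := xget (aone D) c.

Lemma coset_refl (x : amat D) : coset x x.
Proof.
exists (fun p => 1%:M), (fun p => 1); split; [exact: GL2O1|exact: idele1|].
by apply: functional_extensionality_dep => p; rewrite /ascale /amul mulmx1 scale1r.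
Qed.
Lemma coset_sym (x y : amat D) : coset x y -> coset y x.
Proof.
move=> [u [z [gu iz ->]]]; exists (fun p => invmx (u p)), (fun p => (z p)^-1); split.
- exact: GL2OV.
- exact: ideleV.
apply: functional_extensionality_dep => p; rewrite /ascale /amul.
have [uu _ _] := gu p; have [uz _] := iz.
by rewrite -scalemxAl scalerA (mulVr (uz p)) scale1r mulmxK.
Qed.
Lemma coset_trans (x y w : amat D) : coset x y -> coset y w -> coset x w.
Proof.
move=> [u [z [gu iz ->]]] [u' [z' [gu' iz' ->]]].
exists (fun p => u p *m u' p), (fun p => z' p * z p); split; [exact: GL2OM|exact: ideleM|].
apply: functional_extensionality_dep => p; rewrite /ascale /amul.
by rewrite -scalemxAl scalerA mulmxA.
Qed.
Lemma coset_eq (x y : amat D) : coset x y -> coset x = coset y.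
Proof.
move=> h; apply/seteqP; split=> w hw; last exact: coset_trans h hw.
exact: coset_trans (coset_sym h) hw.
Qed.
Lemma rep_coset (x : amat D) : coset x (rep (coset x)).
Proof. by rewrite /rep; case: xgetP => [y _ //|n]; case: (n x); apply: coset_refl. Qed.

Lemma GL2A_coset (x y : amat D) : GL2A x -> coset x y -> GL2A y.
Proof.
by move=> Gx [u [z [gu iz ->]]]; apply: GL2AZ => //; apply: GL2AM => //; apply: GL2O_A.
Qed.

Lemma coset_mul (u x y : amat D) : coset x y -> coset (amul u x) (amul u y).
Proof.
move=> [w [z [gw iz ->]]]; exists w, z; split=> //; apply: functional_extensionality_dep => p.
by rewrite /amul /ascale -scalemxAr mulmxA.
Qed.

Definition cosets := [set coset x | x in @GL2A _ _ _ D].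

Lemma GL2A_rep c : cosets c -> GL2A (rep c).
Proof. by move=> [x Gx <-]; apply: GL2A_coset Gx (rep_coset x). Qed.

Lemma rep_class c : cosets c -> coset (rep c) = c.
Proof. by move=> [x Gx <-]; apply/esym; apply: coset_eq; exact: rep_coset. Qed.

(** * A Hecke operator acting on sections *)

Section Operator.
Variables (h : amat D -> R[i]) (h_H : in_Hecke h) (s : section D R) (s_S : in_S eta a psi s).

(* The Hecke operator applied to [s]. *)
Definition sp (g : amat D) Phi : R[i] := \sum_(c \in cosets) h (rep c) * s (amul g (rep c)) Phi.

Let suppH : finite_set [set c | cosets c /\ h (rep c) != 0].
Proof.
have [_ _ [n [y hy]]] := h_H.
have fI : finite_set [set coset (y j) | j in [set: 'I_n]].
  by apply: finite_image; apply: finite_finset.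
apply: sub_finite_set fI => c /= [hc h0].
have [j hj] := hy _ h0; exists j => //; rewrite -(rep_class hc); exact: coset_eq.
Qed.

Definition rc : seq (set (amat D)) := fset_set [set c | cosets c /\ h (rep c) != 0].

Lemma mem_rc c : c \in rc <-> cosets c /\ h (rep c) != 0.
Proof. by rewrite /rc in_fset_set //; split=> [/set_mem|/mem_set]. Qed.

Lemma fsum_rc (f : set (amat D) -> R[i]) :
  \sum_(c \in cosets) h (rep c) * f c = \sum_(c <- rc) h (rep c) * f c.
Proof.
apply: fsum_seq; first exact: fset_uniq.
  by move=> c hc h0; apply/mem_rc; split=> //; apply: contra_neq h0 => ->; rewrite mul0r.
by move=> c /mem_rc [].
Qed.

Lemma h_coset x y : GL2A x -> coset x y -> h y = h x.
Proof.
move=> Gx [u [z [gu iz ->]]]; have [_ h1 _] := h_H.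
have := h1 x (fun p => 1%:M) u z Gx (GL2O1 D) gu iz => <-.
by congr h; apply: functional_extensionality_dep => p; rewrite /ascale /amul mul1mx.
Qed.

Lemma s_coset g x y Phi : coset x y -> s (amul g y) Phi = s (amul g x) Phi.
Proof.
move=> [u [z [gu iz ->]]].
have hs : hstep 1%:M u z (fun p => 0) (amul g x, Phi) (amul g (ascale z (amul x u)), Phi).
  split; first by split=> //; [exact: unitmx1|exact: nil_mx0].
  split=> /=; last by rewrite conj_red1.
  apply: functional_extensionality_dep => p.
  by rewrite /gact /amul /ascale addr0 map_mx1 !mul1mx -scalemxAr mulmxA.
by rewrite (hstep_sec HS s_S hs) /= (pair0 HS) (psi0 psi_char) mul1r.
Qed.

Lemma sp_left c z e g g' Phi Phi' : hstep c (fun p => 1%:M) z e (g, Phi) (g', Phi') ->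
  sp g' Phi' = psi (pr Phi e) * sp g Phi.
Proof.
move=> [[uc gu iz ne] [/= e1 e2]]; rewrite /sp mulr_fsumr; apply: eq_fsbigr => x _.
have hs : hstep c (fun p => 1%:M) z e (amul g (rep x), Phi) (amul g' (rep x), Phi').
  split=> //; split=> //=; rewrite e1; apply: functional_extensionality_dep => p.
  by rewrite /gact /amul !mulmx1 -scalemxAl !mulmxA.
by rewrite (hstep_sec HS s_S hs) /= mulrCA.
Qed.

(** Left multiplication by u permutes the cosets and preserves h by left invariance. *)
Lemma sp_right g u Phi : GL2O u -> sp (amul g u) Phi = sp g Phi.
Proof.
move=> gu; have [_ h1 _] := h_H.
pose sg (w : amat D) c := coset (amul w (rep c)).
have sgP (w : amat D) c : GL2A w -> cosets c -> cosets (sg w c).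
  by move=> Gw hc; exists (amul w (rep c)) => //; apply: GL2AM => //; exact: GL2A_rep.
have Gu := GL2O_A gu; have Gui := GL2AV Gu; have gui := GL2OV gu.
have cancel (w w' : amat D) c : (forall p, w p *m w' p = 1%:M) -> cosets c -> sg w (sg w' c) = c.
  move=> e hc; rewrite /sg -[RHS](rep_class hc); apply/esym/coset_eq.
  have := coset_mul w (rep_coset (amul w' (rep c))).
  congr (coset _ _); apply: functional_extensionality_dep => p.
  by rewrite /amul mulmxA e mul1mx.
have uV p : u p *m invmx (u p) = 1%:M by case: (gu p) => uu _ _; rewrite mulmxV.
have Vu p : invmx (u p) *m u p = 1%:M by case: (gu p) => uu _ _; rewrite mulVmx.
have bij : set_bij cosets cosets (sg u).
  split; first by move=> c; apply: sgP.
    move=> c c'; rewrite !inE => hc hc' e.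
    by rewrite -(cancel _ _ _ Vu hc) e (cancel _ _ _ Vu).
  move=> c hc; exists (sg (fun p => invmx (u p)) c); first exact: sgP.
  exact: cancel.
rewrite /sp [RHS](reindex_fsbig _ _ _ _ bij); apply: eq_fsbigr => c; rewrite inE => hc.
have Gr := GL2A_rep hc; have Gur := GL2AM Gu Gr.
have hcs := rep_coset (amul u (rep c)).
rewrite (h_coset Gur hcs) (s_coset g Phi hcs).
have -> : h (amul u (rep c)) = h (rep c).
  have := h1 (rep c) u (fun p => 1%:M) (fun p => 1) Gr gu (GL2O1 D) (idele1 D) => <-.
  by congr h; apply: functional_extensionality_dep => p; rewrite /ascale /amul mulmx1 scale1r.
by congr (_ * s _ _); apply: functional_extensionality_dep => p; rewrite /amul mulmxA.
Qed.

Lemma sp_hstep c u z e x y : hstep c u z e x y -> sp y.1 y.2 = psi (pr x.2 e) * sp x.1 x.2.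
Proof.
case: x => g Phi; case: y => g' Phi' [[uc gu iz ne] [/= e1 e2]].
rewrite -(sp_right g Phi gu); apply: (@sp_left c z).
split; first by split=> //; exact: GL2O1.
by split=> //=; rewrite e1; apply: functional_extensionality_dep => p; rewrite /gact /amul mulmx1 !mulmxA.
Qed.

(* If an entry of the Higgs field in the lattice [g] is not regular at [p], some integral nilpotent matrix
   at [p] pairs nontrivially with it, although it does not change the class of [g]. *)
Lemma sp_not_higgs g Phi : GL2A g -> \tr Phi = 0 -> - \det Phi = a -> ~ higgs eta a (g, Phi) ->
  sp g Phi = 0.
Proof.
move=> Gg tP dP nh; have [ug _] := Gg; have [ag agi] := GL2A_amx Gg; have ef := su_form HS.
pose M p := invmx (g p) *m locm p Phi *m g p.
have /existsNP [p /existsNP [i /existsNP [j nr]]] : ~ forall p i j, reg eta (M p i j).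
  by move=> hM; apply: nh; split.
have [m [nm Om nz]] : exists m : cp_F D p, [/\ nl m, Oh m & eta (single (M p i j * m)) != 0].
  apply: contrapT => hn; apply: nr; apply/(regE eta) => m nm Om.
  by apply: contrapT => /eqP n; apply: hn; exists m.
set v := eta _ in nz.
have [_ _ [x0 hx0]] := psi_char.
have f0 : (4%:R : k) != 0 by rewrite (natrM _ 2 2) mulf_neq0 ?(su_char HS).
(* Normalized so that the pairing below equals x0, where psi is not 1; the 4 comes from the Killing
   form. *)
pose t : k := x0 / (4%:R * v).
pose m' := loc D p (ff_const X t) * m.
have nm' : nl m' by apply: nl_mull.
have Om' : Oh m' by apply: Obar_mul_nl => //; rewrite Obar_loc; exact: pl_const.
(* The single nonzero entry, at (j, i), makes the trace of M N equal to M_ij m'. *)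
pose N q : 'M[cp_F D q]_2 := \matrix_(i', j') if (i' == j) && (j' == i) then single m' q else 0.
have sg q : nl (single m' q) /\ Oh (single m' q).
  have [e|ne] := pselect (p = q); last by rewrite single_out; [split; [exact: nl0|exact: Oh0]|exact/eqP].
  by subst q; rewrite single_in.
have hN q : nlm (N q) /\ intmx (N q).
  have [s1 s2] := sg q; split=> i' j'; rewrite mxE; case: ifP => _ //; [exact: nl0|exact: Oh0].
have nN : nil_mx N.
  by apply/nil_mxP; split; [apply/amx_aev/aev_all => q|move=> q]; case: (hN q).
pose e q := g q *m N q *m invmx (g q).
have ne : nil_mx e by apply: nil_mx_conj.
have gu : GL2O (fun q => 1%:M + N q) by move=> q; apply: iu_1nlm; case: (hN q).
have hs : hstep 1%:M (fun q => 1%:M) (fun q => 1) e (g, Phi) (amul g (fun q => 1%:M + N q), Phi).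
  split; first by split=> //; [exact: unitmx1|exact: GL2O1|exact: idele1].
  split=> /=; last by rewrite conj_red1.
  apply: functional_extensionality_dep => q.
  by rewrite /gact map_mx1 scale1r mul1mx mulmx1 /amul mulmxDr mulmx1 mulmxDl mul1mx mulmxKV.
have := sp_hstep hs; rewrite /= sp_right //.
have ep : pr Phi e = x0.
  rewrite /higgs_pairing.
  have -> : (fun q => 4%:R * \tr (locm q Phi *m e q)) =
      (fun q => loc D q (ff_const X t) * (single (M p i j * m) q *+ 4)).
    apply: functional_extensionality_dep => q.
    have -> : \tr (locm q Phi *m e q) = \tr (M q *m N q).
      by rewrite /e /M !mulmxA mxtrace_mulC !mulmxA.
    have -> : \tr (M q *m N q) = M q i j * single m' q.
      rewrite /mxtrace (bigD1 i) //= mxE (bigD1 j) //= [N q j i]mxE !eqxx /=.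
      rewrite big1 ?addr0; last by move=> j' nj; rewrite [N q j' i]mxE (negbTE nj) mulr0.
      rewrite big1 ?addr0 // => i' ni; rewrite mxE big1 // => j' _.
      by rewrite [N q j' i']mxE (negbTE ni) andbF mulr0.
    have [epq|npq] := pselect (p = q); last first.
      by rewrite !single_out ?mulr0 ?mul0rn ?mulr0 //; apply/eqP.
    by subst q; rewrite !single_in /m' -mulr_natl; ring.
  have ns : nil_adele (single (M p i j * m)) by apply: nil_adele_single; apply: nl_mull.
  have n4 : nil_adele (fun q => single (M p i j * m) q *+ 4).
    have := nil_adeleD (nil_adeleD ns ns) (nil_adeleD ns ns); congr nil_adele.
    by apply: functional_extensionality_dep => q; rewrite -!mulr2n -mulrnA.
  rewrite (eta_scale ef t n4).
  have -> : eta (fun q => single (M p i j * m) q *+ 4) = 4%:R * v.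
    have -> : (fun q => single (M p i j * m) q *+ 4) = (fun q => (single (M p i j * m) q + single (M p i j * m) q) + (single (M p i j * m) q + single (M p i j * m) q)).
      by apply: functional_extensionality_dep => q; rewrite -!mulr2n -mulrnA.
    rewrite (eta_add ef (nil_adeleD ns ns) (nil_adeleD ns ns)) !(eta_add ef ns ns) -/v.
    by rewrite -!mulr2n -mulrnA mulr_natl.
  by rewrite /t divfK // mulf_neq0.
(* Right invariance and the change of lifting give sp g Phi = psi(x0) sp g Phi. *)
rewrite ep => /eqP; rewrite eq_sym -subr_eq0 -{2}[sp g Phi]mul1r -mulrBl mulf_eq0 subr_eq0.
by rewrite (negbTE hx0) => /eqP.
Qed.

Definition good : set 'M[X]_2 := [set Phi | \tr Phi = 0 /\ - \det Phi = a].

Lemma s_good g Phi : ~ good Phi -> s g Phi = 0.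
Proof. by move=> n; have [s0 _ _ _] := s_S; apply: s0 => -[_ h1 h2 _]; apply: n. Qed.

Lemma sp_good g Phi : ~ good Phi -> sp g Phi = 0.
Proof. by move=> n; rewrite /sp fsbig1 // => c _; rewrite s_good // mulr0. Qed.

Lemma s_higgs g Phi : s g Phi != 0 -> higgs eta a (g, Phi).
Proof. by move=> hs; apply: contrapT => n; have [s0 _ _ _] := s_S; rewrite s0 // eqxx in hs. Qed.

Lemma aut_fun_seq (rP : seq 'M[X]_2) (g : amat D) : uniq rP ->
  (forall Phi, higgs eta a (g, Phi) -> Phi \in rP) -> aut_fun a s g = \sum_(Phi <- rP) s g Phi.
Proof.
move=> ur hr; apply: fsum_seq => // Phi; first by move=> _ /s_higgs /hr.
by move=> _ n; apply: s_good.
Qed.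

(** [sp] acts on each Higgs field separately, so an eigenvalue of [sp] is one of the convolution;
    the sums over cosets and over Higgs fields are exchanged on finite supports. *)
Lemma hecke_conv_sp g (ev : R[i]) : GL2A g ->
  (forall Phi, good Phi -> sp g Phi = ev * s g Phi) ->
  aut_fun a (fun g Phi => ev * s g Phi) g = hecke_conv h (aut_fun a s) g.
Proof.
move=> Gg hsp.
pose B := [set Phi | higgs eta a (g, Phi)] `|` \bigcup_(c in [set` rc]) [set Phi | higgs eta a (amul g (rep c), Phi)].
have fB : finite_set B.
  rewrite /B finite_setU; split; first exact: finite_higgs.
  by apply: bigcup_finite => [|c _]; [exact: finite_seq|exact: finite_higgs].
pose rP : seq 'M[X]_2 := fset_set B; have uP : uniq rP by apply: fset_uniq.
have mP Phi : B Phi -> Phi \in rP by move=> b; rewrite /rP in_fset_set // inE.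
have -> : hecke_conv h (aut_fun a s) g = \sum_(c <- rc) h (rep c) * aut_fun a s (amul g (rep c)).
  exact: fsum_rc.
have -> : \sum_(c <- rc) h (rep c) * aut_fun a s (amul g (rep c)) =
    \sum_(c <- rc) \sum_(Phi <- rP) h (rep c) * s (amul g (rep c)) Phi.
  apply: eq_big_seq => c hc; rewrite (@aut_fun_seq rP) ?mulr_sumr // => Phi hP.
  by apply: mP; right; exists c.
rewrite exchange_big /=.
have -> : \sum_(Phi <- rP) \sum_(c <- rc) h (rep c) * s (amul g (rep c)) Phi = \sum_(Phi <- rP) ev * s g Phi.
  apply: eq_bigr => Phi _; rewrite -fsum_rc -/(sp g Phi).
  have [gP|nP] := pselect (good Phi); first exact: hsp.
  by rewrite sp_good // s_good // mulr0.
apply: fsum_seq => // Phi; last by move=> _ n; rewrite s_good // mulr0.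
by move=> _ hs; apply: mP; left; apply: s_higgs; apply: contra_neq hs => ->; rewrite mulr0.
Qed.

End Operator.

Lemma in_S_scale (ev : R[i]) s : in_S eta a psi s -> in_S eta a psi (fun g Phi => ev * s g Phi).
Proof.
move=> [s0 s1 s2 [n [x hx]]]; split.
- by move=> g Phi nh; rewrite s0 ?mulr0.
- by move=> *; rewrite s1.
- by move=> *; rewrite s2 // mulrCA.
- exists n, x => g Phi hs; apply: hx; apply: contra_neq hs => ->; rewrite mulr0 //.
Qed.


Lemma higgs_actE w g : Tor w -> higgs eta a (g, Phi0) -> higgs eta a (actE a w g, Phi0).
Proof.
move=> Tw /(higgsP HS) [Gg _ _ hO]; have Gwg := GL2AM Tw Gg.
apply/(higgsP HS); split=> //; [exact: tr_Phi0|exact: det_Phi0|move=> p].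
have [uw _] := Tw; have [ug _] := Gg.
apply: Obmx_cong (hO p); rewrite -scalerBr; apply: nlmZ.
have n := emx_fix Tw p; set W := emx a (w p) in n *.
have uW : W \in unitmx by apply: uw.
have -> : invmx (actE a w g p) *m locm p Phi0 *m actE a w g p =
    invmx (g p) *m (invmx W *m locm p Phi0 *m W) *m g p.
  by rewrite /actE -/W invmxM // !mulmxA.
apply: nlm_congM; last exact: nlm_refl.
apply: nlm_congM; first exact: nlm_refl.
have n2 := nlm_congM (nlm_congM (nlm_refl (invmx W)) n) (nlm_refl W).
move: n2; have -> // : invmx W *m (W *m locm p Phi0 *m invmx W) *m W = locm p Phi0.
by rewrite !mulmxA mulVmx // mul1mx mulmxKV.
Qed.

Lemma pt_torus w g (Tw : Tor w) : higgs eta a (g, Phi0) ->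
  pt HS psi_char (actE a w g, Phi0) =
  ((mkH eta r psi Tw (normr1 R[i]) : Hgrp) * pt HS psi_char (g, Phi0))%g.
Proof.
move=> hg; have hwg := higgs_actE Tw hg.
have [v [t [Tv nt el]]] := hclass_tau HS psi_char (x := ((g, Phi0), 1)) hg.
rewrite mulr1 in el; have eg : Hset (pt HS psi_char (g, Phi0)) = tau v t by rewrite ptP.
apply: Hel_eq; rewrite Hgrp_mulE (HmulE HS psi_char (h := mkH eta r psi Tw (normr1 R[i])) Tw Tv (z := 1) erefl eg) mul1r.
rewrite ptP // (lclassE HS psi) /=; last exact: tr_Phi0.
apply/(lrel_set HS psi_char); rewrite /tpt -(actE_gT a r v w); apply: (lrel_torus HS Tw).
apply/(lrel_set HS psi_char); rewrite -/(tau v t) -el (lclassE HS psi) //=; exact: tr_Phi0.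
Qed.

(** * Eigenvectors attached to characters *)

Section Eigen.
Variables (chi : Hgrp -> R[i]) (chiP : ext_char Hi chi).
Local Notation f := (fchi chi).

Lemma fchi_in_S : in_S eta a psi f.
Proof. by apply: sec_in_S; apply: ext_char_equivariant. Qed.

Lemma fchi_torus w : Tor w -> exists l : R[i], forall g, f (actE a w g) Phi0 = l * f g Phi0.
Proof.
move=> Tw; exists (chi (mkH eta r psi Tw (normr1 R[i])))^-1.
move=> g; have [hg|ng] := pselect (higgs eta a (g, Phi0)).
  rewrite /fchi !secE //; last exact: higgs_actE.
  by rewrite (pt_torus Tw hg); have [_ cM _] := chiP; rewrite cM invfM.
have nwg : ~ higgs eta a (actE a w g, Phi0).
  move=> h; apply: ng; have := higgs_actE (Tor_inv Tw) h; congr (higgs _ _ (_, _)).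
  have [uw _] := Tw.
  by apply: functional_extensionality_dep => p; rewrite /actE -emx_inv // mulKmx.
by rewrite /fchi /sec !asboolF // mulr0.
Qed.

Lemma higgs_g0 : higgs eta a (g0, Phi0).
Proof. by rewrite -(gT1 D a r); apply: (higgs_T HS); exact: Tor1. Qed.

Lemma fchi_neq0 g Phi : higgs eta a (g, Phi) -> f g Phi != 0.
Proof. by move=> hg; rewrite /fchi secE // invr_eq0; apply: ext_char_neq0 chiP. Qed.

(** [sp h f] and f obey the same rules under isomorphisms, changes of lifting and the torus, which
    together act transitively on Higgs bundles; so their ratio is its value at g0. *)
Lemma fchi_eigen h : in_Hecke h -> exists ev : R[i], hecke_sec eta a psi h f (fun g Phi => ev * f g Phi).
Proof.
move=> hh; pose S := sp h f; pose ev := S g0 Phi0 / f g0 Phi0; exists ev.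
have fS := fchi_in_S; have f0 := fchi_neq0 higgs_g0.
split; first exact: in_S_scale.
move=> g Gg; apply: (hecke_conv_sp hh fS Gg) => Phi [tP dP].
have [hg|ng] := pselect (higgs eta a (g, Phi)); last first.
  by rewrite (sp_not_higgs hh fS Gg tP dP ng) /fchi /sec asboolF // mulr0.
have [v Tv [c [u [z [e hs]]]]] := higgs_reduce HS hg.
have [l hl] := fchi_torus Tv.
have e1 := sp_hstep hh fS hs; have e2 := hstep_sec HS fS hs; rewrite /= in e1 e2.
have e3 : S (gT v) Phi0 = l * S g0 Phi0.
  rewrite /S /sp mulr_fsumr; apply: eq_fsbigr => x _.
  rewrite mulrCA -hl; congr (_ * f _ _); apply: functional_extensionality_dep => p.
  by rewrite /amul /actE mulmxA.
have e4 : f (gT v) Phi0 = l * f g0 Phi0 by rewrite -hl.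
have p0 := psi_neq0 psi_char (pr Phi e); apply: (mulfI p0).
by rewrite mulrCA -e1 -e2 -/S e3 e4 /ev mulrCA divfK.
Qed.

Lemma fchi_eigenvector : hecke_eigenvector eta a psi f.
Proof.
split; [exact: fchi_in_S|exists g0, Phi0; exact: fchi_neq0 higgs_g0|exact: fchi_eigen].
Qed.

End Eigen.

End Hecke.

Unset Implicit Arguments.

Theorem theorem6p12
  (R : realType) (k : finFieldType) (char_k : (2%:R : k) != 0)
  (X : function_field k) (C : special_extension X) (D : completion C)
  (eta : adele D -> k) (eta_form : twisted_form eta) (eta_nz : nonzero_form eta)
  (a : X) (a_Aprime : in_Aprime eta a) (a_simple : only_simple_zeros eta a)
  (psi : k -> R[i]) (psi_char : nontrivial_character psi) :
  exists (H : groupType) (i : R[i] -> H) (q : H -> set (hpair D))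
         (act : H -> set (lrep D R) -> set (lrep D R)),
    [/\ forall h1 h2 : H, (h1 * h2 = h2 * h1)%g,
        extension_of_HF eta a i q,
        torsor_action eta a psi i q act
      & exists f : (H -> R[i]) -> section D R,
          [/\ is_basis eta a psi (ext_char i) f,
              forall chi, ext_char i chi -> hecke_eigenvector eta a psi (f chi)
            & forall chi, ext_char i chi -> forall h : H,
                sec_act eta a psi act h (f chi)
                = (fun g Phi => chi h * f chi g Phi)]].
Proof.
have [r HS] := setup_exists char_k eta_form eta_nz a_Aprime a_simple.
exists (Hgrp HS psi_char), (Hi HS psi_char), (@Hq _ _ _ _ _ _ _ _ HS _ psi_char).
exists (@Hact _ _ _ _ _ _ _ _ HS _ psi_char); split.
- by move=> h1 h2; rewrite !Hgrp_mulE HmulC.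
- exact: H_extension.
- exact: H_action.
exists (@fchi _ _ _ _ _ _ _ _ HS _ psi_char); split.
- exact: fchi_basis.
- by move=> chi hc; apply: fchi_eigenvector.
- by move=> chi hc h; apply: fchi_act.
Qed.
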